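(* Let $M=M(t,x,v)>0$ be an entropy-invariant solution of the Boltzmann equation with confining potential $\Phi$. (1) If $p\in(2,\infty)$ and $\Phi(x)=|x|^p/p$, then $M$ is necessarily of the form $$M(t,x,v)=m\exp\Big\{-\alpha\Big(\Phi(x)+\tfrac12|v|^2\Big)+Rx\cdot v\Big\}$$ for some $m>0$, $\alpha>0$ and some real $3\times3$ skew-symmetric matrix $R$. Conversely, every function of this form (with $m>0$, $\alpha>0$, $R$ real $3\times 3$ skew-symmetric) is a positive entropy-invariant solution. (2) If $p\in(1,2)$ and $\Phi(x)=\langle x\rangle^p/p$, then $M$ is necessarily of the form $$M(t,x,v)=m\exp\Big\{-\alpha\Big(\Phi(x)+\tfrac12|v|^2\Big)\Big\}$$ for some $m>0$, $\alpha>0$. Conversely, every function of this form (with $m>0$, $\alpha>0$) is a positive entropy-invariant solution.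
   Context: $\langle x\rangle=(1+|x|^2)^{1/2}$. The Boltzmann equation is $\partial_tF+v\cdot\nabla_xF-\nabla_x\Phi\cdot\nabla_vF=Q(F,F)$ for $F(t,x,v)$, $t\ge0$, $x,v\in\mathbb R^3$, where $$Q(F,G)(v)=\int_{\mathbb R^3\times\mathbb S^2}B(v-v_*,\sigma)\,[F(v_*')G(v')-F(v_* )G(v)]\,d\sigma\,dv_*,$$ $v'=\frac{v+v_*}2+\frac{|v-v_*|}2\sigma$, $v'_*=\frac{v+v_*}2-\frac{|v-v_*|}2\sigma$ (the operator acts only on $v$). Collision kernel assumptions: $B(v-v_*,\sigma)=|v-v_*|^\gamma b(\cos\theta)$ with $\gamma\in(-3,1]$, $\cos\theta=\frac{v-v_*}{|v-v_*|}\cdot\sigma$; the angular kernel $b$ is nonnegative and satisfies either Grad's cutoff condition $\int_{\mathbb S^2}b(\hat z\cdot\sigma)\,d\sigma<\infty$ for $\hat z\in\mathbb S^2$, or the non-cutoff condition $c_b\theta^{-2-2s}\le b(\cos\theta)\le C_b\theta^{-2-2s}$ for $0<\theta\le\pi/2$, for some $s\in(0,1)$ and constants $0<c_b\le C_b<\infty$; and (without loss of generality, by symmetrization) $b(\cos\theta)$ is supported in $0\le\theta\le\pi/2$. A sufficiently regular positive function $M=M(t,x,v)>0$ is called an entropy-invariant solution of the Boltzmann equation if $\int_{\mathbb R^6}(\Phi(x)+|v|^2+1)M(t,x,v)\,dx\,dv<+\infty$ and, for every $t\ge0$, $$\partial_tM+v\cdot\nabla_xM-\nabla_x\Phi\c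dot\nabla_vM=0=Q(M,M).$$
   Formalization: In the cutoff case b is also required not to vanish almost everywhere (for b = 0 the claim fails); ''sufficiently regular'' is read as C^1 in (t,x,v), C^2 in v with rapid decay of M and its v-derivatives up to order 2, and log M of polynomial growth in v. *)

(* Defs.v *)
From HB Require Import structures.
From mathcomp Require Import all_boot all_order all_algebra.
From mathcomp Require Import all_classical all_reals all_analysis.
From mathcomp Require Import measurable_realfun ring lra.

Set Implicit Arguments.
Unset Strict Implicit.
Unset Printing Implicit Defensive.
Import Order.TTheory GRing.Theory Num.Theory.
Import numFieldNormedType.Exports.

Local Open Scope classical_set_scope.
Local Open Scope ring_scope.

(* The library norm on row vectors is the sup norm; enorm is the Euclidean
   one. *)
Section euclidean.
Context {R : realType} {n : nat}.
Implicit Types x y : 'rV[R]_n.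

Definition dot x y : R := \sum_i x 0 i * y 0 i.
Definition enorm x : R := Num.sqrt (dot x x).
Definition japanese x : R := Num.sqrt (1 + enorm x ^+ 2).
Definition partial (i : 'I_n) (f : 'rV[R]_n -> R) (x : 'rV[R]_n) : R :=
  'D_(delta_mx 0 i) f x.
Definition gradient (f : 'rV[R]_n -> R) (x : 'rV[R]_n) : 'rV[R]_n :=
  \row_i partial i f x.

End euclidean.

(* Row vectors with the sigma-algebra generated by the coordinates, that is,
   the Borel sigma-algebra. *)
Definition rV_display : measure_display.
Proof. exact: default_measure_display. Qed.

Section rV_measurable.
Context {R : realType} {n : nat}.

Definition rV_coord (i : 'I_n) (x : 'rV[R]_n) : measurableTypeR R := x 0 i.

Let rV_set0 : g_sigma_preimage rV_coord set0.
Proof. exact: sigma_algebra0. Qed.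

Let rV_setC A : g_sigma_preimage rV_coord A -> g_sigma_preimage rV_coord (~` A).
Proof. exact: sigma_algebraC. Qed.

Let rV_bigcup (F : (set 'rV[R]_n)^nat) :
  (forall i, g_sigma_preimage rV_coord (F i)) ->
  g_sigma_preimage rV_coord (\bigcup_i (F i)).
Proof. exact: sigma_algebra_bigcup. Qed.

HB.instance Definition _ := @isMeasurable.Build rV_display
  'rV[R]_n (g_sigma_preimage rV_coord) rV_set0 rV_setC rV_bigcup.

Lemma measurable_rV_coord i : measurable_fun [set: 'rV[R]_n] (rV_coord i).
Proof.
move=> _ Y mY; rewrite setTI; apply: sub_sigma_algebra => /=.
rewrite -bigcup_seq/=; exists i => /=; first by rewrite mem_index_enum.
by exists Y => //; rewrite setTI.
Qed.

Lemma measurable_fun_rV d (T : measurableType d) (f : T -> 'rV[R]_n) :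
  (forall i, measurable_fun [set: T] (rV_coord i \o f)) ->
  measurable_fun [set: T] f.
Proof.
move=> mf.
have H : g_sigma_preimage (fun i => rV_coord i \o f) `<=` measurable.
  apply: smallest_sub; first exact: sigma_algebra_measurable.
  apply: (big_ind (fun S => S `<=` measurable)) => [//|A B hA hB|i _].
    by rewrite subUset.
  by move=> A [B mB <-]; exact: (mf i).
by move=> _ A mA; apply: H; rewrite g_sigma_preimage_comp; exists A.
Qed.

Lemma measurable_dot d (T : measurableType d) (f g : T -> 'rV[R]_n) :
  measurable_fun [set: T] f -> measurable_fun [set: T] g ->
  measurable_fun [set: T] (fun t => dot (f t) (g t)).
Proof.
move=> mf mg; apply: measurable_sum => i; apply: measurable_funM.
  exact: (measurableT_comp (measurable_rV_coord i) mf).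
exact: (measurableT_comp (measurable_rV_coord i) mg).
Qed.

Lemma measurable_enorm : measurable_fun [set: 'rV[R]_n] enorm.
Proof.
have ms : measurable_fun [set: R] (@Num.sqrt R).
  by apply: continuous_measurable_fun; exact: sqrt_continuous.
by apply: (measurableT_comp ms); exact: measurable_dot.
Qed.

Lemma measurable_unit_sphere : measurable [set x : 'rV[R]_n | enorm x = 1].
Proof.
rewrite (_ : mkset _ = enorm @^-1` [set 1]) //.
by rewrite -[X in measurable X]setTI; exact: measurable_enorm.
Qed.

Lemma measurable_unit_ball : measurable [set x : 'rV[R]_n | enorm x <= 1].
Proof.
rewrite (_ : mkset _ = enorm @^-1` `]-oo, 1]%classic); last first.
  by apply/seteqP; split => x; rewrite /= in_itv.
by rewrite -[X in measurable X]setTI; exact: measurable_enorm.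
Qed.

Definition normalize (u : 'rV[R]_n) : 'rV[R]_n := (enorm u)^-1 *: u.

Lemma measurable_normalize : measurable_fun [set: 'rV[R]_n] normalize.
Proof.
apply: measurable_fun_rV => i.
rewrite (_ : _ \o _ = (fun u => enorm u `^ (-1) * rV_coord i u)); last first.
  by apply/funext => u; rewrite /= /rV_coord mxE powR_inv1 ?sqrtr_ge0.
apply: measurable_funM; last exact: measurable_rV_coord.
by apply: (measurableT_comp (measurable_powR _)); exact: measurable_enorm.
Qed.

End rV_measurable.

(* The canonical instance of the library for sigma-finiteness of products is
   shadowed by the one for products of subprobabilities. *)
Lemma sigma_finite_product d1 d2 (T1 : measurableType d1)
    (T2 : measurableType d2) (R : realType)
    (m1 : {sigma_finite_measure set T1 -> \bar R})
    (m2 : {sigma_finite_measure set T2 -> \bar R}) :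
  sigma_finite setT (m1 \x m2)%E.
Proof.
have /sigma_finiteP[F [TF ndF Foo]] := sigma_finiteT m1.
have /sigma_finiteP[G [TG ndG Goo]] := sigma_finiteT m2.
exists (fun n => F n `*` G n).
  rewrite -setXTT TF TG predeqE => -[x y]; split.
    move=> [/= [n _ Fnx] [k _ Gky]]; exists (maxn n k) => //; split.
    - by move: x Fnx; exact/subsetPset/ndF/leq_maxl.
    - by move: y Gky; exact/subsetPset/ndG/leq_maxr.
  by move=> [n _ []/= ? ?]; split; exists n.
move=> k; have [? ?] := Foo k; have [? ?] := Goo k.
split; first exact: measurableX.
by rewrite product_measure1E// lte_mul_pinfty// ge0_fin_numE.
Qed.

Section lebesgue3.
Context {R : realType}.

Definition lebesgue2 : set (measurableTypeR R * measurableTypeR R) -> \bar R :=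
  (@lebesgue_measure R \x @lebesgue_measure R)%E.

HB.instance Definition _ := Measure.on lebesgue2.

HB.instance Definition _ := Measure_isSigmaFinite.Build _ _ _ lebesgue2
  (sigma_finite_product _ _).

Definition rV3 (p : measurableTypeR R * measurableTypeR R * measurableTypeR R)
  : 'rV[R]_3 := \row_i [:: p.1.1; p.1.2; p.2]`_i.

Lemma measurable_rV3 : measurable_fun [set: _] rV3.
Proof.
apply: measurable_fun_rV; rewrite /rV_coord/rV3 => -[[|[|[|//]]] i] /=.
- rewrite [X in measurable_fun _ X](_ : _ = fst \o fst).
    exact: measurableT_comp.
  by apply/funext => p; rewrite /= mxE.
- rewrite [X in measurable_fun _ X](_ : _ = snd \o fst).
    exact: measurableT_comp.
  by apply/funext => p; rewrite /= mxE.
- rewrite [X in measurable_fun _ X](_ : _ = snd) //.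
  by apply/funext => p; rewrite /= mxE.
Qed.

Definition lebesgue3 : set 'rV[R]_3 -> \bar R :=
  pushforward (lebesgue2 \x @lebesgue_measure R)%E rV3.

#[local] Hint Resolve measurable_rV3 : core.

Let lebesgue3_0 : lebesgue3 set0 = 0%E.
Proof. exact: measure0. Qed.

Let lebesgue3_ge0 A : (0 <= lebesgue3 A)%E.
Proof. exact: measure_ge0. Qed.

Let lebesgue3_sigma_additive : semi_sigma_additive lebesgue3.
Proof. exact: measure_semi_sigma_additive. Qed.

HB.instance Definition _ := isMeasure.Build _ _ _ lebesgue3
  lebesgue3_0 lebesgue3_ge0 lebesgue3_sigma_additive.

Definition unrV3 (x : 'rV[R]_3) :
    measurableTypeR R * measurableTypeR R * measurableTypeR R :=
  (rV_coord 0 x, rV_coord 1 x, rV_coord 2%:R x).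

Lemma rV3K : cancel rV3 unrV3.
Proof. by move=> [[x y] z]; rewrite /unrV3 /rV_coord/rV3 !mxE. Qed.

Lemma measurable_unrV3 : measurable_fun [set: 'rV[R]_3] unrV3.
Proof.
apply/measurable_fun_pairP; split; last exact: measurable_rV_coord.
by apply/measurable_fun_pairP; split; exact: measurable_rV_coord.
Qed.

Let lebesgue3_sigma_finite : sigma_finite setT lebesgue3.
Proof.
have [F TF Foo] : sigma_finite setT (lebesgue2 \x @lebesgue_measure R)%E.
  exact: sigma_finite_product.
exists (fun n => unrV3 @^-1` F n).
  by rewrite -preimage_bigcup -TF preimage_setT.
move=> n; have [mF Fn] := Foo n; split.
  by rewrite -[X in measurable X]setTI; exact: measurable_unrV3.
rewrite /lebesgue3/pushforward (_ : _ @^-1` _ = F n) //.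
by apply/seteqP; split => x; rewrite /preimage/= rV3K.
Qed.

HB.instance Definition _ := Measure_isSigmaFinite.Build _ _ _ lebesgue3
  lebesgue3_sigma_finite.

Lemma lebesgue3_unit_ball : (lebesgue3 [set x | (enorm x <= 1)%R] < +oo)%E.
Proof.
pose I : set (measurableTypeR R) := `[(-1)%R, 1%R]%classic.
have mI : measurable I by exact: measurable_itv.
have Ioo : (lebesgue_measure I < +oo)%E.
  by rewrite /I lebesgue_measure_itv/= lte_fin; case: ifP => _; rewrite ?ltry.
have coordI (x : 'rV[R]_3) i : enorm x <= 1 -> I (x 0 i).
  move=> x1; rewrite /I /= in_itv /= -ler_norml.
  rewrite (le_trans _ x1)// /enorm /dot -sqrtr_sqr ler_wsqrtr//.
  rewrite (bigD1 i)//= -expr2 lerDl sumr_ge0// => j _.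
  by rewrite -expr2 sqr_ge0.
apply: (@le_lt_trans _ _ ((lebesgue2 \x @lebesgue_measure R)%E ((I `*` I) `*` I))).
  rewrite /lebesgue3 /pushforward; apply: le_measure; rewrite ?inE.
  - rewrite -[X in measurable X]setTI; apply: measurable_rV3 => //.
    exact: measurable_unit_ball.
  - by apply: measurableX => //; exact: measurableX.
  - move=> p /= p1; rewrite -(rV3K p); split; first split; exact: coordI.
rewrite product_measure1E//; last exact: measurableX.
rewrite [X in (X * _)%E](product_measure1E _ _ mI mI).
have If : lebesgue_measure I \is a fin_num by rewrite ge0_fin_numE.
by rewrite -ge0_fin_numE ?mule_ge0// !fin_numM.
Qed.

(* The surface measure of the unit sphere, carried by R^3:
   sphere_measure A = 3 |{u : |u| <= 1, u / |u| \in A}|. *)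
Definition sphere_measure : set 'rV[R]_3 -> \bar R :=
  pushforward (mscale 3%:nng (mrestr lebesgue3 measurable_unit_ball)) normalize.

Let sphere_measure0 : sphere_measure set0 = 0%E.
Proof. by rewrite /sphere_measure /pushforward preimage_set0 measure0. Qed.

Let sphere_measure_ge0 A : (0 <= sphere_measure A)%E.
Proof. by rewrite /sphere_measure /pushforward; exact: measure_ge0. Qed.

Let sphere_measure_sigma_additive : semi_sigma_additive sphere_measure.
Proof.
have mn := @measurable_normalize R 3.
exact: measure_semi_sigma_additive.
Qed.

HB.instance Definition _ := isMeasure.Build _ _ _ sphere_measure
  sphere_measure0 sphere_measure_ge0 sphere_measure_sigma_additive.

Let sphere_measure_fin : fin_num_fun sphere_measure.
Proof.
apply: lty_fin_num_fun; rewrite -[ltLHS]/(_ * lebesgue3 (_ `&` _))%E.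
rewrite preimage_setT setTI -ge0_fin_numE ?mule_ge0//.
by rewrite fin_numM// ge0_fin_numE//; exact: lebesgue3_unit_ball.
Qed.

HB.instance Definition _ := Measure_isFinite.Build _ _ _ sphere_measure
  sphere_measure_fin.

End lebesgue3.

Section collision.
Context {R : realType}.
Local Notation V := 'rV[R]_3.
Implicit Types (gamma : R) (b : R -> R) (F G : V -> R) (v w sigma k : V).

Definition cos_deviation (z : V) sigma : R := dot z sigma / enorm z.

Definition kernel gamma b (z : V) sigma : R :=
  enorm z `^ gamma * b (cos_deviation z sigma).

Definition post v w sigma : V :=
  2^-1 *: (v + w) + (enorm (v - w) / 2) *: sigma.

Definition post_star v w sigma : V :=
  2^-1 *: (v + w) - (enorm (v - w) / 2) *: sigma.

Definition S2 : set V := [set sigma | enorm sigma = 1].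

(* A point z of R^3 x S^2 is the pair of z.1 = v_* and z.2 = sigma. *)
Definition collision_integrand gamma b F G v (z : V * V) : R :=
  kernel gamma b (v - z.1) z.2 *
  (F (post_star v z.1 z.2) * G (post v z.1 z.2) - F z.1 * G v).

Definition truncate b (m : nat) (c : R) : R := Num.min (b c) m%:R.

(* Q(F, G)(v) = q. For a non-integrable b the integral does not converge
   absolutely in general (only after averaging over the azimuthal angle), and
   it is understood, as usual, in the principal value sense, as the limit for
   the bounded angular kernels min(b, m). When it converges absolutely, it is
   the Lebesgue integral over R^3 x S^2: see collision_value_integrable. *)
Definition collision_value gamma b F G v (q : R) : Prop :=
  (forall m, (lebesgue3 \x sphere_measure)%E.-integrable (setT `*` S2)
     (EFin \o collision_integrand gamma (truncate b m) F G v)) /\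
  (\int[lebesgue3 \x sphere_measure]_(z in setT `*` S2)
     (collision_integrand gamma (truncate b m) F G v z)%:E)%E
    @[m --> \oo] --> q%:E.

Definition grad_cutoff b : Prop :=
  forall k, S2 k -> (\int[sphere_measure]_(s in S2) (b (dot k s))%:E < +oo)%E.

Definition nontrivial_kernel b : Prop :=
  forall k, S2 k -> (0 < \int[sphere_measure]_(s in S2) (b (dot k s))%:E)%E.

Definition noncutoff (s : R) b : Prop :=
  exists cb Cb : R, [/\ 0 < cb, cb <= Cb &
    forall theta : R, 0 < theta <= pi / 2 ->
      cb * theta `^ (- 2 - 2 * s) <= b (cos theta)
        <= Cb * theta `^ (- 2 - 2 * s)].

(* The angular kernel is b : [-1, 1] -> [0, +oo[, seen as a function of
   cos theta. A cutoff kernel is required not to vanish almost everywhere: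
   otherwise Q = 0. *)
Record angular_kernel b : Prop := AngularKernel {
  angular_measurable : measurable_fun `[(-1 : R), 1] b ;
  angular_ge0 : forall c, -1 <= c <= 1 -> 0 <= b c ;
  angular_support : forall c, -1 <= c < 0 -> b c = 0 ;
  angular_singularity : (grad_cutoff b /\ nontrivial_kernel b) \/
    (exists2 s, 0 < s < 1 & noncutoff s b) }.

Lemma cauchy_schwarz (x y : V) : `|dot x y| <= enorm x * enorm y.
Proof.
have dot0 (z : V) : 0 <= dot z z by apply: sumr_ge0 => i _; rewrite -expr2 sqr_ge0.
rewrite /enorm -sqrtrM// -sqrtr_sqr ler_wsqrtr//.
rewrite /dot !big_ord_recl !big_ord0 !addr0.
set a := x _ _; set a' := y _ _; set c := x _ _; set c' := y _ _.
set d := x _ _; set d' := y _ _.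
rewrite -subr_ge0 (_ : _ - _ =
  (a * c' - c * a') ^+ 2 + (a * d' - d * a') ^+ 2 + (c * d' - d * c') ^+ 2).
  by rewrite !addr_ge0// sqr_ge0.
by ring.
Qed.

Lemma cos_deviation_itv z sigma : S2 sigma -> -1 <= cos_deviation z sigma <= 1.
Proof.
rewrite /S2/= -ler_norml /cos_deviation normrM normfV => s1.
have [->|z0] := eqVneq (enorm z) 0; first by rewrite normr0 invr0 mulr0.
have z_gt0 : 0 < enorm z by rewrite lt_neqAle eq_sym z0 sqrtr_ge0.
rewrite (gtr0_norm z_gt0) ler_pdivrMr// mul1r.
by rewrite (le_trans (cauchy_schwarz _ _))// s1 mulr1.
Qed.

Lemma measurable_cos_deviation v :
  measurable_fun [set: V * V] (fun z => cos_deviation (v - z.1) z.2).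
Proof.
have mvB : measurable_fun [set: V * V] (fun z => v - z.1).
  apply: measurable_fun_rV => i.
  rewrite (_ : _ \o _ = (fun z => v 0 i - rV_coord i z.1)); last first.
    by apply/funext => z; rewrite /= /rV_coord !mxE.
  apply: measurable_funB => //.
  exact: (measurableT_comp (measurable_rV_coord i) measurable_fst).
rewrite (_ : (fun _ => _) = (fun z : V * V =>
    dot (v - z.1) z.2 * enorm (v - z.1) `^ (-1))); last first.
  by apply/funext => z; rewrite powR_inv1 ?sqrtr_ge0.
apply: measurable_funM; first exact: measurable_dot.
apply: (measurableT_comp (measurable_powR _)).
exact: (measurableT_comp measurable_enorm).
Qed.

Lemma collision_value_integrable gamma b F G v q : angular_kernel b ->
  (lebesgue3 \x sphere_measure)%E.-integrable (setT `*` S2)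
    (EFin \o collision_integrand gamma b F G v) ->
  collision_value gamma b F G v q <->
  q%:E = (\int[lebesgue3 \x sphere_measure]_(z in setT `*` S2)
            (collision_integrand gamma b F G v z)%:E)%E.
Proof.
move=> [mb b0 _ _] intQ.
set mu := (lebesgue3 \x sphere_measure)%E.
have mS : measurable (setT `*` S2 : set (V * V)).
  by apply: measurableX => //; exact: measurable_unit_sphere.
have mcos : measurable_fun (setT `*` S2)
    (fun z : V * V => cos_deviation (v - z.1) z.2).
  by apply: measurable_funTS; exact: measurable_cos_deviation.
pose Q m (z : V * V) := collision_integrand gamma (truncate b m) F G v z.
have /integrableP[/measurable_EFinP mQ _] := intQ.
have mr m : measurable_fun `[(-1 : R), 1] (fun c => truncate b m c * b c `^ (-1)).
  apply: measurable_funM; first exact: measurable_minr.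
  exact: measurableT_comp (measurable_powR _) mb.
have QE m z : (setT `*` S2) z -> Q m z =
    collision_integrand gamma b F G v z *
    (truncate b m (cos_deviation (v - z.1) z.2) *
     b (cos_deviation (v - z.1) z.2) `^ (-1)).
  move=> [_ z1]; rewrite /Q /collision_integrand /kernel.
  set c := cos_deviation _ _.
  have bc : 0 <= b c by apply: b0; exact: cos_deviation_itv.
  rewrite powR_inv1//; have [bc0|bc0] := eqVneq (b c) 0.
    by rewrite /truncate bc0 (min_idPl _) ?invr0 ?(mulr0, mul0r).
  by field.
have mQm m : measurable_fun (setT `*` S2) (Q m).
  apply: (eq_measurable_fun _ (fun z => fun z1 => esym (QE m z (set_mem z1)))).
  apply: measurable_funM => //.
  apply: (measurable_comp _ _ (mr m) mcos); first exact: measurable_itv.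
  by move=> _ [z [_ zS] <-]; rewrite /= in_itv; exact: cos_deviation_itv.
have Qle m z : (setT `*` S2) z ->
    `|Q m z| <= `|collision_integrand gamma b F G v z|.
  move=> [_ z1]; rewrite /Q /collision_integrand /kernel !normrM.
  rewrite ler_wpM2r// ler_wpM2l//.
  set c := cos_deviation _ _.
  have bc : 0 <= b c by apply: b0; exact: cos_deviation_itv.
  by rewrite !ger0_norm// /truncate ?ge_min ?lexx// le_min bc ler0n.
have Qcvg z : (setT `*` S2) z ->
    Q m z @[m --> \oo] --> collision_integrand gamma b F G v z.
  move=> _; rewrite /Q /collision_integrand /kernel.
  set c := cos_deviation _ _.
  apply: cvg_near_cst; near=> m; rewrite /truncate (min_idPl _)//.
  near: m; exact: nbhs_infty_ger.
have intQm m : mu.-integrable (setT `*` S2) (EFin \o Q m).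
  apply: (le_integrable mS _ _ intQ); first exact/measurable_EFinP.
  by move=> z zS /=; rewrite lee_fin; exact: Qle.
have cvgQ : (\int[mu]_(z in setT `*` S2) (Q m z)%:E)%E @[m --> \oo] -->
    (\int[mu]_(z in setT `*` S2) (collision_integrand gamma b F G v z)%:E)%E.
  apply: (@dominated_cvg _ _ R mu _ mS (fun m => EFin \o Q m) _
    (fun z => `|collision_integrand gamma b F G v z|%:E)) => //.
  - by move=> m; exact/measurable_EFinP.
  - by move=> z zS; apply: cvg_EFin; [exact: nearW|exact: Qcvg].
  - exact: integrable_abse intQ.
split; first by case=> _ cvgq; exact: (cvg_unique _ cvgq cvgQ).
by move=> qE; split => //; rewrite qE.
Unshelve. all: by end_near. Qed.

End collision.

Section entropy_invariant.
Context {R : realType}.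
Local Notation V := 'rV[R]_3.
Implicit Types (f : V -> R) (M : R -> V -> V -> R) (Phi : V -> R).

(* Time derivative of a function on [0, +oo[, one-sided at t = 0. *)
Definition time_quotient (f : R -> R) (t : R) : set_system R :=
  (fun h => h^-1 * (f (t + h) - f t)) @ within [set h | 0 <= t + h] (0 : R)^'.

Definition time_derivable (f : R -> R) (t : R) : Prop := cvg (time_quotient f t).

Definition time_derivative (f : R -> R) (t : R) : R := lim (time_quotient f t).

Definition continuous_phase (g : R -> V -> V -> R) : Prop :=
  {within [set z : R * V * V | 0 <= z.1.1],
    continuous (fun z : R * V * V => g z.1.1 z.1.2 z.2)}.

(* M is of class C^1 on [0, +oo[ x R^3 x R^3. *)
Record C1_phase M : Prop := C1Phase {
  C1_derivable : forall t x v, 0 <= t ->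
    time_derivable (fun s => M s x v) t /\
    forall i, derivable (fun y => M t y v) x (delta_mx 0 i) /\
              derivable (M t x) v (delta_mx 0 i) ;
  C1_continuous : continuous_phase M ;
  C1_continuous_t :
    continuous_phase (fun t x v => time_derivative (fun s => M s x v) t) ;
  C1_continuous_x : forall i,
    continuous_phase (fun t x v => partial i (fun y => M t y v) x) ;
  C1_continuous_v : forall i, continuous_phase (fun t x v => partial i (M t x) v) }.

Definition rapidly_decreasing f : Prop :=
  forall k : nat, exists C : R, forall v, japanese v ^+ k * `|f v| <= C.

Record C2_rapidly_decreasing f : Prop := C2RapidlyDecreasing {
  C2_derivable : forall i v, derivable f v (delta_mx 0 i) ;
  C2_derivable2 : forall i j v, derivable (partial i f) v (delta_mx 0 j) ;
  C2_continuous2 : forall i j, continuous (partial j (partial i f)) ;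
  C2_decay : rapidly_decreasing f ;
  C2_decay1 : forall i, rapidly_decreasing (partial i f) ;
  C2_decay2 : forall i j, rapidly_decreasing (partial j (partial i f)) }.

Definition slowly_growing_log f : Prop :=
  exists (C : R) (k : nat), forall v, `|ln (f v)| <= C * japanese v ^+ k.

(* The regularity under which the terms of the equation and of the H-theorem
   make sense: M is C^1; at each (t, x), M is C^2 in v, rapidly decreasing with
   its derivatives up to order 2, and log M has at most polynomial growth. *)
Definition sufficiently_regular M : Prop :=
  C1_phase M /\
  forall t x, 0 <= t ->
    C2_rapidly_decreasing (M t x) /\ slowly_growing_log (M t x).

Record entropy_invariant (gamma : R) (b : R -> R) Phi M : Prop :=
  EntropyInvariant {
  ei_gt0 : forall t x v, 0 <= t -> 0 < M t x v ;
  ei_regular : sufficiently_regular M ;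
  ei_energy : forall t, 0 <= t ->
    (\int[lebesgue3 \x lebesgue3]_z
       ((Phi z.1 + enorm z.2 ^+ 2 + 1) * M t z.1 z.2)%:E < +oo)%E ;
  ei_transport : forall t x v, 0 <= t ->
    time_derivative (fun s => M s x v) t
      + dot v (gradient (fun y => M t y v) x)
      - dot (gradient Phi x) (gradient (M t x) v) = 0 ;
  ei_collision : forall t x v, 0 <= t ->
    collision_value gamma b (M t x) (M t x) v 0 }.

End entropy_invariant.

(* Main.v *)
Require Import Defs.
From HB Require Import structures.
From mathcomp Require Import all_boot all_order all_algebra.
From mathcomp Require Import all_classical all_reals all_analysis.
From mathcomp Require Import measurable_realfun ring lra zify.

Set Implicit Arguments.
Unset Strict Implicit.
Unset Printing Implicit Defensive.
Import Order.TTheory GRing.Theory Num.Theory.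
Import numFieldNormedType.Exports.

Local Open Scope classical_set_scope.
Local Open Scope ring_scope.

(* Weighting Q(M, M) = 0 by log M and symmetrizing over the collision
involutions gives an entropy production that is nonnegative, nondecreasing in
the truncation level m of the kernel, and tends to 0 as m goes to infinity.
Hence almost every collision with b > 0 conserves log M. As M is continuous and
the collisions of a given deviation angle form one orbit of translations,
dilations and rotations, of which the rational ones are dense, this gives a
single angle acos c0 > 0 at which every collision conserves log M. Two collisions of angle acos c0 compose
to any angle up to 2 acos c0, so by doubling all angles are reached; then
log M, up to its odd and even parts, is orthogonally additive, and
log M = a(t, x) + u(t, x) . v + c(t, x) |v|^2 with c < 0.

In the transport equation the powers of v separate. Degree 3 makes c independent
of x; degree 2 makes u affine with symmetric part -c' Id; degrees 1 and 0 say
that q = a - 2 c Phi is quadratic in x and fix its time derivative. As Phi is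
neither quadratic nor homogeneous of degree 2, c' = 0 and u(t, 0) = 0, hence
u = S x with S skew and a = 2 c Phi + const, all independent of t.

For Phi ~ |x|^p with p < 2 and S <> 0, completing the square in v shows that the
x-marginal is comparable to exp(|S x|^2 / (2 alpha) - alpha Phi), which is not
integrable: the term |S x|^2 dominates Phi on a tube around a coordinate axis. *)

(** * Measure-preserving maps *)

(** For a singular [b] the collision integral at a given v is only a limit over truncations. The
    weighting by log M is therefore done at each level m, and the limit is taken afterwards under
    the integral in v. This needs a bound on the truncated integrals that is uniform in m and decays
    in v faster than log M grows. Uniformity comes from averaging over the reflection of sigma in
    the axis z, which leaves a factor 1 - cos theta, integrable against [b]. Decay comes from
    energy: v' and v_*' cannot both be small when v or v_* is large. The set where b > 0 is merely
    measurable, and conservation is known only almost everywhere; this is why a single angle is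
    extracted, by a countable family of null-preserving maps, before any functional equation is
    solved. In time, M has only a one-sided derivative at 0, so the transport analysis takes place
    at t > 0 and t = 0 is recovered by continuity. Moreover c is a priori only once differentiable
    in t, so its second derivative is reached through u. *)

Section preserving_maps.
Context {R : realType}.
Local Open Scope ereal_scope.

Definition preserving d (T : measurableType d) (m : set T -> \bar R)
    (S : T -> T) : Prop :=
  measurable_fun setT S /\ forall A, measurable A -> m (S @^-1` A) = m A.

Definition null_preserving d (T : measurableType d) (m : set T -> \bar R)
    (S : T -> T) : Prop :=
  measurable_fun setT S /\
  forall A, measurable A -> m A = 0 -> m (S @^-1` A) = 0.

Lemma preserving_null d (T : measurableType d) (m : set T -> \bar R) S :
  preserving m S -> null_preserving m S.
Proof. by case=> mS mE; split => // A mA; rewrite mE. Qed.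

Lemma measurable_preimT d d' (T : measurableType d) (T' : measurableType d')
    (S : T -> T') A : measurable_fun setT S -> measurable A ->
  measurable (S @^-1` A).
Proof. by move=> mS mA; rewrite -[X in measurable X]setTI; exact: mS. Qed.

Lemma preserving_comp d (T : measurableType d) (m : set T -> \bar R) S1 S2 :
  preserving m S1 -> preserving m S2 -> preserving m (S1 \o S2).
Proof.
move=> [mS1 m1] [mS2 m2]; split; first exact: measurableT_comp.
by move=> A mA; rewrite comp_preimage m2 ?m1//; exact: measurable_preimT.
Qed.

Lemma null_preserving_comp d (T : measurableType d) (m : set T -> \bar R) S1 S2 :
  null_preserving m S1 -> null_preserving m S2 -> null_preserving m (S1 \o S2).
Proof.
move=> [mS1 m1] [mS2 m2]; split; first exact: measurableT_comp.
move=> A mA A0; rewrite comp_preimage m2 ?m1//; exact: measurable_preimT.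
Qed.

Lemma ge0_integral_preserving d (T : measurableType d)
    (m : {measure set T -> \bar R}) S (f : T -> \bar R) :
  preserving m S -> measurable_fun setT f -> (forall x, 0 <= f x) ->
  \int[m]_x f (S x) = \int[m]_x f x.
Proof.
move=> [mS mE] mf f0.
have -> : \int[m]_x f (S x) = \int[pushforward m S]_x f x.
  by rewrite ge0_integral_pushforward// preimage_setT.
by apply: eq_measure_integral => A mA _; exact: mE.
Qed.

Lemma integrable_preserving d (T : measurableType d)
    (m : {measure set T -> \bar R}) S (f : T -> \bar R) :
  preserving m S -> m.-integrable setT f -> m.-integrable setT (f \o S).
Proof.
move=> pS /integrableP[mf If]; have [mS _] := pS; apply/integrableP; split.
  exact: measurableT_comp.
rewrite (ge0_integral_preserving (f := fun x => `|f x|) pS)//.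
exact: measurableT_comp.
Qed.

Lemma integral_preserving d (T : measurableType d)
    (m : {measure set T -> \bar R}) S (f : T -> \bar R) :
  preserving m S -> measurable_fun setT f ->
  \int[m]_x f (S x) = \int[m]_x f x.
Proof.
move=> pS mf; rewrite integralE [RHS]integralE; congr (_ - _).
- rewrite -(ge0_integral_preserving (f := f^\+) pS)//; last first.
    exact: measurable_funepos.
  by apply: eq_integral => x _; rewrite !funeposE.
- rewrite -(ge0_integral_preserving (f := f^\-) pS)//; last first.
    exact: measurable_funeneg.
  by apply: eq_integral => x _; rewrite !funenegE.
Qed.

Lemma ge0_integral_mrestr d (T : measurableType d)
    (m : {measure set T -> \bar R}) (D : set T) (mD : measurable D)
    (f : T -> \bar R) : measurable_fun setT f -> (forall x, 0 <= f x) ->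
  \int[mrestr m mD]_x f x = \int[m]_(x in D) f x.
Proof.
move=> mf f0; pose r : {measure set T -> \bar R} := mrestr m mD.
have rE A : r A = m (A `&` D) by [].
have mC : measurable (~` D) by exact: measurableC.
rewrite -[LHS]/(\int[r]_x f x).
rewrite (@ge0_negligible_integral _ _ _ r _ (~` D))//; last first.
  by rewrite rE setICl measure0.
rewrite setTD setCK; apply: eq_measure_integral => A mA AB.
by rewrite /= /mrestr (setIidl AB).
Qed.

Lemma pushforward_measure d d' (T : measurableType d) (T' : measurableType d')
    (m : {measure set T -> \bar R}) (S : T -> T') : measurable_fun setT S ->
  exists mu : {measure set T' -> \bar R}, forall A, mu A = m (S @^-1` A).
Proof.
move=> mS; pose mu : set T' -> \bar R := fun A => m (S @^-1` A).
have mu0 : mu set0 = 0 by rewrite /mu preimage_set0 measure0.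
have mu_ge0 X : 0 <= mu X by exact: measure_ge0.
have mu_sig : semi_sigma_additive mu.
  rewrite -[mu]/(pushforward m S); exact: measure_semi_sigma_additive.
pose nu : {measure set T' -> \bar R} :=
  HB.pack mu (isMeasure.Build _ _ _ mu mu0 mu_ge0 mu_sig).
by exists nu.
Qed.

Lemma sigma_finite_measure_of d (T : measurableType d)
    (mu : {measure set T -> \bar R}) : sigma_finite setT mu ->
  exists nu : {sigma_finite_measure set T -> \bar R}, forall A, nu A = mu A.
Proof.
move=> mu_sf.
pose s1 := isSFinite.Build _ _ _ _ (sfinite_measure_sigma_finite mu_sf).
pose s2 := isSigmaFinite.Build _ _ _ _ mu_sf.
pose nu := HB.pack_for (SigmaFiniteMeasure.type T R) (Measure.sort mu) s1 s2.
by exists nu.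
Qed.

(** The preimages under [S'] of an exhaustion of the source exhaust the target, and they keep their
    measure because [S'] undoes [S]. *)
Lemma pushforward_sigma_finite d d' (T : measurableType d)
    (T' : measurableType d') (m : {sigma_finite_measure set T -> \bar R})
    (S : T -> T') (S' : T' -> T) :
  measurable_fun setT S -> measurable_fun setT S' -> cancel S S' ->
  exists mu : {sigma_finite_measure set T' -> \bar R},
    forall A, mu A = m (S @^-1` A).
Proof.
move=> mS mS' SK; have [mu muE] := pushforward_measure m mS.
have [|nu nuE] := @sigma_finite_measure_of _ _ mu; last first.
  by exists nu => A; rewrite nuE.
have [F TF Foo] := sigma_finiteT m; exists (fun n => S' @^-1` F n).
  by rewrite -preimage_bigcup -TF preimage_setT.
move=> n; have [mF Fn] := Foo n; split; first exact: measurable_preimT.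
rewrite muE -comp_preimage (_ : S' \o S = id) ?preimage_id//.
by apply/funext => x; exact: SK.
Qed.

End preserving_maps.

(** * Triangular maps on product spaces *)

Section skew_products.
Context {R : realType} d1 d2 (T1 : measurableType d1) (T2 : measurableType d2).
Context (m1 : {sigma_finite_measure set T1 -> \bar R})
  (m2 : {sigma_finite_measure set T2 -> \bar R}).
Local Open Scope ereal_scope.

Definition skew (S : T1 -> T1) (U : T1 -> T2 -> T2) (y : T1 * T2) : T1 * T2 :=
  (S y.1, U y.1 y.2).

Lemma measurable_skew S U : measurable_fun setT S ->
  measurable_fun setT (fun y : T1 * T2 => U y.1 y.2) ->
  measurable_fun setT (skew S U).
Proof.
move=> mS mU; apply/measurable_fun_pairP; split => //.
by rewrite (_ : _ \o _ = S \o fst)//; exact: measurableT_comp.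
Qed.

Lemma xsection_skew S U A x :
  xsection (skew S U @^-1` A) x = U x @^-1` xsection A (S x).
Proof. by apply/seteqP; split => y; rewrite /xsection/= !inE. Qed.

(** The changes of variables on collisions are mostly triangular: one factor moves on its own, the
    other by a map that depends on the first. Sections commute with such a map, so invariance is
    checked on the base and on each fibre separately. *)
Lemma preserving_skew S U : preserving m1 S ->
  measurable_fun setT (fun y : T1 * T2 => U y.1 y.2) ->
  (forall x, preserving m2 (U x)) -> preserving (m1 \x m2) (skew S U).
Proof.
move=> pS mU pU; have mSU := measurable_skew pS.1 mU; split => // A mA.
rewrite /product_measure1 -(ge0_integral_preserving (f := m2 \o xsection A) pS)//.
- apply: eq_integral => x _ /=; rewrite xsection_skew (pU x).2//.
  exact: measurable_xsection.
- exact: measurable_fun_xsection.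
Qed.

Lemma product_measure1_eq0P A : measurable A ->
  (m1 \x m2) A = 0 <-> {ae m1, forall x, m2 (xsection A x) = 0}.
Proof.
move=> mA; have mx := measurable_fun_xsection m2 mA.
have := ae_eq_integral_abs m1 measurableT mx.
rewrite (eq_integral (m2 \o xsection A)); last first.
  by move=> x _; rewrite gee0_abs.
rewrite -[X in X = 0 <-> _]/((m1 \x m2) A) => ->.
split; apply: filterS => x /=; last by [].
by apply.
Qed.

(** Dilations rescale the measure but keep null sets, which is all that almost-everywhere statements
    need in order to be transported. *)
Lemma null_preserving_skew S U : null_preserving m1 S ->
  measurable_fun setT (fun y : T1 * T2 => U y.1 y.2) ->
  (forall x, null_preserving m2 (U x)) -> null_preserving (m1 \x m2) (skew S U).
Proof.
move=> pS mU pU; have mSU := measurable_skew pS.1 mU; split => // A mA.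
have mSA := measurable_preimT mSU mA.
move=> /(product_measure1_eq0P mA) [N [mN N0 AN]].
apply/(product_measure1_eq0P mSA).
exists (S @^-1` N); split.
- exact: measurable_preimT pS.1 mN.
- exact: pS.2.
- move=> x /= Ax; apply: AN => /= ASx; apply: Ax.
  rewrite xsection_skew; apply: (pU x).2 => //; exact: measurable_xsection.
Qed.

Lemma product_measure12 A : measurable A -> (m1 \x^ m2) A = (m1 \x m2) A.
Proof.
move=> mA; apply/esym/product_measure_unique => //= A1 A2 mA1 mA2.
by rewrite product_measure2E.
Qed.

End skew_products.

(** * Euclidean vectors and Lebesgue measure *)

Section vector_measurability.
Context {R : realType} {n : nat} d (T : measurableType d).
Local Notation V := 'rV[R]_n.
Implicit Types f g : T -> V.

Lemma measurable_coord f i : measurable_fun setT f ->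
  measurable_fun setT (fun t => f t 0 i : R).
Proof. by move=> mf; exact: (measurableT_comp (measurable_rV_coord i) mf). Qed.

Lemma measurable_rVD f g : measurable_fun setT f -> measurable_fun setT g ->
  measurable_fun setT (fun t => f t + g t).
Proof.
move=> mf mg; apply: measurable_fun_rV => i.
rewrite (_ : _ \o _ = (fun t => f t 0 i + g t 0 i)); last first.
  by apply/funext => t; rewrite /= /rV_coord !mxE.
by apply: measurable_funD; exact: measurable_coord.
Qed.

Lemma measurable_rVZ (h : T -> R) f : measurable_fun setT h ->
  measurable_fun setT f -> measurable_fun setT (fun t => h t *: f t).
Proof.
move=> mh mf; apply: measurable_fun_rV => i.
rewrite (_ : _ \o _ = (fun t => h t * f t 0 i)); last first.
  by apply/funext => t; rewrite /= /rV_coord !mxE.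
by apply: measurable_funM => //; exact: measurable_coord.
Qed.

Lemma measurable_rVN f : measurable_fun setT f ->
  measurable_fun setT (fun t => - f t).
Proof.
move=> mf; rewrite (_ : (fun _ => _) = (fun t => (-1) *: f t)); last first.
  by apply/funext => t; rewrite scaleN1r.
exact: measurable_rVZ.
Qed.

Lemma measurable_rVB f g : measurable_fun setT f -> measurable_fun setT g ->
  measurable_fun setT (fun t => f t - g t).
Proof. by move=> mf mg; apply: measurable_rVD => //; exact: measurable_rVN. Qed.

Lemma measurable_enorm_comp f : measurable_fun setT f ->
  measurable_fun setT (fun t => enorm (f t)).
Proof. by move=> mf; exact: (measurableT_comp measurable_enorm mf). Qed.

Lemma measurable_normalize_comp f : measurable_fun setT f ->
  measurable_fun setT (fun t => normalize (f t)).
Proof. by move=> mf; exact: (measurableT_comp measurable_normalize mf). Qed.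

End vector_measurability.

Section euclidean_algebra.
Context {R : realType} {n : nat}.
Implicit Types (x y z : 'rV[R]_n) (a : R).

Lemma dotC x y : dot x y = dot y x.
Proof. by apply: eq_bigr => i _; rewrite mulrC. Qed.

Lemma dotDl x y z : dot (x + y) z = dot x z + dot y z.
Proof. by rewrite /dot -big_split; apply: eq_bigr => i _; rewrite mxE mulrDl. Qed.

Lemma dotDr x y z : dot z (x + y) = dot z x + dot z y.
Proof. by rewrite dotC dotDl ![dot _ z]dotC. Qed.

Lemma dotZl a x y : dot (a *: x) y = a * dot x y.
Proof. by rewrite /dot mulr_sumr; apply: eq_bigr => i _; rewrite mxE mulrA. Qed.

Lemma dotZr a x y : dot x (a *: y) = a * dot x y.
Proof. by rewrite dotC dotZl dotC. Qed.

Lemma dotNl x y : dot (- x) y = - dot x y.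
Proof. by rewrite -scaleN1r dotZl mulN1r. Qed.

Lemma dotNr x y : dot x (- y) = - dot x y.
Proof. by rewrite dotC dotNl dotC. Qed.

Lemma dotBl x y z : dot (x - y) z = dot x z - dot y z.
Proof. by rewrite dotDl dotNl. Qed.

Lemma dotBr x y z : dot z (x - y) = dot z x - dot z y.
Proof. by rewrite dotDr dotNr. Qed.

Lemma dot0l x : dot 0 x = 0.
Proof. by rewrite -(scale0r x) dotZl mul0r. Qed.

Lemma dot0r x : dot x 0 = 0.
Proof. by rewrite dotC dot0l. Qed.

Definition dotE := (dotDl, dotDr, dotBl, dotBr, dotNl, dotNr, dotZl, dotZr,
  dot0l, dot0r).

Lemma dot_ge0 x : 0 <= dot x x.
Proof. by apply: sumr_ge0 => i _; rewrite -expr2 sqr_ge0. Qed.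

Lemma enorm_ge0 x : 0 <= enorm x.
Proof. exact: sqrtr_ge0. Qed.

Lemma enorm_sqr x : enorm x ^+ 2 = dot x x.
Proof. by rewrite sqr_sqrtr// dot_ge0. Qed.

Lemma dot_eq0 x : dot x x = 0 -> x = 0.
Proof.
move=> /eqP; rewrite psumr_eq0; last by move=> i _; rewrite -expr2 sqr_ge0.
move=> /allP x0; apply/rowP => i; rewrite mxE.
by have := x0 i (mem_index_enum i); rewrite /= -expr2 sqrf_eq0 => /eqP.
Qed.

Lemma enorm_eq0 x : enorm x = 0 -> x = 0.
Proof. by move=> x0; apply: dot_eq0; rewrite -enorm_sqr x0 expr0n. Qed.

Lemma enorm0 : enorm (0 : 'rV[R]_n) = 0.
Proof. by rewrite /enorm dot0l sqrtr0. Qed.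

Lemma enorm_gt0 x : x != 0 -> 0 < enorm x.
Proof.
move=> x0; rewrite lt_neqAle enorm_ge0 andbT eq_sym; apply: contra x0 => /eqP.
by move/enorm_eq0 ->.
Qed.

Lemma enormZ a x : enorm (a *: x) = `|a| * enorm x.
Proof.
by rewrite /enorm dotZl dotZr mulrA -expr2 sqrtrM ?sqr_ge0// sqrtr_sqr.
Qed.

Lemma enormN x : enorm (- x) = enorm x.
Proof. by rewrite /enorm dotNl dotNr opprK. Qed.

Lemma enorm_inj x y : enorm x ^+ 2 = enorm y ^+ 2 -> enorm x = enorm y.
Proof. by move=> /eqP; rewrite eqrXn2 ?enorm_ge0// => /eqP. Qed.

Lemma dot1_enorm x : dot x x = 1 -> enorm x = 1.
Proof. by move=> x1; rewrite /enorm x1 sqrtr1. Qed.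

Lemma enorm_normalize x : x != 0 -> enorm (normalize x) = 1.
Proof.
move=> x0; have x_gt0 := enorm_gt0 x0.
by rewrite /normalize enormZ ger0_norm ?invr_ge0 ?enorm_ge0// mulVf ?gt_eqF.
Qed.

Lemma scale_normalize x : enorm x *: normalize x = x.
Proof.
have [->|x0] := eqVneq x 0; first by rewrite enorm0 scale0r.
by rewrite /normalize scalerA divff ?scale1r// gt_eqF// enorm_gt0.
Qed.

Lemma normalizeZ a x : 0 < a -> normalize (a *: x) = normalize x.
Proof.
move=> a0; rewrite /normalize enormZ gtr0_norm// scalerA invfM.
by rewrite mulrAC mulVf ?gt_eqF// mul1r.
Qed.

End euclidean_algebra.

Lemma I3P (i : 'I_3) : [\/ i = 0, i = 1 | i = 2%:R].
Proof.
by case: i => -[|[|[|//]]] h; [apply: Or31|apply: Or32|apply: Or33]; exact: val_inj.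
Qed.

Lemma rV3P {R : realType} (x y : 'rV[R]_3) :
  x 0 0 = y 0 0 -> x 0 1 = y 0 1 -> x 0 2%:R = y 0 2%:R -> x = y.
Proof.
by move=> h0 h1 h2; apply/rowP => i; have [] := I3P i => ->.
Qed.

(** * Translation invariance and uniqueness of Lebesgue measure on R^3 *)

Section lebesgue_invariance.
Context {R : realType}.
Local Notation V := 'rV[R]_3.
Local Notation leb := (@lebesgue_measure R).

Lemma preserving_lebesgueD (a : R) :
  preserving leb (fun x : measurableTypeR R => (x + a)%R).
Proof.
have mS : measurable_fun setT (fun x : measurableTypeR R => (x + a)%R).
  exact: measurable_funD.
split => // A mA.
have [mu muE] := pushforward_measure (T' := measurableTypeR R) leb mS; rewrite -muE; apply/esym.
apply: lebesgue_measure_unique mA => _ [[b c]] _ <-; rewrite muE (_ : _ @^-1` _ = [set` (`](b - a)%R, (c - a)%R] : interval R)]); last first.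
  by apply/seteqP; split => x /=; rewrite !in_itv/= ltrBlDr lerBrDr.
apply: etrans (etrans (lebesgue_measure_itv _) _)
  (esym (lebesgue_measure_itv _)) => /=.
rewrite !lte_fin ltrD2r.
by case: ifP => // _; rewrite -!EFinB; congr (_%:E); ring.
Qed.

Lemma preserving_lebesgueN : preserving leb (-%R : measurableTypeR R -> _).
Proof. by split => [//|A mA]; exact: lebesgue_measureN. Qed.

Lemma preserving_lebesgue3 (s0 s1 s2 : R -> R) (S : V -> V) :
  preserving leb s0 -> preserving leb s1 -> preserving leb s2 ->
  (forall x, S x = \row_i [:: s0 (x 0 0); s1 (x 0 1); s2 (x 0 2%:R)]`_i) ->
  preserving lebesgue3 S.
Proof.
move=> p0 p1 p2 SE.
have m2 (s : R -> R) : preserving leb s ->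
    measurable_fun setT (fun y : measurableTypeR R * measurableTypeR R => s y.2).
  by case=> ms _; exact: measurableT_comp.
have q2 : preserving lebesgue2 (skew s0 (fun=> s1)).
  by apply: preserving_skew => //; exact: m2.
have q3 : preserving (lebesgue2 \x leb)%E
    (skew (skew s0 (fun=> s1)) (fun=> s2)).
  apply: preserving_skew => //.
  by case: p2 => ms _; exact: measurableT_comp.
have SrV3 : S \o rV3 = rV3 \o (skew (skew s0 (fun=> s1)) (fun=> s2)).
  by apply/funext => p; rewrite /= SE; apply/rowP => i; rewrite /rV3 !mxE.
have mS : measurable_fun setT S.
  have -> : S = rV3 \o (skew (skew s0 (fun=> s1)) (fun=> s2)) \o unrV3.
    apply/funext => x /=; rewrite SE; apply/rowP => i.
    by rewrite /rV3 /skew /unrV3 /rV_coord/= !mxE.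
  apply: measurableT_comp measurable_unrV3; apply: measurableT_comp q3.1.
  exact: measurable_rV3.
split; first exact: mS.
move=> A mA; rewrite /lebesgue3/= /pushforward -comp_preimage SrV3.
by rewrite comp_preimage q3.2//; exact: measurable_preimT measurable_rV3 mA.
Qed.

Lemma preserving_lebesgue3D (a : V) : preserving lebesgue3 (fun x => x + a)%R.
Proof.
apply: (@preserving_lebesgue3 (+%R^~ (a 0 0)) (+%R^~ (a 0 1)) (+%R^~ (a 0 2%:R)));
  try exact: preserving_lebesgueD.
by move=> x; apply: rV3P; rewrite !mxE.
Qed.

Lemma preserving_lebesgue3N : preserving lebesgue3 (-%R : V -> V).
Proof.
apply: (@preserving_lebesgue3 -%R -%R -%R); try exact: preserving_lebesgueN.
by move=> x; apply: rV3P; rewrite !mxE.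
Qed.

Local Open Scope ereal_scope.

Lemma preserving_lebesgue3_sub (a : V) :
  preserving lebesgue3 (fun x => a - x)%R.
Proof.
rewrite (_ : (fun _ => _) = (fun x => x + a)%R \o -%R); last first.
  by apply/funext => x /=; rewrite addrC.
by apply: preserving_comp; [exact: preserving_lebesgue3D|exact: preserving_lebesgue3N].
Qed.

(* Both sides are [\int\int 1_A(y) 1_B(x + y) dx mu(dy)]. *)
Lemma translation_invariant_lebesgue3
    (mu : {sigma_finite_measure set V -> \bar R}) :
  (forall a : V, preserving mu (fun x => x + a)%R) ->
  forall A B, measurable A -> measurable B ->
  lebesgue3 B * mu A = lebesgue3 A * mu B.
Proof.
move=> pmu A B mA mB.
pose f (p : V * V) := (\1_A p.2 * \1_B (p.1 + p.2)%R)%:E : \bar R.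
pose g (p : V * V) := (\1_A (p.2 - p.1)%R * \1_B p.2)%:E : \bar R.
have mind (C : set V) (h : V * V -> V) : measurable C ->
    measurable_fun setT h -> measurable_fun setT (fun p => \1_C (h p) : R).
  by move=> mC mh; exact: (measurableT_comp (measurable_indic mC) mh).
have mf : measurable_fun setT f.
  apply/measurable_EFinP; apply: measurable_funM; first exact: mind.
  by apply: mind => //; exact: measurable_rVD.
have mg : measurable_fun setT g.
  apply/measurable_EFinP; apply: measurable_funM; last exact: mind.
  by apply: mind => //; exact: measurable_rVB.
have i0 (C : set V) (x : V) : (0 <= (\1_C x : R))%R by rewrite indicE.
have f0 p : 0 <= f p by rewrite lee_fin mulr_ge0.
have g0 p : 0 <= g p by rewrite lee_fin mulr_ge0.
have mD (a : V) : measurable_fun setT (fun x : V => x + a)%R.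
  exact: (preserving_lebesgue3D a).1.
have m1 (C : set V) (S : V -> V) : measurable C -> measurable_fun setT S ->
    measurable_fun setT (fun p => (\1_C (S p))%:E : \bar R).
  move=> mC mS; apply/measurable_EFinP.
  exact: (measurableT_comp (measurable_indic mC) mS).
have F1 : \int[mu]_y \int[lebesgue3]_x f (x, y) = lebesgue3 B * mu A.
  rewrite (eq_integral (fun y => lebesgue3 B * (\1_A y)%:E)); last first.
    move=> y _; rewrite /f /=.
    under eq_integral do rewrite EFinM.
    rewrite ge0_integralZl_EFin//; last exact: (m1 B _ mB (mD y)).
    rewrite (ge0_integral_preserving (f := fun x => (\1_B x)%:E)
      (preserving_lebesgue3D y))//; last exact: (m1 B id).
    by rewrite integral_indic// setIT muleC.
  rewrite ge0_integralZl//; last exact: (m1 A id).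
  by rewrite integral_indic// setIT.
have F2 : \int[mu]_y \int[lebesgue3]_x g (x, y) = lebesgue3 A * mu B.
  rewrite (eq_integral (fun y => lebesgue3 A * (\1_B y)%:E)); last first.
    move=> y _; rewrite /g /=.
    under eq_integral do rewrite mulrC EFinM.
    have p := preserving_lebesgue3_sub y.
    rewrite ge0_integralZl_EFin//; last exact: (m1 A _ mA p.1).
    rewrite (ge0_integral_preserving (f := fun x => (\1_A x)%:E) p)//; last exact: (m1 A id).
    by rewrite integral_indic// setIT muleC.
  rewrite ge0_integralZl//; last exact: (m1 B id).
  by rewrite integral_indic// setIT.
rewrite -F1 -F2 -(fubini_tonelli (m1 := lebesgue3) (m2 := mu) f mf f0).
rewrite -(fubini_tonelli (m1 := lebesgue3) (m2 := mu) g mg g0).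
apply: eq_integral => x _; rewrite /fubini_F.
rewrite -(ge0_integral_preserving (f := fun y => g (x, y)) (pmu x))//.
  by apply: eq_integral => y _; rewrite /f /g /= addrK addrC.
exact: measurableT_comp.
Qed.

(** The image of Lebesgue measure under an additive bijection is again translation invariant, hence
    proportional to Lebesgue measure. The cross-multiplied form keeps the factor, the absolute value
    of a determinant, implicit. *)
Lemma lebesgue3_additive_map (T T' : V -> V) :
  measurable_fun setT T -> measurable_fun setT T' ->
  {morph T : x y / (x + y)%R} -> cancel T T' -> cancel T' T ->
  forall A B, measurable A -> measurable B ->
  lebesgue3 B * lebesgue3 (T @^-1` A) = lebesgue3 A * lebesgue3 (T @^-1` B).
Proof.
move=> mT mT' TD TK T'K A B mA mB.
have [mu muE] := pushforward_sigma_finite lebesgue3 mT mT' TK.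
rewrite -!muE; apply: translation_invariant_lebesgue3 => // a.
split; first exact: (preserving_lebesgue3D a).1.
move=> C mC; rewrite /= !muE.
rewrite -[RHS](preserving_lebesgue3D (T' a)).2; last exact: measurable_preimT.
by congr (lebesgue3 _); apply/seteqP; split => x /=; rewrite TD T'K.
Qed.

End lebesgue_invariance.

(** * Isometries, reflections and the sphere measure *)

Section isometries.
Context {R : realType}.
Local Notation V := 'rV[R]_3.
Local Notation leb := (@lebesgue_measure R).
Local Open Scope ereal_scope.

Definition unit_ball : set V := [set x : V | (enorm x <= 1)%R].

Lemma measurable_ball (r : R) : measurable [set x : V | (enorm x <= r)%R].
Proof.
rewrite (_ : mkset _ = enorm @^-1` [set` (`]-oo, r] : interval R)]).
  by apply: measurable_preimT; [exact: measurable_enorm|exact: measurable_itv].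
by apply/seteqP; split => x; rewrite /= in_itv.
Qed.

Lemma lebesgue3_box (A B C : set R) : measurable A -> measurable B ->
  measurable C ->
  lebesgue3 [set x : V | [/\ A (x ord0 0%R), B (x ord0 1%R) & C (x ord0 2%:R)]] =
  leb A * leb B * leb C.
Proof.
move=> mA mB mC; rewrite /lebesgue3/= /pushforward.
rewrite (_ : _ @^-1` _ = (A `*` B) `*` C); last first.
  apply/seteqP; split => [p /=|p [[/= Ap Bp] Cp]]; rewrite /rV3 !mxE//=.
  by case.
rewrite product_measure1E//; last exact: measurableX.
by congr (_ * _); exact: product_measure1E.
Qed.

Lemma lebesgue3_coord0 (i : 'I_3) : lebesgue3 [set x : V | x ord0 i = 0%R] = 0.
Proof.
have m0 : @measurable _ (measurableTypeR R) [set 0%R] by exact: measurable_set1.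
have mT : @measurable _ (measurableTypeR R) setT by exact: measurableT.
have l0 : leb [set 0%R] = 0 by exact: lebesgue_measure_set1.
have [->|->|->] := I3P i.
- rewrite (_ : mkset _ = [set x : V | [/\ [set 0%R] (x ord0 0%R),
    setT (x ord0 1%R) & setT (x ord0 2%:R)]]).
    by rewrite lebesgue3_box// l0 !mul0e.
  by apply/seteqP; split => x //= -[].
- rewrite (_ : mkset _ = [set x : V | [/\ setT (x ord0 0%R),
    [set 0%R] (x ord0 1%R) & setT (x ord0 2%:R)]]).
    by rewrite lebesgue3_box// l0 mule0 mul0e.
  by apply/seteqP; split => x //= -[].
- rewrite (_ : mkset _ = [set x : V | [/\ setT (x ord0 0%R),
    setT (x ord0 1%R) & [set 0%R] (x ord0 2%:R)]]).
    by rewrite lebesgue3_box// l0 mule0.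
  by apply/seteqP; split => x //= -[].
Qed.

Lemma measurable_coord0 (i : 'I_3) : measurable [set x : V | x ord0 i = 0%R].
Proof.
rewrite (_ : mkset _ = rV_coord i @^-1` [set 0%R])//.
by apply: measurable_preimT; [exact: measurable_rV_coord|exact: measurable_set1].
Qed.

Lemma lebesgue3_unit_ball_gt0 : 0 < lebesgue3 unit_ball.
Proof.
(* The centred cube of side 1 has volume 1, and its points satisfy |x|^2 <= 3/4. *)
pose I : set (measurableTypeR R) := [set` (`[(- 2^-1)%R, 2^-1%R] : interval R)].
have mI : measurable I by exact: measurable_itv.
have lI : leb I = 1.
  rewrite /I lebesgue_measure_itv/= lte_fin ifT; last by lra.
  by rewrite -EFinB; congr _%:E; lra.
have mb := measurable_ball 1.
apply: (@lt_le_trans _ _ (leb I * leb I * leb I)); first by rewrite lI !mule1.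
rewrite -lebesgue3_box//; apply: le_measure; rewrite ?inE//.
  rewrite (_ : mkset _ = (rV_coord 0%R @^-1` I) `&` (rV_coord 1%R @^-1` I)
    `&` (rV_coord 2%:R @^-1` I)).
    by do 2 (try apply: measurableI); apply: measurable_preimT => //;
      exact: measurable_rV_coord.
  by apply/seteqP; split => [x []//|x [[]//]].
move=> x /= [h0 h1 h2]; rewrite /unit_ball/=.
have sq (a : R) : I a -> (a * a <= 4^-1)%R.
  by rewrite /I /= in_itv /= => /andP[? ?]; nra.
rewrite -(@ler_sqr _ (enorm x) 1%R) ?nnegrE ?enorm_ge0// enorm_sqr expr1n.
rewrite /dot !big_ord_recl big_ord0 addr0.
have -> : lift ord0 ord0 = 1%R :> 'I_3 by exact: val_inj.
have -> : lift ord0 (lift ord0 ord0) = 2%:R :> 'I_3 by exact: val_inj.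
by move: (sq _ h0) (sq _ h1) (sq _ h2); lra.
Qed.

Lemma lebesgue3_unit_ball_fin : lebesgue3 unit_ball \is a fin_num.
Proof. by rewrite ge0_fin_numE//; exact: lebesgue3_unit_ball. Qed.

(** The unit ball is invariant and has finite positive volume, so the proportionality factor of
    [lebesgue3_additive_map] is 1. Involutivity provides the measurable inverse. *)
Lemma preserving_isometry (T : V -> V) : measurable_fun setT T ->
  {morph T : x y / (x + y)%R} -> involutive T ->
  (forall x, enorm (T x) = enorm x) -> preserving lebesgue3 T.
Proof.
move=> mT TD TK Tn; split; first exact: mT.
move=> A mA; have := lebesgue3_additive_map mT mT TD TK TK mA (measurable_ball 1).
rewrite (_ : T @^-1` [set x | (enorm x <= 1)%R] = unit_ball); last first.
  by apply/seteqP; split => x /=; rewrite Tn.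
rewrite [RHS]muleC; move/eqP; rewrite -/unit_ball.
rewrite -(fineK lebesgue3_unit_ball_fin).
have l0 : (0 < fine (lebesgue3 unit_ball))%R.
  by rewrite fine_gt0// lebesgue3_unit_ball_gt0/= lebesgue3_unit_ball.
rewrite -lte_fin in l0.
by rewrite eq_le !(lee_pmul2l (erefl : _%:E \is a fin_num) l0) -eq_le => /eqP.
Qed.

Lemma sphere_measureE (A : set V) :
  sphere_measure A = 3%:E * lebesgue3 (normalize @^-1` A `&` unit_ball).
Proof. by []. Qed.

Lemma preserving_sphere (T : V -> V) : measurable_fun setT T ->
  {morph T : x y / (x + y)%R} -> (forall a, {morph T : x / (a *: x)%R}) ->
  involutive T -> (forall x, enorm (T x) = enorm x) ->
  preserving sphere_measure T.
Proof.
move=> mT TD TZ TK Tn; split; first exact: mT.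
move=> A mA; rewrite !sphere_measureE; congr (_ * _).
rewrite -[RHS](preserving_isometry mT TD TK Tn).2; last first.
  apply: measurableI; last exact: measurable_ball.
  exact: measurable_preimT measurable_normalize mA.
congr (lebesgue3 _); apply/seteqP; split => x /=.
  by rewrite /unit_ball /= Tn /normalize Tn TZ.
by rewrite /unit_ball /= Tn /normalize Tn TZ.
Qed.

(** Reflections are their own inverses, as [preserving_isometry] requires, and two of them compose
    to a rotation. For [n = 0] this is the identity. *)
Definition householder (n x : V) : V :=
  (x - (2 * (dot x n / dot n n)) *: n)%R.

Lemma householder_dot (n x y : V) :
  dot (householder n x) (householder n y) = dot x y.
Proof.
rewrite /householder; have [->|n0] := eqVneq n 0%R.
  by rewrite !scaler0 !subr0.
have nn : dot n n != 0%R by apply: contra n0 => /eqP /dot_eq0 ->.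
rewrite !dotE [dot n y]dotC; field.
exact: nn.
Qed.

Lemma householderK n : involutive (householder n).
Proof.
move=> x; rewrite /householder; have [->|n0] := eqVneq n 0%R.
  by rewrite !scaler0 !subr0.
have nn : dot n n != 0%R by apply: contra n0 => /eqP /dot_eq0 ->.
rewrite -addrA -opprD -scalerDl !dotE.
rewrite [X in (X *: _)%R](_ : _ = 0%R); first by rewrite scale0r subr0.
by field; exact: nn.
Qed.

Lemma householderD n : {morph householder n : x y / (x + y)%R}.
Proof.
move=> x y; rewrite /householder dotDl [X in (X *: n)%R](_ : _ =
  2 * (dot x n / dot n n) + 2 * (dot y n / dot n n))%R; last by ring.
by rewrite scalerDl opprD addrACA.
Qed.

Lemma householderZ n a : {morph householder n : x / (a *: x)%R}.
Proof.
move=> x; rewrite /householder !dotE scalerBr scalerA; congr (_ - _ *: _)%R.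
by rewrite -!mulrA mulrCA.
Qed.

Lemma householder_enorm n x : enorm (householder n x) = enorm x.
Proof. by rewrite /enorm householder_dot. Qed.

Lemma measurable_householder d (T : measurableType d) (f g : T -> V) :
  measurable_fun setT f -> measurable_fun setT g ->
  measurable_fun setT (fun t => householder (f t) (g t)).
Proof.
move=> mf mg; apply: measurable_rVB => //; apply: measurable_rVZ => //.
apply: measurable_funM => //; apply: measurable_funM; first exact: measurable_dot.
rewrite (_ : (fun _ => _) = (fun t => (dot (f t) (f t)) `^ (-1))%R).
  by apply: (measurableT_comp (measurable_powR _)); exact: measurable_dot.
by apply/funext => t; rewrite powR_inv1// dot_ge0.
Qed.

Lemma preserving_householder n : preserving lebesgue3 (householder n).
Proof.
apply: preserving_isometry; [|exact: householderD|exact: householderK|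
  exact: householder_enorm].
by apply: measurable_householder => //; exact: measurable_cst.
Qed.

Lemma preserving_sphere_householder n : preserving sphere_measure (householder n).
Proof.
apply: preserving_sphere; [|exact: householderD|exact: householderZ|
  exact: householderK|exact: householder_enorm].
by apply: measurable_householder => //; exact: measurable_cst.
Qed.

Lemma preserving_sphereN : preserving sphere_measure (-%R : V -> V).
Proof.
apply: preserving_sphere; [|exact: opprD|by move=> a x; rewrite scalerN|
  exact: opprK|exact: enormN].
exact: measurable_rVN.
Qed.

(** Away from the origin [normalize] lands on the sphere, and the origin lies in a null coordinate
    plane. *)
Lemma sphere_measure_setC : sphere_measure (~` (@S2 R)) = 0.
Proof.
rewrite sphere_measureE (_ : lebesgue3 _ = 0) ?mule0//.
apply/eqP; rewrite eq_le measure_ge0 andbT.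
rewrite -(lebesgue3_coord0 0%R); apply: le_measure; rewrite ?inE.
- apply: measurableI; last exact: measurable_ball.
  apply: measurable_preimT; first exact: measurable_normalize.
  by apply: measurableC; exact: measurable_unit_sphere.
- exact: measurable_coord0.
- move=> x /= [nx _]; have [->|x0] := eqVneq x 0%R; first by rewrite mxE.
  by exfalso; apply: nx; rewrite /S2 /= enorm_normalize.
Qed.

Lemma lebesgue3_scale (r : R) (A B : set V) : r != 0%R ->
  measurable A -> measurable B ->
  lebesgue3 B * lebesgue3 ( *:%R r @^-1` A) =
  lebesgue3 A * lebesgue3 ( *:%R r @^-1` B).
Proof.
move=> r0 mA mB.
apply: (@lebesgue3_additive_map _ ( *:%R r) ( *:%R r^-1)) => //.
- exact: measurable_rVZ.
- exact: measurable_rVZ.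
- by move=> x y; rewrite scalerDr.
- by move=> x; rewrite scalerA mulVf// scale1r.
- by move=> x; rewrite scalerA mulfV// scale1r.
Qed.

Lemma measure_unique_halfline (m1 m2 : {measure set (measurableTypeR R) -> \bar R}) :
  (forall r : R, m1 [set x | (x <= r)%R] = m2 [set x | (x <= r)%R]) ->
  (forall r : R, m1 [set x | (x <= r)%R] < +oo) ->
  forall A, measurable A -> m1 A = m2 A.
Proof.
move=> m12 m1oo; pose G := [set A : set R | exists r : R, A = [set x | (x <= r)%R]].
have mle (r : R) : @measurable _ (measurableTypeR R) [set x | (x <= r)%R].
  rewrite (_ : mkset _ = [set` (`]-oo, r] : interval R)]).
    exact: measurable_itv.
  by apply/seteqP; split => x; rewrite /= in_itv.
move=> A; apply: (@measure_unique _ R (measurableTypeR R) G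
  (fun n => [set x | (x <= n%:R)%R])).
- apply/seteqP; split.
    rewrite [X in X `<=` _](RGenInftyO.measurableE R).
    apply: smallest_sub; first exact: smallest_sigma_algebra.
    move=> _ [x ->].
    have -> : [set` (`]-oo, x[ : interval R)] =
        \bigcup_n [set y : R | (y <= x - n.+1%:R^-1)%R].
      apply/seteqP; split => y /=; rewrite in_itv/=.
        rewrite -subr_gt0 => xy0; have iv : (0 <= (x - y)^-1)%R by rewrite invr_ge0 ltW.
        have hk := archi_boundP iv; exists (Num.bound (x - y)^-1) => //=.
        rewrite lerBrDr -lerBrDl -[leRHS]invrK lef_pV2 ?posrE ?invr_gt0//.
        by apply: ltW; apply: lt_le_trans hk _; rewrite ler_nat.
      move=> [k _ /= yk]; apply: le_lt_trans yk _.
      by rewrite ltrBlDr ltrDl invr_gt0 ltr0n.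
    apply: sigma_algebra_bigcup => k; apply: sub_sigma_algebra.
    by exists (x - k.+1%:R^-1)%R.
  apply: smallest_sub; first exact: sigma_algebra_measurable.
  by move=> _ [r ->]; exact: mle.
- move=> _ _ [r ->] [s ->]; exists (Num.min r s).
  by apply/seteqP; split => x /=; rewrite le_min => /andP.
- by move=> n; exists n%:R.
- apply/seteqP; split => // x _; exists (Num.bound `|x|) => //=.
  by rewrite (le_trans (ler_norm x))// ltW// archi_boundP.
- by move=> _ [r ->]; exact: m12.
- by move=> n; exact: m1oo.
Qed.

End isometries.

(** * Polar coordinates and integrals over space and sphere *)

Section polar_coordinates.
Context {R : realType}.
Local Notation V := 'rV[R]_3.
Local Notation leb := (@lebesgue_measure R).
Local Open Scope ereal_scope.

Lemma mule_pos_inj (c : R) (x y : \bar R) : (0 < c)%R ->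
  c%:E * x = c%:E * y -> x = y.
Proof.
move=> c0 /eqP; rewrite -lte_fin in c0.
by rewrite eq_le !(lee_pmul2l (erefl : _%:E \is a fin_num) c0) -eq_le => /eqP.
Qed.

Lemma coord_le_enorm (x : V) i : (`|x ord0 i| <= enorm x)%R.
Proof.
rewrite -sqrtr_sqr /enorm ler_wsqrtr// /dot (bigD1 i)//= -expr2 lerDl.
by apply: sumr_ge0 => j _; rewrite -expr2 sqr_ge0.
Qed.

Lemma lebesgue3_ball_lty (r : R) : lebesgue3 [set x : V | (enorm x <= r)%R] < +oo.
Proof.
pose I : set (measurableTypeR R) := [set` (`[(- r)%R, r] : interval R)].
have mI : measurable I by exact: measurable_itv.
have lI : leb I \is a fin_num.
  rewrite ge0_fin_numE// /I lebesgue_measure_itv/=.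
  by case: ifP => _; rewrite ?ltry// lte_fin.
apply: (@le_lt_trans _ _ (leb I * leb I * leb I)); last first.
  by rewrite -ge0_fin_numE ?mule_ge0// !fin_numM.
rewrite -lebesgue3_box//; apply: le_measure; rewrite ?inE.
- exact: measurable_ball.
- rewrite (_ : mkset _ = (rV_coord 0%R @^-1` I) `&` (rV_coord 1%R @^-1` I)
    `&` (rV_coord 2%:R @^-1` I)).
    by do 2 (try apply: measurableI); apply: measurable_preimT => //;
      exact: measurable_rV_coord.
  by apply/seteqP; split => [x []//|x [[]//]].
- move=> x /= xr; have xI i : I (x ord0 i).
    by rewrite /I /= in_itv /= -ler_norml (le_trans (coord_le_enorm x i)).
  by split.
Qed.

(** The total mass of [sphere_measure], that is, the area of the unit sphere. *)
Definition kappa : R := 3 * fine (lebesgue3 (@unit_ball R)).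

Lemma kappa_gt0 : (0 < kappa)%R.
Proof.
rewrite /kappa mulr_gt0// fine_gt0// lebesgue3_unit_ball_gt0/=.
exact: lebesgue3_unit_ball.
Qed.

(** Dilation by [r] multiplies the volumes of the unit ball and of the unit sector over [B] by the
    same factor, which therefore need not be computed. For [r <= 0] both sides vanish. *)
Lemma polar_sector (r : R) (B : set V) : measurable B ->
  kappa%:E * lebesgue3 [set z | (enorm z <= r)%R /\ B (normalize z)] =
  lebesgue3 [set z : V | (enorm z <= r)%R] * sphere_measure B.
Proof.
move=> mB; have mnB := measurable_preimT (@measurable_normalize R 3) mB.
have [r0|r0] := leP r 0%R.
  have z0 (A : set V) : measurable A ->
      lebesgue3 [set z | (enorm z <= r)%R /\ A (normalize z)] = 0.
    move=> mA; apply/eqP; rewrite eq_le measure_ge0 andbT.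
    rewrite -(lebesgue3_coord0 0%R); apply: le_measure; rewrite ?inE.
    - apply: measurableI; first exact: measurable_ball.
      exact: (measurable_preimT (@measurable_normalize R 3) mA).
    - exact: measurable_coord0.
    - move=> z /= [zr _]; have -> : z = 0%R; last by rewrite mxE.
      by apply/enorm_eq0/eqP; rewrite eq_le enorm_ge0 (le_trans zr).
  rewrite z0// mule0; move: (z0 setT measurableT).
  rewrite (_ : mkset _ = [set z : V | (enorm z <= r)%R]) => [->|].
    by rewrite mul0e.
  by apply/seteqP; split => [z []//|z /=].
have ri0 : (r^-1 != 0)%R by rewrite invr_neq0// gt_eqF.
pose A : set V := normalize @^-1` B `&` unit_ball.
have mA : measurable A by apply: measurableI => //; exact: measurable_ball.
have := lebesgue3_scale ri0 mA (measurable_ball 1).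
have leE (z : V) : (enorm (r^-1 *: z) <= 1)%R = (enorm z <= r)%R.
  rewrite (_ : enorm _ = enorm z / r)%R ?ler_pdivrMr ?mul1r//.
  by rewrite enormZ gtr0_norm ?invr_gt0// mulrC.
rewrite (_ : *:%R (r^-1)%R @^-1` A = [set z | (enorm z <= r)%R /\ B (normalize z)]);
  last first.
  apply/seteqP; split => z; rewrite /A/unit_ball/= leE normalizeZ ?invr_gt0//.
    by case.
  by case.
rewrite (_ : *:%R (r^-1)%R @^-1` [set x | (enorm x <= 1)%R] =
  [set z | (enorm z <= r)%R]); last by apply/seteqP; split => z /=; rewrite leE.
rewrite sphere_measureE -/A -/unit_ball => e.
have kE : kappa%:E = 3%:E * lebesgue3 (@unit_ball R).
  by rewrite /kappa EFinM (fineK lebesgue3_unit_ball_fin).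
transitivity (3%:E * (lebesgue3 A * lebesgue3 [set z : V | (enorm z <= r)%R])).
  by rewrite kE -e muleA.
by rewrite [RHS]muleC muleA.
Qed.

Definition polar (z : V) : measurableTypeR R * V := (enorm z, normalize z).

Lemma measurable_polar : measurable_fun setT polar.
Proof.
apply/measurable_fun_pairP; split; first exact: measurable_enorm.
exact: measurable_normalize.
Qed.

(** [rho] is the image of Lebesgue measure under [enorm]. By [polar_sector] the two measures agree
    on every half-line times [B], and half-lines determine a measure on the line. *)
Lemma polar_product : exists rho : {sigma_finite_measure set (measurableTypeR R) -> \bar R},
  forall A, measurable A ->
  (rho \x sphere_measure) A = kappa%:E * lebesgue3 (polar @^-1` A).
Proof.
have [rho0 rho0E] := pushforward_measure (T' := measurableTypeR R) lebesgue3
  (@measurable_enorm R 3).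
have mle (r : R) : @measurable _ (measurableTypeR R) [set x | (x <= r)%R].
  rewrite (_ : mkset _ = [set` (`]-oo, r] : interval R)]).
    exact: measurable_itv.
  by apply/seteqP; split => x; rewrite /= in_itv.
have [|rho rhoE] := @sigma_finite_measure_of _ _ _ rho0.
  exists (fun n => [set x : R | (x <= n%:R)%R]).
    apply/seteqP; split => // x _; exists (Num.bound `|x|) => //=.
    by rewrite (le_trans (ler_norm x))// ltW// archi_boundP.
  by move=> n; split; [exact: mle|rewrite rho0E; exact: lebesgue3_ball_lty].
exists rho => A mA.
have [P PE] := pushforward_measure lebesgue3 measurable_polar.
pose c : {nonneg R} := NngNum (ltW kappa_gt0).
pose Pc : {measure set (measurableTypeR R * V) -> \bar R} := mscale c P.
have PcE B : Pc B = kappa%:E * lebesgue3 (polar @^-1` B).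
  by rewrite /Pc /= /mscale /= PE.
rewrite -PcE; apply: product_measure_unique => // {A mA} A B mA mB.
have mnB := measurable_preimT (@measurable_normalize R 3) mB.
pose LB : {measure set V -> \bar R} := mrestr lebesgue3 mnB.
have [m1 m1E] := pushforward_measure (T' := measurableTypeR R) LB
  (@measurable_enorm R 3).
pose m1c : {measure set (measurableTypeR R) -> \bar R} := mscale c m1.
have sB : sphere_measure B \is a fin_num by exact: fin_num_measure.
have sB0 : (0 <= fine (sphere_measure B))%R by exact/fine_ge0/measure_ge0.
pose m2c : {measure set (measurableTypeR R) -> \bar R} := mscale (NngNum sB0) rho.
rewrite PcE (_ : kappa%:E * _ = m1c A); last first.
  by rewrite /m1c /= /mscale /= m1E.
rewrite (_ : rho A * _ = m2c A); last first.
  by rewrite /m2c /= /mscale/= fineK// muleC.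
apply: measure_unique_halfline => // r.
- rewrite /m1c /= /mscale /= m1E /LB /= /mrestr polar_sector//.
  by rewrite rhoE rho0E fineK// muleC.
- rewrite /m1c /= /mscale /= m1E /LB /= /mrestr polar_sector//.
  rewrite lte_mul_pinfty ?lebesgue3_ball_lty//.
    by rewrite ge0_fin_numE// lebesgue3_ball_lty.
  by rewrite -ge0_fin_numE.
Qed.

Definition swap_polar (p : V * V) : V * V := (enorm p.1 *: p.2, normalize p.1).

Lemma measurable_swap_polar : measurable_fun setT swap_polar.
Proof.
apply/measurable_fun_pairP; split.
  by apply: measurable_rVZ => //; exact: measurable_enorm_comp.
exact: measurable_normalize_comp.
Qed.

(* In polar coordinates [z = r k] the map is the exchange of [k] and [sigma]. *)
Lemma preserving_swap_polar :
  preserving (lebesgue3 \x sphere_measure) swap_polar.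
Proof.
split; first exact: measurable_swap_polar.
move=> A mA; have mSA := measurable_preimT measurable_swap_polar mA.
apply: (mule_pos_inj kappa_gt0).
have [rho rhoE] := polar_product.
pose C : set (measurableTypeR R * V * V) :=
  (fun p => (p.1.1 *: p.2, p.1.2)) @^-1` A.
pose C' : set (measurableTypeR R * V * V) :=
  (fun p => (p.1.1 *: p.1.2, p.2)) @^-1` A.
have m11 : measurable_fun setT (fun p : measurableTypeR R * V * V => p.1.1 : R).
  exact: measurableT_comp.
have m12 : measurable_fun setT (fun p : measurableTypeR R * V * V => p.1.2).
  exact: measurableT_comp.
have mC : measurable C.
  by apply: measurable_preimT mA; apply/measurable_fun_pairP; split => //;
    exact: measurable_rVZ.
have mC' : measurable C'.
  apply: measurable_preimT mA; apply/measurable_fun_pairP; split.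
    exact: measurable_rVZ m11 m12.
  exact: measurable_snd.
pose h := sphere_measure \o xsection C.
pose h' := sphere_measure \o xsection C'.
have mh : measurable_fun setT h := measurable_fun_xsection sphere_measure mC.
have mh' : measurable_fun setT h' := measurable_fun_xsection sphere_measure mC'.
have [P PE] := pushforward_measure lebesgue3 measurable_polar.
have intP (g : measurableTypeR R * V -> \bar R) : measurable_fun setT g ->
    (forall x, 0 <= g x) ->
    kappa%:E * \int[lebesgue3]_z g (polar z) = \int[rho]_r \int[sphere_measure]_k g (r, k).
  move=> mg g0; rewrite -(fubini_tonelli1 (m1 := rho) (m2 := sphere_measure))//.
  pose c : {nonneg R} := NngNum (ltW kappa_gt0).
  have -> : \int[rho \x sphere_measure]_z g z = \int[mscale c P]_z g z.
    apply: eq_measure_integral => B mB _.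
    by apply: etrans (rhoE _ mB) _; rewrite /= /mscale /= PE.
  rewrite ge0_integral_mscale//; congr (_ * _).
  transitivity (\int[pushforward lebesgue3 polar]_z g z).
    rewrite [RHS]ge0_integral_pushforward ?preimage_setT//.
    exact: measurable_polar.
  apply: eq_measure_integral; first exact: measurable_polar.
  by move=> ? B mB _; exact/esym/PE.
have E1 : (lebesgue3 \x sphere_measure) (swap_polar @^-1` A) =
    \int[lebesgue3]_z h (polar z).
  apply: eq_integral => z _; rewrite /h /=; apply: (congr1 sphere_measure).
  by apply/seteqP; split => s; rewrite /xsection /= !inE.
have E2 : (lebesgue3 \x sphere_measure) A = \int[lebesgue3]_z h' (polar z).
  apply: eq_integral => z _; rewrite /h' /=; apply: (congr1 sphere_measure).
  by apply/seteqP; split => s; rewrite /xsection /= !inE /C'/= scale_normalize.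
refine (etrans (congr1 (mule kappa%:E) E1) (etrans _ (esym (congr1 (mule kappa%:E) E2)))).
have h0 x : 0 <= h x by exact: measure_ge0.
have h'0 x : 0 <= h' x by exact: measure_ge0.
refine (etrans (intP _ mh h0) (etrans _ (esym (intP _ mh' h'0)))).
(* At fixed radius the two sides are iterated integrals of the same set over pairs of points of the
   sphere, taken in the two orders. *)
apply: eq_integral => r _.
pose D : set (V * V) := (fun p => (r *: p.1, p.2)) @^-1` A.
have mD : measurable D.
  apply: (measurable_preimT _ mA).
  exact: measurable_fun_pair (measurable_rVZ (measurable_cst _) measurable_fst)
    measurable_snd.
transitivity ((sphere_measure \x^ sphere_measure) D).
  apply: eq_integral => k _; rewrite /h /=; apply: (congr1 sphere_measure).
  by apply/seteqP; split => s; rewrite /xsection /ysection /= !inE.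
transitivity ((sphere_measure \x sphere_measure) D).
  exact: product_measure12.
apply: eq_integral => k _; rewrite /h' /=; apply: (congr1 sphere_measure).
by apply/seteqP; split => s; rewrite /xsection /= !inE.
Qed.

End polar_coordinates.

(** * Integrability of powers and weights *)

Section integrable_powers.
Context {R : realType}.
Local Notation V := 'rV[R]_3.
Local Notation leb := (@lebesgue_measure R).

Lemma integral_oneDsqrV_lty :
  (\int[leb]_x ((1 + x ^+ 2)^-1)%:E < +oo)%E.
Proof.
have ge0 (x : R) : 0 <= (1 + x ^+ 2)^-1 by rewrite invr_ge0 addr_ge0// sqr_ge0.
have cf : continuous (fun x : R => (1 + x ^+ 2)^-1).
  exact: (@continuous_oneDsqrV R).
have -> := ge0_symfun_integralT ge0 cf _; last first.
  by move=> x /=; rewrite sqrrN.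
rewrite -set_itvcy (@ge0_continuous_FTC2y R _ (@atan R) 0 (pi / 2)) => //.
- by rewrite -EFinB -EFinM ltry.
- exact: continuous_subspaceT.
- exact: cvgy_atan.
- by apply: cvg_at_right_filter; exact: continuous_atan.
- by move=> x _; rewrite derive1_atan.
Qed.

Definition singular (a x : R) : R := \1_`]0, 1] x * x `^ (- a).

Lemma singular_ge0 a x : 0 <= singular a x.
Proof. by rewrite /singular mulr_ge0 ?powR_ge0// indicE. Qed.

Lemma measurable_singular a : measurable_fun [set: R] (singular a).
Proof.
apply: measurable_funM; last exact: measurable_powR.
by apply: measurable_indic; exact: measurable_itv.
Qed.

Lemma integral_singular_lty (a : R) : 0 <= a < 1 ->
  (\int[leb]_x (singular a x)%:E < +oo)%E.
Proof.
move=> /andP[a0 a1]; pose c := 1 - a; have c0 : 0 < c by rewrite subr_gt0.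
(* Monotone limit over the intervals [1/(n+1), 1], on which the primitive x^c / c bounds every
   integral by 1 / c. *)
pose F n : set (measurableTypeR R) := [set` (`[n.+1%:R^-1, 1] : interval R)].
have F01 n x : F n x -> 0 < x <= 1.
  rewrite /F /= in_itv /= => /andP[nx ->]; rewrite andbT.
  by apply: lt_le_trans nx; rewrite invr_gt0.
have ndF : nondecreasing_seq F.
  apply/nondecreasing_seqP => n; apply/subsetPset => x; rewrite /F /= !in_itv /=.
  move=> /andP[nx ->]; rewrite andbT; apply: le_trans nx.
  by rewrite lef_pV2 ?posrE// ler_nat.
have mF n : measurable (F n) by exact: measurable_itv.
have mf n : measurable_fun (F n) (fun x => (singular a x)%:E).
  by apply/measurable_EFinP; apply: measurable_funTS; exact: measurable_singular.
have f0 n x : F n x -> (0 <= (singular a x)%:E)%E.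
  by move=> _; rewrite lee_fin singular_ge0.
have := @ge0_nondecreasing_set_cvg_integral _ _ R F (fun x => (singular a x)%:E)
  leb ndF mF mf f0.
have -> : \bigcup_n F n = [set` (`]0, 1] : interval R)].
  apply/seteqP; split => x; first by move=> [n _ /F01]; rewrite /= in_itv.
  rewrite /= in_itv /= => /andP[x0 x1].
  have iv : 0 <= x^-1 by rewrite invr_ge0 ltW.
  exists (Num.bound x^-1) => //=; rewrite /F /= in_itv /= x1 andbT.
  rewrite -[leRHS]invrK lef_pV2 ?posrE ?invr_gt0//.
  by apply: ltW; apply: lt_le_trans (archi_boundP iv) _; rewrite ler_nat.
move=> cvgI.
have -> : (\int[leb]_x (singular a x)%:E =
    \int[leb]_(x in [set` (`]0%R, 1%R] : interval R)]) (singular a x)%:E)%E.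
  rewrite [RHS]integral_mkcond; apply: eq_integral => x _.
  rewrite patchE; have [xI|xI] := pselect (0 < x <= 1).
    by rewrite mem_set//= in_itv.
  rewrite memNset /= ?in_itv// /singular indicE memNset /= ?in_itv//.
  by rewrite mul0r.
apply: (@le_lt_trans _ _ (c^-1)%:E); last exact: ltry.
rewrite -(cvg_lim _ cvgI)//; apply: lime_le; first by apply/cvg_ex; eexists; exact: cvgI.
apply: nearW => n.
have n1 : n.+1%:R^-1 <= 1 :> R by rewrite invf_le1// ler1n.
have n0 : 0 < n.+1%:R^-1 :> R by rewrite invr_gt0.
(* For [n = 0] the interval is the single point 1 and is treated apart, since the fundamental
   theorem of calculus asks for distinct endpoints. *)
move: n1; rewrite le_eqVlt => /orP[/eqP n1|n1].
  rewrite /F n1 set_itv1 integral_set1 lee_fin invr_ge0 ltW//.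
rewrite (eq_integral (fun x : measurableTypeR R => ((x : R) `^ (- a))%:E)); last first.
  move=> x; rewrite inE => Fx; rewrite /singular indicE mem_set ?mul1r//=.
  by rewrite in_itv /=; exact: F01 Fx.
have pos (x : R) : x \in `[n.+1%:R^-1, 1] -> 0 < x.
  by rewrite in_itv /= => /andP[nx _]; exact: lt_le_trans nx.
have dpow (b x : R) : 0 < x -> {for x, continuous (fun y : R => y `^ b)}.
  move=> x0; apply: differentiable_continuous; apply/derivable1_diffP.
  by apply: ex_derive; exact: is_derive1_powR.
rewrite /F (@continuous_FTC2 R _ (fun x => c^-1 * x `^ c) _ _ n1).
- rewrite powR1 mulr1 -EFinB lee_fin lerBlDr lerDl mulr_ge0 ?powR_ge0//.
  by rewrite invr_ge0 ltW.
- apply: continuous_in_subspaceT => x; rewrite inE => xI.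
  by apply: dpow; exact: pos.
- have cG (x : R) : 0 < x -> {for x, continuous (fun y : R => c^-1 * y `^ c)}.
    by move=> x0; apply: cvgM; [exact: cvg_cst|exact: dpow].
  split.
  + move=> x; rewrite in_itv /= => /andP[nx _].
    apply: derivableM; first exact: derivable_cst.
    by apply: ex_derive; apply: is_derive1_powR; exact: lt_trans nx.
  + by apply: cvg_at_right_filter; exact: cG.
  + by apply: cvg_at_left_filter; exact: cG.
- move=> x; rewrite in_itv /= => /andP[nx _].
  have x0 : 0 < x := lt_trans n0 nx.
  have dp := is_derive1_powR c x0.
  rewrite derive1E deriveMl ?derive_val; last exact: ex_derive.
  by rewrite mulrA mulVf ?gt_eqF// mul1r /c addrAC subrr add0r.
Qed.

Definition singular_abs (a x : R) : R := singular a x + singular a (- x).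

Lemma singular_abs_ge0 a x : 0 <= singular_abs a x.
Proof. by rewrite addr_ge0// singular_ge0. Qed.

Lemma measurable_singular_abs a : measurable_fun [set: R] (singular_abs a).
Proof.
apply: measurable_funD; first exact: measurable_singular.
by apply: measurableT_comp => //; exact: measurable_singular.
Qed.

Lemma integral_singular_abs_lty (a : R) : 0 <= a < 1 ->
  (\int[leb]_x (singular_abs a x)%:E < +oo)%E.
Proof.
move=> a01; have ms := measurable_singular a.
rewrite /singular_abs; under eq_integral do rewrite EFinD.
have m1 : measurable_fun [set: measurableTypeR R] (fun x => (singular a x)%:E).
  exact/measurable_EFinP.
rewrite ge0_integralD//=.
- rewrite (ge0_integral_preserving (T := measurableTypeR R)
    (f := fun x => (singular a x)%:E) preserving_lebesgueN)//.
    by rewrite lte_add_pinfty// integral_singular_lty.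
  by move=> x; rewrite lee_fin singular_ge0.
- by move=> x _; rewrite lee_fin singular_ge0.
- by move=> x _; rewrite lee_fin singular_ge0.
- by apply: (measurableT_comp m1); exact: measurable_funN.
Qed.

Lemma singular_absE (a x : R) : x != 0 -> `|x| <= 1 ->
  singular_abs a x = `|x| `^ (- a).
Proof.
move=> x0 x1; rewrite /singular_abs /singular !indicE.
have : 0 < x \/ x < 0 by case: (ltgtP x 0) x0 => //; [right|left].
move=> [xp|xn].
  rewrite mem_set; last by rewrite /= in_itv/= xp -(gtr0_norm xp).
  rewrite memNset; last by rewrite /= in_itv/= oppr_gt0 ltNge (ltW xp).
  by rewrite mul1r mul0r addr0 (gtr0_norm xp).
rewrite memNset; last by rewrite /= in_itv/= ltNge (ltW xn).
rewrite mem_set; last by rewrite /= in_itv/= oppr_gt0 xn -(ltr0_norm xn).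
by rewrite mul0r add0r mul1r (ltr0_norm xn).
Qed.

Lemma integral_lebesgue3_prod_lty (g0 g1 g2 : R -> R) :
  measurable_fun setT g0 -> measurable_fun setT g1 -> measurable_fun setT g2 ->
  (forall x, 0 <= g0 x) -> (forall x, 0 <= g1 x) -> (forall x, 0 <= g2 x) ->
  (\int[leb]_x (g0 x)%:E < +oo)%E -> (\int[leb]_x (g1 x)%:E < +oo)%E ->
  (\int[leb]_x (g2 x)%:E < +oo)%E ->
  (\int[lebesgue3]_x (g0 (x ord0 0) * g1 (x ord0 1) * g2 (x ord0 2%:R))%:E
    < +oo)%E.
Proof.
move=> m0 m1 m2 p0 p1 p2 f0 f1 f2.
pose T := measurableTypeR R.
have prodint (d : measure_display) (S : measurableType d)
    (mu : {sigma_finite_measure set S -> \bar R}) (h : S -> R) (g : R -> R) :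
    measurable_fun setT h -> measurable_fun setT g ->
    (forall x, 0 <= h x) -> (forall x, 0 <= g x) ->
    (\int[mu]_x (h x)%:E < +oo)%E -> (\int[leb]_x (g x)%:E < +oo)%E ->
    (\int[mu \x leb]_p (h p.1 * g p.2)%:E < +oo)%E.
  move=> mh mg h0 gg0 fh fg.
  have mhg : measurable_fun setT (fun p : S * T => (h p.1 * g p.2)%:E).
    apply/measurable_EFinP; apply: measurable_funM.
      exact: (measurableT_comp mh measurable_fst).
    exact: (measurableT_comp mg measurable_snd).
  rewrite fubini_tonelli1//; last by move=> p; rewrite lee_fin mulr_ge0.
  have gfin : (\int[leb]_x (g x)%:E)%E \is a fin_num.
    by rewrite ge0_fin_numE// integral_ge0// => x _; rewrite lee_fin.
  rewrite /fubini_F /=.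
  rewrite (eq_integral (fun x => (h x)%:E * \int[leb]_y (g y)%:E)%E); last first.
    move=> x _; under eq_integral do rewrite EFinM.
    rewrite ge0_integralZl_EFin//; last by exact/measurable_EFinP.
    by move=> y _; rewrite lee_fin.
  rewrite ge0_integralZr//.
  - apply: lte_mul_pinfty => //; first by apply: integral_ge0 => x _; rewrite lee_fin.
    by rewrite ge0_fin_numE// integral_ge0// => x _; rewrite lee_fin.
  - exact/measurable_EFinP.
  - by move=> x _; rewrite lee_fin.
  - by apply: integral_ge0 => x _; rewrite lee_fin.
have mc (g : R -> R) i : measurable_fun setT g ->
    measurable_fun setT (fun x : V => g (x ord0 i)).
  by move=> mg; exact: (measurableT_comp mg (measurable_rV_coord i)).
rewrite /lebesgue3 ge0_integral_pushforward//=.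
- rewrite preimage_setT.
  under eq_integral => p _ do rewrite /rV3 !mxE/=.
  apply: (@prodint _ _ lebesgue2 (fun q : T * T => g0 q.1 * g1 q.2)) => //.
  + apply: measurable_funM.
      exact: (measurableT_comp m0 measurable_fst).
    exact: (measurableT_comp m1 measurable_snd).
  + by move=> x; rewrite mulr_ge0.
  + exact: (@prodint _ _ leb).
- exact: measurable_rV3.
- apply/measurable_EFinP; apply: measurable_funM; last exact: mc.
  by apply: measurable_funM; exact: mc.
- by move=> x _; rewrite lee_fin !mulr_ge0.
Qed.

Lemma japanese_ge1 n (x : 'rV[R]_n) : 1 <= japanese x.
Proof. by rewrite -[leLHS]sqrtr1 ler_wsqrtr// lerDl sqr_ge0. Qed.

Lemma japanese_gt0 n (x : 'rV[R]_n) : 0 < japanese x.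
Proof. exact: lt_le_trans ltr01 (japanese_ge1 x). Qed.

Lemma japanese_sqr n (x : 'rV[R]_n) : japanese x ^+ 2 = 1 + dot x x.
Proof. by rewrite sqr_sqrtr ?addr_ge0 ?sqr_ge0// enorm_sqr. Qed.

Lemma enorm_le_japanese n (x : 'rV[R]_n) : enorm x <= japanese x.
Proof.
rewrite -ler_sqr ?nnegrE ?enorm_ge0 ?sqrtr_ge0//.
by rewrite japanese_sqr enorm_sqr lerDr.
Qed.

Lemma dot3 (x y : V) : dot x y =
  x ord0 0 * y ord0 0 + x ord0 1 * y ord0 1 + x ord0 2%:R * y ord0 2%:R.
Proof.
rewrite /dot !big_ord_recl big_ord0 addr0 addrA.
have -> : lift ord0 ord0 = 1%R :> 'I_3 by exact: val_inj.
by have -> : lift ord0 (lift ord0 ord0) = 2%:R :> 'I_3 by exact: val_inj.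
Qed.

Lemma measurable_japanese n : measurable_fun [set: 'rV[R]_n] japanese.
Proof.
have ms : measurable_fun [set: R] (@Num.sqrt R).
  by apply: continuous_measurable_fun; exact: sqrt_continuous.
apply: (measurableT_comp ms); apply: measurable_funD => //.
by apply: measurable_funX; exact: measurable_enorm.
Qed.

Lemma measurable_japaneseV n k :
  measurable_fun [set: 'rV[R]_n] (fun x => japanese x ^- k).
Proof.
rewrite (_ : (fun _ => _) = (fun x => (japanese x ^+ k) `^ (-1))).
  apply: (measurableT_comp (measurable_powR _)).
  by apply: measurable_funX; exact: measurable_japanese.
by apply/funext => x; rewrite powR_inv1// exprn_ge0// ltW// japanese_gt0.
Qed.

(** The exponent 6 allows a domination by a product of one-variable functions: (1 + |x|^2)^3 is at
    least the product of the three factors 1 + x_i^2. *)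
Lemma integral_japanese_lty :
  (\int[lebesgue3]_x (japanese (x : V) ^- 6)%:E < +oo)%E.
Proof.
pose g (x : R) := (1 + x ^+ 2)^-1.
have g0 x : 0 <= g x by rewrite invr_ge0 addr_ge0// sqr_ge0.
have mg : measurable_fun setT g.
  by apply: continuous_measurable_fun; exact: (@continuous_oneDsqrV R).
have mgi i : measurable_fun setT (fun x : V => g (x ord0 i)).
  exact: (measurableT_comp mg (measurable_rV_coord i)).
apply: le_lt_trans (integral_lebesgue3_prod_lty mg mg mg g0 g0 g0
  integral_oneDsqrV_lty integral_oneDsqrV_lty integral_oneDsqrV_lty).
apply: ge0_le_integral => //.
- by move=> x _; rewrite lee_fin invr_ge0 exprn_ge0// ltW// japanese_gt0.
- by apply/measurable_EFinP; exact: measurable_japaneseV.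
- apply/measurable_EFinP; apply: measurable_funM; last exact: mgi.
  by apply: measurable_funM; exact: mgi.
move=> x _; rewrite lee_fin /g -!invfM.
have p (y : R) : 0 < 1 + y ^+ 2 by rewrite ltr_wpDr// sqr_ge0.
rewrite lef_pV2 ?posrE ?mulr_gt0 ?exprn_gt0 ?japanese_gt0//.
rewrite (_ : 6 = 2 * 3)%N// exprM japanese_sqr dot3 -!expr2.
have := sqr_ge0 (x ord0 0); have := sqr_ge0 (x ord0 1).
have := sqr_ge0 (x ord0 2%:R).
set A := _ ^+ 2; set B := _ ^+ 2; set C := _ ^+ 2 => C0 B0 A0.
rewrite (_ : _ ^+ 3 = (1 + (A + B + C)) * (1 + (A + B + C)) * (1 + (A + B + C))).
  by apply: ler_pM; [nra|lra|apply: ler_pM; lra|lra].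
by ring.
Qed.

Lemma powR_le_japanese (gamma : R) (z : V) : gamma <= 1 -> 1 <= enorm z ->
  enorm z `^ gamma <= japanese z.
Proof.
move=> g1 z1; apply: le_trans (enorm_le_japanese z).
by rewrite -[leRHS]powRr1 ?enorm_ge0// ler_powR.
Qed.

(** Beyond radius 1, |z|^gamma costs one of the seven powers because gamma <= 1. Within radius 1 and
    off the coordinate planes, |z|^gamma is at most the product of the |z_i|^(-a) with 3 a >= -
    gamma; since gamma > -3, such an [a] exists below 1 and every factor is integrable. *)
Lemma integral_power_lty (gamma : R) : -3 < gamma <= 1 ->
  (\int[lebesgue3]_z (enorm (z : V) `^ gamma * japanese z ^- 7)%:E < +oo)%E.
Proof.
move=> /andP[g3 g1]; pose a := Num.max 0 (- gamma / 3).
have a01 : 0 <= a < 1 by rewrite /a le_max lexx/= gt_max ltr01/=; lra.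
pose g := singular_abs a.
have g0 x : 0 <= g x by exact: singular_abs_ge0.
have mg : measurable_fun setT g by exact: measurable_singular_abs.
have mgi i : measurable_fun setT (fun x : V => g (x ord0 i)).
  exact: (measurableT_comp mg (measurable_rV_coord i)).
pose h (z : V) := g (z ord0 0) * g (z ord0 1) * g (z ord0 2%:R).
have h0 z : 0 <= h z by rewrite !mulr_ge0.
have mh : measurable_fun setT (fun z => (h z)%:E).
  apply/measurable_EFinP; apply: measurable_funM; last exact: mgi.
  by apply: measurable_funM; exact: mgi.
have gi := integral_singular_abs_lty a01.
have hlty := integral_lebesgue3_prod_lty mg mg mg g0 g0 g0 gi gi gi.
have j0 k (z : V) : 0 <= japanese z ^- k.
  by rewrite invr_ge0 exprn_ge0// ltW// japanese_gt0.
have mj : measurable_fun setT (fun z : V => (japanese z ^- 6)%:E).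
  by apply/measurable_EFinP; exact: measurable_japaneseV.
apply: (@le_lt_trans _ _ (\int[lebesgue3]_z ((h z)%:E + (japanese (z : V) ^- 6)%:E))%E);
  last first.
  rewrite ge0_integralD//.
  - by rewrite lte_add_pinfty//; exact: integral_japanese_lty.
  - by move=> z _; rewrite lee_fin.
  - by move=> z _; rewrite lee_fin.
apply: ae_ge0_le_integral => //.
- by move=> z _; rewrite lee_fin mulr_ge0 ?powR_ge0.
- apply/measurable_EFinP; apply: measurable_funM; last exact: measurable_japaneseV.
  by apply: (measurableT_comp (measurable_powR _)); exact: measurable_enorm.
- by move=> z _; rewrite adde_ge0 ?lee_fin.
- exact: emeasurable_funD.
pose N (i : 'I_3) := [set z : V | z ord0 i = 0].
exists (N 0 `|` N 1 `|` N 2%:R); split.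
- by do 2 (try apply: measurableU); exact: measurable_coord0.
- apply/eqP; rewrite eq_le measure_ge0 andbT.
  apply: le_trans (measureU2 _ _ _) _.
  + by apply: measurableU; exact: measurable_coord0.
  + exact: measurable_coord0.
  + apply: le_trans (leeD2r _ (measureU2 _ _ _)) _; try exact: measurable_coord0.
    by rewrite /= /N !lebesgue3_coord0 !adde0.
move=> z /= zN; apply: contrapT => zn; apply: zN => _.
have z0 : z ord0 0 != 0 by apply/eqP => e; apply: zn; left; left.
have z1 : z ord0 1 != 0 by apply/eqP => e; apply: zn; left; right.
have z2 : z ord0 2%:R != 0 by apply/eqP => e; apply: zn; right.
rewrite -EFinD lee_fin; have [zle|zgt] := leP (enorm z) 1; last first.
  rewrite -[leLHS]add0r lerD// exprS invfM mulrA ler_piMl//.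
  by rewrite ler_pdivrMr ?japanese_gt0// mul1r powR_le_japanese// ltW.
rewrite -[leLHS]addr0 lerD//.
have zp : 0 < enorm z.
  by rewrite enorm_gt0//; apply: contra z0 => /eqP ->; rewrite mxE.
apply: (@le_trans _ _ (enorm z `^ gamma)).
  rewrite ler_piMr ?powR_ge0// invf_le1 ?exprn_gt0 ?japanese_gt0//.
  by rewrite exprn_ege1// japanese_ge1.
apply: (@le_trans _ _ (enorm z `^ (- (3 * a)))).
  apply: ger_powR; first by rewrite zp zle.
  by rewrite /a lerNl -ler_pdivrMl// mulrC le_max lexx orbT.
have ai i : z ord0 i != 0 -> enorm z `^ (- a) <= g (z ord0 i).
  move=> zi; rewrite /g singular_absE ?(le_trans (coord_le_enorm z i))//.
  rewrite !powRN lef_pV2 ?posrE ?powR_gt0 ?normr_gt0//.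
  apply: ge0_ler_powR; rewrite ?nnegrE ?enorm_ge0//.
    by case/andP: a01.
  exact: coord_le_enorm.
have -> : - (3 * a) = - a + - a + - a by ring.
rewrite !powRD ?(gt_eqF zp) ?implybT//.
by apply: ler_pM; rewrite ?mulr_ge0 ?powR_ge0//; [apply: ler_pM; rewrite ?powR_ge0//|]; exact: ai.
Qed.

End integrable_powers.

(** * Zonal integrals and momentum transfer of the angular kernel *)

Section sphere_integrals.
Context {R : realType}.
Local Notation V := 'rV[R]_3.
Local Notation leb := (@lebesgue_measure R).

Lemma integral_sphereE (g : V -> \bar R) : measurable_fun setT g ->
  (forall x, 0 <= g x)%E ->
  (\int[sphere_measure]_s g s =
   3%:E * \int[lebesgue3]_(u in @unit_ball R) g (normalize u))%E.
Proof.
move=> mg g0; have mb : measurable (@unit_ball R) := measurable_ball 1.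
pose r : {measure set V -> \bar R} := mrestr lebesgue3 measurable_unit_ball.
pose m3 : {measure set V -> \bar R} := mscale (NngNum (ler0n R 3)) r.
have mgn : measurable_fun setT (g \o normalize).
  exact: (measurableT_comp mg measurable_normalize).
have -> : (\int[sphere_measure]_s g s =
    \int[pushforward m3 normalize]_s g s)%E.
  by [].
rewrite ge0_integral_pushforward ?preimage_setT//; last exact: measurable_normalize.
transitivity (3%:E * \int[r]_x (g \o normalize) x)%E.
  apply: ge0_integral_mscale; [exact: measurableT|exact: mgn|].
  by move=> x _; exact: g0.
apply: (congr1 (mule 3%:E)).
exact: ge0_integral_mrestr mgn (fun x => g0 _).
Qed.

Lemma householder_swap (k e : V) : enorm k = enorm e -> householder (k - e) k = e.
Proof.
move=> ke; rewrite /householder; have [k0|k0] := eqVneq (k - e) 0.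
  by rewrite k0 scaler0 subr0; apply/eqP; rewrite -subr_eq0 k0.
have nn : dot (k - e) (k - e) != 0 by apply: contra k0 => /eqP /dot_eq0 ->.
have dd : dot k k = dot e e by rewrite -!enorm_sqr ke.
have -> : 2 * (dot k (k - e) / dot (k - e) (k - e)) = 1.
  rewrite mulrA; apply: (mulIf nn); rewrite divfK// mul1r.
  by rewrite !dotE [dot e k]dotC -dd; ring.
by rewrite scale1r opprB addrC subrK.
Qed.

(** The reflection that exchanges [k] and [e] preserves the sphere measure. *)
Lemma integral_sphere_zonal (k e : V) (h : R -> \bar R) : S2 k -> S2 e ->
  measurable_fun setT h -> (forall c, 0 <= h c)%E ->
  (\int[sphere_measure]_s h (dot k s) = \int[sphere_measure]_s h (dot e s))%E.
Proof.
rewrite /S2 /= => k1 e1 mh h0.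
have md : measurable_fun setT (fun s : V => h (dot e s)).
  by apply: (measurableT_comp mh); exact: measurable_dot.
rewrite -(ge0_integral_preserving (f := fun s => h (dot e s))
  (preserving_sphere_householder (k - e)))//.
apply: eq_integral => s _.
have hE : householder (k - e) k = e by apply: householder_swap; rewrite k1 e1.
by rewrite -(householder_dot (k - e) k s) hE.
Qed.

Lemma sin_le (x : R) : 0 <= x -> sin x <= x.
Proof.
rewrite le_eqVlt => /orP[/eqP <-|x0]; first by rewrite sin0.
have [c _] := @MVT_segment R sin cos 0 x (ltW x0)
  (fun y _ => is_derive_sin y) (continuous_subspaceT (@continuous_sin R)).
rewrite sin0 !subr0 => ->; by rewrite ler_piMl ?(ltW x0)// cos_le1.
Qed.

Lemma cos_ge_quadratic (x : R) : 0 <= x <= pi -> 2 * (1 - cos x) <= x ^+ 2.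
Proof.
move=> /andP[x0 xpi].
have -> : x = (x / 2) *+ 2 by rewrite -mulr_natr divfK.
set y := x / 2; have y0 : 0 <= y by rewrite divr_ge0.
have ypi : y <= pi by rewrite ler_pdivrMr//; have := @pi_ge0 R; lra.
rewrite cos_mulr2n cos2sin2; have sy := sin_le y0.
have sy0 : 0 <= sin y by apply: sin_ge0_pi; rewrite y0 ypi.
have sy2 : sin y ^+ 2 <= y ^+ 2 by rewrite ler_sqr.
have -> : (y *+ 2) ^+ 2 = 4 * y ^+ 2 by ring.
by rewrite mulr2n; lra.
Qed.

(** A version of [b] that is measurable and nonnegative on the whole line; by the support condition
    it agrees with [b] on [-1, 1]. *)
Definition angular (b : R -> R) (c : R) : R := if 0 <= c <= 1 then b c else 0.

Lemma measurable_angular b : measurable_fun `[(-1 : R), 1] b ->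
  measurable_fun setT (angular b).
Proof.
move=> mb.
have mI : measurable [set` (`[0%R, 1%R] : interval R)] by exact: measurable_itv.
rewrite (_ : angular b = b \_ [set` (`[0%R, 1%R] : interval R)]).
  apply/(measurable_restrictT b mI); apply: measurable_funS mb => //.
  by move=> x /=; rewrite !in_itv /= => /andP[x0 ->]; rewrite andbT; lra.
apply/funext => c; rewrite patchE /angular; case: ifPn => cI.
  by rewrite mem_set//= in_itv.
by rewrite memNset//= in_itv /=; exact/negP.
Qed.

Lemma angular_pos b c : angular_kernel b -> 0 <= angular b c.
Proof.
move=> [_ b0 _ _]; rewrite /angular; case: ifP => // /andP[c0 c1].
by apply: b0; rewrite c1 andbT; lra.
Qed.

Lemma angularE b c : angular_kernel b -> -1 <= c <= 1 -> angular b c = b c.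
Proof.
move=> [_ _ bs _] /andP[c1 c2]; rewrite /angular c2 andbT.
by case: (leP 0 c) => // c0; rewrite bs// c1 c0.
Qed.

Lemma dot_S2_itv (k s : V) : S2 k -> S2 s -> -1 <= dot k s <= 1.
Proof.
rewrite /S2 /= => k1 s1; rewrite -ler_norml.
by rewrite (le_trans (cauchy_schwarz _ _))// k1 s1 mulr1.
Qed.

(** With c = cos theta, 1 - c <= theta^2, so theta^(-2-2s) = (theta^2)^(-(1+s)) is at most (1 -
    c)^(-(1+s)); the factor 1 - c then takes one power off. *)
Lemma noncutoff_bound (s : R) b : 0 < s < 1 -> noncutoff s b ->
  exists2 C : R, 0 < C & forall c, 0 <= c < 1 ->
    b c * (1 - c) <= C * (1 - c) `^ (- s).
Proof.
move=> /andP[s0 s1] [cb [Cb [cb0 cC hb]]].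
have C0 : 0 < Cb by exact: lt_le_trans cC.
exists Cb => // c /andP[c0 c1].
have c1' : 0 < 1 - c by rewrite subr_gt0.
have cI : -1 <= c <= 1 by lra.
pose t := acos c; have ct : cos t = c by rewrite acosK// in_itv/=.
have tpi : 0 <= t <= pi by rewrite acos_ge0// acos_lepi.
have t0 : 0 < t.
  rewrite lt_neqAle (andP tpi).1 andbT; apply/eqP => t0.
  by move: ct c1; rewrite -t0 cos0 => <-; rewrite ltxx.
have th : t <= pi / 2.
  rewrite leNgt; apply/negP => th; move: c0; rewrite leNgt => /negP; apply.
  rewrite -ct -[t](subrK (pi / 2)) cosDpihalf oppr_lt0; apply: sin_gt0_pi.
  by case/andP: tpi => _ tp; have := @pi_gt0 R; lra.
have := hb t; rewrite t0 th => /(_ isT) /andP[_]; rewrite ct => bc.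
have t2 := cos_ge_quadratic tpi; rewrite ct in t2.
apply: (@le_trans _ _ (Cb * t `^ (- 2 - 2 * s) * (1 - c))).
  by rewrite ler_pM2r.
rewrite -mulrA ler_pM2l//.
have -> : - 2 - 2 * s = 2%:R * (- (1 + s)) by ring.
rewrite powRrM powR_mulrn ?(ltW t0)//.
apply: (@le_trans _ _ ((1 - c) `^ (- (1 + s)) * (1 - c))).
  rewrite ler_pM2r// !powRN lef_pV2 ?posrE ?powR_gt0 ?exprn_gt0//.
  apply: ge0_ler_powR; rewrite ?nnegrE ?exprn_ge0 ?(ltW t0) ?(ltW c1')//; first by lra.
  by apply: (le_trans _ t2); lra.
rewrite -[X in _ * X <= _]powRr1 ?(ltW c1')// -powRD ?(gt_eqF c1') ?implybT//.
by rewrite (_ : - (1 + s) + 1 = - s)//; ring.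
Qed.

(** The momentum transfer of [b] is finite even when its total mass is not. By zonal invariance a
    single axis suffices. A cutoff kernel is dominated by itself, as 0 <= 1 - c <= 1 on its support;
    for a non-cutoff kernel there remains the singularity (1 - c)^(-s) with s < 1. *)
Lemma angular_momentum_bound b : angular_kernel b ->
  exists2 K : R, 0 <= K & forall k : V, S2 k ->
  (\int[sphere_measure]_s (angular b (dot k s) * (1 - dot k s))%:E <= K%:E)%E.
Proof.
move=> ab; have [mb b0 bs sing] := ab.
pose e : V := delta_mx 0 0.
have dote (x : V) : dot e x = x ord0 0.
  by rewrite dot3 !mxE /= mul1r !mul0r !addr0.
have e1 : S2 e.
  by rewrite /S2 /=; apply: dot1_enorm; rewrite dote /e mxE eqxx.
have mh : measurable_fun setT (fun c => (angular b c * (1 - c))%:E).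
  apply/measurable_EFinP; apply: measurable_funM; first exact: measurable_angular.
  exact: measurable_funB.
have h0 c : (0 <= (angular b c * (1 - c))%:E)%E.
  rewrite lee_fin; have [c1|c1] := leP c 1.
    by rewrite mulr_ge0 ?angular_pos// subr_ge0.
  by rewrite /angular [c <= 1]leNgt c1 andbF mul0r.
suff fin : (\int[sphere_measure]_s (angular b (dot e s) * (1 - dot e s))%:E < +oo)%E.
  have fn : (\int[sphere_measure]_s (angular b (dot e s) * (1 - dot e s))%:E
      \is a fin_num)%E.
    by rewrite ge0_fin_numE// integral_ge0// => s _; exact: h0.
  exists (fine (\int[sphere_measure]_s (angular b (dot e s) * (1 - dot e s))%:E)%E).
    by apply/fine_ge0/integral_ge0 => s _; exact: h0.
  move=> k k1; rewrite fineK//.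
  rewrite (integral_sphere_zonal (h := fun c => (angular b c * (1 - c))%:E) k1 e1)//.
have mhe : measurable_fun setT
    (fun s : V => (angular b (dot e s) * (1 - dot e s))%:E).
  by apply: (measurableT_comp mh); exact: measurable_dot.
case: sing => [[gc _]|[s s01 nc]].
  apply: le_lt_trans (gc e e1).
  have mS := @measurable_unit_sphere R 3.
  rewrite (@ge0_negligible_integral _ _ _ sphere_measure _ (~` @S2 R))//; last 2 first.
  - exact: measurableC.
  - exact: sphere_measure_setC.
  rewrite setTD setCK; apply: ge0_le_integral => //.
  - exact: measurable_funTS.
  - apply/measurable_EFinP.
    apply: (@eq_measurable_fun _ _ _ _ _ (fun x => angular b (dot e x))).
      move=> x /set_mem xS; rewrite angularE//; exact: dot_S2_itv.
    apply: measurable_funTS; apply: (measurableT_comp (measurable_angular mb)).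
    exact: measurable_dot.
  - move=> x xS; have xI := dot_S2_itv e1 xS; rewrite lee_fin (angularE ab xI).
    have [c0|c0] := leP 0 (dot e x).
      by rewrite ler_piMr ?b0//; lra.
    by rewrite bs ?mul0r// c0; case/andP: xI => ->.
have [C C0 bC] := noncutoff_bound s01 nc.
have s01' : 0 <= s < 1 by case/andP: s01 => /ltW -> ->.
pose g1 := singular_abs s; pose g0 := \1_`[-1, 1] : R -> R.
have mI : measurable [set` (`[-1, 1] : interval R)] by exact: measurable_itv.
have mg0 : measurable_fun setT g0 by exact: measurable_indic.
have mg1 : measurable_fun setT g1 by exact: measurable_singular_abs.
have g00 x : 0 <= g0 x by rewrite /g0 indicE.
have g10 x : 0 <= g1 x by exact: singular_abs_ge0.
have ig0 : (\int[leb]_x (g0 x)%:E < +oo)%E.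
  rewrite integral_indic// setIT.
  apply: (eq_ind_r (fun x => x < +oo)%E _ (lebesgue_measure_itv _)) => /=.
  by case: ifP => _; rewrite ?ltry// -EFinB ltry.
have ig1 := integral_singular_abs_lty s01'.
have hlty := integral_lebesgue3_prod_lty mg0 mg1 mg1 g00 g10 g10 ig0 ig1 ig1.
rewrite integral_sphereE//.
rewrite lte_mul_pinfty//.
pose h (u : V) := g0 (u ord0 0) * g1 (u ord0 1) * g1 (u ord0 2%:R).
have hh0 u : 0 <= h u by rewrite !mulr_ge0.
have mgi (g : R -> R) i : measurable_fun setT g ->
    measurable_fun setT (fun x : V => g (x ord0 i)).
  by move=> mg; exact: (measurableT_comp mg (measurable_rV_coord i)).
have mhh : measurable_fun setT (fun z => (h z)%:E).
  apply/measurable_EFinP; apply: measurable_funM; last exact: mgi.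
  by apply: measurable_funM; exact: mgi.
apply: (@le_lt_trans _ _ (\int[lebesgue3]_(u in @unit_ball R) (C%:E * (h u)%:E))%E);
  last first.
  rewrite ge0_integralZl_EFin//; last 4 first.
  - exact: measurable_ball.
  - by move=> x _; rewrite lee_fin.
  - exact: measurable_funTS.
  - exact: ltW.
  rewrite lte_mul_pinfty ?lee_fin ?ltW//.
  apply: le_lt_trans hlty; apply: ge0_subset_integral => //.
  - exact: measurable_ball.
  - by move=> x _; rewrite lee_fin.
have mbn : measurable_fun (@unit_ball R) (fun u : V =>
    (angular b (dot e (normalize u)) * (1 - dot e (normalize u)))%:E).
  apply: measurable_funTS.
  exact: (measurableT_comp mhe measurable_normalize).
apply: ae_ge0_le_integral => //.
- exact: measurable_ball.
- by move=> x _; rewrite -EFinM lee_fin mulr_ge0// ltW.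
- by apply: measurable_funTS; exact: emeasurable_funM.
pose N (i : 'I_3) := [set z : V | z ord0 i = 0].
exists (N 1 `|` N 2%:R); split.
- by apply: measurableU; exact: measurable_coord0.
- apply/eqP; rewrite eq_le measure_ge0 andbT.
  apply: le_trans (measureU2 _ _ _) _; try exact: measurable_coord0.
  by rewrite /= /N !lebesgue3_coord0 !adde0.
move=> u /= uN; apply: contrapT => un; apply: uN => uB.
have u1 : u ord0 1 != 0 by apply/eqP => h1; apply: un; left.
have u2 : u ord0 2%:R != 0 by apply/eqP => h1; apply: un; right.
have un0 : u != 0 by apply: contra u1 => /eqP ->; rewrite mxE.
have up := enorm_gt0 un0.
have uS : S2 (normalize u) by rewrite /S2 /=; exact: enorm_normalize.
have cI := dot_S2_itv e1 uS; set c := dot e (normalize u) in cI *.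
rewrite -EFinM lee_fin (angularE ab cI).
have [c0|c0] := ltP c 0.
  rewrite bs ?mul0r ?mulr_ge0 ?(ltW C0)//.
  by rewrite c0 andbT; case/andP: cI.
(* In the unit ball the left-hand side is |u|^2 (1 - c^2). Hence |u_1| |u_2| <= 1 - c, and (1 -
   c)^(-s) splits into the product of two integrable one-dimensional singularities. *)
have u01 : u ord0 1 ^+ 2 + u ord0 2%:R ^+ 2 <= 2 * (1 - c).
  have uu : dot u u <= 1.
    by rewrite -enorm_sqr expr_le1// enorm_ge0.
  have ce : c * enorm u = u ord0 0.
    by rewrite /c dote /normalize mxE mulrAC mulVf ?mul1r// gt_eqF.
  have d := enorm_sqr u; rewrite dot3 -!expr2 -ce in d.
  have := cI => /andP[_ c1].
  have en1 : enorm u ^+ 2 <= 1 by rewrite enorm_sqr.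
  have en0 : 0 <= enorm u ^+ 2 by rewrite sqr_ge0.
  have cc : 0 <= 1 - c ^+ 2 by nra.
  have : enorm u ^+ 2 * (1 - c ^+ 2) <= 1 - c ^+ 2 by rewrite ler_piMl.
  rewrite exprMn in d.
  have -> : u ord0 1 ^+ 2 + u ord0 2%:R ^+ 2 = enorm u ^+ 2 * (1 - c ^+ 2).
    by rewrite mulrBr mulr1 {1}d mulrC; ring.
  move=> h1; apply: le_trans h1 _; nra.
have c1 : c < 1.
  have : 0 < u ord0 1 ^+ 2 by rewrite exprn_even_gt0.
  have : 0 <= u ord0 2%:R ^+ 2 by rewrite sqr_ge0.
  by lra.
apply: le_trans (bC c _) _; first by rewrite c0 c1.
rewrite ler_pM2l//.
have ub i : `|u ord0 i| <= 1 by rewrite (le_trans (coord_le_enorm u i)).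
rewrite /h /g0 indicE mem_set; last by rewrite /= in_itv/= -ler_norml.
rewrite mul1r /g1 !singular_absE// -powRM//.
rewrite !powRN lef_pV2 ?posrE ?powR_gt0 ?mulr_gt0 ?normr_gt0 ?subr_gt0//.
apply: ge0_ler_powR; rewrite ?nnegrE ?subr_ge0 ?mulr_ge0 ?(ltW c1)//.
  by case/andP: s01 => /ltW.
have n1 := normr_ge0 (u ord0 1); have n2 := normr_ge0 (u ord0 2%:R).
have := sqr_ge0 (`|u ord0 1| - `|u ord0 2%:R|).
rewrite -(real_normK (num_real (u ord0 1))) -(real_normK (num_real (u ord0 2%:R))) in u01.
by nra.
Qed.

End sphere_integrals.

(** * Collision transformations *)

Section collision_space.
Context {R : realType}.
Local Notation V := 'rV[R]_3.

Definition lebS : set (V * V) -> \bar R := (lebesgue3 \x sphere_measure)%E.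

HB.instance Definition _ := Measure.on lebS.

HB.instance Definition _ := Measure_isSigmaFinite.Build _ _ _ lebS
  (sigma_finite_product _ _).

(* A collision is a triple ((z, sigma), v), where z = v - v_*. *)
Definition collM : set (V * V * V) -> \bar R := (lebS \x lebesgue3)%E.

HB.instance Definition _ := Measure.on collM.

HB.instance Definition _ := Measure_isSigmaFinite.Build _ _ _ collM
  (sigma_finite_product _ _).

(** The displacement v' - v. As it depends on z and sigma only, collisions act on v by translations
    once (z, sigma) is fixed. *)
Definition jump (y : V * V) : V := 2^-1 *: (enorm y.1 *: y.2 - y.1).
Definition vpost (p : V * V * V) : V := p.2 + jump p.1.
Definition vstar (p : V * V * V) : V := p.2 - p.1.1.
Definition vspost (p : V * V * V) : V := vstar p - jump p.1.

Lemma vpostE z s v : vpost (z, s, v) = post v (v - z) s.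
Proof.
rewrite /vpost /jump /post /=.
have -> : v - (v - z) = z by rewrite opprB addrC subrK.
by apply/rowP => i; rewrite !mxE; field.
Qed.

Lemma vspostE z s v : vspost (z, s, v) = post_star v (v - z) s.
Proof.
rewrite /vspost /vstar /jump /post_star /=.
have -> : v - (v - z) = z by rewrite opprB addrC subrK.
by apply/rowP => i; rewrite !mxE; field.
Qed.

Definition neg_pair (y : V * V) : V * V := (- y.1, - y.2).

Lemma preserving_neg_pair : preserving lebS neg_pair.
Proof.
have h : preserving (lebesgue3 \x sphere_measure)%E
    (skew (fun x : V => - x) (fun (_ : V) (s : V) => - s)).
  apply: preserving_skew; first exact: preserving_lebesgue3N.
    exact: measurable_rVN measurable_snd.
  by move=> _; exact: preserving_sphereN.
exact: h.
Qed.

Lemma measurable_jump : measurable_fun setT jump.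
Proof.
apply: measurable_rVZ; first exact: measurable_cst.
apply: measurable_rVB; last exact: measurable_fst.
exact: measurable_rVZ (measurable_enorm_comp measurable_fst) measurable_snd.
Qed.

Lemma measurable_p11 : measurable_fun setT (fun p : V * V * V => p.1.1).
Proof. exact: (measurableT_comp measurable_fst measurable_fst). Qed.

Lemma measurable_p12 : measurable_fun setT (fun p : V * V * V => p.1.2).
Proof. exact: (measurableT_comp measurable_snd measurable_fst). Qed.

Lemma measurable_vpost : measurable_fun setT vpost.
Proof.
apply: measurable_rVD; first exact: measurable_snd.
exact: (measurableT_comp measurable_jump measurable_fst).
Qed.

Lemma measurable_vstar : measurable_fun setT vstar.
Proof. by apply: measurable_rVB; [exact: measurable_snd|exact: measurable_p11]. Qed.

Lemma measurable_vspost : measurable_fun setT vspost.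
Proof.
apply: measurable_rVB; first exact: measurable_vstar.
exact: (measurableT_comp measurable_jump measurable_fst).
Qed.

(** Exchange of the two particles: with z it is sigma that must change sign for v' and v_*' to be
    exchanged as well. *)
Definition exchange (p : V * V * V) : V * V * V := (neg_pair p.1, vstar p).

(** Exchange of the velocities before and after the collision: the relative velocity becomes |z|
    sigma, and the direction that leads back is z / |z|. *)
Definition prepost (p : V * V * V) : V * V * V := (swap_polar p.1, vpost p).

Lemma preserving_exchange : preserving collM exchange.
Proof.
have h : preserving (lebS \x lebesgue3)%E
    (skew neg_pair (fun (y : V * V) (v : V) => v - y.1)).
  apply: preserving_skew; first exact: preserving_neg_pair.
    exact: measurable_vstar.
  by move=> y; exact: preserving_lebesgue3D.
exact: h.
Qed.

Lemma preserving_prepost : preserving collM prepost.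
Proof.
have h : preserving (lebS \x lebesgue3)%E
    (skew (@swap_polar R) (fun (y : V * V) (v : V) => v + jump y)).
  apply: preserving_skew; first exact: preserving_swap_polar.
    exact: measurable_vpost.
  by move=> y; exact: preserving_lebesgue3D.
exact: h.
Qed.

Lemma jump_neg y : jump (neg_pair y) = - jump y.
Proof. by rewrite /jump /neg_pair /= enormN scalerN -opprD scalerN. Qed.

Lemma vpost_exchange p : vpost (exchange p) = vspost p.
Proof. by rewrite /vpost /exchange /= jump_neg. Qed.

Lemma vstar_exchange p : vstar (exchange p) = p.2.
Proof. by rewrite /vstar /exchange /= opprK subrK. Qed.

Lemma vspost_exchange p : vspost (exchange p) = vpost p.
Proof. by rewrite /vspost vstar_exchange /exchange /= jump_neg opprK. Qed.

Lemma vstar_prepost p : vstar (prepost p) = vspost p.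
Proof.
rewrite /vstar /vspost /vstar /prepost /= /jump.
by apply/rowP => i; rewrite !mxE; field.
Qed.

Lemma jump_prepost (p : V * V * V) : S2 p.1.2 -> jump (swap_polar p.1) = - jump p.1.
Proof.
move=> s1; rewrite /jump /swap_polar /= enormZ s1 mulr1.
by rewrite ger0_norm ?enorm_ge0// scale_normalize -[RHS]scalerN opprB.
Qed.

Lemma vpost_prepost p : S2 p.1.2 -> vpost (prepost p) = p.2.
Proof. by move=> s1; rewrite /vpost /prepost /= jump_prepost// addrK. Qed.

Lemma vspost_prepost p : S2 p.1.2 -> vspost (prepost p) = vstar p.
Proof.
move=> s1; rewrite /vspost vstar_prepost /prepost /= jump_prepost//.
by rewrite opprK /vspost subrK.
Qed.

Lemma collM_setC_sphere : collM [set p : V * V * V | ~ S2 p.1.2] = 0%E.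
Proof.
have mS : measurable (~` @S2 R) by apply: measurableC; exact: measurable_unit_sphere.
rewrite (_ : mkset _ = (setT `*` ~` @S2 R) `*` setT); last first.
  by apply/seteqP; split => [p /= ps|p [[_ ps] _]].
rewrite /collM product_measure1E//; last exact: measurableX.
have l0 : lebS (setT `*` ~` @S2 R) = 0%E.
  by rewrite /lebS product_measure1E//= sphere_measure_setC mule0.
by rewrite /= l0 mul0e.
Qed.

Lemma ae_sphere (P : V * V * V -> Prop) :
  (forall p, S2 p.1.2 -> P p) -> {ae collM, forall p, P p}.
Proof.
move=> h; exists [set p : V * V * V | ~ S2 p.1.2]; split.
- rewrite (_ : mkset _ = (fun p : V * V * V => p.1.2) @^-1` (~` @S2 R))//.
  apply: measurable_preimT; first exact: measurable_p12.
  by apply: measurableC; exact: measurable_unit_sphere.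
- exact: collM_setC_sphere.
- by move=> p /= nP sp; apply: nP; exact: h.
Qed.

Definition entropy_jump (phi : V -> R) (p : V * V * V) : R :=
  phi (vpost p) + phi (vspost p) - phi p.2 - phi (vstar p).

(* Average [W phi(v)] over the group generated by the two involutions. *)
Lemma H_identity (W : V * V * V -> R) (phi : V -> R) :
  measurable_fun setT phi -> measurable_fun setT W ->
  (forall p, W (exchange p) = W p) ->
  (forall p, S2 p.1.2 -> W (prepost p) = - W p) ->
  collM.-integrable setT (fun p => (W p * phi p.2)%:E) ->
  collM.-integrable setT (fun p => (W p * entropy_jump phi p)%:E) /\
  (\int[collM]_p (W p * entropy_jump phi p)%:E =
   (- 4)%:E * \int[collM]_p (W p * phi p.2)%:E)%E.
Proof.
move=> mphi mW W1 W2 iF; pose F p := (W p * phi p.2)%:E.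
have mF : measurable_fun setT F := measurable_int _ iF.
have p1 := preserving_exchange; have p2 := preserving_prepost.
have p12 := preserving_comp p1 p2.
have i1 := integrable_preserving p1 iF.
have i2 := integrable_preserving p2 iF.
have i3 := integrable_preserving p12 iF.
have e1 := integral_preserving p1 mF.
have e2 := integral_preserving p2 mF.
have e3 := integral_preserving p12 mF.
pose G p := (F p + F (exchange p) + F (prepost p) + F ((exchange \o prepost) p))%E.
have iG1 := integrableD measurableT iF i1.
have iG2 := integrableD measurableT iG1 i2.
have iG : collM.-integrable setT G := integrableD measurableT iG2 i3.
have IG : (\int[collM]_p G p = 4%:E * \int[collM]_p F p)%E.
  rewrite /G integralD// [X in (X + _)%E]integralD// [X in (X + _ + _)%E]integralD//.
  rewrite [X in (_ + X)%E]e3 [X in (_ + X + _)%E]e2 [X in (_ + X + _ + _)%E]e1.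
  have : (\int[collM]_p F p)%E \is a fin_num by exact: integrable_fin_num.
  by case: (\int[collM]_p F p)%E => // r _; rewrite -!EFinD -EFinM; congr _%:E; ring.
have GE p : S2 p.1.2 -> (- G p)%E = (W p * entropy_jump phi p)%:E.
  move=> sp; rewrite /G /F /= !W1 vstar_prepost W2//.
  congr _%:E.
  by rewrite /entropy_jump; ring.
have mE : measurable_fun setT (fun p => (W p * entropy_jump phi p)%:E).
  apply/measurable_EFinP; apply: measurable_funM => //.
  have mc (g : V * V * V -> V) : measurable_fun setT g ->
      measurable_fun setT (fun p => phi (g p)).
    by move=> mg; exact: (measurableT_comp mphi mg).
  apply: measurable_funB; last exact: mc measurable_vstar.
  apply: measurable_funB; last exact: mc measurable_snd.
  by apply: measurable_funD; [exact: mc measurable_vpost|exact: mc measurable_vspost].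
have iNG := integrableN iG.
have ae : ae_eq collM setT (-%E \o G) (fun p => (W p * entropy_jump phi p)%:E).
  by apply: ae_sphere => p sp _; exact: GE.
split.
  apply/integrableP; split => //.
  have /integrableP[_] := iNG; congr (_ < _)%E.
  apply: ae_eq_integral => //.
  - by apply: measurableT_comp => //; exact: measurable_int iNG.
  - exact: measurableT_comp.
  - exact: ae_eq_abse.
have mNG := measurable_int _ iNG.
transitivity (\int[collM]_p (-%E \o G) p)%E.
  by apply/esym; apply: ae_eq_integral.
apply: etrans (integralN (f := G) _) _.
  by apply: fin_num_adde_defl; rewrite fin_numN; exact: integrable_neg_fin_num.
by rewrite IG EFinN mulNe.
Qed.

End collision_space.

(** * Directional derivatives and Taylor bounds *)

Section directional_derivatives.
Context {R : realType} {V : normedModType R}.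
Implicit Types (f : V -> R) (x y a b : V).

Lemma is_derive_lineE f y b (s l : R) :
  is_derive s 1 (fun t => f (t *: b + y)) l <-> is_derive (s *: b + y) b f l.
Proof.
have E : (fun h : R => h^-1 *: (((fun t => f (t *: b + y)) \o shift s) (h *: 1)
    - f (s *: b + y))) =
  (fun h : R => h^-1 *: ((f \o shift (s *: b + y)) (h *: b) - f (s *: b + y))).
  by apply/funext => h /=; rewrite addrA -scalerDl [h *: _]mulr1.
split=> -[]; rewrite /derivable /derive.
  by rewrite E => d1 d2; split.
by rewrite -E => d1 d2; split.
Qed.

Lemma is_derive_line f y b (s l : R) :
  is_derive (s *: b + y) b f l -> is_derive s 1 (fun t => f (t *: b + y)) l.
Proof. by move/is_derive_lineE. Qed.

Lemma is_derive_line0 f x b (l : R) :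
  is_derive (0 : R) 1 (fun t => f (t *: b + x)) l -> is_derive x b f l.
Proof. by move/is_derive_lineE; rewrite scale0r add0r. Qed.

Lemma mvt_line (g dg : R -> R) (h : R) :
  (forall s : R, is_derive s 1 g (dg s)) ->
  exists2 xi : R, `|xi| <= `|h| & g h - g 0 = dg xi * h.
Proof.
move=> gd.
have cg : continuous g.
  move=> s; apply: differentiable_continuous; apply/derivable1_diffP.
  by apply: ex_derive.
have [h0|h0] := leP 0 h.
  have [c cI e] := @MVT_segment R g dg 0 h h0 (fun s _ => gd s)
    (continuous_subspaceT cg).
  exists c; last by rewrite e subr0.
  move: cI; rewrite in_itv /= => /andP[c0 ch].
  by rewrite !ger0_norm.
have [c cI e] := @MVT_segment R g dg h 0 (ltW h0) (fun s _ => gd s)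
  (continuous_subspaceT cg).
exists c.
  move: cI; rewrite in_itv /= => /andP[hc c0].
  by rewrite ler0_norm// ltr0_norm// lerN2.
by rewrite -opprB e sub0r mulrN opprK.
Qed.

(** The increment along h (a + b) is an increment along h a from x followed by one along h b from a
    moving base point. The mean value theorem turns the latter into a value of [db] near x, whence
    the continuity hypothesis on [db] alone. *)
Lemma is_deriveD_dir f a b (da : R) (db : V -> R) x :
  is_derive x a f da -> (forall y, is_derive y b f (db y)) ->
  {for x, continuous db} -> is_derive x (a + b) f (da + db x).
Proof.
move=> [dfa Dfa] dfb cdb.
suff cq : h^-1 *: ((f \o shift x) (h *: (a + b)) - f x) @[h --> 0^'] -->
    (da + db x : R).
  by split; [apply/cvg_ex; exists (da + db x)|exact: cvg_lim].
have c1 : h^-1 *: ((f \o shift x) (h *: a) - f x) @[h --> 0^'] --> (da : R).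
  by rewrite -Dfa; exact: dfa.
pose r (h : R) : R := h^-1 * (f (h *: b + (h *: a + x)) - f (h *: a + x)).
have c2 : r h @[h --> 0^'] --> (db x : R).
  apply/cvgrPdist_le => e e0.
  have /cvgrPdist_le /(_ e e0) := cdb.
  move=> /nbhs_ballP[d /= d0 hd].
  have N0 : 0 < `|a| + `|b| + 1 by rewrite ltr_wpDl// addr_ge0.
  have dN : 0 < d / (`|a| + `|b| + 1) by rewrite divr_gt0.
  have nd : \forall h \near (0 : R)^', `|h| < d / (`|a| + `|b| + 1).
    exact: dnbhs0_lt.
  have nn : \forall h \near (0 : R)^', h != 0 :> R by exact: nbhs_dnbhs_neq.
  near=> h.
  have h0 : h != 0 by near: h.
  have hs : `|h| < d / (`|a| + `|b| + 1) by near: h.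
  have [xi xih e1] := @mvt_line (fun s => f (s *: b + (h *: a + x)))
    (fun s => db (s *: b + (h *: a + x))) h
    (fun s => is_derive_line (dfb _)).
  have -> : r h = db (xi *: b + (h *: a + x)).
    by rewrite /r scale0r add0r in e1 *; rewrite e1 mulrC mulfK.
  apply: hd; rewrite -ball_normE /=.
  rewrite addrA opprD addrCA subrr addr0 normrN.
  apply: le_lt_trans (ler_normD _ _) _; rewrite !normrZ.
  apply: (@le_lt_trans _ _ (`|h| * (`|a| + `|b| + 1))).
    rewrite !mulrDr mulr1 addrC -addrA lerD2l.
    by rewrite (le_trans (ler_wpM2r _ xih))// lerDl.
  by rewrite -ltr_pdivlMr.
apply: cvg_trans (cvgD c1 c2).
apply: near_eq_cvg; near=> h => /=.
rewrite -[LHS]/(h^-1 * (f (h *: a + x) - f x) + r h).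
rewrite -[RHS]/(h^-1 * (f (h *: (a + b) + x) - f x)) /r -mulrDr; congr (_ * _).
by rewrite addrC subrKA scalerDr [h *: a + h *: b]addrC -addrA.
Unshelve. all: by end_near. Qed.

Lemma is_deriveZ_dir f b (l c : R) x :
  is_derive x b f l -> is_derive x (c *: b) f (c * l).
Proof.
move=> df; apply: is_derive_line0.
have -> : (fun t : R => f (t *: (c *: b) + x)) =
    (fun t => f (t *: b + x)) \o (fun t => c * t).
  by apply/funext => t /=; rewrite scalerA mulrC.
have d1 : is_derive (0 : R) 1 (fun t : R => c * t) c.
  by apply: is_derive_eq; rewrite [_ *: _]mulr1.
have d2 : is_derive (c * 0 : R) 1 (fun t => f (t *: b + x)) l.
  by apply: is_derive_line; rewrite mulr0 scale0r add0r.
by apply: (is_derive_eq (is_derive1_comp d2 d1)); rewrite [LHS]mulrC.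
Qed.

End directional_derivatives.

Section C1_functions.
Context {R : realType} {n : nat}.
Local Notation V := 'rV[R]_n.
Implicit Types (f : V -> R) (x v w : V).

Definition C1 f : Prop :=
  (forall i x, derivable f x (delta_mx 0 i)) /\
  (forall i, continuous (partial i f)).

Lemma C1_is_derive f x w : C1 f -> is_derive x w f (dot w (gradient f x)).
Proof.
move=> [df cf].
have -> : w = \sum_(i <- index_enum 'I_n) w 0 i *: delta_mx 0 i.
  by rewrite {1}[w]row_sum_delta.
have -> : dot (\sum_(i <- index_enum 'I_n) w 0 i *: delta_mx 0 i) (gradient f x) =
    \sum_(i <- index_enum 'I_n) w 0 i * partial i f x.
  rewrite -row_sum_delta; apply: eq_bigr => i _.
  by rewrite /gradient mxE.
elim: (index_enum 'I_n) x => [|i r IH] x.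
  by rewrite !big_nil; exact: is_derive0.
rewrite !big_cons addrC [X in is_derive _ _ _ X]addrC.
apply: (@is_deriveD_dir _ _ f _ _ _ (fun y => w 0 i * partial i f y)).
- by move=> y; apply: is_deriveZ_dir; apply: derivableP.
- have cw : {for x, continuous (cst (w 0 i) : V -> R)} by exact: cst_continuous.
  exact: (continuousM cw (cf i x)).
Qed.

Lemma C1_line f x w (s : R) : C1 f ->
  is_derive s 1 (fun t => f (t *: w + x)) (dot w (gradient f (s *: w + x))).
Proof. by move=> cf; apply: is_derive_line; exact: C1_is_derive. Qed.

Lemma norm_coord_le x i : `|x 0 i| <= `|x|.
Proof.
have -> : `|x| = mx_norm x by [].
rewrite mx_normrE; by apply/bigmax_geP; right => /=; exists (0, i).
Qed.

Lemma C1_continuous_fun f : C1 f -> continuous f.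
Proof.
move=> c1; have [df cf] := c1.
suff H (x : V) : f y @[y --> x] --> f x by move=> x; exact: H.
pose M := 1 + \sum_i (`|partial i f x| + 1).
have M0 : 0 < M by rewrite ltr_pwDl// sumr_ge0// => i _; rewrite addr_ge0.
have nM : \forall y \near x, forall i, `|partial i f y| <= `|partial i f x| + 1.
  apply: (@filter_forall V 'I_n
    (fun i y => `|partial i f y| <= `|partial i f x| + 1) (nbhs x)) => i.
  have /cvgrPdist_le /(_ 1 ltr01) := cf i x.
  apply: filterS => y h; rewrite -lerBlDl.
  apply: le_trans h; rewrite distrC; apply: le_trans (lerB_dist _ _) _.
  by [].
move: nM => /nbhs_ballP[d /= d0 hd].
have FF : Filter (nbhs x) := nbhs_filter x.
apply/cvgrPdist_lt => e e0.
near=> y.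
have yd : `|x - y| < d by near: y; exact: cvgr_dist_lt.
have ye : `|x - y| < e / M.
  by near: y; apply: cvgr_dist_lt => //; rewrite divr_gt0.
have [xi xi1 e1] := @mvt_line _ (fun s => f (s *: (y - x) + x))
   (fun s => dot (y - x) (gradient f (s *: (y - x) + x))) 1
   (fun s => C1_line _ _ _ c1).
rewrite scale0r add0r scale1r subrK mulr1 normr1 in e1 xi1.
rewrite distrC e1.
apply: (@le_lt_trans _ _ (`|y - x| * M)); last first.
  by rewrite distrC -ltr_pdivlMr.
rewrite /dot; apply: le_trans (ler_norm_sum _ _ _) _.
rewrite /M mulrDr mulr1 ler_wpDl// mulr_sumr.
apply: ler_sum => i _; rewrite normrM /gradient [_ 0 i in X in _ * X]mxE.
apply: ler_pM => //; first exact: norm_coord_le.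
apply: hd; rewrite -ball_normE /= opprD addrCA subrr addr0 normrN normrZ.
by apply: le_lt_trans yd; rewrite distrC ler_piMl.
Unshelve. all: by end_near. Qed.

Lemma rat_row_dense (x : V) (e : R) : 0 < e ->
  exists q : 'rV[rat]_n, `|x - map_mx ratr q| < e.
Proof.
move=> e0.
have hi i : {q : rat | ratr q \in `](x 0 i - e), (x 0 i + e)[ }.
  by apply: cid; apply: rat_in_itvoo; lra.
exists (\row_i sval (hi i)).
rewrite -[ltLHS]/(mx_norm _) mx_normrE; apply/bigmax_ltP; split => //= -[a i] _ /=.
rewrite (ord1 a) !mxE; case: (hi i) => q /=; rewrite in_itv /= => /andP[q1 q2].
by rewrite ltr_norml; lra.
Qed.

(** This links the topology of the sup norm to the sigma-algebra generated by the coordinates: an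
    open set is a countable union of rational sup-norm balls, which are finite intersections of
    coordinate strips. *)
Lemma open_measurable_rV (U : set V) : open U -> measurable U.
Proof.
move=> oU.
pose box (p : 'rV[rat]_n * rat) : set V :=
  [set x | `|x - map_mx ratr p.1| < ratr p.2].
pose G k : set V := if unpickle k is Some p then
  (if `[< box p `<=` U >] then box p else set0) else set0.
have mc (i : 'I_n) (c r : R) : measurable [set x : V | `|x 0 i - c| < r].
  rewrite (_ : mkset _ = rV_coord i @^-1` [set` (`](c - r), (c + r)[ : interval R)]).
    apply: measurable_preimT; last exact: measurable_itv.
    exact: measurable_rV_coord.
  by apply/seteqP; split => x; rewrite /= in_itv /= ltr_distl.
have mbox p : measurable (box p).
  have [p0|p0] := ltP 0 (ratr p.2 : R); last first.
    rewrite (_ : box p = set0)//; apply/seteqP; split => // x.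
    by rewrite /box /= ltNge (le_trans p0).
  rewrite (_ : box p = \bigcap_(i in [set: 'I_n])
    [set x | `|x 0 i - ratr (p.1 0 i)| < ratr p.2]).
    by apply: fin_bigcap_measurable => // i _; exact: mc.
  apply/seteqP; split => x; rewrite /box /= -[X in X < _]/(mx_norm _) mx_normrE.
    by move=> /bigmax_ltP[_ h] i _; have := h (0, i) isT; rewrite !mxE.
  move=> h; apply/bigmax_ltP; split => // -[a i] _ /=.
  by rewrite (ord1 a) !mxE; exact: h.
have -> : U = \bigcup_k G k.
  apply/seteqP; split => x; last first.
    move=> [k _]; rewrite /G; case: unpickle => // p; case: asboolP => // h.
    exact: h.
  move=> Ux; have : nbhs x U by exact: open_nbhs_nbhs.
  move=> /nbhs_ballP[d /= d0 hd].
  have [r] := @rat_in_itvoo R 0 (d / 2) (divr_gt0 d0 (ltr0n _ 2)).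
  rewrite in_itv /= => /andP[r0 rd].
  have [q qx] := rat_row_dense x r0.
  exists (pickle (q, r)) => //; rewrite /G pickleK.
  case: asboolP => [_|]; first by rewrite /box /=.
  case=> y; rewrite /box /= => yq; apply: hd; rewrite -ball_normE /=.
  rewrite -(subrKA (map_mx ratr q)); apply: le_lt_trans (ler_normD _ _) _.
  by rewrite -[X in _ + X]normrN opprB; lra.
apply: bigcupT_measurable => k; rewrite /G.
by case: unpickle => // p; case: asboolP.
Qed.

Lemma continuous_measurable_rV f : continuous f -> measurable_fun setT f.
Proof.
move=> /continuousP cf.
apply: (measurability _ (RGenOInfty.measurableE R)) => _ [_ [r ->] <-].
by rewrite setTI; apply: open_measurable_rV; apply: cf; exact: interval_open.
Qed.

End C1_functions.

(** * Decay and Taylor expansion of products *)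

Section decay.
Context {R : realType}.
Local Notation V := 'rV[R]_3.
Implicit Types (f : V -> R) (v w x z : V).

Lemma C2_partial_C1 f i : C2_rapidly_decreasing f -> C1 (partial i f).
Proof.
move=> cf; split => [j x|j]; first exact: C2_derivable2.
exact: C2_continuous2.
Qed.

Lemma C2_C1 f : C2_rapidly_decreasing f -> C1 f.
Proof.
move=> cf; split => [i x|i]; first exact: C2_derivable.
by apply: C1_continuous_fun; exact: C2_partial_C1.
Qed.

Definition decays f (k : nat) (C : R) : Prop :=
  [/\ forall v, `|f v| <= C * japanese v ^- k,
      forall i v, `|partial i f v| <= C * japanese v ^- k &
      forall i j v, `|partial j (partial i f) v| <= C * japanese v ^- k].

Lemma rapidly_decreasing_bound f k : rapidly_decreasing f ->
  exists2 C, 0 <= C & forall v, `|f v| <= C * japanese v ^- k.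
Proof.
move=> /(_ k)[C hC]; exists C.
  by apply: le_trans (hC 0); rewrite mulr_ge0// exprn_ge0// sqrtr_ge0.
move=> v; rewrite ler_pdivlMr ?exprn_gt0 ?japanese_gt0// mulrC; exact: hC.
Qed.

Lemma le_term_sum (I : finType) (F : I -> R) (i : I) :
  (forall j, 0 <= F j) -> F i <= \sum_j F j.
Proof. by move=> F0; rewrite (bigD1 i)//= lerDl sumr_ge0. Qed.

Lemma C2_decays f k : C2_rapidly_decreasing f ->
  exists2 C, 0 <= C & decays f k C.
Proof.
move=> cf; have [C0 C00 h0] := rapidly_decreasing_bound k (C2_decay cf).
have h1 i := cid2 (rapidly_decreasing_bound k (C2_decay1 cf i)).
have h2 i j := cid2 (rapidly_decreasing_bound k (C2_decay2 cf i j)).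
pose C1 i := s2val (h1 i); pose C2 i j := s2val (h2 i j).
have C10 i : 0 <= C1 i by rewrite /C1; case: (h1 i).
have C20 i j : 0 <= C2 i j by rewrite /C2; case: (h2 i j).
have jp v : 0 <= japanese v ^- k by rewrite invr_ge0 exprn_ge0// sqrtr_ge0.
have s1 : 0 <= \sum_i C1 i by apply: sumr_ge0.
have s2 : 0 <= \sum_i \sum_j C2 i j by apply: sumr_ge0 => i _; apply: sumr_ge0.
exists (C0 + \sum_i C1 i + \sum_i \sum_j C2 i j); first by rewrite !addr_ge0.
split.
- by move=> v; apply: le_trans (h0 v) _; rewrite ler_wpM2r// -addrA lerDl addr_ge0.
- move=> i v; apply: (@le_trans _ _ (C1 i * japanese v ^- k)).
    by rewrite /C1; case: (h1 i).
  rewrite ler_wpM2r//.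
  have t1 : C1 i <= \sum_i C1 i by exact: le_term_sum.
  apply: le_trans t1 _.
  by rewrite addrAC lerDr addr_ge0.
- move=> i j v; apply: (@le_trans _ _ (C2 i j * japanese v ^- k)).
    by rewrite /C2; case: (h2 i j).
  rewrite ler_wpM2r//.
  have t1 : C2 i j <= \sum_j C2 i j by exact: le_term_sum.
  have t2 : \sum_j C2 i j <= \sum_i \sum_j C2 i j.
    by apply: (@le_term_sum _ (fun i => \sum_j C2 i j)) => l; exact: sumr_ge0.
  apply: le_trans t1 (le_trans t2 _).
  by rewrite lerDr addr_ge0.
Qed.

Lemma dot_bound w x (D : R) : (forall i, `|x ord0 i| <= D) ->
  `|dot w x| <= 3 * enorm w * D.
Proof.
move=> xD; rewrite dot3.
have t i : `|w ord0 i * x ord0 i| <= enorm w * D.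
  by rewrite normrM ler_pM// coord_le_enorm.
have := t 0; have := t 1; have := t 2%:R.
set a := w ord0 0 * x ord0 0; set b := w ord0 1 * x ord0 1.
set c := w ord0 2%:R * x ord0 2%:R => ta tb tc.
have := ler_normD (a + b) c; have := ler_normD a b; lra.
Qed.

Definition hess f w x : R := \sum_i w 0 i * dot w (gradient (partial i f) x).

Lemma hess_bound f k C w x : decays f k C ->
  `|hess f w x| <= 9 * enorm w ^+ 2 * (C * japanese x ^- k).
Proof.
move=> [_ _ h2].
have g i : `|dot w (gradient (partial i f) x)| <= 3 * enorm w * (C * japanese x ^- k).
  by apply: dot_bound => j; rewrite /gradient mxE.
have -> : hess f w x = dot w (\row_i dot w (gradient (partial i f) x)).
  by apply: eq_bigr => i _; rewrite mxE.
have -> : 9 * enorm w ^+ 2 * (C * japanese x ^- k) =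
  3 * enorm w * (3 * enorm w * (C * japanese x ^- k)) by ring.
by apply: dot_bound => i; rewrite mxE.
Qed.

Lemma gradient_bound f k C w x : decays f k C ->
  `|dot w (gradient f x)| <= 3 * enorm w * (C * japanese x ^- k).
Proof. by move=> [_ h1 _]; apply: dot_bound => i; rewrite /gradient mxE. Qed.

Lemma mvt_pos (g dg : R -> R) (h : R) : 0 <= h ->
  (forall s : R, is_derive s 1 g (dg s)) ->
  exists2 xi : R, 0 <= xi <= h & g h - g 0 = dg xi * h.
Proof.
move=> h0 gd.
have cg : continuous g.
  move=> s; apply: differentiable_continuous; apply/derivable1_diffP.
  by apply: ex_derive.
have [c cI e] := @MVT_segment R g dg 0 h h0 (fun s _ => gd s)
  (continuous_subspaceT cg).
by exists c; [by move: cI; rewrite in_itv|rewrite e subr0].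
Qed.

Lemma taylor2 (g g1 g2 : R -> R) (B : R) :
  (forall s : R, is_derive s 1 g (g1 s)) ->
  (forall s : R, is_derive s 1 g1 (g2 s)) ->
  (forall s : R, 0 <= s <= 1 -> `|g2 s| <= B) ->
  `|g 1 - g 0 - g1 0| <= B.
Proof.
move=> d1 d2 hB.
have [x1 /andP[x10 x11] ->] := mvt_pos ler01 d1; rewrite mulr1.
have [x2 /andP[x20 x21] ->] := mvt_pos x10 d2.
rewrite normrM; have := hB x2; rewrite x20 (le_trans x21 x11) => /(_ isT) h.
rewrite (ger0_norm x10); apply: le_trans h.
by rewrite ler_piMr.
Qed.

(** With [u] = v_* and [w] the jump, the product on the left is f(v') f(v_*'). The weights are
    bounded jointly and along the whole segment, because a single factor may lose its decay while
    energy keeps the product small. By Leibniz, 36 = 9 + 2 * 9 + 9. *)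
Lemma taylor_product f v u w k C (B : R) : C2_rapidly_decreasing f ->
  0 <= C -> decays f k C ->
  (forall s : R, 0 <= s <= 1 ->
    japanese (s *: w + v) ^- k * japanese (s *: (- w) + u) ^- k <= B) ->
  `|f (w + v) * f (- w + u) - f v * f u -
    (dot w (gradient f v) * f u - f v * dot w (gradient f u))|
  <= 36 * enorm w ^+ 2 * C ^+ 2 * B.
Proof.
move=> cf C0 dC hB; have c1 := C2_C1 cf.
pose a (s : R) := f (s *: w + v); pose b (s : R) := f (s *: (- w) + u).
pose a1 (s : R) := dot w (gradient f (s *: w + v)).
pose b1 (s : R) := dot (- w) (gradient f (s *: (- w) + u)).
pose a2 (s : R) := hess f w (s *: w + v).
pose b2 (s : R) := hess f (- w) (s *: (- w) + u).
have da s : is_derive s (1 : R) a (a1 s) by exact: C1_line.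
have db s : is_derive s (1 : R) b (b1 s) by exact: C1_line.
have dgrad w' x s : is_derive s (1 : R)
    (fun t => dot w' (gradient f (t *: w' + x))) (hess f w' (s *: w' + x)).
  rewrite /hess.
  have -> : (fun t : R => dot w' (gradient f (t *: w' + x))) =
      \sum_i (fun t : R => w' 0 i * partial i f (t *: w' + x)).
    apply/funext => t; rewrite fct_sumE; apply: eq_bigr => i _.
    by rewrite /gradient mxE.
  apply: is_derive_sum => i.
  have h := C1_line x w' s (C2_partial_C1 i cf).
  by have := is_deriveZ (w' 0 i) h.
have da1 s : is_derive s (1 : R) a1 (a2 s) by exact: dgrad.
have db1 s : is_derive s (1 : R) b1 (b2 s) by exact: dgrad.
pose g := a * b; pose g1 := (a1 * b + a * b1).
have dg s : is_derive s (1 : R) g (g1 s).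
  apply: (is_derive_eq (is_deriveM (da s) (db s))).
  by rewrite /g1 addrC [_ *: b1 s]mulrC [_ *: a1 s]mulrC -[RHS]/(a1 s * b s + a s * b1 s); congr (_ + _); rewrite [LHS]mulrC.
pose g2 s := a2 s * b s + 2 * (a1 s * b1 s) + a s * b2 s.
have dg1 s : is_derive s (1 : R) g1 (g2 s).
  have h1 := is_deriveM (da1 s) (db s); have h2 := is_deriveM (da s) (db1 s).
  apply: (is_derive_eq (is_deriveD h1 h2)); rewrite /g2.
  rewrite -![_ *: _]/(_ * _); ring.
have := @taylor2 g g1 g2 (36 * enorm w ^+ 2 * C ^+ 2 * B) dg dg1.
rewrite /g /g1 -[(a * b) 1]/(a 1 * b 1) -[(a * b) 0]/(a 0 * b 0).
rewrite -[(a1 * b + a * b1) 0]/(a1 0 * b 0 + a 0 * b1 0).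
rewrite /a /b /a1 /b1 !scale1r !scale0r !add0r dotNl mulrN; apply.
move=> s s01; have [h0 _ _] := dC.
have n1 : `|a s| <= C * japanese (s *: w + v) ^- k by exact: h0.
have n2 : `|b s| <= C * japanese (s *: (- w) + u) ^- k by exact: h0.
have n3 : `|a1 s| <= 3 * enorm w * (C * japanese (s *: w + v) ^- k).
  exact: gradient_bound.
have n4 : `|b1 s| <= 3 * enorm w * (C * japanese (s *: (- w) + u) ^- k).
  by rewrite -(enormN w); exact: gradient_bound.
have n5 : `|a2 s| <= 9 * enorm w ^+ 2 * (C * japanese (s *: w + v) ^- k).
  exact: hess_bound.
have n6 : `|b2 s| <= 9 * enorm w ^+ 2 * (C * japanese (s *: (- w) + u) ^- k).
  by rewrite -(enormN w); exact: hess_bound.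
have hBs := hB s s01.
set X := japanese (s *: w + v) ^- k in n1 n3 n5 hBs.
set Y := japanese (s *: (- w) + u) ^- k in n2 n4 n6 hBs.
have e0 := enorm_ge0 w.
have m1 : `|a2 s * b s| <= 9 * enorm w ^+ 2 * (C * X) * (C * Y).
  by rewrite normrM ler_pM.
have m2 : `|a1 s * b1 s| <= (3 * enorm w * (C * X)) * (3 * enorm w * (C * Y)).
  by rewrite normrM ler_pM.
have m3 : `|a s * b2 s| <= (C * X) * (9 * enorm w ^+ 2 * (C * Y)).
  by rewrite normrM ler_pM.
apply: (@le_trans _ _ (36 * enorm w ^+ 2 * C ^+ 2 * (X * Y))); last first.
  by rewrite ler_wpM2l// !mulr_ge0// ?sqr_ge0.
rewrite /g2; apply: le_trans (ler_normD _ _) _.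
have t1 := ler_normD (a2 s * b s) (2 * (a1 s * b1 s)).
have t2 : `|2 * (a1 s * b1 s)| = 2 * `|a1 s * b1 s|.
  by rewrite normrM ger0_norm.
have -> : 36 * enorm w ^+ 2 * C ^+ 2 * (X * Y) =
  9 * enorm w ^+ 2 * (C * X) * (C * Y) +
  2 * ((3 * enorm w * (C * X)) * (3 * enorm w * (C * Y))) +
  (C * X) * (9 * enorm w ^+ 2 * (C * Y)) by ring.
apply: lerD _ m3; apply: le_trans t1 _; apply: lerD m1 _.
by rewrite t2 ler_pM2l.
Qed.

End decay.

(** * Bounds on the collision operator, uniform in the truncation *)

Section collision_geometry.
Context {R : realType}.
Local Notation V := 'rV[R]_3.
Implicit Types (f : V -> R) (v w x z : V) (y : V * V).

Lemma cos_deviationE z s : cos_deviation z s * enorm z = dot z s.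
Proof.
rewrite /cos_deviation; have [->|z0] := eqVneq z 0.
  by rewrite dot0l mul0r mul0r.
by rewrite divfK// lt0r_neq0// enorm_gt0.
Qed.

(** Together with [dot_jump] this is conservation of energy: the jump w satisfies w.z = - |w|^2. *)
Lemma dot_jump_fst y : S2 y.2 ->
  dot (jump y) y.1 = - (2^-1 * enorm y.1 ^+ 2 * (1 - cos_deviation y.1 y.2)).
Proof.
move=> s1; rewrite /jump !(dotZl, dotBl) [dot y.2 _]dotC -cos_deviationE.
by rewrite -enorm_sqr; ring.
Qed.

Lemma dot_jump y : S2 y.2 ->
  dot (jump y) (jump y) = 2^-1 * enorm y.1 ^+ 2 * (1 - cos_deviation y.1 y.2).
Proof.
move=> s1; rewrite /jump !(dotZl, dotZr, dotBl, dotBr) [dot y.2 y.1]dotC.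
have -> : dot y.2 y.2 = 1 by rewrite -enorm_sqr s1 expr1n.
by rewrite -cos_deviationE -enorm_sqr; field.
Qed.

(* Along the segment from a pair of velocities to the pair after the collision,
   the energy does not drop below half of its initial value. *)
Lemma segment_energy v z w (s : R) :
  dot w z = - dot w w -> 0 <= s <= 1 ->
  4 * s * (1 - s) * dot w w <= 2^-1 * dot z z ->
  2^-1 * (japanese v ^+ 2 + japanese (v - z) ^+ 2) <=
  japanese (s *: w + v) ^+ 2 * japanese (s *: (- w) + (v - z)) ^+ 2.
Proof.
move=> wz s01 h; rewrite !japanese_sqr.
set A := dot (_ + v) _; set B := dot (_ + _) (_ + (v - z)).
have A0 : 0 <= A by exact: dot_ge0.
have B0 : 0 <= B by exact: dot_ge0.
(* Since w.z = - |w|^2, the energy A + B equals E - 2 s (1 - s) |w|^2, where E = |v|^2 + |v - z|^2;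
   and 4 s (1 - s) |w|^2 <= |z|^2 / 2 <= E. *)
have : dot v v + dot (v - z) (v - z) <= 2 * (A + B).
  have vz : 0 <= dot (v + (v - z)) (v + (v - z)) by exact: dot_ge0.
  rewrite /A /B; move: h vz; rewrite !(dotDl, dotDr, dotNl, dotNr, dotZl, dotZr).
  rewrite [dot z w]dotC wz [dot v w]dotC [dot z v]dotC.
  set ww := dot w w; set zz := dot z z; set vv := dot v v; set vz := dot v z.
  set wv := dot w v; nra.
nra.
Qed.

(** Separates the variables: [T] dominates both half of <v>^2 and a quarter of <z>^2, hence its
    square dominates their product. *)
Lemma pair_decay v z : let T := 2^-1 * (japanese v ^+ 2 + japanese (v - z) ^+ 2) in
  8^-1 * (japanese v ^+ 2 * japanese z ^+ 2) <= T ^+ 2.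
Proof.
rewrite /= !japanese_sqr.
have h1 : 0 <= dot (v + (v - z)) (v + (v - z)) by exact: dot_ge0.
have h2 : 0 <= dot (v - z) (v - z) by exact: dot_ge0.
have h3 : 0 <= dot z z by exact: dot_ge0.
have h4 : 0 <= dot v v by exact: dot_ge0.
move: h1 h2; rewrite !(dotDl, dotDr, dotNl, dotNr) [dot z v]dotC.
set zz := dot z z in h3 *; set vv := dot v v in h4 *; set vz := dot v z => h1 h2.
pose T := 2^-1 * (1 + vv + (1 + (vv - vz + (- vz - - zz)))).
have t1 : 2^-1 * (1 + vv) <= T by rewrite /T; lra.
have t2 : 4^-1 * (1 + zz) <= T by rewrite /T; lra.
rewrite -/T; have -> : 8^-1 * ((1 + vv) * (1 + zz)) = 2^-1 * (1 + vv) * (4^-1 * (1 + zz)).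
  by field.
rewrite expr2; apply: ler_pM => //; lra.
Qed.

(** The square in [pair_decay] halves the exponent: order 4 N along the segment leaves order 2 N in
    v and in z separately. *)
Lemma segment_decay v z w (s : R) N :
  dot w z = - dot w w -> 0 <= s <= 1 ->
  4 * s * (1 - s) * dot w w <= 2^-1 * dot z z ->
  japanese (s *: w + v) ^- (4 * N) * japanese (s *: (- w) + (v - z)) ^- (4 * N) <=
  8 ^+ N * (japanese v ^- (2 * N) * japanese z ^- (2 * N)).
Proof.
move=> wz s01 h; have h1 := segment_energy v wz s01 h.
have h2 := pair_decay v z.
have j0 x := japanese_gt0 x.
set A := s *: w + v in h1 *; set B := _ + (v - z) in h1 *.
have h3 : 8^-1 * (japanese v ^+ 2 * japanese z ^+ 2) <= japanese A ^+ 4 * japanese B ^+ 4.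
  apply: le_trans h2 _.
  have -> : japanese A ^+ 4 * japanese B ^+ 4 = (japanese A ^+ 2 * japanese B ^+ 2) ^+ 2.
    by ring.
  rewrite ler_pXn2r// nnegrE ?mulr_ge0 ?exprn_ge0 ?(ltW (j0 _))//.
  by rewrite addr_ge0 ?exprn_ge0 ?(ltW (j0 _)).
have -> : 8 ^+ N * (japanese v ^- (2 * N) * japanese z ^- (2 * N)) =
    ((8^-1 * (japanese v ^+ 2 * japanese z ^+ 2)) ^+ N)^-1.
  by rewrite (exprMn N 8^-1) (exprMn N (japanese v ^+ 2)) exprVn !invfM invrK -!exprM.
have -> : japanese A ^- (4 * N) * japanese B ^- (4 * N) =
    ((japanese A ^+ 4 * japanese B ^+ 4) ^+ N)^-1.
  by rewrite exprMn invfM !exprM.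
have p1 : 0 < 8^-1 * (japanese v ^+ 2 * japanese z ^+ 2).
  by rewrite !mulr_gt0 ?exprn_gt0.
have p2 := lt_le_trans p1 h3.
rewrite lef_pV2 ?posrE ?exprn_gt0//.
by apply: lerXn2r => //; rewrite nnegrE ltW.
Qed.

Lemma vpost_addE y v : vpost (y, v) = jump y + v.
Proof. by rewrite /vpost addrC. Qed.

Lemma vspost_addE y v : vspost (y, v) = - jump y + (v - y.1).
Proof. by rewrite /vspost addrC. Qed.

Definition collision_defect f (p : V * V * V) : R :=
  f (vspost p) * f (vpost p) - f (vstar p) * f p.2.

Lemma collision_defect_bound f v y N C : S2 y.2 -> 0 <= C ->
  decays f (4 * N) C ->
  `|collision_defect f (y, v)| <=
  2 * C ^+ 2 * 8 ^+ N * (japanese v ^- (2 * N) * japanese y.1 ^- (2 * N)).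
Proof.
move=> s1 C0 [h0 _ _]; have wz := dot_jump_fst s1; rewrite -dot_jump// in wz.
(* The pairs before and after the collision are the endpoints of the segment, where the condition on
   4 s (1 - s) is void. *)
have d0 : 4 * (0 : R) * (1 - 0) * dot (jump y) (jump y) <= 2^-1 * dot y.1 y.1.
  by rewrite mulr0 !mul0r mulr_ge0 ?dot_ge0.
have d1 : 4 * (1 : R) * (1 - 1) * dot (jump y) (jump y) <= 2^-1 * dot y.1 y.1.
  by rewrite subrr mulr0 mul0r mulr_ge0 ?dot_ge0.
have b0 : 0 <= (0 : R) <= 1 by rewrite lexx ler01.
have b1 : 0 <= (1 : R) <= 1 by rewrite lexx ler01.
have e0 := segment_decay v N wz b0 d0; have e1 := segment_decay v N wz b1 d1.
rewrite !scale0r !add0r in e0; rewrite !scale1r in e1.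
have pr x x' : `|f x * f x'| <= C ^+ 2 * (japanese x ^- (4 * N) * japanese x' ^- (4 * N)).
  have -> : C ^+ 2 * (japanese x ^- (4 * N) * japanese x' ^- (4 * N)) =
    (C * japanese x ^- (4 * N)) * (C * japanese x' ^- (4 * N)) by ring.
  by rewrite normrM ler_pM.
rewrite /collision_defect; apply: le_trans (ler_normB _ _) _.
have q1 := pr (vspost (y, v)) (vpost (y, v)).
have q2 := pr (vstar (y, v)) v.
have C2 : 0 <= C ^+ 2 by rewrite sqr_ge0.
have r1 := ler_wpM2l C2 e1; have r0 := ler_wpM2l C2 e0.
have -> : 2 * C ^+ 2 * 8 ^+ N * (japanese v ^- (2 * N) * japanese y.1 ^- (2 * N)) =
  C ^+ 2 * (8 ^+ N * (japanese v ^- (2 * N) * japanese y.1 ^- (2 * N))) +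
  C ^+ 2 * (8 ^+ N * (japanese v ^- (2 * N) * japanese y.1 ^- (2 * N))) by ring.
apply: lerD.
- apply: le_trans q1 _; apply: le_trans r1.
  by rewrite vspost_addE vpost_addE [X in C ^+ 2 * X <= _]mulrC.
- apply: le_trans q2 _; apply: le_trans r0; rewrite /vstar /=.
  by rewrite [X in C ^+ 2 * X <= _]mulrC.
Qed.

(* Reflection of sigma in the axis z: averaging over it cancels the part of the
   jump orthogonal to z and leaves the factor 1 - cos theta that compensates the
   angular singularity. *)
Definition reflect (y : V * V) : V * V := (y.1, - householder y.1 y.2).

Lemma jump_reflect y : jump y + jump (reflect y) = (cos_deviation y.1 y.2 - 1) *: y.1.
Proof.
rewrite /jump /reflect /=; have [->|z0] := eqVneq y.1 0.
  by rewrite enorm0 !scale0r !subr0 !scaler0 addr0.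
have e0 : enorm y.1 != 0 := lt0r_neq0 (enorm_gt0 z0).
rewrite /householder -enorm_sqr /cos_deviation [dot y.2 _]dotC.
by apply/rowP => i; rewrite !mxE; field.
Qed.

Lemma cos_deviation_reflect y : cos_deviation (reflect y).1 (reflect y).2 =
  cos_deviation y.1 y.2.
Proof.
rewrite /reflect /=; have [->|z0] := eqVneq y.1 0.
  by rewrite /cos_deviation !dot0l.
have e0 : enorm y.1 != 0 := lt0r_neq0 (enorm_gt0 z0).
rewrite /cos_deviation /householder; congr (_ / _).
rewrite !(dotNr, dotBr, dotZr) -!enorm_sqr [dot y.2 _]dotC.
by field.
Qed.

Lemma S2_reflect y : S2 y.2 -> S2 (reflect y).2.
Proof. by rewrite /S2 /reflect /= enormN householder_enorm. Qed.

(** The first-order term of the expansion is linear in the jump, and the two jumps add up to (cos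
    theta - 1) z; the remainder is of order |jump|^2 = |z|^2 (1 - cos theta) / 2. Both carry the
    factor 1 - cos theta. The hypothesis cos theta >= 0 gives |jump|^2 <= |z|^2 / 2, as
    [segment_decay] demands. The constant is 42 = 2 * 18 + 6. *)
Lemma collision_defect_reflect f v y N C : S2 y.2 -> 0 <= C ->
  C2_rapidly_decreasing f -> decays f (4 * N) C ->
  0 <= cos_deviation y.1 y.2 ->
  `|collision_defect f (y, v) + collision_defect f (reflect y, v)| <=
  42 * C ^+ 2 * 8 ^+ N * (japanese v ^- (2 * N) * japanese y.1 ^- (2 * N)) *
  (japanese y.1 ^+ 2 * (1 - cos_deviation y.1 y.2)).
Proof.
move=> s1 C0 cf dC c0.
pose B := 8 ^+ N * (japanese v ^- (2 * N) * japanese y.1 ^- (2 * N)).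
set c := cos_deviation y.1 y.2 in c0 *.
have c1 : c <= 1 by have /andP[] := cos_deviation_itv y.1 s1.
pose T w := dot w (gradient f v) * f (v - y.1) - f v * dot w (gradient f (v - y.1)).
have seg y' (s : R) : S2 y'.2 -> y'.1 = y.1 -> cos_deviation y'.1 y'.2 = c ->
    0 <= s <= 1 ->
    japanese (s *: jump y' + v) ^- (4 * N) *
    japanese (s *: (- jump y') + (v - y.1)) ^- (4 * N) <= B.
  move=> s1' e ce s01; apply: segment_decay => //.
    by rewrite -e dot_jump_fst// dot_jump.
  rewrite dot_jump// ce -enorm_sqr e.
  have := sqr_ge0 (enorm y.1); set e2 := _ ^+ 2 => e20.
  have : s * (1 - s) <= 4^-1 by have := sqr_ge0 (s - 2^-1); lra.
  have : 0 <= s * (1 - s) by case/andP: s01 => ? ?; rewrite mulr_ge0 ?subr_ge0.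
  set q := s * (1 - s) => q0 q1.
  have -> : 4 * s * (1 - s) * (2^-1 * e2 * (1 - c)) = 2 * q * (e2 * (1 - c)).
    by rewrite /q; field.
  have k : e2 * (1 - c) <= e2 by rewrite ler_piMr//; lra.
  have k0 : 0 <= e2 * (1 - c) by rewrite mulr_ge0//; lra.
  nra.
have main y' : S2 y'.2 -> y'.1 = y.1 -> cos_deviation y'.1 y'.2 = c ->
    `|collision_defect f (y', v) - T (jump y')| <=
    18 * enorm y.1 ^+ 2 * (1 - c) * C ^+ 2 * B.
  move=> s1' e ce.
  have := @taylor_product R f v (v - y.1) (jump y') (4 * N) C B cf C0 dC
    (fun s => seg y' s s1' e ce).
  rewrite enorm_sqr dot_jump// ce e.
  have -> : 36 * (2^-1 * enorm y.1 ^+ 2 * (1 - c)) * C ^+ 2 * B =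
    18 * enorm y.1 ^+ 2 * (1 - c) * C ^+ 2 * B by field.
  rewrite /collision_defect vspost_addE vpost_addE /vstar /= e.
  by rewrite [f (- _ + _) * _]mulrC [f (v - _) * _]mulrC.
have m1 := main y s1 erefl erefl.
have m2 := main (reflect y) (S2_reflect s1) erefl (cos_deviation_reflect y).
have lin : T (jump y) + T (jump (reflect y)) = (c - 1) * T y.1.
  have -> : T (jump y) + T (jump (reflect y)) = T (jump y + jump (reflect y)).
    by rewrite /T !dotDl; ring.
  by rewrite jump_reflect /T !dotZl -/c; ring.
have Tz : `|(c - 1) * T y.1| <= 6 * enorm y.1 * (1 - c) * C ^+ 2 * B.
  rewrite normrM ler0_norm; last by lra.
  have s0 := seg y 0 s1 erefl erefl; rewrite lexx ler01 !scale0r !add0r in s0.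
  have {}s0 := s0 isT.
  have [h0 _ _] := dC.
  have g1 := gradient_bound y.1 v dC; have g2 := gradient_bound y.1 (v - y.1) dC.
  set X := japanese v ^- _ in s0 g1; set Y := japanese (v - y.1) ^- _ in s0 g2.
  have t1 : `|dot y.1 (gradient f v) * f (v - y.1)| <=
      3 * enorm y.1 * (C * X) * (C * Y) by rewrite normrM ler_pM//; exact: h0.
  have t2 : `|f v * dot y.1 (gradient f (v - y.1))| <=
      C * X * (3 * enorm y.1 * (C * Y)) by rewrite normrM ler_pM//; exact: h0.
  have -> : 6 * enorm y.1 * (1 - c) * C ^+ 2 * B =
    - (c - 1) * (6 * enorm y.1 * C ^+ 2 * B) by ring.
  apply: ler_wpM2l; first by lra.
  rewrite /T; apply: le_trans (ler_normB _ _) _.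
  apply: le_trans (lerD t1 t2) _.
  have -> : 3 * enorm y.1 * (C * X) * (C * Y) + C * X * (3 * enorm y.1 * (C * Y)) =
    6 * enorm y.1 * C ^+ 2 * (X * Y) by ring.
  by apply: ler_wpM2l => //; rewrite !mulr_ge0 ?enorm_ge0 ?sqr_ge0.
have -> : collision_defect f (y, v) + collision_defect f (reflect y, v) =
  (collision_defect f (y, v) - T (jump y)) +
  (collision_defect f (reflect y, v) - T (jump (reflect y))) + (c - 1) * T y.1.
  by rewrite -lin; ring.
apply: le_trans (ler_normD _ _) _.
apply: le_trans (lerD (ler_normD _ _) Tz) _.
apply: le_trans (lerD (lerD m1 m2) (lexx _)) _.
have -> : 18 * enorm y.1 ^+ 2 * (1 - c) * C ^+ 2 * B +
  18 * enorm y.1 ^+ 2 * (1 - c) * C ^+ 2 * B +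
  6 * enorm y.1 * (1 - c) * C ^+ 2 * B =
  (36 * enorm y.1 ^+ 2 + 6 * enorm y.1) * ((1 - c) * C ^+ 2 * B) by ring.
have -> : 42 * C ^+ 2 * 8 ^+ N * (japanese v ^- (2 * N) * japanese y.1 ^- (2 * N)) *
  (japanese y.1 ^+ 2 * (1 - c)) = (42 * japanese y.1 ^+ 2) * ((1 - c) * C ^+ 2 * B).
  by rewrite /B; ring.
apply: ler_wpM2r.
  rewrite mulr_ge0//; first by rewrite mulr_ge0 ?sqr_ge0//; lra.
  by rewrite /B !mulr_ge0 ?exprn_ge0// invr_ge0 exprn_ge0// ltW// japanese_gt0.
rewrite japanese_sqr -enorm_sqr; have := enorm_ge0 y.1.
have := sqr_ge0 (enorm y.1 - 1); nra.
Qed.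

End collision_geometry.

Section general.
Context d (T : measurableType d) (R : realType).
Context (mu : {measure set T -> \bar R}).

Lemma integrable_ae_bound (f g : T -> R) : measurable_fun setT f ->
  measurable_fun setT g -> (forall x, 0 <= g x) ->
  (\int[mu]_x (g x)%:E < +oo)%E -> {ae mu, forall x, `|f x| <= g x} ->
  mu.-integrable setT (EFin \o f) /\
  (`|\int[mu]_x (f x)%:E| <= \int[mu]_x (g x)%:E)%E.
Proof.
move=> mf mg g0 ig fg.
have mEf : measurable_fun setT (EFin \o f) by exact/measurable_EFinP.
have h : (\int[mu]_x `|(EFin \o f) x| <= \int[mu]_x (g x)%:E)%E.
  apply: ae_ge0_le_integral => //.
  - exact: measurableT_comp.
  - by move=> x _; rewrite lee_fin.
  - exact/measurable_EFinP.
  - by apply: filterS fg => x xg _; rewrite /= lee_fin.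
split; first by apply/integrableP; split => //; exact: le_lt_trans ig.
apply: le_trans h.
exact: (@le_abse_integral _ _ _ mu setT (EFin \o f)).
Qed.

Lemma ge0_integral_fin (f : T -> R) : (forall x, 0 <= f x) ->
  (\int[mu]_x (f x)%:E < +oo)%E -> exists2 r : R, 0 <= r &
  (\int[mu]_x (f x)%:E = r%:E)%E.
Proof.
move=> f0 fi.
have i0 : (0 <= \int[mu]_x (f x)%:E)%E by apply: integral_ge0 => x _; rewrite lee_fin.
exists (fine (\int[mu]_x (f x)%:E)%E); first exact: fine_ge0.
by rewrite fineK// ge0_fin_numE.
Qed.

Lemma ge0_integralZl_real (f : T -> R) (k : R) : measurable_fun setT f ->
  (forall x, 0 <= f x) -> 0 <= k ->
  (\int[mu]_x (k * f x)%:E = k%:E * \int[mu]_x (f x)%:E)%E.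
Proof.
move=> mf f0 k0; under eq_integral do rewrite EFinM.
rewrite ge0_integralZl_EFin//; last exact/measurable_EFinP.
by move=> x _; rewrite lee_fin.
Qed.

End general.

Section general_product.
Context d1 d2 (T1 : measurableType d1) (T2 : measurableType d2) (R : realType).
Context (m1 : {sigma_finite_measure set T1 -> \bar R}).
Context (m2 : {sigma_finite_measure set T2 -> \bar R}).

Lemma integral_product_le (F : T1 * T2 -> R) (h : T1 -> R) :
  measurable_fun setT F -> (forall y, 0 <= F y) ->
  measurable_fun setT h -> (forall x, 0 <= h x) ->
  (forall x, \int[m2]_s (F (x, s))%:E <= (h x)%:E)%E ->
  (\int[m1 \x m2]_y (F y)%:E <= \int[m1]_x (h x)%:E)%E.
Proof.
move=> mF F0 mh h0 Fh.
have mEF : measurable_fun setT (EFin \o F) by exact/measurable_EFinP.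
rewrite (fubini_tonelli1 (EFin \o F))//.
apply: ge0_le_integral => //.
- by move=> x _; apply: integral_ge0 => y _; rewrite /= lee_fin.
- exact: measurable_fun_fubini_tonelli_F.
- exact/measurable_EFinP.
- by move=> x _; exact: Fh.
Qed.

End general_product.

(** * Truncated collision integrals, averaged over the reflection *)

Section mean_bound.
Context {R : realType}.
Local Notation V := 'rV[R]_3.
Implicit Types (f : V -> R) (v w x z s : V) (y : V * V) (m : nat) (beta : R -> R).
Context (gamma : R) (gamma_itv : -3 < gamma <= 1).

Definition weight z : R := enorm z `^ gamma * japanese z ^- 7.

Lemma weight_ge0 z : 0 <= weight z.
Proof. by rewrite mulr_ge0 ?powR_ge0// invr_ge0 exprn_ge0// sqrtr_ge0. Qed.

Lemma measurable_weight : measurable_fun setT weight.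
Proof.
apply: measurable_funM; last exact: measurable_japaneseV.
by apply: (measurableT_comp (measurable_powR _)); exact: measurable_enorm.
Qed.

(** [5 <= N] gives 2 N >= 9 = 7 + 2: seven powers for [weight], two for the factor <z>^2 of
    [collision_defect_reflect]. *)
Lemma japanese_decay z N : (5 <= N)%N ->
  japanese z ^- (2 * N) * japanese z ^+ 2 <= japanese z ^- 7.
Proof.
move=> N5; have j1 := japanese_ge1 z; have j0 := japanese_gt0 z.
rewrite -(@subnK 9 (2 * N)); last by rewrite (leq_trans _ (leq_mul (leqnn 2) N5)).
set n := (2 * N - 9)%N.
rewrite (_ : (n + 9 = n + 7 + 2)%N); last by rewrite -addnA.
rewrite exprD invfM divfK ?expf_neq0 ?gt_eqF// exprD invfM.
rewrite ler_piMl ?invr_ge0 ?exprn_ge0 ?(ltW j0)//.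
by rewrite invf_le1 ?exprn_gt0// exprn_ege1.
Qed.

Lemma japanese_decay' z N : (5 <= N)%N -> japanese z ^- (2 * N) <= japanese z ^- 7.
Proof.
move=> N5; apply: le_trans (japanese_decay z N5).
rewrite ler_peMr ?exprn_ege1 ?japanese_ge1//.
by rewrite invr_ge0 exprn_ge0// ltW// japanese_gt0.
Qed.

Lemma lebS_setC_sphere : lebS [set y : V * V | ~ S2 y.2] = 0%E.
Proof.
have mS : measurable (~` @S2 R) by apply: measurableC; exact: measurable_unit_sphere.
rewrite (_ : mkset _ = setT `*` ~` @S2 R); last first.
  by apply/seteqP; split => [p /= ps|p [_ ps]].
by rewrite /lebS product_measure1E//= sphere_measure_setC mule0.
Qed.

Lemma measurable_setC_sphere : measurable [set y : V * V | ~ S2 y.2].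
Proof.
rewrite (_ : mkset _ = (fun y : V * V => y.2) @^-1` (~` @S2 R))//.
apply: measurable_preimT; first exact: measurable_snd.
by apply: measurableC; exact: measurable_unit_sphere.
Qed.

Lemma ae_lebS (P : V * V -> Prop) :
  (forall y, S2 y.2 -> P y) -> {ae lebS, forall y, P y}.
Proof.
move=> h; exists [set y : V * V | ~ S2 y.2]; split.
- exact: measurable_setC_sphere.
- exact: lebS_setC_sphere.
- by move=> p /= nP sp; apply: nP; exact: h.
Qed.

Lemma measurable_cos : measurable_fun setT (fun y : V * V => cos_deviation y.1 y.2).
Proof.
rewrite (_ : (fun _ => _) = (fun y : V * V => dot y.1 y.2 * enorm y.1 `^ (-1))).
  apply: measurable_funM; first exact: measurable_dot.
  by apply: (measurableT_comp (measurable_powR _)); exact: measurable_enorm_comp.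
by apply/funext => y; rewrite powR_inv1 ?enorm_ge0.
Qed.

Lemma measurable_kernel beta : measurable_fun setT beta ->
  measurable_fun setT (fun y : V * V => Defs.kernel gamma beta y.1 y.2).
Proof.
move=> mb; apply: measurable_funM; last exact: (measurableT_comp mb measurable_cos).
by apply: (measurableT_comp (measurable_powR _)); exact: measurable_enorm_comp.
Qed.

Lemma measurable_collision_defect f : measurable_fun setT f ->
  measurable_fun setT (collision_defect f).
Proof.
move=> mf; have mc (g : V * V * V -> V) : measurable_fun setT g ->
    measurable_fun setT (fun p => f (g p)).
  by move=> mg; exact: (measurableT_comp mf mg).
apply: measurable_funB; apply: measurable_funM.
- exact: mc measurable_vspost.
- exact: mc measurable_vpost.
- exact: mc measurable_vstar.
- exact: mc measurable_snd.
Qed.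

Lemma preserving_reflect : preserving lebS (@reflect R).
Proof.
have h : preserving (lebesgue3 \x sphere_measure)%E
    (skew (fun x : V => x) (fun (z : V) (s : V) => - householder z s)).
  apply: preserving_skew.
  - by split => [|A mA]; [exact: measurable_id|rewrite preimage_id].
  - apply: measurable_rVN.
    by apply: measurable_householder; [exact: measurable_fst|exact: measurable_snd].
  - move=> z; exact: preserving_comp preserving_sphereN (preserving_sphere_householder z).
exact: h.
Qed.

Context (b : R -> R) (ab : angular_kernel b).

Definition cutoff_angular m : R -> R := truncate (angular b) m.

Lemma cutoff_angular_ge0 m c : 0 <= cutoff_angular m c.
Proof. by rewrite /cutoff_angular /truncate le_min ler0n (angular_pos c ab). Qed.

Lemma cutoff_angular_le m c : cutoff_angular m c <= angular b c.
Proof. by rewrite /cutoff_angular /truncate ge_min lexx. Qed.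

Lemma cutoff_angular_lem m c : cutoff_angular m c <= m%:R.
Proof. by rewrite /cutoff_angular /truncate ge_min lexx orbT. Qed.

Lemma cutoff_angular_neg m c : c < 0 -> cutoff_angular m c = 0.
Proof.
move=> c0; apply/eqP; rewrite eq_le cutoff_angular_ge0 andbT.
by apply: le_trans (cutoff_angular_le m c) _; rewrite /angular [0 <= c]leNgt c0.
Qed.

Lemma measurable_angular_kernel : measurable_fun setT (angular b).
Proof. by apply: measurable_angular; exact: angular_measurable ab. Qed.

Lemma measurable_cutoff_angular m : measurable_fun setT (cutoff_angular m).
Proof.
apply: measurable_minr; last exact: measurable_cst.
exact: measurable_angular_kernel.
Qed.

Definition collision_weight m f (p : V * V * V) : R :=
  Defs.kernel gamma (cutoff_angular m) p.1.1 p.1.2 * collision_defect f p.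

Lemma measurable_collision_weight m f : measurable_fun setT f ->
  measurable_fun setT (collision_weight m f).
Proof.
move=> mf; apply: measurable_funM; last exact: measurable_collision_defect.
exact: (measurableT_comp (measurable_kernel (measurable_cutoff_angular m)) measurable_fst).
Qed.

Lemma kernel_cutoff_ge0 m z s : 0 <= Defs.kernel gamma (cutoff_angular m) z s.
Proof. by rewrite mulr_ge0 ?powR_ge0 ?cutoff_angular_ge0. Qed.

(** The factor [m] makes this useless in the limit; it serves the integrability at each fixed
    level. *)
Lemma collision_weight_bound m f v y N C : S2 y.2 -> 0 <= C ->
  decays f (4 * N) C -> (5 <= N)%N ->
  `|collision_weight m f (y, v)| <=
  m%:R * (2 * C ^+ 2 * 8 ^+ N * japanese v ^- (2 * N)) * weight y.1.
Proof.
move=> s1 C0 dC N5; have h := collision_defect_bound v s1 C0 dC.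
rewrite /collision_weight normrM (ger0_norm (kernel_cutoff_ge0 _ _ _)).
have jv : 0 <= japanese v ^- (2 * N) by rewrite invr_ge0 exprn_ge0// ltW// japanese_gt0.
have P0 : 0 <= 2 * C ^+ 2 * 8 ^+ N by rewrite !mulr_ge0 ?sqr_ge0 ?exprn_ge0.
have -> : m%:R * (2 * C ^+ 2 * 8 ^+ N * japanese v ^- (2 * N)) * weight y.1 =
  (enorm y.1 `^ gamma * m%:R) *
  (2 * C ^+ 2 * 8 ^+ N * (japanese v ^- (2 * N) * japanese y.1 ^- 7)).
  by rewrite /weight; ring.
apply: ler_pM => //; first exact: kernel_cutoff_ge0.
  by rewrite /Defs.kernel ler_wpM2l ?powR_ge0 ?cutoff_angular_lem.
apply: le_trans h _; rewrite ler_wpM2l// ler_wpM2l//.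
exact: japanese_decay'.
Qed.

Lemma integral_weight_sphere_lty :
  (\int[lebS]_y (weight y.1)%:E < +oo)%E.
Proof.
have [I I0 Ie] := ge0_integral_fin weight_ge0 (integral_power_lty gamma_itv).
pose S := fine (sphere_measure [set: V]).
have Sf : sphere_measure [set: V] = S%:E.
  by rewrite /S fineK//; exact: fin_num_measure.
have S0 : 0 <= S by rewrite fine_ge0.
have mw := measurable_weight.
apply: (@le_lt_trans _ _ (\int[lebesgue3]_z (S * weight z)%:E)%E).
  apply: (@integral_product_le _ _ _ _ R lebesgue3 sphere_measure
     (fun y => weight y.1) (fun z => S * weight z)).
  - exact: (measurableT_comp mw measurable_fst).
  - by move=> y; exact: weight_ge0.
  - by apply: measurable_funM => //; exact: measurable_cst.
  - by move=> z; rewrite mulr_ge0 ?weight_ge0.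
  - move=> x /=; rewrite integral_cst//.
    by rewrite [X in (_ * X)%E]Sf -EFinM mulrC.
rewrite (ge0_integralZl_real _ mw weight_ge0 S0).
by rewrite Ie -EFinM ltry.
Qed.

Lemma angular_momentum_ge0 c : 0 <= angular b c * (1 - c).
Proof.
rewrite /angular; case: ifP => [/andP[c0 c1]|]; last by rewrite mul0r.
rewrite mulr_ge0 ?subr_ge0//.
by have := angular_pos c ab; rewrite /angular c0 c1.
Qed.

Lemma measurable_angular_momentum : measurable_fun setT (fun c => angular b c * (1 - c)).
Proof.
apply: measurable_funM; first exact: measurable_angular_kernel.
by apply: measurable_funB; [exact: measurable_cst|exact: measurable_id].
Qed.

Lemma momentum_bound : exists2 K : R, 0 <= K & forall z,
  (\int[sphere_measure]_s (angular b (cos_deviation z s) *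
    (1 - cos_deviation z s))%:E <= K%:E)%E.
Proof.
have [K K0 hK] := angular_momentum_bound ab.
pose S := fine (sphere_measure [set: V]).
have Sf : sphere_measure [set: V] = S%:E.
  by rewrite /S fineK//; exact: fin_num_measure.
have S0 : 0 <= S by rewrite fine_ge0.
have a0 := angular_pos 0 ab.
(* At z = 0 the deviation cosine is 0 by convention, and the second term pays for this value. *)
exists (K + angular b 0 * S); first by rewrite addr_ge0// mulr_ge0.
move=> z; have [->|z0] := eqVneq z 0.
  have -> : (fun s : V => (angular b (cos_deviation 0 s) * (1 - cos_deviation 0 s))%:E) =
      cst (angular b 0)%:E.
    by apply/funext => s; rewrite /cos_deviation dot0l mul0r subr0 mulr1.
  rewrite integral_cst//.
  by rewrite [X in (_ * X)%E]Sf -EFinM lee_fin lerDr.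
have nz : S2 (normalize z) by rewrite /S2 /=; exact: enorm_normalize.
have -> : (fun s : V => (angular b (cos_deviation z s) * (1 - cos_deviation z s))%:E) =
   (fun s : V => (angular b (dot (normalize z) s) * (1 - dot (normalize z) s))%:E).
  apply/funext => s; have -> // : cos_deviation z s = dot (normalize z) s.
  by rewrite /cos_deviation /normalize dotZl mulrC.
apply: le_trans (hK _ nz) _.
by rewrite lee_fin lerDl mulr_ge0.
Qed.

Lemma integral_momentum_lty : exists2 I : R, 0 <= I &
  (\int[lebS]_y (weight y.1 * (angular b (cos_deviation y.1 y.2) *
    (1 - cos_deviation y.1 y.2)))%:E <= I%:E)%E.
Proof.
have [I I0 Ie] := ge0_integral_fin weight_ge0 (integral_power_lty gamma_itv).
have [K K0 hK] := momentum_bound.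
have mw := measurable_weight.
have p0 := angular_momentum_ge0; have ma := measurable_angular_momentum.
exists (K * I); first by rewrite mulr_ge0.
apply: (@le_trans _ _ (\int[lebesgue3]_z (K * weight z)%:E)%E).
  apply: (@integral_product_le _ _ _ _ R lebesgue3 sphere_measure
     (fun y => weight y.1 * (angular b (cos_deviation y.1 y.2) *
    (1 - cos_deviation y.1 y.2))) (fun z => K * weight z)).
  - apply: measurable_funM; first exact: (measurableT_comp mw measurable_fst).
    exact: (measurableT_comp ma measurable_cos).
  - by move=> y; rewrite mulr_ge0 ?weight_ge0.
  - by apply: measurable_funM => //; exact: measurable_cst.
  - by move=> z; rewrite mulr_ge0 ?weight_ge0.
  - move=> z /=; rewrite ge0_integralZl_real//; last exact: weight_ge0.
      have -> : (K * weight z)%:E = ((weight z)%:E * K%:E)%E by rewrite -EFinM mulrC.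
      apply: lee_wpmul2l; last exact: hK.
      by rewrite lee_fin weight_ge0.
    apply: (measurableT_comp ma).
    exact: (measurableT_comp measurable_cos (measurable_pair1 z)).
rewrite (ge0_integralZl_real _ mw weight_ge0 K0).
by rewrite Ie -EFinM.
Qed.

Lemma collision_weight_reflect m f v y N C : S2 y.2 -> 0 <= C ->
  C2_rapidly_decreasing f -> decays f (4 * N) C -> (5 <= N)%N ->
  `|collision_weight m f (y, v) + collision_weight m f (reflect y, v)| <=
  42 * C ^+ 2 * 8 ^+ N * japanese v ^- (2 * N) *
  (weight y.1 * (angular b (cos_deviation y.1 y.2) * (1 - cos_deviation y.1 y.2))).
Proof.
move=> s1 C0 cf dC N5; pose k2 := 42 * C ^+ 2 * 8 ^+ N * japanese v ^- (2 * N).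
have jv : 0 <= japanese v ^- (2 * N) by rewrite invr_ge0 exprn_ge0// ltW// japanese_gt0.
have k20 : 0 <= k2.
  apply: mulr_ge0 => //; apply: mulr_ge0; last exact: exprn_ge0.
  by apply: mulr_ge0 => //; exact: sqr_ge0.
have p0 := angular_momentum_ge0.
rewrite -/k2 /collision_weight /Defs.kernel.
rewrite [X in _ + X * _]/=.
have -> := cos_deviation_reflect y.
rewrite /= -mulrDr.
set c := cos_deviation _ _.
have [c0|c0] := ltP c 0.
  by rewrite cutoff_angular_neg// mulr0 mul0r normr0 mulr_ge0// mulr_ge0 ?weight_ge0.
have h := collision_defect_reflect v s1 C0 cf dC c0.
have k0 : 0 <= enorm y.1 `^ gamma * cutoff_angular m c.
  by rewrite mulr_ge0 ?powR_ge0 ?cutoff_angular_ge0.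
rewrite normrM (ger0_norm k0).
have c1 : 0 <= 1 - c.
  by have /andP[_ ?] := cos_deviation_itv y.1 s1; rewrite subr_ge0.
have -> : k2 * (weight y.1 * (angular b c * (1 - c))) =
  (enorm y.1 `^ gamma * angular b c) * (k2 * japanese y.1 ^- 7 * (1 - c)).
  by rewrite /weight; ring.
apply: ler_pM; [exact: k0|exact: normr_ge0| |].
  by rewrite ler_wpM2l ?powR_ge0 ?cutoff_angular_le.
apply: le_trans h _.
have -> : 42 * C ^+ 2 * 8 ^+ N * (japanese v ^- (2 * N) * japanese y.1 ^- (2 * N)) *
  (japanese y.1 ^+ 2 * (1 - c)) = k2 * (japanese y.1 ^- (2 * N) * japanese y.1 ^+ 2) * (1 - c).
  by rewrite /k2; ring.
apply: ler_wpM2r; first exact: c1.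
by apply: ler_wpM2l; [exact: k20|exact: japanese_decay].
Qed.

(** [D] is chosen before [m]. Since [reflect] preserves the measure, the integral is half of that of
    the weight plus its reflection, which [collision_weight_reflect] bounds independently of [m];
    hence 21 = 42 / 2. *)
Lemma collision_mean_bound f N C : 0 <= C -> C2_rapidly_decreasing f ->
  decays f (4 * N) C -> (5 <= N)%N -> exists2 D : R, 0 <= D & forall m v,
  lebS.-integrable setT (fun y => (collision_weight m f (y, v))%:E) /\
  (`|\int[lebS]_y (collision_weight m f (y, v))%:E| <=
    (D * japanese v ^- (2 * N))%:E)%E.
Proof.
move=> C0 cf dC N5; have [I I0 hI] := integral_momentum_lty.
have P0 : 0 <= C ^+ 2 * 8 ^+ N by rewrite !mulr_ge0 ?sqr_ge0 ?exprn_ge0.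
exists (21 * (C ^+ 2 * 8 ^+ N) * I); first by rewrite !mulr_ge0.
move=> m v; have mf : measurable_fun setT f.
  by apply: continuous_measurable_rV; apply: C1_continuous_fun; exact: C2_C1.
have jv : 0 <= japanese v ^- (2 * N) by rewrite invr_ge0 exprn_ge0// ltW// japanese_gt0.
pose W y := collision_weight m f (y, v).
have mW : measurable_fun setT W.
  exact: (measurableT_comp (measurable_collision_weight m mf) (measurable_pair2 v)).
pose k1 := m%:R * (2 * C ^+ 2 * 8 ^+ N * japanese v ^- (2 * N)).
have k10 : 0 <= k1 by rewrite /k1 -!mulrA !mulr_ge0 ?exprn_ge0 ?sqr_ge0.
have mw1 : measurable_fun setT (fun y : V * V => weight y.1).
  exact: (measurableT_comp measurable_weight measurable_fst).
have w0 (y : V * V) : 0 <= weight y.1 by exact: weight_ge0.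
have [iW _] : lebS.-integrable setT (EFin \o W) /\
    (`|\int[lebS]_y (W y)%:E| <= \int[lebS]_y (k1 * weight y.1)%:E)%E.
  apply: integrable_ae_bound.
  - exact: mW.
  - by apply: measurable_funM => //; exact: measurable_cst.
  - by move=> y; rewrite mulr_ge0.
  - rewrite (ge0_integralZl_real _ mw1 w0 k10) lte_mul_pinfty ?lee_fin//.
    exact: integral_weight_sphere_lty.
  - by apply: ae_lebS => y s1; exact: collision_weight_bound.
split; first exact: iW.
have pr := preserving_reflect.
have iWr := integrable_preserving pr iW.
have eWr := integral_preserving pr (measurable_int _ iW).
pose k2 := 42 * C ^+ 2 * 8 ^+ N * japanese v ^- (2 * N).
have k20 : 0 <= k2 by rewrite /k2 -!mulrA !mulr_ge0 ?exprn_ge0 ?sqr_ge0.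
have p0 := angular_momentum_ge0; have ma := measurable_angular_momentum.
pose F (y : V * V) := weight y.1 * (angular b (cos_deviation y.1 y.2) *
    (1 - cos_deviation y.1 y.2)).
have F0 y : 0 <= F y by rewrite mulr_ge0.
have mF : measurable_fun setT F.
  by apply: measurable_funM => //; exact: (measurableT_comp ma measurable_cos).
have [_ h2] : lebS.-integrable setT (EFin \o (fun y => W y + W (reflect y))) /\
    (`|\int[lebS]_y (W y + W (reflect y))%:E| <= \int[lebS]_y (k2 * F y)%:E)%E.
  apply: integrable_ae_bound.
  - apply: measurable_funD => //.
    exact: (measurableT_comp mW pr.1).
  - by apply: measurable_funM => //; exact: measurable_cst.
  - by move=> y; rewrite mulr_ge0.
  - rewrite (ge0_integralZl_real _ mF F0 k20) lte_mul_pinfty ?lee_fin//.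
    exact: le_lt_trans hI (ltry _).
  - by apply: ae_lebS => y s1; exact: collision_weight_reflect.
have e2 : (\int[lebS]_y (W y + W (reflect y))%:E = 2%:E * \int[lebS]_y (W y)%:E)%E.
  transitivity (\int[lebS]_y ((EFin \o W) y + ((EFin \o W) \o @reflect R) y))%E.
    by apply: eq_integral => y _; rewrite /= EFinD.
  rewrite (integralD measurableT iW iWr) [X in (_ + X)%E]eWr.
  have : (\int[lebS]_y (EFin \o W) y)%E \is a fin_num by exact: integrable_fin_num.
  rewrite -[(\int[lebS]_y (W y)%:E)%E]/(\int[lebS]_y (EFin \o W) y)%E.
  case: (\int[lebS]_y (EFin \o W) y)%E => // r _.
  by rewrite -EFinD -EFinM; congr _%:E; ring.
rewrite e2 (ge0_integralZl_real _ mF F0 k20) in h2.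
have h3 : (k2%:E * \int[lebS]_y (F y)%:E <= (k2 * I)%:E)%E.
  by rewrite [(k2 * I)%:E]EFinM; apply: lee_wpmul2l => //; rewrite lee_fin.
have h4 := le_trans h2 h3.
rewrite -[(\int[lebS]_y _)%E]/(\int[lebS]_y (EFin \o W) y)%E.
rewrite -[(\int[lebS]_y (W y)%:E)%E]/(\int[lebS]_y (EFin \o W) y)%E in h4.
have : (\int[lebS]_y (EFin \o W) y)%E \is a fin_num by exact: integrable_fin_num.
move: h4; case: (\int[lebS]_y (EFin \o W) y)%E => // r.
rewrite -EFinM !abse_EFin !lee_fin normrM ger0_norm// /k2 => h4 _.
by move: h4; rewrite /k2; set J := japanese v ^- _; lra.
Qed.

End mean_bound.

(** * The H-theorem *)

Section general_integral.
Context d (T : measurableType d) (R : realType).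
Context (mu : {measure set T -> \bar R}).

Lemma integral_conull (D : set T) (g h : T -> \bar R) : measurable D ->
  mu (~` D) = 0%E -> measurable_fun setT h -> (forall x, D x -> g x = h x) ->
  (\int[mu]_(x in D) g x = \int[mu]_x h x)%E.
Proof.
move=> mD D0 mh gh.
transitivity (\int[mu]_(x in D) h x)%E.
  by apply: eq_integral => x /set_mem; exact: gh.
rewrite integral_mkcond; apply: ae_eq_integral => //.
  by apply/(measurable_restrictT _ mD); exact: measurable_funTS.
exists (~` D); split => //; first exact: measurableC.
move=> x /= hx; apply: contra_not hx => Dx _.
by rewrite patchE mem_set.
Qed.

Lemma le_ae_ge0_integral_abs (f g : T -> R) : measurable_fun setT f ->
  measurable_fun setT g -> {ae mu, forall x, 0 <= f x <= g x} ->
  (\int[mu]_x `|(f x)%:E| <= \int[mu]_x (g x)%:E)%E.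
Proof.
move=> mf mg fg.
have mEf : measurable_fun setT (EFin \o f) by exact/measurable_EFinP.
have mEg : measurable_fun setT (EFin \o g) by exact/measurable_EFinP.
have -> : (\int[mu]_x (g x)%:E = \int[mu]_x `|(g x)%:E|)%E.
  apply: ae_eq_integral => //; first exact: measurableT_comp.
  apply: filterS fg => x /andP[f0 fg] _.
  by rewrite abse_EFin ger0_norm// (le_trans f0 fg).
apply: ae_ge0_le_integral => //.
- exact: measurableT_comp.
- exact: measurableT_comp.
- apply: filterS fg => x /andP[f0 fg] _.
  by rewrite !abse_EFin lee_fin !ger0_norm// (le_trans f0 fg).
Qed.

End general_integral.

Section H_theorem.
Context {R : realType}.
Local Notation V := 'rV[R]_3.
Implicit Types (f : V -> R) (v w x z s : V) (y : V * V) (m : nat) (beta : R -> R).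
Context (gamma : R) (gamma_itv : -3 < gamma <= 1).
Context (b : R -> R) (ab : angular_kernel b).

Lemma cutoff_angularE m c : -1 <= c <= 1 -> truncate b m c = cutoff_angular b m c.
Proof. by move=> c1; rewrite /cutoff_angular /truncate angularE. Qed.

(** Passage from the variables (v_*, sigma) on R^3 x S^2 to (z, sigma) with z = v - v_*, in which
    the involutions are written. *)
Lemma collision_mean_cvg f v : measurable_fun setT f ->
  collision_value gamma b f f v 0 ->
  (\int[lebS]_y (collision_weight gamma b m f (y, v))%:E)%E @[m --> \oo] --> 0%E.
Proof.
move=> mf [_]; set u := (X in X @ _ --> _); set u' := (X in _ -> X @ _ --> _).
suff -> : u = u' by [].
apply/funext => m; rewrite /u /u'.
pose W y := collision_weight gamma b m f (y, v).
have mW : measurable_fun setT (EFin \o W).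
  apply/measurable_EFinP.
  exact: (measurableT_comp (measurable_collision_weight gamma ab m mf) (measurable_pair2 v)).
have pT : preserving lebS (fun y : V * V => (v - y.1, y.2)).
  have h : preserving (lebesgue3 \x sphere_measure)%E
    (skew (fun x : V => v - x) (fun (_ : V) (s : V) => s)).
    apply: preserving_skew.
    - exact: preserving_lebesgue3_sub.
    - exact: measurable_snd.
    - by move=> z; split => [|A mA]; [exact: measurable_id|rewrite preimage_id].
  exact: h.
apply: etrans (integral_preserving pT mW).
apply: (@integral_conull _ _ _ lebS).
- by apply: measurableX => //; exact: measurable_unit_sphere.
- rewrite (_ : ~` _ = [set y : V * V | ~ S2 y.2]); first exact: lebS_setC_sphere.
  apply/seteqP; split => y /=; first by move=> h s; apply: h.
  by move=> h [_ s]; apply: h.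
- exact: (measurableT_comp mW pT.1).
- move=> y [_ s1] /=; congr _%:E.
  rewrite /W /collision_weight /collision_integrand /Defs.kernel /collision_defect /=.
  rewrite vspostE vpostE cutoff_angularE; last exact: cos_deviation_itv.
  by rewrite /vstar /= !(opprB, addrCA v, subrr, addr0).
Qed.

Lemma collision_weight_exchange m f p :
  collision_weight gamma b m f (exchange p) = collision_weight gamma b m f p.
Proof.
rewrite /collision_weight /collision_defect vspost_exchange vpost_exchange.
rewrite vstar_exchange /exchange /=.
have -> : Defs.kernel gamma (cutoff_angular b m) (- p.1.1) (- p.1.2) =
    Defs.kernel gamma (cutoff_angular b m) p.1.1 p.1.2.
  by rewrite /Defs.kernel /cos_deviation enormN dotNl dotNr opprK.
by congr (_ * _); rewrite [f (vpost p) * _]mulrC [f p.2 * _]mulrC.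
Qed.

(** Microreversibility: the kernel depends on |z| and cos theta only, both unchanged when the
    velocities before and after are exchanged, while the defect changes sign. *)
Lemma collision_weight_prepost m f (p : V * V * V) : S2 p.1.2 ->
  collision_weight gamma b m f (prepost p) = - collision_weight gamma b m f p.
Proof.
move=> s1; rewrite /collision_weight /collision_defect vspost_prepost// vpost_prepost//.
rewrite vstar_prepost /prepost /=.
have -> : Defs.kernel gamma (cutoff_angular b m) (enorm p.1.1 *: p.1.2) (normalize p.1.1) =
    Defs.kernel gamma (cutoff_angular b m) p.1.1 p.1.2.
  rewrite /Defs.kernel; have e : enorm (enorm p.1.1 *: p.1.2) = enorm p.1.1.
    by rewrite enormZ s1 mulr1 ger0_norm ?enorm_ge0.
  rewrite e /cos_deviation e; congr (_ * cutoff_angular _ _ _).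
  have [->|z0] := eqVneq p.1.1 0; first by rewrite enorm0 invr0 !mulr0.
  have e0 : enorm p.1.1 != 0 := lt0r_neq0 (enorm_gt0 z0).
  by rewrite /normalize dotZl dotZr dotC mulrA divff// mul1r.
by ring.
Qed.

Lemma integral_weight_japanese_lty :
  (\int[collM]_p (weight gamma p.1.1 * japanese p.2 ^- 6)%:E < +oo)%E.
Proof.
have j0 (v : V) : 0 <= japanese v ^- 6 by rewrite invr_ge0 exprn_ge0// sqrtr_ge0.
have mj := @measurable_japaneseV R 3 6.
have [J J0 Je] := ge0_integral_fin j0 integral_japanese_lty.
have mw1 : measurable_fun setT (fun y : V * V => weight gamma y.1).
  exact: (measurableT_comp (measurable_weight gamma) measurable_fst).
have w0 (y : V * V) : 0 <= weight gamma y.1 by exact: weight_ge0.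
apply: (@le_lt_trans _ _ (\int[lebS]_y (J * weight gamma y.1)%:E)%E).
  apply: (@integral_product_le _ _ _ _ R lebS lebesgue3
     (fun p => weight gamma p.1.1 * japanese p.2 ^- 6)
     (fun y => J * weight gamma y.1)).
  - apply: measurable_funM; first exact: (measurableT_comp mw1 measurable_fst).
    exact: (measurableT_comp mj measurable_snd).
  - by move=> p; exact: mulr_ge0.
  - by apply: measurable_funM; [exact: measurable_cst|exact: mw1].
  - by move=> y; exact: mulr_ge0.
  - move=> y /=; rewrite (ge0_integralZl_real _ mj j0 (w0 y)).
    by rewrite Je -EFinM mulrC.
rewrite (ge0_integralZl_real _ mw1 w0 J0) lte_mul_pinfty ?lee_fin//.
exact: integral_weight_sphere_lty.
Qed.

Section entropy.
Context f (f_gt0 : forall v, 0 < f v) (f_C2 : C2_rapidly_decreasing f).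
Context (f_log : slowly_growing_log f).
Context (f_Q : forall v, collision_value gamma b f f v 0).

Let mf : measurable_fun setT f.
Proof. by apply: continuous_measurable_rV; apply: C1_continuous_fun; exact: C2_C1. Qed.

Let L v := ln (f v).

Let mL : measurable_fun setT L.
Proof. by apply: (measurableT_comp _ mf); exact: measurable_ln. Qed.

Let W m := collision_weight gamma b m f.

Let mW m : measurable_fun setT (W m).
Proof. exact: measurable_collision_weight. Qed.

Let Phi m (p : V * V * V) := W m p * L p.2.

Let mPhi m : measurable_fun setT (Phi m).
Proof. by apply: measurable_funM; [exact: mW|exact: (measurableT_comp mL measurable_snd)]. Qed.

Let growth : exists (A : R) (k : nat), 0 <= A /\ forall v, `|L v| <= A * japanese v ^+ k.
Proof.
have [A [k h]] := f_log; exists A, k; split => //.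
have := le_trans (normr_ge0 _) (h 0).
by rewrite pmulr_lge0// exprn_gt0// japanese_gt0.
Qed.

Let decay_growth v (A : R) (k : nat) : 0 <= A -> `|L v| <= A * japanese v ^+ k ->
  japanese v ^- (2 * (k + 5)) * `|L v| <= A * japanese v ^- 6.
Proof.
move=> A0 h; have j0 := japanese_gt0 v.
have -> : japanese v ^- 6 = japanese v ^- (k + 6) * japanese v ^+ k.
  by rewrite (exprD _ k 6) (invfM (japanese v ^+ k)) mulrAC mulVf ?mul1r// expf_neq0// gt_eqF.
rewrite mulrCA; apply: ler_pM => //.
  by rewrite invr_ge0 exprn_ge0// ltW.
rewrite lef_pV2 ?posrE ?exprn_gt0// ler_weXn2l ?japanese_ge1//.
lia.
Qed.

Let iPhi m : collM.-integrable setT (EFin \o Phi m).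
Proof.
have [A [k [A0 hA]]] := growth.
(* Order 4 (k + 5) leaves 2 (k + 5) powers in v, of which k absorb the growth of log f and at least
   6 remain for integrability; in z, k + 5 is above the threshold 5. *)
have [C C0 dC] := C2_decays (4 * (k + 5)) f_C2.
pose c1 := m%:R * (2 * C ^+ 2 * 8 ^+ (k + 5)) * A.
have c10 : 0 <= c1.
  by rewrite /c1; apply: mulr_ge0 => //; apply: mulr_ge0 => //;
    rewrite !mulr_ge0 ?sqr_ge0 ?exprn_ge0.
have mwj : measurable_fun setT (fun p : V * V * V => weight gamma p.1.1 * japanese p.2 ^- 6).
  apply: measurable_funM; last exact: (measurableT_comp (@measurable_japaneseV R 3 6) measurable_snd).
  exact: (measurableT_comp (measurable_weight gamma) (@measurable_p11 R)).
have wj0 (p : V * V * V) : 0 <= weight gamma p.1.1 * japanese p.2 ^- 6.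
  by rewrite mulr_ge0 ?weight_ge0// invr_ge0 exprn_ge0// sqrtr_ge0.
suff [] : collM.-integrable setT (EFin \o Phi m) /\
    (`|\int[collM]_p (Phi m p)%:E| <=
     \int[collM]_p (c1 * (weight gamma p.1.1 * japanese p.2 ^- 6))%:E)%E by [].
apply: integrable_ae_bound.
- exact: mPhi.
- by apply: measurable_funM; [exact: measurable_cst|exact: mwj].
- by move=> p; exact: mulr_ge0.
- rewrite (ge0_integralZl_real _ mwj wj0 c10) lte_mul_pinfty ?lee_fin//.
  exact: integral_weight_japanese_lty.
- apply: ae_sphere => -[y v] s1; rewrite /Phi normrM.
  have N5 : (5 <= k + 5)%N by rewrite leq_addl.
  have h1 := collision_weight_bound gamma ab m v s1 C0 dC N5.
  apply: le_trans (ler_wpM2r (normr_ge0 _) h1) _.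
  have h2 := decay_growth A0 (hA v).
  have -> : m%:R * (2 * C ^+ 2 * 8 ^+ (k + 5) * japanese v ^- (2 * (k + 5))) *
     weight gamma y.1 * `|L v| = m%:R * (2 * C ^+ 2 * 8 ^+ (k + 5)) * weight gamma y.1 *
     (japanese v ^- (2 * (k + 5)) * `|L v|) by rewrite /=; ring.
  have -> : c1 * (weight gamma y.1 * japanese v ^- 6) =
    m%:R * (2 * C ^+ 2 * 8 ^+ (k + 5)) * weight gamma y.1 * (A * japanese v ^- 6).
    by rewrite /c1; ring.
  apply: ler_wpM2l => //.
  by rewrite mulr_ge0 ?weight_ge0// mulr_ge0// !mulr_ge0 ?sqr_ge0 ?exprn_ge0.
Qed.

(** Integrating over (z, sigma) first produces the truncated collision integrals, which tend to 0 at
    every v by hypothesis. The bound of [collision_mean_bound], uniform in m, absorbs log f and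
    dominates them in v. *)
Let Phi_cvg : (\int[collM]_p (Phi m p)%:E)%E @[m --> \oo] --> 0%E.
Proof.
have [A [k [A0 hA]]] := growth.
have [C C0 dC] := C2_decays (4 * (k + 5)) f_C2.
have N5 : (5 <= k + 5)%N by rewrite leq_addl.
have [D D0 hD] := collision_mean_bound gamma_itv ab C0 f_C2 dC N5.
pose Q m v := (\int[lebS]_y (W m (y, v))%:E)%E.
have Qfin m v : Q m v \is a fin_num by exact: integrable_fin_num (hD m v).1.
have QL m v : fubini_G lebS (EFin \o Phi m) v = (Q m v * (L v)%:E)%E.
  rewrite /fubini_G /Phi /=.
  under eq_integral do rewrite EFinM.
  by rewrite integralZr//; exact: (hD m v).1.
have mQL m : measurable_fun setT (fun v => (Q m v * (L v)%:E)%E).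
  rewrite (_ : (fun _ => _) = fubini_G lebS (EFin \o Phi m)); last first.
    by apply/funext => v; rewrite QL.
  exact: (@measurable_fubini_G _ _ _ _ _ lebS lebesgue3 _ (iPhi m)).
have IQ m : (\int[collM]_p (Phi m p)%:E = \int[lebesgue3]_v (Q m v * (L v)%:E))%E.
  apply: etrans (esym (@integral21_prod_meas1 _ _ _ _ _ lebS lebesgue3 _ (iPhi m))) _.
  by apply: eq_integral => v _; exact: QL.
have j0 (v : V) : 0 <= japanese v ^- 6 by rewrite invr_ge0 exprn_ge0// sqrtr_ge0.
have mj := @measurable_japaneseV R 3 6.
have DA0 : 0 <= D * A by exact: mulr_ge0.
have iG : lebesgue3.-integrable setT (fun v : V => (D * A * japanese v ^- 6)%:E).
  apply/integrableP; split.
    by apply/measurable_EFinP; apply: measurable_funM; [exact: measurable_cst|exact: mj].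
  under eq_integral => v _ do rewrite abse_EFin ger0_norm ?mulr_ge0//.
  rewrite (ge0_integralZl_real _ mj j0 DA0) lte_mul_pinfty ?lee_fin//.
  exact: integral_japanese_lty.
rewrite (_ : (fun m => _) = (fun m => (\int[lebesgue3]_v (Q m v * (L v)%:E))%E)); last first.
  by apply/funext => m; exact: IQ.
have -> : 0%E = (\int[lebesgue3]_v (cst 0%E (v : V)))%E :> \bar R by rewrite integral0.
apply: (@dominated_cvg _ _ R lebesgue3 setT measurableT
  (fun m v => (Q m v * (L v)%:E)%E) (cst 0%E)
  (fun v => (D * A * japanese v ^- 6)%:E)).
- exact: mQL.
- move=> v _; have h : Q m v @[m --> \oo] --> 0%E by exact: collision_mean_cvg.
  rewrite [X in _ --> X](_ : _ = (0 * (L v)%:E)%E); last by rewrite mul0e.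
  by apply: cvgeZr.
- by [].
- exact: iG.
- move=> m v _ /=; rewrite abseM abse_EFin.
  apply: le_trans (lee_wpmul2r _ (hD m v).2) _; first by rewrite lee_fin.
  rewrite -EFinM lee_fin -!mulrA ler_wpM2l//.
  exact: decay_growth.
Qed.

Let Psi m (p : V * V * V) := W m p * entropy_jump L p.

Let entropy_production (p : V * V * V) : 0 <= collision_defect f p * entropy_jump L p.
Proof.
rewrite /entropy_jump /L -lnM ?posrE// -addrA -opprD -lnM ?posrE//.
rewrite /collision_defect.
have p1 : 0 < f (vpost p) * f (vspost p) by rewrite mulr_gt0.
have p2 : 0 < f p.2 * f (vstar p) by rewrite mulr_gt0.
rewrite [f (vspost p) * _]mulrC [f (vstar p) * _]mulrC.
set X := f _ * _ in p1 *; set Y := f _ * _ in p2 *.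
have [XY|XY] := leP X Y.
  have h : ln X <= ln Y by rewrite ler_ln.
  by rewrite mulr_le0// subr_le0.
have h : ln Y <= ln X by rewrite ler_ln// ltW.
by rewrite mulr_ge0// subr_ge0// ltW.
Qed.

Lemma H_theorem : {ae collM, forall p : V * V * V,
  S2 p.1.2 -> p.1.1 != 0 -> 0 < angular b (cos_deviation p.1.1 p.1.2) ->
  collision_defect f p = 0}.
Proof.
have idm m := H_identity mL (mW m) (collision_weight_exchange m f)
  (@collision_weight_prepost m f) (iPhi m).
have mPsi m : measurable_fun setT (Psi m).
  by apply/measurable_EFinP; exact: measurable_int (idm m).1.
(* Level 1 decides: min(b, 1) is positive wherever b is, and its production is below that of every
   level m >= 1, whose integrals tend to 0. *)
have le1 m : (0 < m)%N ->
    (\int[collM]_p `|(Psi 1%N p)%:E| <= \int[collM]_p (Psi m p)%:E)%E.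
  move=> m0; apply: le_ae_ge0_integral_abs; [exact: mPsi|exact: mPsi|].
  apply: ae_sphere => p s1; have e := entropy_production p.
  rewrite /Psi /W /collision_weight -!(mulrA (Defs.kernel _ _ _ _)); apply/andP; split.
    by rewrite mulr_ge0//; exact: kernel_cutoff_ge0.
  apply: ler_wpM2r => //; rewrite /Defs.kernel ler_wpM2l ?powR_ge0//.
  rewrite /cutoff_angular /truncate le_min ge_min lexx /= ge_min.
  by rewrite ler_nat m0 orbT.
have c0 : (\int[collM]_p (Psi m p)%:E)%E @[m --> \oo] --> 0%E.
  rewrite (_ : (fun m => _) = (fun m => ((- 4)%:E * \int[collM]_p (Phi m p)%:E)%E)); last first.
    by apply/funext => m; exact: (idm m).2.
  rewrite [X in _ --> X](_ : _ = ((- 4)%:E * 0)%E); last by rewrite mule0.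
  by apply: cvgeZl => //; exact: Phi_cvg.
have z : (\int[collM]_p `|(Psi 1%N p)%:E| = 0)%E.
  apply/eqP; rewrite eq_le; apply/andP; split.
    rewrite -(cvg_lim _ c0)//; apply: lime_ge; first by apply/cvg_ex; exists 0%E.
    by near=> m; apply: le1; near: m; exact: nbhs_infty_gt.
  by apply: integral_ge0 => p _; exact: abse_ge0.
have mE : measurable_fun setT (EFin \o Psi 1%N) by exact/measurable_EFinP.
have := (ae_eq_integral_abs collM measurableT mE).1 z.
apply: filterS => p /(_ I) /= [] P0 s1 z0 ang.
move: P0; rewrite /Psi /W /collision_weight /Defs.kernel => /eqP.
rewrite -!mulrA mulf_eq0 gt_eqF ?powR_gt0 ?enorm_gt0//=.
rewrite mulf_eq0 gt_eqF /=; last first.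
  by rewrite /cutoff_angular /truncate lt_min ang ltr01.
rewrite mulf_eq0 => /orP[/eqP //|].
rewrite /entropy_jump /L -lnM ?posrE// -addrA -opprD -lnM ?posrE//.
rewrite subr_eq0 => /eqP/ln_inj; rewrite !posrE !mulr_gt0// => /(_ isT isT) e.
by rewrite /collision_defect [f (vspost p) * _]mulrC e mulrC subrr.
Unshelve. all: by end_near. Qed.

End entropy.

End H_theorem.

(** * Conservation at a fixed deviation angle *)

Section generic_points.
Context {R : realType}.

Lemma ae_null_preserving d (T : measurableType d) (mu : {measure set T -> \bar R})
    (S : T -> T) (P : T -> Prop) : null_preserving mu S ->
  {ae mu, forall x, P x} -> {ae mu, forall x, P (S x)}.
Proof.
move=> [mS S0] [N [mN N0 PN]]; exists (S @^-1` N); split.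
- exact: measurable_preimT.
- exact: S0.
- by move=> x /= nP; apply: PN.
Qed.

Lemma ae_countable d (T : measurableType d) (mu : {measure set T -> \bar R})
    (I : countType) (P : I -> T -> Prop) :
  (forall i, {ae mu, forall x, P i x}) -> {ae mu, forall x, forall i, P i x}.
Proof.
move=> h; have : {ae mu, forall x, forall n : nat,
    if unpickle n is Some i then P i x else True}.
  apply: ae_foralln => n; case: (unpickle n) => [i|]; first exact: h.
  by apply: aeW.
by apply: filterS => x hx i; have := hx (pickle i); rewrite pickleK.
Qed.

Lemma ae_exists d (T : measurableType d) (mu : {measure set T -> \bar R})
    (A : set T) (P : T -> Prop) : measurable A -> mu A != 0%E ->
  {ae mu, forall x, P x} -> exists2 x, A x & P x.
Proof.
move=> mA A0 [N [mN N0 PN]]; apply: contrapT => h.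
have AN : A `<=` N by move=> x Ax; apply: PN => Px; apply: h; exists x.
have : (mu A <= mu N)%E by apply: le_measure; rewrite ?inE.
by rewrite N0 measure_le0 (negbTE A0).
Qed.

Lemma ae_product d1 d2 (T1 : measurableType d1) (T2 : measurableType d2)
    (m1 : {sigma_finite_measure set T1 -> \bar R})
    (m2 : {sigma_finite_measure set T2 -> \bar R})
    (mu : {measure set (T1 * T2) -> \bar R}) (P : T1 * T2 -> Prop) :
  (forall A, measurable A -> mu A = (m1 \x m2)%E A) ->
  {ae mu, forall p, P p} ->
  {ae m1, forall x, {ae m2, forall y, P (x, y)}}.
Proof.
move=> muE [N [mN N0 PN]]; rewrite muE// in N0.
have [M [mM M0 h]] := (product_measure1_eq0P m1 m2 mN).1 N0.
exists M; split => //; move=> x /= nP; apply: h => /= Nx; apply: nP.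
exists (xsection N x); split => //; first exact: measurable_xsection.
by move=> y /= nPy; rewrite /xsection /= inE; exact: PN.
Qed.

Local Notation V := 'rV[R]_3.

Lemma sphere_measureT_neq0 : sphere_measure [set: V] != 0%E.
Proof.
rewrite sphere_measureE preimage_setT setTI.
have h := @lebesgue3_unit_ball_gt0 R.
by rewrite gt_eqF// mule_gt0.
Qed.

Lemma lebesgue3T_neq0 : lebesgue3 [set: V] != 0%E.
Proof.
rewrite gt_eqF//; apply: lt_le_trans (@lebesgue3_unit_ball_gt0 R) _.
by apply: le_measure; rewrite ?inE//; exact: measurable_ball.
Qed.

Lemma sphere_measure_coord0 (i : 'I_3) :
  sphere_measure [set s : V | s ord0 i = 0] = 0%E.
Proof.
rewrite sphere_measureE (_ : lebesgue3 _ = 0%E) ?mule0//.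
apply/eqP; rewrite -measure_le0 -(@lebesgue3_coord0 R i).
apply: le_measure; rewrite ?inE.
- apply: measurableI; last exact: measurable_ball.
  by apply: measurable_preimT; [exact: measurable_normalize|exact: measurable_coord0].
- exact: measurable_coord0.
- move=> u [/= h _] /=; have [->|u0] := eqVneq u 0; first by rewrite mxE.
  move: h; rewrite /normalize mxE => /eqP; rewrite mulf_eq0 => /orP[|/eqP //].
  by rewrite invr_eq0 => /eqP /enorm_eq0 u00; rewrite u00 eqxx in u0.
Qed.

Context (b : R -> R) (ab : angular_kernel b).

(** The condition [c < 1] discards the deviation angle 0, at which a collision changes nothing. *)
Let active : set R := [set c | 0 < angular b c /\ c < 1].

Let measurable_active : measurable active.
Proof.
rewrite (_ : active = (angular b @^-1` [set` (`]0, +oo[ : interval R)]) `&`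
    [set` (`]-oo, 1[ : interval R)]).
  apply: measurableI; last exact: measurable_itv.
  by apply: measurable_preimT; [exact: measurable_angular_kernel|exact: measurable_itv].
by apply/seteqP; split => c; rewrite /active /= !in_itv /= andbT.
Qed.

Let e : V := delta_mx 0 0.

Let dote (x : V) : dot e x = x ord0 0.
Proof. by rewrite dot3 /e !mxE /= mul1r !mul0r !addr0. Qed.

Let e1 : S2 e.
Proof. by rewrite /S2 /=; apply/dot1_enorm; rewrite dote /e mxE. Qed.

(** If the active set were null, a cutoff kernel would have integral 0 over the sphere, against
    nontriviality. A non-cutoff kernel is active for every cosine in [0, 1[, so a hemisphere would
    be null, then its opposite, then the whole sphere. *)
Lemma active_pole : sphere_measure [set s : V | active (dot e s)] != 0%E.
Proof.
have mA : measurable [set s : V | active (dot e s)].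
  apply: (measurable_preimT _ measurable_active).
  by apply: measurable_dot; [exact: measurable_cst|exact: measurable_id].
set A := mkset _ in mA *.
(* Off this null set a point lies on the sphere and is neither of the two poles, so its first
   coordinate lies strictly between -1 and 1. *)
pose D : set V := ~` (@S2 R) `|` [set s : V | s ord0 1 = 0].
have mS := @measurable_unit_sphere R 3.
have mD : measurable D.
  by apply: measurableU; [exact: measurableC|exact: measurable_coord0].
have D0 : sphere_measure D = 0%E.
  apply/eqP; rewrite -measure_le0; apply: le_trans (measureU2 _ _ _) _.
  - exact: measurableC.
  - exact: measurable_coord0.
  - by rewrite -[X in (X <= _)%E]/(sphere_measure _ + sphere_measure _)%E
      sphere_measure_setC sphere_measure_coord0 adde0.
have DS (s : V) : ~ D s -> S2 s /\ `|s ord0 0| < 1.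
  move=> Ds; have s1 : S2 s by apply: contrapT => h; apply: Ds; left.
  have n1 : s ord0 1 != 0 by apply/eqP => h; apply: Ds; right.
  split => //; have := enorm_sqr s; rewrite s1 expr1n dot3 -!expr2 => h.
  have p : 0 < s ord0 1 ^+ 2 by rewrite exprn_even_gt0.
  have q : 0 <= s ord0 2%:R ^+ 2 by exact: sqr_ge0.
  rewrite -ltr_sqr ?nnegrE// expr1n real_normK ?num_real//; lra.
apply/eqP => A0; have [mb b0 bs sing] := ab.
have null (B : set V) : measurable B -> B `<=` A `|` D -> sphere_measure B = 0%E.
  move=> mB BAD; apply/eqP; rewrite -measure_le0.
  apply: (@le_trans _ _ (sphere_measure (A `|` D))).
    by apply: le_measure; rewrite ?inE//; exact: measurableU.
  apply: le_trans (measureU2 _ mA mD) _.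
  by rewrite -[X in (X <= _)%E]/(sphere_measure _ + sphere_measure _)%E A0 D0 adde0.
case: sing => [[_ nt]|[r r01 [cb [Cb [cb0 _ hb]]]]].
  have := nt e e1; suff -> : (\int[sphere_measure]_(s in S2) (b (dot e s))%:E = 0)%E.
    by rewrite ltxx.
  rewrite (eq_integral (fun s => (angular b (dot e s))%:E)); last first.
    move=> s /set_mem s1; rewrite angularE//; exact: dot_S2_itv.
  have mab : measurable_fun setT (fun s : V => (angular b (dot e s))%:E).
    apply/measurable_EFinP; apply: (measurableT_comp (measurable_angular_kernel ab)).
    by apply: measurable_dot; [exact: measurable_cst|exact: measurable_id].
  have -> : (\int[sphere_measure]_(s in S2) (angular b (dot e s))%:E =
      \int[sphere_measure]_(s in S2) (cst 0%E s))%E.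
    apply: ae_eq_integral; [exact: mS|exact: measurable_funTS|exact: measurable_cst|].
    exists (A `|` D); split; first exact: measurableU.
      by apply: null => //; exact: measurableU.
    move=> s /= hs; apply: contrapT => nAD; apply: hs => s1 /=.
    have [sS sl] := DS s (fun h => nAD (or_intror h)).
    have a0 := angular_pos (dot e s) ab.
    congr _%:E; apply/eqP; rewrite eq_le a0 andbT leNgt; apply/negP => ap.
    apply: nAD; left; rewrite /A /= /active /=; split => //.
    by rewrite dote; exact: le_lt_trans (ler_norm _) sl.
  by rewrite integral0.
have act (c : R) : 0 <= c < 1 -> active c.
  move=> /andP[c0 c1]; have c1' : -1 <= c <= 1 by rewrite (ltW c1) andbT; lra.
  have ca : cos (acos c) = c by exact: acosK.
  have a0 : 0 < acos c.
    by apply: acos_gt0; rewrite c1 andbT; lra.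
  have a2 : acos c <= pi / 2.
    rewrite leNgt; apply/negP => h2; have := acos_lepi c1' => api.
    have : cos (acos c) < 0 by rewrite -(cos_pihalf R); rewrite ltr_cos// in_itv /=; have := pi_gt0 R; lra.
    by rewrite ca ltNge c0.
  have := hb (acos c); rewrite a0 a2 => /(_ isT) /andP[h _].
  rewrite ca in h; split => //; rewrite angularE//.
  by apply: lt_le_trans h; rewrite mulr_gt0// powR_gt0.
pose P : set V := [set s | 0 <= s ord0 0].
pose N : set V := [set s | s ord0 0 <= 0].
have mc : measurable_fun setT (fun s : V => s ord0 0) by exact: measurable_rV_coord.
have mP : measurable P.
  rewrite (_ : P = (fun s : V => s ord0 0) @^-1` [set` (`[0, +oo[ : interval R)]).
    by apply: measurable_preimT => //; exact: measurable_itv.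
  by apply/seteqP; split => s; rewrite /P /= in_itv /= andbT.
have mN : measurable N.
  rewrite (_ : N = (fun s : V => s ord0 0) @^-1` [set` (`]-oo, 0] : interval R)]).
    by apply: measurable_preimT => //; exact: measurable_itv.
  by apply/seteqP; split => s; rewrite /N /= in_itv.
have P0 : sphere_measure P = 0%E.
  apply: null => // s /= sP; have [Ds|Ds] := pselect (D s); [by right|left].
  have [sS sl] := DS s Ds; rewrite /A /= dote; apply: act; rewrite sP.
  exact: le_lt_trans (ler_norm _) sl.
have N0 : sphere_measure N = 0%E.
  have [_ h] := @preserving_sphereN R.
  rewrite -P0; apply: etrans (h P mP).
  apply: (congr1 sphere_measure).
  by apply/seteqP; split => s; rewrite /P /N /= mxE oppr_ge0.
have := sphere_measureT_neq0; rewrite -measure_le0.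
have -> : [set: V] = P `|` N.
  by apply/seteqP; split => s _ //; case: (leP 0 (s ord0 0)) => h; [left|right; exact: ltW].
apply/negP; rewrite negbK.
apply: le_trans (measureU2 _ mP mN) _.
by rewrite -[X in (X <= _)%E]/(sphere_measure _ + sphere_measure _)%E P0 N0 adde0.
Qed.

Lemma active_sphere (k : V) : S2 k ->
  sphere_measure [set s : V | active (dot k s)] != 0%E.
Proof.
move=> k1; pose h c : \bar R := (\1_active c)%:E.
have mh : measurable_fun setT h.
  by apply/measurable_EFinP; exact: measurable_indic.
have h0 c : (0 <= h c)%E by rewrite lee_fin indicE.
have E (k' : V) : (\int[sphere_measure]_s h (dot k' s) =
    sphere_measure [set s : V | active (dot k' s)])%E.
  have mA : measurable [set s : V | active (dot k' s)].
    apply: (measurable_preimT _ measurable_active).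
    by apply: measurable_dot; [exact: measurable_cst|exact: measurable_id].
  apply: etrans (etrans (integral_indic _ measurableT mA) _); last by rewrite setIT.
  by apply: eq_integral => s _; rewrite /h !indicE.
by rewrite -E (integral_sphere_zonal k1 e1 mh h0) E; exact: active_pole.
Qed.

(** By Fubini, z, sigma and v are chosen one after the other, sigma in the active set around z /
    |z|, which has positive measure. *)
Lemma exists_generic (P : V * V * V -> Prop) : {ae collM, forall p, P p} ->
  exists z s v, [/\ z != 0, S2 s, 0 < angular b (cos_deviation z s),
    cos_deviation z s < 1 & P ((z, s), v)].
Proof.
move=> aeP.
have h1 : {ae lebS, forall y : V * V, {ae lebesgue3, forall v : V, P (y, v)}}.
  exact: (@ae_product _ _ _ _ lebS lebesgue3 collM P (fun A _ => erefl)).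
have h2 : {ae lebesgue3, forall z : V, {ae sphere_measure, forall s : V,
    {ae lebesgue3, forall v : V, P ((z, s), v)}}}.
  exact: (@ae_product _ _ _ _ lebesgue3 sphere_measure lebS _ (fun A _ => erefl) h1).
have mZ : measurable (~` [set z : V | z ord0 0 = 0]).
  by apply: measurableC; exact: measurable_coord0.
have Z0 : lebesgue3 (~` [set z : V | z ord0 0 = 0]) != 0%E.
  apply/eqP => Z0; have := lebesgue3T_neq0.
  rewrite -(setUv [set z : V | z ord0 0 = 0]) -measure_le0.
  apply/negP; rewrite negbK.
  apply: le_trans (measureU2 _ (measurable_coord0 _) mZ) _.
  by rewrite -[X in (X <= _)%E]/(lebesgue3 _ + lebesgue3 _)%E lebesgue3_coord0 Z0 adde0.
have [z zn hz] := ae_exists mZ Z0 h2.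
have z0 : z != 0 by apply/eqP => zz; apply: zn; rewrite /= zz mxE.
have k1 : S2 (normalize z) by rewrite /S2 /=; exact: enorm_normalize.
have mA : measurable ([set s : V | active (dot (normalize z) s)] `&` @S2 R).
  apply: measurableI; last exact: measurable_unit_sphere.
  apply: (measurable_preimT _ measurable_active).
  by apply: measurable_dot; [exact: measurable_cst|exact: measurable_id].
have A0 : sphere_measure ([set s : V | active (dot (normalize z) s)] `&` @S2 R) != 0%E.
  apply/eqP => A0; have := active_sphere k1; rewrite -measure_le0.
  have mA' : measurable [set s : V | active (dot (normalize z) s)].
    apply: (measurable_preimT _ measurable_active).
    by apply: measurable_dot; [exact: measurable_cst|exact: measurable_id].
  have mS : measurable (~` @S2 R) by apply: measurableC; exact: measurable_unit_sphere.
  apply/negP; rewrite negbK.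
  apply: (@le_trans _ _ (sphere_measure
    (([set s : V | active (dot (normalize z) s)] `&` @S2 R) `|` ~` @S2 R))).
    apply: le_measure; rewrite ?inE//; first exact: measurableU.
    by move=> s hs; have [sS|sS] := pselect (S2 s); [left|right].
  apply: le_trans (measureU2 _ mA mS) _.
  by rewrite -[X in (X <= _)%E]/(sphere_measure _ + sphere_measure _)%E A0
    sphere_measure_setC adde0.
have [s [[sa sl] s1] hs] := ae_exists mA A0 hz.
have [v _ Pv] := ae_exists measurableT lebesgue3T_neq0 hs.
have ce : cos_deviation z s = dot (normalize z) s.
  by rewrite /cos_deviation /normalize dotZl mulrC.
by exists z, s, v; split => //; rewrite ce.
Qed.

End generic_points.

(** * Orbits of collisions under translations, dilations and rotations *)

Section dense_orbit.
Context {R : realType}.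
Local Notation V := 'rV[R]_3.

Lemma null_preserving_lebesgue3Z (r : R) : r != 0 ->
  null_preserving lebesgue3 ( *:%R r : V -> V).
Proof.
move=> r0; split.
  by apply: measurable_rVZ; [exact: measurable_cst|exact: measurable_id].
move=> A mA A0; have mB := measurable_ball (1 : R).
have h := lebesgue3_scale r0 mA mB; rewrite A0 mul0e in h.
have p := @lebesgue3_unit_ball_gt0 R.
by move/eqP: h; rewrite mule_eq0 gt_eqF//= => /eqP.
Qed.

Definition rotate (n : V * V) (x : V) : V := householder n.2 (householder n.1 x).

(** The rotation acts on z and sigma jointly and the dilation on z alone; with [r > 0] these keep
    the deviation angle. *)
Definition orbit_map (n : V * V) (r : R) (q : V) (p : V * V * V) : V * V * V :=
  ((r *: rotate n p.1.1, rotate n p.1.2), p.2 + q).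

Lemma null_preserving_orbit_map n (r : R) q : r != 0 ->
  null_preserving collM (orbit_map n r q).
Proof.
move=> r0.
have h1 : null_preserving lebesgue3 (fun x : V => r *: rotate n x).
  apply: (null_preserving_comp (null_preserving_lebesgue3Z r0)).
  apply: preserving_null.
  exact: preserving_comp (preserving_householder n.2) (preserving_householder n.1).
have h2 : null_preserving sphere_measure (rotate n).
  apply: preserving_null.
  exact: preserving_comp (preserving_sphere_householder n.2)
    (preserving_sphere_householder n.1).
have h3 : null_preserving (lebesgue3 \x sphere_measure)%E
    (skew (fun x : V => r *: rotate n x) (fun _ : V => rotate n)).
  apply: null_preserving_skew => //.
  exact: (measurableT_comp h2.1 measurable_snd).
have h4 : null_preserving (lebS \x lebesgue3)%E
    (skew (skew (fun x : V => r *: rotate n x) (fun _ : V => rotate n))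
       (fun (_ : V * V) (v : V) => v + q)).
  apply: null_preserving_skew; first exact: h3.
    by apply: measurable_rVD; [exact: measurable_snd|exact: measurable_cst].
  by move=> _; apply: preserving_null; exact: preserving_lebesgue3D.
exact: h4.
Qed.

Lemma rotate_dot n x y : dot (rotate n x) (rotate n y) = dot x y.
Proof. by rewrite /rotate !householder_dot. Qed.

Lemma rotate_enorm n x : enorm (rotate n x) = enorm x.
Proof. by rewrite /rotate !householder_enorm. Qed.

Lemma rotateZ n a x : rotate n (a *: x) = a *: rotate n x.
Proof. by rewrite /rotate !householderZ. Qed.

Lemma rotateD n x y : rotate n (x + y) = rotate n x + rotate n y.
Proof. by rewrite /rotate !householderD. Qed.

Lemma rotateB n x y : rotate n (x - y) = rotate n x - rotate n y.
Proof. by rewrite rotateD -scaleN1r rotateZ scaleN1r. Qed.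

Lemma cos_orbit_map n (r : R) q p : 0 < r ->
  cos_deviation (orbit_map n r q p).1.1 (orbit_map n r q p).1.2 =
  cos_deviation p.1.1 p.1.2.
Proof.
move=> r0; rewrite /orbit_map /cos_deviation /= dotZl rotate_dot enormZ rotate_enorm.
by rewrite (gtr0_norm r0) -mulf_div divff ?mul1r// gt_eqF.
Qed.

Lemma jump_orbit_map n (r : R) q p : 0 < r ->
  jump (orbit_map n r q p).1 = r *: rotate n (jump p.1).
Proof.
move=> r0; rewrite /orbit_map /jump /= enormZ rotate_enorm (gtr0_norm r0).
by rewrite [in RHS]rotateZ [in RHS]rotateB [in RHS]rotateZ -scalerA -scalerBr scalerA mulrC -scalerA.
Qed.

(* Every collision with positive relative velocity is in the closure of the
   orbit of any other one with the same deviation angle. *)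
Lemma rotate_transitive (k s k' s' : V) : S2 k -> S2 s -> S2 k' -> S2 s' ->
  dot k s = dot k' s' -> exists n, rotate n k = k' /\ rotate n s = s'.
Proof.
rewrite /S2 /= => k1 s1 k1' s1' e.
pose t := householder (k - k') s.
have ke : enorm k = enorm k' by rewrite k1 k1'.
have hk := householder_swap ke.
have t1 : enorm t = enorm s' by rewrite /t householder_enorm s1 s1'.
have hs := householder_swap t1.
exists (k - k', t - s'); rewrite /rotate /= hk; split => //.
have kt : dot k' t = dot k' s' by rewrite -e -[RHS](householder_dot (k - k')) hk.
by rewrite /householder dotBr kt subrr mul0r mulr0 scale0r subr0.
Qed.

Section defect.
Context (f : V -> R) (cf : continuous f).

(* [a] is the relative velocity and [c] the jump of v. *)
Definition defect_at (a c v : V) : R := f (v - a - c) * f (v + c) - f (v - a) * f v.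

Lemma defect_atE p : collision_defect f p = defect_at p.1.1 (jump p.1) p.2.
Proof. by []. Qed.

Lemma defect_orbit_map n (r : R) q p : 0 < r ->
  collision_defect f (orbit_map n r q p) =
  defect_at (r *: rotate n p.1.1) (r *: rotate n (jump p.1)) (p.2 + q).
Proof. by move=> r0; rewrite defect_atE jump_orbit_map. Qed.

Lemma cvg_defect_at (T : Type) (F : set_system T) {FF : Filter F}
    (a c v : T -> V) (a0 c0 v0 : V) :
  a @ F --> a0 -> c @ F --> c0 -> v @ F --> v0 ->
  defect_at (a t) (c t) (v t) @[t --> F] --> defect_at a0 c0 v0.
Proof.
move=> ha hc hv; rewrite /defect_at.
have cvf (u : T -> V) u0 : u @ F --> u0 -> f (u t) @[t --> F] --> f u0.
  by move=> hu; apply: cvg_comp hu _; exact: cf.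
apply: cvgB; apply: cvgM; apply: cvf.
- by apply: cvgB => //; exact: cvgB.
- exact: cvgD.
- exact: cvgB.
- exact: hv.
Qed.

End defect.

(** Continuity is asked at [x] only, because a reflection is not a continuous function of its normal
    vector at 0. *)
Lemma cvg_rat_zero (g : V -> R) (x : V) :
  (forall q : 'rV[rat]_3, g (map_mx ratr q) = 0) -> g @ x --> g x -> g x = 0.
Proof.
move=> g0 cg; apply/eqP; rewrite -normr_le0 leNgt; apply/negP => e0.
have FF : Filter (nbhs x) := nbhs_filter x.
have /cvgrPdist_lt /(_ _ e0) := cg.
move=> /nbhs_ballP[d /= d0 hd].
have [q qx] := rat_row_dense x d0.
have := hd (map_mx ratr q); rewrite -ball_normE /= => /(_ qx).
by rewrite g0 subr0 ltxx.
Qed.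

Lemma cvg_rat_pos_zero (g : R -> R) (x : R) : 0 < x ->
  (forall q : rat, 0 < ratr q :> R -> g (ratr q) = 0) -> g @ x --> g x -> g x = 0.
Proof.
move=> x0 g0 cg; apply/eqP; rewrite -normr_le0 leNgt; apply/negP => e0.
have /cvgrPdist_lt /(_ _ e0) := cg.
move=> /nbhs_ballP[d /= d0 hd].
have [q] := @rat_in_itvoo R x (x + d) (ltr_pwDr d0 (lexx x)).
rewrite in_itv /= => /andP[q1 q2].
have := hd (ratr q); rewrite /ball /= => h.
have {}h : `|x - ratr q| < d -> `|g x - g (ratr q)| < `|g x| by exact: h.
rewrite g0 ?subr0 in h; last exact: lt_trans q1.
have : `|x - ratr q| < d by rewrite ltr_distl; lra.
by move=> /h; rewrite ltxx.
Qed.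

Lemma coord_cvg (x : V) i : (fun y : V => y 0 i) @ x --> x 0 i.
Proof.
have FF : Filter (nbhs x) := nbhs_filter x.
apply/cvgrPdist_lt => e e0; near=> y.
have h : `|x - y| < e by near: y; exact: cvgr_dist_lt.
apply: le_lt_trans h; have -> : x 0 i - y 0 i = (x - y) 0 i by rewrite !mxE.
exact: norm_coord_le.
Unshelve. all: by end_near. Qed.

Lemma cvg_dot_filter (T : Type) (F : set_system T) {FF : Filter F}
    (g h : T -> V) (a b : V) : g @ F --> a -> h @ F --> b ->
  dot (g p) (h p) @[p --> F] --> dot a b.
Proof.
move=> hg hh.
have ci (g' : T -> V) (a' : V) i : g' @ F --> a' -> (fun p => g' p ord0 i) @ F --> a' ord0 i.
  move=> h'; apply: (@cvg_comp _ _ _ g' (fun y : V => y ord0 i) _ (nbhs a')) => //.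
  exact: coord_cvg.
rewrite dot3 (_ : (fun p => _) = (fun p : T => g p ord0 0 * h p ord0 0 +
  g p ord0 1 * h p ord0 1 + g p ord0 2%:R * h p ord0 2%:R)); last first.
  by apply/funext => p; rewrite dot3.
by apply: cvgD; [apply: cvgD|]; apply: cvgM; exact: ci.
Qed.

Lemma cvg_dot (x0 : V) (g h : V -> V) (a b : V) : g @ x0 --> a -> h @ x0 --> b ->
  dot (g t) (h t) @[t --> x0] --> dot a b.
Proof.
move=> hg hh; have FF : Filter (nbhs x0) := nbhs_filter x0.
exact: cvg_dot_filter.
Qed.

Lemma cvg_householder (n : V) (g : V -> V) (a : V) : n != 0 -> g @ n --> a ->
  householder t (g t) @[t --> n] --> householder n a.
Proof.
move=> n0 hg; have FF : Filter (nbhs n) := nbhs_filter n.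
have ci : (fun t : V => t) @ n --> n by exact: cvg_id.
rewrite /householder; apply: cvgB => //; apply: cvgZ => //.
apply: cvgM; first exact: cvg_cst.
apply: cvgM; first exact: cvg_dot.
apply: cvgV; last exact: cvg_dot.
by apply: contra n0 => /eqP /dot_eq0 ->.
Qed.

Lemma defect_zero_dense (f : V -> R) (a c v0 : V) : continuous f ->
  (forall (n1 n2 q : 'rV[rat]_3) (r : rat), 0 < ratr r :> R ->
    defect_at f (ratr r *: rotate (map_mx ratr n1, map_mx ratr n2) a)
      (ratr r *: rotate (map_mx ratr n1, map_mx ratr n2) c)
      (v0 + map_mx ratr q) = 0) ->
  forall n (r : R) v, 0 < r ->
    defect_at f (r *: rotate n a) (r *: rotate n c) v = 0.
Proof.
move=> cf h0.
have h1 (n1 n2 : 'rV[rat]_3) (r : rat) (v : V) : 0 < ratr r :> R ->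
    defect_at f (ratr r *: rotate (map_mx ratr n1, map_mx ratr n2) a)
      (ratr r *: rotate (map_mx ratr n1, map_mx ratr n2) c) v = 0.
  move=> r0; rewrite -[v](addrNK v0) addrC.
  have FF : Filter (nbhs (v - v0)) := nbhs_filter (v - v0).
  apply: (@cvg_rat_zero (fun q => defect_at f _ _ (v0 + q)) (v - v0)).
    by move=> q; exact: h0.
  by apply: cvg_defect_at => //; [exact: cvg_cst|exact: cvg_cst|
    apply: cvgD; [exact: cvg_cst|exact: cvg_id]].
have h2 (n1 n2 : 'rV[rat]_3) (r : R) (v : V) : 0 < r ->
    defect_at f (r *: rotate (map_mx ratr n1, map_mx ratr n2) a)
      (r *: rotate (map_mx ratr n1, map_mx ratr n2) c) v = 0.
  move=> r0; set x := rotate _ a; set y := rotate _ c.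
  apply: (@cvg_rat_pos_zero (fun r => defect_at f (r *: x) (r *: y) v) r r0).
    by move=> q q0; exact: h1.
  by apply: cvg_defect_at => //; [apply: cvgZr_tmp; exact: cvg_id|
    apply: cvgZr_tmp; exact: cvg_id|exact: cvg_cst].
have h3 (n1 : 'rV[rat]_3) (n2 : V) (r : R) (v : V) : 0 < r ->
    defect_at f (r *: rotate (map_mx ratr n1, n2) a)
      (r *: rotate (map_mx ratr n1, n2) c) v = 0.
  (* The zero normal, where continuity fails, is itself rational and is covered by the previous
     stage. *)
  move=> r0; have [->|n0] := eqVneq n2 0.
    by have := h2 n1 0 r v r0; rewrite map_mx0.
  have FF : Filter (nbhs n2) := nbhs_filter n2.
  apply: (@cvg_rat_zero (fun n2 => defect_at f (r *: rotate (map_mx ratr n1, n2) a)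
      (r *: rotate (map_mx ratr n1, n2) c) v) n2).
    by move=> q; exact: h2.
  apply: cvg_defect_at => //; last exact: cvg_cst.
  - by apply: cvgZl_tmp; apply: cvg_householder => //; exact: cvg_cst.
  - by apply: cvgZl_tmp; apply: cvg_householder => //; exact: cvg_cst.
move=> [n1 n2] r v r0; have [->|n0] := eqVneq n1 0.
  by have := h3 0 n2 r v r0; rewrite map_mx0.
have FF : Filter (nbhs n1) := nbhs_filter n1.
have ch (x : V) : continuous (householder n2 : V -> V).
  move=> y; have FFy : Filter (nbhs y) := nbhs_filter y.
  rewrite /householder /continuous_at; apply: cvgB; first exact: cvg_id.
  apply: cvgZr_tmp; apply: cvgM; first exact: cvg_cst.
  apply: cvgM; last exact: cvg_cst.
  by apply: cvg_dot; [exact: cvg_id|exact: cvg_cst].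
apply: (@cvg_rat_zero (fun n1 => defect_at f (r *: rotate (n1, n2) a)
    (r *: rotate (n1, n2) c) v) n1).
  by move=> q; exact: h3.
have cr (x : V) : rotate (t, n2) x @[t --> n1] --> rotate (n1, n2) x.
  apply: (@cvg_comp _ _ _ (fun t => householder t x) (householder n2) _
    (nbhs (householder n1 x))); last exact: (ch x).
  by apply: cvg_householder => //; exact: cvg_cst.
apply: cvg_defect_at => //; last exact: cvg_cst.
- by apply: cvgZl_tmp; exact: cr.
- by apply: cvgZl_tmp; exact: cr.
Qed.

Context (gamma : R) (gamma_itv : -3 < gamma <= 1).
Context (b : R -> R) (ab : angular_kernel b).

Lemma fixed_angle_conservation (f : V -> R) :
  (forall v, 0 < f v) -> C2_rapidly_decreasing f -> slowly_growing_log f ->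
  (forall v, collision_value gamma b f f v 0) ->
  exists2 c0 : R, 0 <= c0 < 1 & forall p : V * V * V, S2 p.1.2 -> p.1.1 != 0 ->
    cos_deviation p.1.1 p.1.2 = c0 -> collision_defect f p = 0.
Proof.
move=> f0 cf lf qf; have H := H_theorem gamma_itv ab f0 cf lf qf.
have cof : continuous f by apply: C1_continuous_fun; exact: C2_C1.
(* With rational parameters there are countably many maps, so almost every collision has its whole
   rational orbit outside the exceptional set. *)
pose I : countType := ('rV[rat]_3 * 'rV[rat]_3 * rat * 'rV[rat]_3)%type.
pose S (i : I) : V * V * V -> V * V * V :=
  orbit_map (map_mx ratr i.1.1.1, map_mx ratr i.1.1.2) (ratr i.1.2) (map_mx ratr i.2).
have HS : {ae collM, forall p : V * V * V, forall i : I, 0 < ratr i.1.2 :> R ->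
    S2 (S i p).1.2 -> (S i p).1.1 != 0 ->
    0 < angular b (cos_deviation (S i p).1.1 (S i p).1.2) ->
    collision_defect f (S i p) = 0}.
  apply: ae_countable => i; have [r0|r0] := boolP (0 < ratr i.1.2 :> R); last first.
    by apply: aeW.
  have := ae_null_preserving (null_preserving_orbit_map
    (map_mx ratr i.1.1.1, map_mx ratr i.1.1.2) (map_mx ratr i.2) (lt0r_neq0 r0)) H.
  by apply: filterS => p hp _; exact: hp.
have [z [s [v [z0 s1 ang c1 hp]]]] := exists_generic ab HS.
have c0 : 0 <= cos_deviation z s.
  by rewrite leNgt; apply/negP => cn; move: ang; rewrite /angular leNgt cn ltxx.
exists (cos_deviation z s); first by rewrite c0 c1.
have D : forall n (r : R) v', 0 < r ->
    defect_at f (r *: rotate n z) (r *: rotate n (jump (z, s))) v' = 0.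
  apply: (@defect_zero_dense f z (jump (z, s)) v cof) => n1 n2 q r r0.
  have := hp (n1, n2, r, q) r0; rewrite /S defect_orbit_map//=; apply.
  - by rewrite /S2 /= rotate_enorm.
  - have zp : 0 < enorm (ratr r *: rotate (map_mx ratr n1, map_mx ratr n2) z).
      by rewrite enormZ rotate_enorm mulr_gt0 ?enorm_gt0// normr_gt0 gt_eqF.
    by apply/eqP => h; rewrite h enorm0 ltxx in zp.
  - by have -> := cos_orbit_map (map_mx ratr n1, map_mx ratr n2) (map_mx ratr q) (z, s, v) r0.
move=> [[z' s'] v'] /= s1' z0' ce.
have e0 := enorm_gt0 z0; have e0' := enorm_gt0 z0'.
have cE x y : cos_deviation x y = dot (normalize x) y.
  by rewrite /cos_deviation /normalize dotZl mulrC.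
rewrite !cE in ce.
have [n [nk ns]] := rotate_transitive (enorm_normalize z0) s1
  (enorm_normalize z0') s1' (esym ce).
rewrite defect_atE /=.
(* The dilation factor is |z'| / |z|; no translation is involved, since [D] holds at every
   velocity. *)
have zE : z' = (enorm z' / enorm z) *: rotate n z.
  rewrite -{2}(scale_normalize z) rotateZ nk scalerA divfK ?gt_eqF//.
  by rewrite scale_normalize.
have jE : jump (z', s') = (enorm z' / enorm z) *: rotate n (jump (z, s)).
  rewrite /jump /= rotateZ rotateB rotateZ ns scalerA [_ * 2^-1]mulrC -scalerA.
  rewrite [in RHS]scalerBr -zE; congr (_ *: (_ - _)).
  by rewrite scalerA divfK ?gt_eqF.
by rewrite {1}zE jE; apply: D; rewrite divr_gt0.
Qed.

End dense_orbit.

(** * Collision invariants *)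

Section collision_invariants.
Context {R : realType}.
Local Notation V := 'rV[R]_3.
Implicit Types (x y k m r v w : V).

Definition cross x y : V := \row_i
  [:: x ord0 1 * y ord0 2%:R - x ord0 2%:R * y ord0 1;
      x ord0 2%:R * y ord0 0 - x ord0 0 * y ord0 2%:R;
      x ord0 0 * y ord0 1 - x ord0 1 * y ord0 0]`_i.

Lemma dot_crossl x y : dot x (cross x y) = 0.
Proof. by rewrite dot3 /cross !mxE /=; ring. Qed.

Lemma dot_crossr x y : dot y (cross x y) = 0.
Proof. by rewrite dot3 /cross !mxE /=; ring. Qed.

Lemma cross_sqr x y :
  dot (cross x y) (cross x y) = dot x x * dot y y - dot x y ^+ 2.
Proof. by rewrite !dot3 /cross !mxE /=; ring. Qed.

Lemma S2_dot k : S2 k -> dot k k = 1.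
Proof. by rewrite /S2 /= -enorm_sqr => ->; rewrite expr1n. Qed.

Lemma dot_S2 k : dot k k = 1 -> S2 k.
Proof. by move=> h; rewrite /S2 /=; exact/dot1_enorm. Qed.

Lemma S2_antipodal k k' : S2 k -> S2 k' -> dot k k' = -1 -> k' = - k.
Proof.
move=> k1 k1' d; apply/eqP; rewrite -subr_eq0 opprK; apply/eqP; apply: dot_eq0.
by rewrite dotDl !dotDr [dot k' k]dotC d (S2_dot k1) (S2_dot k1'); ring.
Qed.

(* Two steps of angle acos c0 reach every deviation angle in [0, 2 acos c0]. *)
Lemma two_steps k k' (c0 : R) : S2 k -> S2 k' -> 0 <= c0 -> -1 < dot k k' ->
  2 * c0 ^+ 2 - 1 <= dot k k' ->
  exists w, [/\ S2 w, dot k w = c0 & dot w k' = c0].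
Proof.
move=> k1 k1' c00 dN1 hd.
have kk := S2_dot k1; have kk' := S2_dot k1'.
have /andP[_ d1] := dot_S2_itv k1 k1'.
set d := dot k k' in dN1 hd d1 *.
have dp : 0 < 1 + d by lra.
(* A unit vector orthogonal to [k] and [k']. Their cross product provides it unless k' = k, where
   [k] is crossed with a coordinate vector that is not parallel to it. *)
have [n [nk nk' nn]] : exists n, [/\ dot k n = 0, dot k' n = 0 & dot n n = 1].
  have [dl|de] := ltP d 1.
    have c0' : cross k k' != 0.
      apply/eqP => h; have := cross_sqr k k'; rewrite h dot0l kk kk' -/d; nra.
    exists (normalize (cross k k')); split.
    - by rewrite /normalize dotZr dot_crossl mulr0.
    - by rewrite /normalize dotZr dot_crossr mulr0.
    - by apply: S2_dot; exact: enorm_normalize.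
  have e : k' = k.
    apply/eqP; rewrite -subr_eq0; apply/eqP; apply: dot_eq0.
    rewrite dotBl !dotBr [dot k' k]dotC -/d kk kk'; have -> : d = 1 by lra.
    by ring.
  pose u : V := if k ord0 0 == 0 then delta_mx 0 0 else delta_mx 0 1.
  have u0 : cross k u != 0.
    apply/eqP => h; have := cross_sqr k u; rewrite h dot0l kk /u.
    move: kk; rewrite !dot3; case: ifP => [/eqP k0|/eqP k0].
      by rewrite k0 !mxE /=; lra.
    rewrite !mxE /= => kk; have : 0 < k ord0 0 ^+ 2.
      by rewrite exprn_even_gt0//=; exact/eqP.
    by have := sqr_ge0 (k ord0 2%:R); nra.
  exists (normalize (cross k u)); rewrite e; split.
  - by rewrite /normalize dotZr dot_crossl mulr0.
  - by rewrite /normalize dotZr dot_crossl mulr0.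
  - by apply: S2_dot; exact: enorm_normalize.
(* The component along k + k' fixes both inner products to [c0]; the component along [n] restores
   the unit length, and the radicand is nonnegative exactly when 2 c0^2 <= 1 + d. *)
pose a := c0 / (1 + d); pose be := Num.sqrt (1 - 2 * c0 ^+ 2 / (1 + d)).
have b2 : be ^+ 2 = 1 - 2 * c0 ^+ 2 / (1 + d).
  rewrite sqr_sqrtr// subr_ge0 ler_pdivrMr// mul1r; lra.
exists (a *: (k + k') + be *: n); split.
- apply: dot_S2; rewrite !(dotDl, dotDr, dotZl, dotZr) [dot n k]dotC [dot n k']dotC.
  rewrite nk nk' nn kk kk' [dot k' k]dotC -/d.
  rewrite !(mulr0, addr0, add0r, mulr1) -[be * be]expr2 b2 /a; field.
  by rewrite gt_eqF.
- rewrite !(dotDr, dotZr) nk kk -/d mulr0 addr0 /a; field; by rewrite gt_eqF.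
- rewrite !(dotDl, dotZl) [dot n k']dotC nk' kk' -/d mulr0 addr0 /a; field.
  by rewrite gt_eqF.
Qed.

(** [delta] is the range of 1 - k.k' covered by [two_steps], and the induction doubles it: the
    bisector w of k and k' satisfies 1 - k.w <= (1 - k.k') / 2. Antipodal pairs have no bisector;
    evenness of [H] settles them. *)
Lemma sphere_constant (H : V -> R) (c0 : R) : 0 <= c0 < 1 ->
  (forall k, H (- k) = H k) ->
  (forall k k', S2 k -> S2 k' -> dot k k' = c0 -> H k = H k') ->
  forall k k', S2 k -> S2 k' -> H k = H k'.
Proof.
move=> /andP[c00 c01] Hev Hc0.
pose delta := 2 - 2 * c0 ^+ 2.
have d0 : 0 < delta by rewrite /delta; nra.
have P n k k' : S2 k -> S2 k' -> 1 - dot k k' <= 2 ^+ n * delta -> H k = H k'.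
  elim: n k k' => [|n IH] k k' k1 k1'.
    rewrite expr0 mul1r => h.
    have [dN1|dN1] := ltP (-1) (dot k k'); last first.
      have dd : dot k k' = -1.
        by have /andP[h1 _] := dot_S2_itv k1 k1'; apply/eqP; rewrite eq_le dN1.
      by rewrite (S2_antipodal k1 k1' dd) Hev.
    have hh : 2 * c0 ^+ 2 - 1 <= dot k k' by move: h; rewrite /delta; lra.
    have [w [w1 kw wk]] := two_steps k1 k1' c00 dN1 hh.
    by rewrite (Hc0 k w)// (Hc0 w k').
  rewrite exprS -mulrA; set D := 2 ^+ n * delta in IH * => h.
  have [dN1|dN1] := ltP (-1) (dot k k'); last first.
    have dd : dot k k' = -1.
      by have /andP[h1 _] := dot_S2_itv k1 k1'; apply/eqP; rewrite eq_le dN1.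
    by rewrite (S2_antipodal k1 k1' dd) Hev.
  have kk := S2_dot k1; have kk' := S2_dot k1'.
  set d := dot k k' in h dN1.
  pose N := enorm (k + k').
  have N2 : N ^+ 2 = 2 + 2 * d.
    by rewrite /N enorm_sqr dotDl !dotDr [dot k' k]dotC kk kk' -/d; ring.
  have kn0 : k + k' != 0.
    by apply/eqP => e0; move: N2; rewrite /N e0 enorm0; lra.
  have N0 : 0 < N by exact: enorm_gt0.
  have w1 : S2 (normalize (k + k')) by exact: enorm_normalize.
  have kw : dot k (normalize (k + k')) = N / 2.
    rewrite /normalize dotZr dotDr kk -/d -/N.
    have -> : 1 + d = N ^+ 2 / 2 by rewrite N2; field.
    by field; rewrite gt_eqF.
  have wk : dot (normalize (k + k')) k' = N / 2.
    rewrite /normalize dotZl dotDl kk' -/d -/N.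
    have -> : d + 1 = N ^+ 2 / 2 by rewrite N2; field.
    by field; rewrite gt_eqF.
  have hN : 1 - N / 2 <= D.
    have /andP[_ d1] := dot_S2_itv k1 k1'; rewrite -/d in d1.
    have NL : N <= 2 by rewrite -ler_sqr ?nnegrE ?(ltW N0)// N2; lra.
    suff : 1 - N / 2 <= (1 - d) / 2 by lra.
    nra.
  by rewrite (IH k (normalize (k + k')))// ?kw// (IH _ k')// wk.
move=> k k' k1 k1'.
apply: (P (Num.bound (2 / delta)) k k' k1 k1').
have /andP[h _] := dot_S2_itv k1 k1'.
have q0 : 0 <= 2 / delta by rewrite divr_ge0// ltW.
have := archi_boundP q0; set n := Num.bound _ => hn.
have n2 : n%:R <= 2 ^+ n :> R by rewrite -natrX ler_nat ltnW// ltn_expl.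
have : 2 <= 2 ^+ n * delta.
  by rewrite -ler_pdivrMr// (le_trans (ltW hn)).
lra.
Qed.

Lemma additive_halfline (h : R -> R) :
  (forall s t : R, 0 <= s -> 0 <= t -> h (s + t) = h s + h t) ->
  (forall x : R, 0 < x -> h @ x --> h x) -> forall s : R, 0 <= s -> h s = s * h 1.
Proof.
move=> ha hc.
have h0 : h 0 = 0.
  by have := ha 0 0 (lexx _) (lexx _); rewrite addr0 => /eqP; rewrite -subr_eq0 opprD addrA subrr sub0r oppr_eq0 => /eqP.
have hn (n : nat) (t : R) : 0 <= t -> h (n%:R * t) = n%:R * h t.
  move=> t0; elim: n => [|n IH]; first by rewrite !mul0r.
  by rewrite -natr1 !mulrDl !mul1r ha// ?IH// mulr_ge0.
have hq (q : rat) : 0 < ratr q :> R -> h (ratr q) = ratr q * h 1.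
  move=> q0; pose n := `|numq q|%N; pose d := `|denq q|%N.
  have dR : (denq q)%:~R = d%:R :> R by rewrite /d -[in LHS](gtz0_abs (denq_gt0 q)).
  have qp : 0 < q by rewrite -(ltr0q R).
  have nR : (numq q)%:~R = n%:R :> R.
    by rewrite /n -[in LHS](@gtz0_abs (numq q))// numq_gt0.
  have d0 : d%:R != 0 :> R by rewrite -dR intr_eq0 denq_eq0.
  have e : d%:R * ratr q = n%:R :> R.
    by rewrite /ratr dR nR mulrC divfK.
  have := hn d (ratr q) (ltW q0); rewrite e -[n%:R]mulr1 hn// => h1.
  apply: (mulfI d0); rewrite -h1 mulrA e.
  by [].
move=> s; rewrite le_eqVlt => /orP[/eqP <-|s0]; first by rewrite h0 mul0r.
apply/eqP; rewrite -subr_eq0; apply/eqP.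
apply: (@cvg_rat_pos_zero R (fun s => h s - s * h 1) s s0).
  by move=> q q0; rewrite hq// subrr.
apply: cvgB; first exact: hc.
by apply: cvgM; [exact: cvg_id|exact: cvg_cst].
Qed.

Section orthogonally_additive.
Context (phi : V -> R) (cphi : continuous phi).
Context (phiD : forall x y, dot x y = 0 -> phi (x + y) = phi x + phi y).

Let e (i : 'I_3) : V := delta_mx 0 i.

Let dote i j : dot (e i) (e j) = (i == j)%:R.
Proof.
rewrite /dot (bigD1 i)//= big1 => [|l li]; rewrite !mxE !eqxx/=.
  by rewrite mul1r addr0.
by rewrite (negbTE li) mul0r.
Qed.

Lemma cvg_ray (x : V) (s : R) : phi (t *: x) @[t --> s] --> phi (s *: x).
Proof.
apply: (@cvg_comp _ _ _ (fun t : R => t *: x) phi _ (nbhs (s *: x))).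
  by apply: cvgZr_tmp; exact: cvg_id.
exact: cphi.
Qed.

Lemma odd_orthogonally_additive : (forall x, phi (- x) = - phi x) ->
  exists b : V, forall x, phi x = dot b x.
Proof.
move=> odd_phi.
have add i (s t : R) : phi ((s + t) *: e i) = phi (s *: e i) + phi (t *: e i).
  have [j ij] : exists j, i != j.
    by exists (if i == 0 then 1 else 0); case: ifP => [/eqP ->|/negbT].
  have dij : dot (e i) (e j) = 0 by rewrite dote (negbTE ij).
  have dji : dot (e j) (e i) = 0 by rewrite dotC.
  have dii l : dot (e l) (e l) = 1 by rewrite dote eqxx.
  have o (a b : R) : phi (a *: e i + b *: e j) = phi (a *: e i) + phi (b *: e j).
    by apply: phiD; rewrite dotZl dotZr dij !mulr0.
  (* The condition says that s e_i + u e_j and t e_i - u' e_j are orthogonal. Adding the instances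
     (u, u') = (s, t) and (t, s) eliminates every term along e_j. *)
  have q (u u' : R) : s * t = u * u' ->
      phi ((s + t) *: e i) + phi ((u - u') *: e j) =
      phi (s *: e i) + phi (u *: e j) + (phi (t *: e i) - phi (u' *: e j)).
    move=> su; rewrite -odd_phi -scaleNr -!o -phiD.
      by congr phi; rewrite addrACA -!scalerDl.
    rewrite !(dotDl, dotDr, dotZl, dotZr) dij dji !dii.
    by rewrite !(mulr0, mulr1, addr0, add0r) su; ring.
  have q1 := q s t erefl; have q2 := q t s (mulrC _ _).
  have k : phi ((t - s) *: e j) = - phi ((s - t) *: e j).
    by rewrite -odd_phi -scaleNr opprB.
  by rewrite k in q2; lra.
have lin i (s : R) : phi (s *: e i) = s * phi (e i).
  have pos (u : R) : 0 <= u -> phi (u *: e i) = u * phi (e i).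
    move=> u0; have := additive_halfline (fun s t _ _ => add i s t)
      (fun (x : R) _ => @cvg_ray (e i) x) u0.
    by rewrite scale1r.
  have [s0|s0] := leP 0 s; first exact: pos.
  have := pos (- s); rewrite scaleNr odd_phi mulNr oppr_ge0 => /(_ (ltW s0)).
  by move/oppr_inj.
exists (\row_i phi (e i)) => x.
have {1}-> : x = x ord0 0 *: e 0 + x ord0 1 *: e 1 + x ord0 2%:R *: e 2%:R.
  by apply: rV3P; rewrite !mxE /=; ring.
rewrite phiD; last by rewrite dotDl !dotZl !dotZr !dote /= !mulr0 addr0.
rewrite phiD; last by rewrite dotZl dotZr dote /= !mulr0.
by rewrite !lin dot3 !mxE; ring.
Qed.

(** Vectors x and y of equal length are p + q and p - q with p and q orthogonal, so an even [phi] is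
    radial. As a function of |x|^2 it is additive, by Pythagoras on two orthogonal vectors. *)
Lemma even_orthogonally_additive : (forall x, phi (- x) = phi x) ->
  exists c : R, forall x, phi x = c * dot x x.
Proof.
move=> even_phi.
have radial x y : dot x x = dot y y -> phi x = phi y.
  move=> xy; pose p := 2^-1 *: (x + y); pose q := 2^-1 *: (x - y).
  have pq : dot p q = 0.
    by rewrite /p /q dotZl dotZr !(dotDl, dotBr) [dot y x]dotC xy; ring.
  have -> : x = p + q by apply/rowP => i; rewrite !mxE; field.
  have {1}-> : y = p + - q by apply/rowP => i; rewrite !mxE; field.
  by rewrite !phiD ?even_phi// dotNr pq oppr0.
pose h (s : R) := phi (Num.sqrt s *: e 0).
have hE x : phi x = h (dot x x).
  apply: radial; rewrite dotZl dotZr dote eqxx mulr1 -expr2 sqr_sqrtr//.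
  exact: dot_ge0.
exists (h 1) => x; rewrite hE mulrC.
apply: additive_halfline; last exact: dot_ge0.
- move=> s t s0 t0.
  have := @phiD (Num.sqrt s *: e 0) (Num.sqrt t *: e 1).
  rewrite dotZl dotZr dote !mulr0 => /(_ erefl); rewrite hE.
  rewrite !(dotDl, dotDr, dotZl, dotZr) !dote /= !(mulr0, mulr1, addr0, add0r).
  rewrite -!expr2 !sqr_sqrtr// => ->; congr (_ + _).
  by apply: radial; rewrite !dotZl !dotZr !dote.
- move=> s _; apply: (@cvg_comp _ _ _ (@Num.sqrt R) (fun t => phi (t *: e 0)) _
    (nbhs (Num.sqrt s))); last exact: cvg_ray.
  exact: sqrt_continuous.
Qed.

End orthogonally_additive.

Lemma orthogonally_additive_quadratic (phi : V -> R) : continuous phi ->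
  (forall x y, dot x y = 0 -> phi (x + y) = phi x + phi y) ->
  exists (b : V) (c : R), forall x, phi x = dot b x + c * dot x x.
Proof.
move=> cphi phiD.
pose o x := phi x - phi (- x); pose ev x := phi x + phi (- x).
have phiND x y : dot x y = 0 -> phi (- (x + y)) = phi (- x) + phi (- y).
  by move=> xy; rewrite opprD phiD// dotNl dotNr opprK.
have cN : continuous (fun x => phi (- x)).
  move=> x; have FF : Filter (nbhs x) := nbhs_filter x.
  apply: (@cvg_comp _ _ _ (fun y : V => - y) phi _ (nbhs (- x))); last exact: cphi.
  exact: (cvgN (f := fun y : V => y) cvg_id).
have [b hb] : exists b : V, forall x, o x = dot b x.
  apply: odd_orthogonally_additive.
  - by move=> x; exact: (cvgB (cphi x) (cN x)).
  - by move=> x y xy; rewrite /o phiND// phiD//; ring.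
  - by move=> x; rewrite /o opprK opprB.
have [c hc] : exists c : R, forall x, ev x = c * dot x x.
  apply: even_orthogonally_additive.
  - by move=> x; exact: (cvgD (cphi x) (cN x)).
  - by move=> x y xy; rewrite /ev phiND// phiD//; ring.
  - by move=> x; rewrite /ev opprK addrC.
exists (2^-1 *: b), (c / 2) => x.
by have := hb x; have := hc x; rewrite /o /ev dotZl => h1 h2; lra.
Qed.

(** By [sphere_constant], the sum of [L] at the ends of a diameter depends only on the sphere. If x
    and y are orthogonal, the pairs (0, x + y) and (x, y) are diameters of the same sphere, so L -
    L(0) is orthogonally additive. *)
Lemma fixed_angle_invariant (L : V -> R) (c0 : R) : continuous L -> 0 <= c0 < 1 ->
  (forall p : V * V * V, S2 p.1.2 -> p.1.1 != 0 ->
    cos_deviation p.1.1 p.1.2 = c0 -> entropy_jump L p = 0) ->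
  exists (a : R) (b : V) (c : R), forall v, L v = a + dot b v + c * dot v v.
Proof.
move=> cL c01 hL.
have inv m r r' : enorm r = enorm r' -> L (m + r) + L (m - r) = L (m + r') + L (m - r').
  move=> rr; have [r0|r0] := eqVneq (enorm r) 0.
    by rewrite (enorm_eq0 r0) (@enorm_eq0 _ _ r')// -rr.
  have rp : 0 < enorm r by rewrite lt_neqAle eq_sym r0 enorm_ge0.
  set rho := enorm r in rr rp.
  pose H k := L (m + rho *: k) + L (m - rho *: k).
  have Hk : forall k k', S2 k -> S2 k' -> H k = H k'.
    apply: (sphere_constant c01).
      by move=> k; rewrite /H scalerN opprK addrC.
    move=> k k' k1 k1' kk.
    (* The pair m + rho k, m - rho k collides with sigma = k' and becomes m + rho k', m - rho k';
       its deviation cosine is k.k'. *)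
    have z0 : 2 * rho *: k != 0.
      apply/eqP => h; have : enorm (2 * rho *: k) = 0 by rewrite h enorm0.
      rewrite enormZ k1 mulr1 gtr0_norm ?mulr_gt0//; lra.
    have ez : enorm (2 * rho *: k) = 2 * rho.
      by rewrite enormZ k1 mulr1 gtr0_norm ?mulr_gt0.
    have := hL ((2 * rho *: k, k'), m + rho *: k) k1' z0.
    rewrite /cos_deviation /= ez dotZl mulrAC divff ?mul1r ?mulf_neq0 ?gt_eqF//.
    move=> /(_ kk); rewrite /entropy_jump /vspost /vpost /vstar /jump /= ez.
    have -> : 2^-1 *: (2 * rho *: k' - 2 * rho *: k) = rho *: k' - rho *: k.
      by apply/rowP => i; rewrite !mxE; field.
    have -> : m + rho *: k + (rho *: k' - rho *: k) = m + rho *: k'.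
      by apply/rowP => i; rewrite !mxE; ring.
    have -> : m + rho *: k - 2 * rho *: k - (rho *: k' - rho *: k) = m - rho *: k'.
      by apply/rowP => i; rewrite !mxE; ring.
    have -> : m + rho *: k - 2 * rho *: k = m - rho *: k.
      by apply/rowP => i; rewrite !mxE; ring.
    by rewrite /H => h; lra.
  have nr x : enorm x = rho -> S2 (normalize x) /\ rho *: normalize x = x.
    move=> xr; split; last by rewrite -{1}xr scale_normalize.
    apply: enorm_normalize; apply/eqP => h; move: xr rp; rewrite h enorm0.
    by move=> <-; rewrite ltxx.
  have [s1 e1] := nr r erefl; have [s2 e2] := nr r' (esym rr).
  by have := Hk _ _ s1 s2; rewrite /H e1 e2.
suff D : forall x y, dot x y = 0 ->
    L (x + y) - L 0 = (L x - L 0) + (L y - L 0).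
  have [b [c h]] := @orthogonally_additive_quadratic (fun x => L x - L 0)
    (fun x => cvgB (cL x) (cvg_cst (L 0))) D.
  by exists (L 0), b, c => v; have := h v; lra.
move=> x y xy.
have := @inv (2^-1 *: (x + y)) (2^-1 *: (x + y)) (2^-1 *: (x - y)).
have -> : 2^-1 *: (x + y) + 2^-1 *: (x + y) = x + y.
  by apply/rowP => i; rewrite !mxE; field.
have -> : 2^-1 *: (x + y) + 2^-1 *: (x - y) = x.
  by apply/rowP => i; rewrite !mxE; field.
have -> : 2^-1 *: (x + y) - 2^-1 *: (x - y) = y.
  by apply/rowP => i; rewrite !mxE; field.
rewrite subrr => h; suff : L (x + y) + L 0 = L x + L y by move=> h'; lra.
apply: h.
apply: enorm_inj; rewrite !enorm_sqr !(dotZl, dotZr) !(dotDl, dotBl) !(dotDr, dotBr) !(dotNl, dotNr).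
by rewrite [dot y x]dotC xy; ring.
Qed.

Context (gamma : R) (gamma_itv : -3 < gamma <= 1).
Context (b : R -> R) (ab : angular_kernel b).

Lemma maxwellian_log (f : V -> R) :
  (forall v, 0 < f v) -> C2_rapidly_decreasing f -> slowly_growing_log f ->
  (forall v, collision_value gamma b f f v 0) ->
  exists (a : R) (u : V) (c : R), c < 0 /\ forall v, ln (f v) = a + dot u v + c * dot v v.
Proof.
move=> f0 cf lf qf; have [c0 c01 H] := fixed_angle_conservation gamma_itv ab f0 cf lf qf.
have cof : continuous f by apply: C1_continuous_fun; exact: C2_C1.
have cL : continuous (fun v => ln (f v)).
  move=> v; apply: (@cvg_comp _ _ _ f (@ln R) _ (nbhs (f v))); first exact: cof.
  exact: continuous_ln.
have hL (p : V * V * V) : S2 p.1.2 -> p.1.1 != 0 -> cos_deviation p.1.1 p.1.2 = c0 ->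
    entropy_jump (fun v => ln (f v)) p = 0.
  move=> s1 z0 pc; have := H p s1 z0 pc.
  rewrite /collision_defect /entropy_jump => /eqP; rewrite subr_eq0 => /eqP e.
  have := congr1 (@ln R) e; rewrite !lnM ?posrE// => e'; lra.
have [a [u [c h]]] := fixed_angle_invariant cL c01 hL.
exists a, u, c; split => //; rewrite ltNge; apply/negP => c00.
have [C hC] := C2_decay cf 1.
pose e : V := delta_mx 0 0.
have [s [s1 us]] : exists s : V, dot s s = 1 /\ 0 <= dot u s.
  have ee : dot e e = 1 by rewrite dot3 /e !mxE /=; ring.
  have [ue|ue] := leP 0 (dot u e); first by exists e.
  by exists (- e); rewrite dotNl !dotNr opprK ee; split => //; rewrite oppr_ge0 ltW.
(* If c >= 0, then f >= exp a along the ray of [s], whereas decay of order 1 gives t f(t s) <= C.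
   For this [t], t exp a = |C| + exp a exceeds C. *)
pose t := `|C| * expR (- a) + 1.
have t0 : 0 < t by rewrite ltr_pwDr// mulr_ge0// expR_ge0.
have fE : f (t *: s) >= expR a.
  rewrite -[leRHS]lnK ?posrE// ler_expR h dotZr dotZl dotZr s1 mulr1 -addrA lerDl.
  by rewrite addr_ge0// ?mulr_ge0 ?(ltW t0).
have := hC (t *: s); rewrite expr1 (ger0_norm (ltW (f0 _))) => h1.
have jt : t <= japanese (t *: s).
  apply: le_trans (enorm_le_japanese _).
  by rewrite enormZ (gtr0_norm t0) (dot1_enorm s1) ?mulr1.
have : t * expR a <= C.
  by apply: le_trans h1; apply: ler_pM => //; exact: ltW.
rewrite /t mulrDl mul1r -mulrA -expRD addNr expR0 mulr1 => h2.
by have := ler_norm C; have := expR_gt0 a; lra.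
Qed.

End collision_invariants.

(** * The transport equation *)

Section derivative_arithmetic.
Context {R : realType} {W : normedModType R}.
Implicit Types (f g : W -> R) (x w : W) (l : R).

Lemma is_derive_add f g x w l l' : is_derive x w f l -> is_derive x w g l' ->
  is_derive x w (fun s => f s + g s) (l + l').
Proof. by move=> hf hg; exact: (is_deriveD hf hg). Qed.

Lemma is_derive_sub f g x w l l' : is_derive x w f l -> is_derive x w g l' ->
  is_derive x w (fun s => f s - g s) (l - l').
Proof. by move=> hf hg; exact: (is_deriveB hf hg). Qed.

Lemma is_derive_mulcl f x w l k : is_derive x w f l ->
  is_derive x w (fun s => k * f s) (k * l).
Proof. by move=> hf; exact: (is_deriveZ k hf). Qed.

Lemma is_derive_outer (h : R -> R) f x w l l' : is_derive (f x) 1 h l' ->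
  is_derive x w f l -> is_derive x w (fun y => h (f y)) (l' * l).
Proof.
move=> hd fd; apply: is_derive_line0.
have d1 : is_derive (f (0 *: w + x)) 1 h l' by rewrite scale0r add0r.
have d2 : is_derive (0 : R) 1 (fun t => f (t *: w + x)) l.
  by apply: is_derive_line; rewrite scale0r add0r.
exact: (is_derive1_comp d1 d2).
Qed.

End derivative_arithmetic.

Section time_derivatives.
Context {R : realType}.
Implicit Types (f g : R -> R) (t l : R).

Lemma is_derive_pos_eq f g t l l' : 0 < t -> (forall s, 0 < s -> f s = g s) ->
  is_derive t 1 f l -> is_derive t 1 g l' -> l = l'.
Proof.
move=> t0 fg df dg.
have n : {near t, f =1 g}.
  by near=> s; apply: fg; near: s; exact: lt_nbhsr.
have df' := near_eq_is_derive n df.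
by rewrite -(@derive_val _ _ _ _ _ _ _ df') -(@derive_val _ _ _ _ _ _ _ dg).
Unshelve. all: by end_near. Qed.

Lemma pos_constant f : (forall t, 0 < t -> is_derive t 1 f 0) ->
  forall t, 0 < t -> f t = f 1.
Proof.
move=> df.
have H (x y : R) : 0 < x -> x <= y -> f y = f x.
  move=> x0 xy.
  have [||c _ e] := @MVT_segment R f (fun _ => 0) x y xy.
  - move=> s; rewrite in_itv /= => /andP[xs _]; apply: df; exact: lt_trans xs.
  - apply: derivable_within_continuous => s; rewrite in_itv /= => /andP[xs _].
    by apply: ex_derive; apply: df; exact: lt_le_trans xs.
  by apply/eqP; rewrite -subr_eq0 e mul0r.
move=> t t0; have [t1|t1] := leP t 1; first by rewrite (H t 1).
by rewrite (H 1 t)// ltW.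
Qed.

Lemma line_constant f (df : R -> R) h : (forall s : R, is_derive s 1 f (df s)) ->
  (forall s, df s = 0) -> f h = f 0.
Proof.
by move=> d d0; have [xi _ e] := mvt_line h d; apply/eqP; rewrite -subr_eq0 e d0 mul0r.
Qed.

Lemma cubic_eq0 (a0 a1 a2 a3 : R) :
  (forall s : R, a0 + s * a1 + s ^+ 2 * a2 + s ^+ 3 * a3 = 0) ->
  [/\ a0 = 0, a1 = 0, a2 = 0 & a3 = 0].
Proof.
move=> h; have := h 0; have := h 1; have := h (-1); have := h 2.
by rewrite !expr2 !exprS !expr0 => h1 h2 h3 h4; split; lra.
Qed.

End time_derivatives.

Section transport.
Context {R : realType}.
Local Notation V := 'rV[R]_3.
Implicit Types (x y v w : V) (s t : R).

Lemma dot_delta x i : dot x (delta_mx 0 i) = x ord0 i.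
Proof.
rewrite /dot (bigD1 i)//= big1 => [|j ji]; rewrite !mxE !eqxx/=.
  by rewrite mulr1 addr0.
by rewrite (negbTE ji) mulr0.
Qed.

Lemma is_derive_dotl u x w : is_derive x w (fun y => dot u y) (dot u w).
Proof.
apply: is_derive_line0.
have -> : (fun t : R => dot u (t *: w + x)) = (fun t => t * dot u w + dot u x).
  by apply/funext => t; rewrite dotDr dotZr.
by apply: is_derive_eq; rewrite [_ *: 1]mulr1 [_ *: 0]mulr0; ring.
Qed.

Lemma is_derive_dot_sqr x w : is_derive x w (fun y => dot y y) (2 * dot x w).
Proof.
apply: is_derive_line0.
have -> : (fun t : R => dot (t *: w + x) (t *: w + x)) =
    (fun t => t ^+ 2 * dot w w + (t * (2 * dot x w) + dot x x)).
  apply/funext => t; rewrite !(dotDl, dotDr, dotZl, dotZr) [dot w x]dotC; ring.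
apply: is_derive_eq; rewrite -![_ *: _]/(_ * _); ring.
Qed.

(** The hypothesis is a conformal Killing equation, Du having symmetric part - kap Id. Along a
    segment only the symmetric part contributes to the derivative of u.w, which is thus constant. *)
Lemma dot_diff_bilinear (u : V -> V) (kap : R) :
  (forall i, C1 (fun x => u x ord0 i)) ->
  (forall x v, kap * dot v v + \sum_i v ord0 i * dot v (gradient (fun x => u x ord0 i) x) = 0) ->
  forall x y, dot (u x - u y) (x - y) = - kap * dot (x - y) (x - y).
Proof.
move=> cu hu x y; set w := x - y.
pose g s := dot (u (s *: w + y)) w.
have dg (s : R) : is_derive s 1 g (- kap * dot w w).
  have -> : - kap * dot w w =
      \sum_i w ord0 i * dot w (gradient (fun x => u x ord0 i) (s *: w + y)).
    by have := hu (s *: w + y) w => h; lra.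
  have -> : g = \sum_i (fun s : R => w ord0 i * u (s *: w + y) ord0 i).
    apply/funext => r; rewrite fct_sumE; apply: eq_bigr => i _.
    by rewrite mulrC.
  apply: is_derive_sum => i; apply: is_derive_mulcl.
  exact: (C1_line y w s (cu i)).
have [xi _] := mvt_line 1 dg.
by rewrite /g scale1r scale0r add0r addrNK mulr1 dotBl.
Qed.

Context (Phi vp : V -> R).
Context (Phi_derive : forall x w, is_derive x w Phi (vp x * dot x w)).
Context (Phi_even : forall x, Phi (- x) = Phi x) (vp_even : forall x, vp (- x) = vp x).
(** The two facts about [Phi] that the argument rests on. [vp x * dot x x + 2 * Phi x] is x.grad Phi
    + 2 Phi, the coefficient of c' in the time derivative of a - 2 c Phi; the second fact says that
    grad Phi is not linear along rays and excludes a drift u(t, 0). *)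
Context (not_quadratic : forall k p0 p2 : R,
  (forall x, k * (vp x * dot x x + 2 * Phi x) = p0 + p2 * dot x x) -> k = 0).
Context (not_harmonic : forall x, x != 0 -> vp (2 *: x) != vp x).

Lemma gradient_Phi x : gradient Phi x = vp x *: x.
Proof.
apply/rowP => i; rewrite !mxE /partial (@derive_val _ _ _ _ _ _ _ (Phi_derive _ _)).
by rewrite dot_delta.
Qed.

Context (a : R -> V -> R) (u : R -> V -> V) (c : R -> V -> R).
Context (a1 : R -> V -> R) (u1 : R -> V -> V) (c1 : R -> V -> R).
Context (da : forall t x, 0 < t -> is_derive t 1 (a ^~ x) (a1 t x)).
Context (du : forall t x i, 0 < t ->
  is_derive t 1 (fun s => u s x ord0 i) (u1 t x ord0 i)).
Context (dc : forall t x, 0 < t -> is_derive t 1 (c ^~ x) (c1 t x)).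
Context (Ca : forall t, 0 < t -> C1 (a t)).
Context (Cu : forall t i, 0 < t -> C1 (fun x => u t x ord0 i)).
Context (Cc : forall t, 0 < t -> C1 (c t)).
(** The transport equation divided by M, for log M = a + u.v + c |v|^2; the last term is grad Phi .
    grad_v log M. *)
Context (transport : forall t x v, 0 < t ->
  a1 t x + dot (u1 t x) v + c1 t x * dot v v +
  (dot v (gradient (a t) x) +
   \sum_i v ord0 i * dot v (gradient (fun x => u t x ord0 i) x) +
   dot v v * dot v (gradient (c t) x)) -
  vp x * dot x (u t x + (2 * c t x) *: v) = 0).

Let Du t x v : R := \sum_i v ord0 i * dot v (gradient (fun x => u t x ord0 i) x).

Let DuZ t x v s : Du t x (s *: v) = s ^+ 2 * Du t x v.
Proof.
rewrite /Du mulr_sumr; apply: eq_bigr => i _; rewrite mxE dotZl; ring.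
Qed.

Let separated t x v : 0 < t ->
  [/\ a1 t x = vp x * dot x (u t x),
      dot (u1 t x) v + dot v (gradient (a t) x) = 2 * c t x * vp x * dot x v,
      c1 t x * dot v v + Du t x v = 0 &
      dot v v * dot v (gradient (c t) x) = 0].
Proof.
move=> t0.
have H (s : R) : (a1 t x - vp x * dot x (u t x)) +
    s * (dot (u1 t x) v + dot v (gradient (a t) x) - 2 * c t x * vp x * dot x v) +
    s ^+ 2 * (c1 t x * dot v v + Du t x v) +
    s ^+ 3 * (dot v v * dot v (gradient (c t) x)) = 0.
  have := transport x (s *: v) t0.
  rewrite -[X in _ + (_ + X + _) - _]/(Du t x (s *: v)) DuZ.
  by rewrite !(dotDr, dotZl, dotZr) => <-; ring.
by have [h0 h1 h2 h3] := cubic_eq0 H; split => //; lra.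
Qed.

Let c_const t x : 0 < t -> c t x = c t 0.
Proof.
move=> t0.
have := @line_constant R (fun s => c t (s *: x + 0)) _ 1
  (fun s => C1_line 0 x s (Cc t0)).
rewrite scale1r scale0r !addr0; apply => s.
have [_ _ _] := separated (s *: x + 0) x t0.
move=> /eqP; rewrite mulf_eq0 => /orP[/eqP/dot_eq0 ->|/eqP //].
by rewrite dot0l.
Qed.

Let kap t : R := c1 t 0.

Let c1_const t x : 0 < t -> c1 t x = kap t.
Proof.
move=> t0; apply: (is_derive_pos_eq t0 _ (dc x t0) (dc 0 t0)) => s s0.
exact: c_const.
Qed.

Let u_diff t x y : 0 < t ->
  dot (u t x - u t y) (x - y) = - kap t * dot (x - y) (x - y).
Proof.
move=> t0; apply: (@dot_diff_bilinear (u t)) => [i|z v]; first exact: Cu.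
by have [_ _ h _] := separated z v t0; rewrite -(c1_const z t0).
Qed.

Let e : V := delta_mx 0 0.

Let dee : dot e e = 1.
Proof. by rewrite dot_delta /e !mxE. Qed.

(** The derivative [kap] of c is thereby a difference of values of u, hence itself differentiable in
    time, with derivative [kap2]. *)
Let kapE t : 0 < t -> kap t = - (u t e ord0 0 - u t 0 ord0 0).
Proof.
move=> t0; have := u_diff e 0 t0; rewrite subr0 dee mulr1 dot_delta !mxE => h; lra.
Qed.

Let kap2 t : R := - (u1 t e ord0 0 - u1 t 0 ord0 0).

Let dkap t : 0 < t -> is_derive t 1 (fun s => - (u s e ord0 0 - u s 0 ord0 0)) (kap2 t).
Proof. by move=> t0; exact: (is_deriveN (is_derive_sub (du e 0 t0) (du 0 0 t0))). Qed.

Let ddot t x v : 0 < t -> is_derive t 1 (fun s => dot (u s x) v) (dot (u1 t x) v).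
Proof.
move=> t0; have -> : (fun s => dot (u s x) v) =
    \sum_i (fun s => v ord0 i * u s x ord0 i).
  by apply/funext => r; rewrite fct_sumE; apply: eq_bigr => i _; rewrite mulrC.
have -> : dot (u1 t x) v = \sum_i v ord0 i * u1 t x ord0 i.
  by apply: eq_bigr => i _; rewrite mulrC.
by apply: is_derive_sum => i; apply: is_derive_mulcl; exact: du.
Qed.

Let u1_diff t x : 0 < t -> dot (u1 t x) x - dot (u1 t 0) x = - kap2 t * dot x x.
Proof.
move=> t0.
have d1 := is_derive_sub (ddot x x t0) (ddot 0 x t0).
have d2 := is_derive_mulcl (- dot x x) (dkap t0).
rewrite (is_derive_pos_eq t0 _ d1 d2); first by ring.
move=> s s0; rewrite -kapE// -dotBl.
have := u_diff x 0 s0; rewrite subr0 => ->; ring.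
Qed.

Let q t x := a t x - 2 * c t 0 * Phi x.

Let q_line t x (s : R) : 0 < t ->
  is_derive s 1 (fun r => q t (r *: x + 0)) (- dot (u1 t (s *: x)) x).
Proof.
move=> t0.
have h := is_derive_sub (C1_line 0 x s (Ca t0))
  (is_derive_mulcl (2 * c t 0) (is_derive_line (Phi_derive (s *: x + 0) x))).
apply: (is_derive_eq h); rewrite addr0.
have [_ h1 _ _] := separated (s *: x) x t0.
rewrite c_const// in h1; rewrite -mulrA in h1; lra.
Qed.

Let q_quadratic t x : 0 < t ->
  q t x = q t 0 - dot (u1 t 0) x + kap2 t / 2 * dot x x.
Proof.
move=> t0.
have u1E (s : R) : dot (u1 t (s *: x)) x = dot (u1 t 0) x - kap2 t * s * dot x x.
  have [->|s0] := eqVneq s 0; first by rewrite scale0r; ring.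
  have := u1_diff (s *: x) t0; rewrite !(dotZl, dotZr) => h.
  apply: (mulfI s0); lra.
pose g (r : R) := q t (r *: x + 0) - (r * (- dot (u1 t 0) x) + r ^+ 2 * (kap2 t / 2 * dot x x)).
have dg (s : R) : is_derive s 1 g 0.
  have d2 : is_derive s 1 (fun r : R => r * (- dot (u1 t 0) x) + r ^+ 2 * (kap2 t / 2 * dot x x))
      (- dot (u1 t 0) x + s * kap2 t * dot x x).
    by apply: is_derive_eq; rewrite -![_ *: _]/(_ * _); field.
  apply: (is_derive_eq (is_derive_sub (q_line x s t0) d2)).
  by rewrite u1E; ring.
have := @line_constant R g (fun _ => 0) 1 dg (fun _ => erefl).
rewrite /g scale1r scale0r !addr0 !(expr1n, expr0n, mul0r, mul1r) /= => h; lra.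
Qed.

Let q1 t x : R := a1 t x - 2 * kap t * Phi x.

Let dq t x : 0 < t -> is_derive t 1 (fun s => q s x) (q1 t x).
Proof.
move=> t0; rewrite /q /q1.
have h := is_derive_sub (da x t0) (is_derive_mulcl (2 * Phi x) (dc 0 t0)).
have -> : (fun s => a s x - 2 * c s 0 * Phi x) = (fun s => a s x - 2 * Phi x * c s 0).
  by apply/funext => s; ring.
by apply: (is_derive_eq h); rewrite -/(kap t); ring.
Qed.

Let q1E t x : 0 < t ->
  q1 t x = vp x * (dot x (u t 0) - kap t * dot x x) - 2 * kap t * Phi x.
Proof.
move=> t0; rewrite /q1; have [-> _ _ _] := separated x 0 t0.
have := u_diff x 0 t0; rewrite subr0 dotBl [dot (u t x) x]dotC [dot (u t 0) x]dotC => h.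
by congr (_ * _ - _); lra.
Qed.

(** The even part of q is |x|^2 times its value at [e], at all times. Differentiating this
    proportionality in time, rather than the formula of [q_quadratic], involves no derivative of
    [kap2]. It shows that kap (x.grad Phi + 2 Phi) is quadratic. *)
Let kap_eq0 t : 0 < t -> kap t = 0.
Proof.
move=> t0.
pose sym s x := q s x + q s (- x) - 2 * q s 0.
have dsym x : is_derive t 1 (fun s => sym s x) (q1 t x + q1 t (- x) - 2 * q1 t 0).
  exact: (is_derive_sub (is_derive_add (dq x t0) (dq (- x) t0))
    (is_derive_mulcl 2 (dq 0 t0))).
pose P := q1 t e + q1 t (- e) - 2 * q1 t 0.
have id x : q1 t x + q1 t (- x) - 2 * q1 t 0 = dot x x * P.
  apply: (is_derive_pos_eq t0 _ (dsym x) (is_derive_mulcl (dot x x) (dsym e))).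
  move=> s s0; rewrite /sym (q_quadratic x s0) (q_quadratic (- x) s0) (q_quadratic e s0)
    (q_quadratic (- e) s0) !(dotNr, dotNl, opprK) dee.
  ring.
apply: (@not_quadratic (kap t) (- q1 t 0) (- P / 2)) => x.
have := id x; rewrite (q1E x t0) (q1E (- x) t0) !(dotNl, dotNr, opprK).
rewrite Phi_even vp_even => h; lra.
Qed.

(** The odd part of q is linear in x, hence so is its time derivative, which is 2 vp(x) x.u(t, 0).
    Comparing the values at x and 2 x for x = u(t, 0) contradicts [not_harmonic] unless this vector
    is 0. *)
Let u0_eq0 t : 0 < t -> u t 0 = 0.
Proof.
move=> t0.
pose asym s x := q s x - q s (- x).
have dasym x : is_derive t 1 (fun s => asym s x) (q1 t x - q1 t (- x)).
  exact: (is_derive_sub (dq x t0) (dq (- x) t0)).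
have id x : q1 t (2 *: x) - q1 t (- (2 *: x)) = 2 * (q1 t x - q1 t (- x)).
  apply: (is_derive_pos_eq t0 _ (dasym (2 *: x)) (is_derive_mulcl 2 (dasym x))).
  move=> s s0; rewrite /asym (q_quadratic x s0) (q_quadratic (- x) s0)
    (q_quadratic (2 *: x) s0) (q_quadratic (- (2 *: x)) s0) !(dotNr, dotNl, opprK, dotZl, dotZr).
  ring.
apply/eqP/negPn/negP => u0; set d := u t 0 in u0.
have := id d; rewrite !(q1E _ t0) (kap_eq0 t0) -/d !(dotNl, dotZl) !vp_even.
have dd : dot d d != 0 by apply: contra u0 => /eqP /dot_eq0 ->.
move=> h; have /eqP := not_harmonic u0; apply.
by apply: (mulIf dd); lra.
Qed.

Let u1_0 t v : 0 < t -> dot (u1 t 0) v = 0.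
Proof.
move=> t0.
have d0 : is_derive t (1 : R) (fun _ : R => 0 : R) 0 by exact: is_derive_cst.
apply: (is_derive_pos_eq t0 _ (ddot 0 v t0) d0) => s s0.
by rewrite u0_eq0// dot0l.
Qed.

Let kap2_0 t : 0 < t -> kap2 t = 0.
Proof.
move=> t0.
have d0 : is_derive t (1 : R) (fun _ : R => 0 : R) 0 by exact: is_derive_cst.
apply: (is_derive_pos_eq t0 _ (dkap t0) d0) => s s0.
by rewrite -kapE// kap_eq0.
Qed.

Let q_const t x : 0 < t -> q t x = q t 0.
Proof. by move=> t0; rewrite q_quadratic// u1_0// kap2_0//; ring. Qed.

(** As q is constant in x, grad a = 2 c grad Phi, and the part of degree 1 of the equation then
    leaves only the time derivative of u. *)
Let u1_eq0 t x v : 0 < t -> dot (u1 t x) v = 0.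
Proof.
move=> t0.
have d0 : is_derive (0 : R) (1 : R) (fun _ : R => q t 0) 0 by exact: is_derive_cst.
have h := is_derive_sub (C1_line x v 0 (Ca t0))
  (is_derive_mulcl (2 * c t 0) (is_derive_line (Phi_derive (0 *: v + x) v))).
have e0 : (fun s => a t (s *: v + x) - 2 * c t 0 * Phi (s *: v + x)) = (fun _ => q t 0).
  by apply/funext => s; exact: q_const.
rewrite e0 in h.
have := @derive_val _ _ _ _ _ _ _ h; rewrite (@derive_val _ _ _ _ _ _ _ d0).
rewrite scale0r add0r => h'.
have [_ h1 _ _] := separated x v t0; rewrite c_const// -mulrA in h1; lra.
Qed.

Lemma transport_stationary : exists (q0 c0 : R) (A : 'M[R]_3), A^T = - A /\ forall t x v, 0 < t -> a t x + dot (u t x) v + c t x * dot v v =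
    q0 + 2 * c0 * Phi x + dot (x *m A^T) v + c0 * dot v v.
Proof.
(* Polarization of (u x - u y).(x - y) = 0, given u z . z = 0. *)
have lin x y t : 0 < t -> dot (u t x) y = - dot (u t y) x.
  move=> t0; have h z : dot (u t z) z = 0.
    by have := u_diff z 0 t0; rewrite u0_eq0// kap_eq0// !subr0 oppr0 mul0r.
  have := u_diff x y t0; rewrite kap_eq0// oppr0 mul0r dotBl !dotBr !h => h'; lra.
(* Row j is - u(1, e_j), so that antisymmetry turns [x *m A^T] into u(1, x). *)
pose A : 'M[R]_3 := \matrix_(j, i) - u 1 (delta_mx 0 j) ord0 i.
exists (q 1 0), (c 1 0), A; split.
  apply/matrixP => i j; rewrite !mxE opprK.
  have := lin (delta_mx 0 j) (delta_mx 0 i) 1 ltr01.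
  by rewrite !dot_delta => ->; rewrite opprK.
move=> t x v t0.
have uc : dot (u t x) v = dot (u 1 x) v.
  apply: (@pos_constant R (fun t => dot (u t x) v)) => // s s0.
  by have := ddot x v s0; rewrite u1_eq0.
have cc : c t 0 = c 1 0.
  apply: (@pos_constant R (fun t => c t 0)) => // s s0.
  by have := dc 0 s0; rewrite -/(kap s) kap_eq0.
have qc : q t 0 = q 1 0.
  apply: (@pos_constant R (fun t => q t 0)) => // s s0.
  by have := dq 0 s0; rewrite q1E// u0_eq0// kap_eq0// dot0l !(mulr0, mul0r, subr0).
have aE : a t x = q 1 0 + 2 * c 1 0 * Phi x.
  by have := q_const x t0; rewrite qc /q cc => h; lra.
rewrite c_const// cc aE uc; congr (_ + _ + _).
congr dot; apply/rowP => j; rewrite !mxE.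
have := lin x (delta_mx 0 j) 1 ltr01; rewrite dot_delta => ->.
rewrite /dot -sumrN; apply: eq_bigr => i _; rewrite !mxE; ring.
Qed.

End transport.

(** * From phase-space regularity to each variable *)

Section phase_regularity.
Context {R : realType}.
Local Notation V := 'rV[R]_3.
Implicit Types (x y v w : V) (s t : R).

Lemma C1_intro (f : V -> R) (g : 'I_3 -> V -> R) :
  (forall i x, is_derive x (delta_mx 0 i) f (g i x)) ->
  (forall i, continuous (g i)) -> C1 f.
Proof.
move=> df cg; split=> [i x|i]; first by apply: ex_derive; exact: df.
rewrite (_ : partial i f = g i)//; apply/funext => x.
exact: (@derive_val _ _ _ _ _ _ _ (df i x)).
Qed.

Lemma C1_partial (f : V -> R) i x : C1 f -> is_derive x (delta_mx 0 i) f (partial i f x).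
Proof. by move=> [df _]; exact: derivableP. Qed.

Lemma C1_add (f g : V -> R) : C1 f -> C1 g -> C1 (fun x => f x + g x).
Proof.
move=> cf cg; apply: (@C1_intro _ (fun i x => partial i f x + partial i g x)).
  by move=> i x; exact: (is_derive_add (C1_partial i x cf) (C1_partial i x cg)).
by move=> i x; exact: (cvgD (cf.2 i x) (cg.2 i x)).
Qed.

Lemma C1_mulcl (f : V -> R) k : C1 f -> C1 (fun x => k * f x).
Proof.
move=> cf; apply: (@C1_intro _ (fun i x => k * partial i f x)).
  by move=> i x; exact: (is_derive_mulcl k (C1_partial i x cf)).
by move=> i x; exact: (cvgM (cvg_cst k) (cf.2 i x)).
Qed.

Lemma C1_ln (f : V -> R) : (forall x, 0 < f x) -> C1 f -> C1 (fun x => ln (f x)).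
Proof.
move=> f0 cf; apply: (@C1_intro _ (fun i x => (f x)^-1 * partial i f x)).
  move=> i x.
  exact: (is_derive_outer (is_derive1_ln (f0 x)) (C1_partial i x cf)).
move=> i x; have FF : Filter (nbhs x) := nbhs_filter x.
apply: cvgM; last exact: cf.2.
by apply: cvgV; [rewrite gt_eqF|exact: C1_continuous_fun].
Qed.

(** At t > 0 the restriction 0 <= t + h is void for small h, so the one-sided derivative is an
    ordinary one. *)
Lemma time_derivative_is_derive (f : R -> R) t : 0 < t -> time_derivable f t ->
  is_derive t 1 f (time_derivative f t).
Proof.
move=> t0 ft; set l := time_derivative f t.
have h : h^-1 * (f (t + h) - f t) @[h --> 0^'] --> (l : R).
  have n : \forall h \near (0 : R)^', 0 <= t + h.
    near=> h; have : `|h| < t by near: h; exact: dnbhs0_lt.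
    by rewrite ltr_norml; lra.
  by move=> P lP; have q := ft P lP; apply: filterS2 n q => h h0; apply.
have E : (fun h : R => h^-1 * (f (t + h) - f t)) =
    (fun h : R => h^-1 *: ((f \o shift t) (h *: 1) - f t)).
  by apply/funext => h' /=; rewrite [_%:A]mulr1 [t + _]addrC.
rewrite E in h; split; first by apply/cvg_ex; exists l.
exact: cvg_lim.
Unshelve. all: by end_near. Qed.

Lemma cvg_triple (T : Type) (F : set_system T) {FF : Filter F}
    (f : T -> R) (g h : T -> V) t x v :
  f @ F --> t -> g @ F --> x -> h @ F --> v ->
  (fun p : T => (f p, g p, h p)) @ F --> (t, x, v).
Proof.
move=> hf hg hh; exact: (cvg_pair (cvg_pair hf hg) hh).
Qed.

Lemma continuous_phase_x (g : R -> V -> V -> R) t v : 0 <= t ->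
  continuous_phase g -> continuous (fun x => g t x v).
Proof.
move=> t0 /subspace_continuousP cg x.
have FF : Filter (nbhs x) := nbhs_filter x.
have h := cg (t, x, v) t0.
apply: (@cvg_comp _ _ _ (fun y : V => (t, y, v)) (fun z : R * V * V => g z.1.1 z.1.2 z.2)
  _ (within [set z : R * V * V | 0 <= z.1.1] (nbhs (t, x, v)))); last exact: h.
move=> P /= hP.
have c : (fun y : V => (t, y, v)) @ x --> (t, x, v).
  exact: (cvg_triple (cvg_cst t) cvg_id (cvg_cst v)).
have n := c _ hP; apply: (@filterS _ (nbhs x) FF _ _ _ n) => y; exact.
Qed.

Lemma continuous_phase_time0 (g : R -> V -> V -> R) x v (k : R) :
  continuous_phase g -> (forall t, 0 < t -> g t x v = k) -> g 0 x v = k.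
Proof.
move=> /subspace_continuousP cg gk.
have h := cg (0, x, v) (lexx _).
apply/eqP; rewrite -subr_eq0 -normr_le0 leNgt; apply/negP => e0.
have /cvgrPdist_lt /(_ _ e0) := h.
rewrite /= near_withinE => n.
have c : (fun t : R => (t, x, v)) @ (0 : R)^'+ --> (0 : R, x, v).
  have c0 : (fun t : R => t) @ (0 : R)^'+ --> (0 : R) by exact: cvg_within.
  exact: (cvg_triple c0 (cvg_cst x) (cvg_cst v)).
have n' := c _ n.
have : \forall t \near (0 : R)^'+, False.
  near=> t.
  have t0 : 0 < t by near: t; exact: nbhs_right_gt.
  have : 0 <= t -> `|g 0 x v - g t x v| < `|g 0 x v - k| by near: t.
  by move=> h'; have := h' (ltW t0); rewrite (gk _ t0) ltxx.
by move=> /filter_ex[].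
Unshelve. all: by end_near. Qed.

End phase_regularity.

(** * Necessity of the form *)

Section direct.
Context {R : realType}.
Local Notation V := 'rV[R]_3.
Implicit Types (x y v w : V) (s t : R).
Context (gamma : R) (gamma_itv : -3 < gamma <= 1).
Context (b : R -> R) (ab : angular_kernel b).
Context (Phi vp : V -> R).
Context (Phi_derive : forall x w, is_derive x w Phi (vp x * dot x w)).
Context (Phi_even : forall x, Phi (- x) = Phi x) (vp_even : forall x, vp (- x) = vp x).
Context (not_quadratic : forall k p0 p2 : R,
  (forall x, k * (vp x * dot x x + 2 * Phi x) = p0 + p2 * dot x x) -> k = 0).
Context (not_harmonic : forall x, x != 0 -> vp (2 *: x) != vp x).

Lemma entropy_invariant_form (M : R -> V -> V -> R) :
  entropy_invariant gamma b Phi M -> exists (m alpha : R) (A : 'M[R]_3),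
  [/\ 0 < m, 0 < alpha, A^T = - A & forall t x v, 0 <= t ->
    M t x v = m * expR (- alpha * (Phi x + enorm v ^+ 2 / 2) + dot (x *m A^T) v)].
Proof.
move=> [M0 [cM rM] _ tr col].
pose L t x v := ln (M t x v).
pose e i : V := delta_mx 0 i.
(* [maxwellian_log] gives coefficients separately at each (t, x), with no regularity. Reading them
   off from log M at 0, e_i and - e_i makes them inherit the differentiability of M in t and x. *)
pose a t x := L t x 0.
pose u t x : V := \row_i (2^-1 * (L t x (e i) - L t x (- e i))).
pose c t x := 2^-1 * (L t x (e 0) + L t x (- e 0)) - L t x 0.
have Lform t x v : 0 <= t -> L t x v = a t x + dot (u t x) v + c t x * dot v v /\ c t x < 0.
  move=> t0; have [r1 r2] := rM t x t0.
  have [a' [u' [c' [c0 h]]]] := maxwellian_log gamma_itv ab (fun v => M0 t x v t0) r1 r2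
    (fun v => col t x v t0).
  have aE : a t x = a' by rewrite /a /L h !dot0r; ring.
  have cE : c t x = c'.
    by rewrite /c /L !h !dot0r !(dotNl, dotNr) !dot_delta /e !mxE /=; lra.
  have uE : u t x = u'.
    apply/rowP => i; rewrite /u mxE /L !h !(dotNl, dotNr) !dot_delta; lra.
  rewrite aE cE uE; split; [exact: h|exact: c0].
pose Lt t x v := (M t x v)^-1 * time_derivative (fun s => M s x v) t.
have dL t x v : 0 < t -> is_derive t 1 (fun s => L s x v) (Lt t x v).
  move=> t0; have [td _] := C1_derivable cM x v (ltW t0).
  exact: (is_derive_outer (is_derive1_ln (M0 t x v (ltW t0)))
    (time_derivative_is_derive t0 td)).
have CM t v : 0 <= t -> C1 (fun x => M t x v).
  move=> t0; split=> [i x|i].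
    have [_ h] := C1_derivable cM x v t0; have [h1 _] := h i; exact: h1.
  have h : continuous_phase (fun t x v => partial i (fun y => M t y v) x).
    by case: cM => _ _ _ cx _; exact: cx.
  exact: (@continuous_phase_x R _ t v t0 h).
have CL t v : 0 <= t -> C1 (fun x => L t x v).
  by move=> t0; apply: C1_ln; [move=> x; exact: M0|exact: CM].
pose a1 t x := Lt t x 0.
pose u1 t x : V := \row_i (2^-1 * (Lt t x (e i) - Lt t x (- e i))).
pose c1 t x := 2^-1 * (Lt t x (e 0) + Lt t x (- e 0)) - Lt t x 0.
have da t x : 0 < t -> is_derive t 1 (a ^~ x) (a1 t x) by exact: dL.
have du t x i : 0 < t -> is_derive t 1 (fun s => u s x ord0 i) (u1 t x ord0 i).
  move=> t0; rewrite mxE (_ : (fun s => _) =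
    (fun s => 2^-1 * (L s x (e i) - L s x (- e i)))); last first.
    by apply/funext => s; rewrite mxE.
  exact: (is_derive_mulcl _ (is_derive_sub (dL t x (e i) t0) (dL t x (- e i) t0))).
have dc t x : 0 < t -> is_derive t 1 (c ^~ x) (c1 t x).
  move=> t0; apply: is_derive_sub; last exact: dL.
  exact: (is_derive_mulcl _ (is_derive_add (dL t x (e 0) t0) (dL t x (- e 0) t0))).
have Ca t : 0 < t -> C1 (a t) by move=> t0; exact: CL (ltW t0).
have Cu t i : 0 < t -> C1 (fun x => u t x ord0 i).
  move=> /ltW t0; rewrite (_ : (fun x => _) =
    (fun x => 2^-1 * (L t x (e i) + -1 * L t x (- e i)))); last first.
    by apply/funext => x; rewrite mxE mulN1r.
  apply: C1_mulcl; apply: C1_add; first exact: CL.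
  by apply: C1_mulcl; exact: CL.
have Cc t : 0 < t -> C1 (c t).
  move=> /ltW t0; rewrite (_ : c t =
    (fun x => 2^-1 * (L t x (e 0) + L t x (- e 0)) + -1 * L t x 0)); last first.
    by apply/funext => x; rewrite /c mulN1r.
  apply: C1_add; last by apply: C1_mulcl; exact: CL.
  by apply: C1_mulcl; apply: C1_add; exact: CL.
have gM t x v i : 0 <= t -> partial i (M t x) v =
    M t x v * (u t x ord0 i + 2 * c t x * v ord0 i).
  move=> t0.
  have ME : M t x = (fun v => expR (a t x + (dot (u t x) v + c t x * dot v v))).
    by apply/funext => w; rewrite -[LHS]lnK ?posrE ?M0// addrA; congr expR; have [] := Lform t x w t0.
  have d1 := is_derive_add (is_derive_cst (a t x) v (e i))
    (is_derive_add (is_derive_dotl (u t x) v (e i))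
      (is_derive_mulcl (c t x) (is_derive_dot_sqr v (e i)))).
  have d2 := is_derive_outer (is_derive_expR _) d1.
  rewrite /partial ME; apply: etrans (@derive_val _ _ _ _ _ _ _ d2) _.
  by rewrite /cst !dot_delta; ring.
have gPhi := gradient_Phi Phi_derive.
have main t x v : 0 < t ->
  a1 t x + dot (u1 t x) v + c1 t x * dot v v +
  (dot v (gradient (a t) x) +
   \sum_i v ord0 i * dot v (gradient (fun x => u t x ord0 i) x) +
   dot v v * dot v (gradient (c t) x)) -
  vp x * dot x (u t x + (2 * c t x) *: v) = 0.
  move=> t0; have t0' := ltW t0.
  have dotu (f : V -> V) w : dot (f w) v = \sum_i v ord0 i * f w ord0 i.
    by apply: eq_bigr => i _; rewrite mulrC.
  have -> : a1 t x + dot (u1 t x) v + c1 t x * dot v v = Lt t x v.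
    have d : is_derive t 1 (fun s => a s x + (\sum_i (fun s => v ord0 i * u s x ord0 i)) s +
        dot v v * c s x) (a1 t x + \sum_i v ord0 i * u1 t x ord0 i + dot v v * c1 t x).
      apply: is_derive_add; last exact: is_derive_mulcl (dc t x t0).
      apply: is_derive_add; first exact: da.
      by apply: is_derive_sum => i; apply: is_derive_mulcl; exact: du.
    rewrite dotu [c1 t x * _]mulrC.
    apply: (is_derive_pos_eq t0 _ d (dL t x v t0)) => s s0.
    have [-> _] := Lform s x v (ltW s0).
    by rewrite fct_sumE -dotu [c s x * _]mulrC.
  have -> : dot v (gradient (a t) x) +
     \sum_i v ord0 i * dot v (gradient (fun x => u t x ord0 i) x) +
     dot v v * dot v (gradient (c t) x) = dot v (gradient (fun x => L t x v) x).
    have d : is_derive x v (fun y => a t y + (\sum_i (fun y => v ord0 i * u t y ord0 i)) y +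
        dot v v * c t y) (dot v (gradient (a t) x) +
     \sum_i v ord0 i * dot v (gradient (fun x => u t x ord0 i) x) +
     dot v v * dot v (gradient (c t) x)).
      apply: is_derive_add; last exact: is_derive_mulcl _ (C1_is_derive x v (Cc t t0)).
      apply: is_derive_add; first exact: C1_is_derive (Ca t t0).
      by apply: is_derive_sum => i; apply: is_derive_mulcl; exact: C1_is_derive (Cu t i t0).
    have d' := C1_is_derive x v (CL t v t0').
    have E : (fun x => L t x v) = (fun y => a t y +
        (\sum_i (fun y => v ord0 i * u t y ord0 i)) y + dot v v * c t y).
      apply/funext => y; have [-> _] := Lform t y v t0'.
      by rewrite fct_sumE -dotu [c t y * _]mulrC.
    rewrite E in d'.
    by rewrite -(@derive_val _ _ _ _ _ _ _ d) E -(@derive_val _ _ _ _ _ _ _ d').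
  have Mp := M0 t x v t0'; have Mn : M t x v != 0 by rewrite gt_eqF.
  have gL : dot v (gradient (fun x => L t x v) x) =
      (M t x v)^-1 * dot v (gradient (fun x => M t x v) x).
    have d1 := C1_is_derive x v (CL t v t0').
    have d2 := is_derive_outer (is_derive1_ln Mp) (C1_is_derive x v (CM t v t0')).
    by rewrite -(@derive_val _ _ _ _ _ _ _ d1) -(@derive_val _ _ _ _ _ _ _ d2).
  have gv : dot (gradient Phi x) (gradient (M t x) v) =
      M t x v * (vp x * dot x (u t x + (2 * c t x) *: v)).
    rewrite gPhi dotZl mulrCA; congr (_ * _).
    rewrite -dotZr; apply: eq_bigr => i _.
    by rewrite /gradient !mxE gM// !mxE; congr (_ * _); ring.
  have := tr t x v t0'; rewrite gv gL /Lt => h.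
  by apply: (mulfI Mn); rewrite mulr0 -[RHS]h; field.
have [q0 [c0 [A [AT hA]]]] := transport_stationary Phi_derive Phi_even vp_even
  not_quadratic not_harmonic da du dc Ca Cu Cc main.
have c00 : c0 < 0.
  have [_ c1'] := Lform 1 0 0 (ler01).
  have h1 := hA 1 0 (e 0) ltr01; have h2 := hA 1 0 (- e 0) ltr01; have h3 := hA 1 0 0 ltr01.
  rewrite !(mul0mx, dot0l, dot0r, dotNr, dotNl) !dot_delta /e !mxE /= in h1 h2 h3.
  lra.
exists (expR q0), (- 2 * c0), A; split => //; [exact: expR_gt0|lra|].
have form t x v : 0 < t -> M t x v =
    expR q0 * expR (- (- 2 * c0) * (Phi x + enorm v ^+ 2 / 2) + dot (x *m A^T) v).
  move=> t0; rewrite -[LHS]lnK ?posrE ?M0 ?(ltW t0)// -expRD; congr expR.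
  have [h _] := Lform t x v (ltW t0).
  by rewrite -/(L t x v) h hA// enorm_sqr; field.
move=> t x v; rewrite le_eqVlt => /orP[/eqP <-|t0]; last exact: form.
by apply: (continuous_phase_time0 (C1_continuous cM)) => s s0; exact: form.
Qed.

End direct.

(** * The two families of potentials *)

Section potentials.
Context {R : realType}.
Local Notation V := 'rV[R]_3.
Implicit Types (x y v w : V) (s t p r : R).

Lemma continuous_dot_self : continuous (fun x : V => dot x x).
Proof. by move=> x; exact: (cvg_dot cvg_id cvg_id). Qed.

Lemma continuous_enorm : continuous (@enorm R 3).
Proof.
move=> x; apply: (@cvg_comp _ _ _ (fun y : V => dot y y) Num.sqrt _ (nbhs (dot x x))).
  exact: continuous_dot_self.
exact: sqrt_continuous.
Qed.

Lemma continuous_japanese : continuous (@japanese R 3).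
Proof.
move=> x; rewrite /japanese; have FF : Filter (nbhs x) := nbhs_filter x.
apply: (@cvg_comp _ _ _ (fun y : V => 1 + enorm y ^+ 2) Num.sqrt _
  (nbhs (1 + enorm x ^+ 2))); last exact: sqrt_continuous.
apply: cvgD; first exact: cvg_cst.
rewrite (_ : (fun y : V => enorm y ^+ 2) = (fun y : V => dot y y)); last first.
  by apply/funext => y; rewrite enorm_sqr.
by rewrite enorm_sqr; exact: continuous_dot_self.
Qed.

Lemma cvg_powR (s r : R) : 0 < s -> (fun t => t `^ r) @ s --> s `^ r.
Proof.
move=> s0; have d := is_derive1_powR r s0.
have h : differentiable (fun t => t `^ r) s by apply/derivable1_diffP; exact: ex_derive.
exact: differentiable_continuous h.
Qed.

(** Common to both potentials: [k = 0] gives |x|^p away from the origin, [k = 1] gives <x>^p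
    everywhere. *)
Lemma is_derive_sqr_powR (k p : R) x w : 0 < k + dot x x -> p != 0 ->
  is_derive x w (fun y => (k + dot y y) `^ (p / 2) / p)
    ((k + dot x x) `^ ((p - 2) / 2) * dot x w).
Proof.
move=> x0 p0.
have d1 := is_derive_add (is_derive_cst k x w) (is_derive_dot_sqr x w).
have d2 := is_derive_mulcl p^-1 (@is_derive_outer _ _ (fun t => t `^ (p / 2))
  (fun y : V => cst k y + dot y y) x w _ _ (is_derive1_powR (p / 2) x0) d1).
have -> : (fun y => (k + dot y y) `^ (p / 2) / p) =
    (fun y => p^-1 * (cst k y + dot y y) `^ (p / 2)).
  by apply/funext => y; rewrite mulrC.
apply: (is_derive_eq d2).
have -> : (p - 2) / 2 = p / 2 - 1 by field.
by field.
Qed.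

Lemma sqrt_powR (s r : R) : 0 <= s -> Num.sqrt s `^ r = s `^ (r / 2).
Proof. by move=> s0; rewrite -powR12_sqrt// -powRrM mulrC. Qed.

Lemma enorm_powR x r : enorm x `^ r = (0 + dot x x) `^ (r / 2).
Proof. by rewrite add0r -sqrt_powR ?dot_ge0. Qed.

Lemma japanese_powR x r : japanese x `^ r = (1 + dot x x) `^ (r / 2).
Proof. by rewrite -sqrt_powR ?addr_ge0 ?dot_ge0// /japanese enorm_sqr. Qed.

Lemma japaneseN x : japanese (- x) = japanese x.
Proof. by rewrite /japanese enormN. Qed.

Lemma powR_neq (s t r : R) : 0 < s -> 0 < t -> r != 0 -> s != t -> s `^ r != t `^ r.
Proof.
move=> s0 t0 r0 st; have -> : s = (s / t) * t by rewrite divfK// gt_eqF.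
rewrite powRM ?(ltW t0)// ?divr_ge0 ?(ltW s0) ?(ltW t0)//.
apply/eqP => h; have tr := powR_gt0 r t0.
have : (s / t) `^ r = 1 by apply: (mulIf (lt0r_neq0 tr)); rewrite mul1r.
move/eqP; rewrite powR_eq1 (negbTE r0) orbF ltNge divr_ge0 ?(ltW s0) ?(ltW t0)//= orbF.
move=> /eqP q; case/eqP: st.
by rewrite -[s](divfK (lt0r_neq0 t0)) q mul1r.
Qed.

Lemma is_derive_enorm_powR p x w : 2 < p ->
  is_derive x w (fun y => enorm y `^ p / p) (enorm x `^ (p - 2) * dot x w).
Proof.
move=> p2; have p0 : p != 0 by rewrite gt_eqF//; lra.
have [->|x0] := eqVneq x 0; last first.
  have xx : 0 < 0 + dot x x.
    by rewrite add0r lt_neqAle dot_ge0 andbT eq_sym; apply: contra x0 => /eqP /dot_eq0 ->.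
  have -> : (fun y : V => enorm y `^ p / p) = (fun y => (0 + dot y y) `^ (p / 2) / p).
    by apply/funext => y; rewrite enorm_powR.
  by rewrite enorm_powR; exact: is_derive_sqr_powR.
rewrite dot0l mulr0.
(* At the origin the quotient is of order |h|^(p-1), at most |h| for |h| < 1 because p > 2. *)
suff c : h^-1 *: (((fun y : V => enorm y `^ p / p) \o shift 0) (h *: w) -
    (fun y : V => enorm y `^ p / p) 0) @[h --> (0 : R)^'] --> (0 : R).
  by split; [apply/cvg_ex; exists 0|exact: cvg_lim].
pose K := enorm w `^ p / p.
have K0 : 0 <= K by rewrite /K divr_ge0 ?powR_ge0//; lra.
apply/cvgrPdist_le => e e0; near=> h.
have h0 : h != 0 by near: h; exact: nbhs_dnbhs_neq.
have h1 : `|h| < 1 by near: h; exact: dnbhs0_lt.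
have he : `|h| < e / (K + 1).
  by near: h; apply: dnbhs0_lt; rewrite divr_gt0// ltr_wpDl.
rewrite /= addr0 enorm0 powR0// mul0r subr0 sub0r normrN enormZ.
rewrite powRM ?enorm_ge0// -mulrA -/K normrM (ger0_norm (x := _ * K)); last first.
  by rewrite mulr_ge0 ?powR_ge0.
rewrite normfV.
have hp : `|h| `^ p <= `|h| ^+ 2.
  rewrite -powR_mulrn//; apply: ger_powR; last by lra.
  by rewrite normr_gt0 h0 ltW.
have hn : 0 < `|h| by rewrite normr_gt0.
apply: (@le_trans _ _ (`|h|^-1 * (`|h| ^+ 2 * K))).
  by rewrite ler_wpM2l ?invr_ge0// ler_wpM2r.
have -> : `|h|^-1 * (`|h| ^+ 2 * K) = `|h| * K by field; rewrite gt_eqF.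
have : `|h| * (K + 1) < e by rewrite -ltr_pdivlMr// ltr_wpDl.
by rewrite mulrDr mulr1; lra.
Unshelve. all: by end_near. Qed.

Lemma is_derive_japanese_powR p x w : p != 0 ->
  is_derive x w (fun y => japanese y `^ p / p) (japanese x `^ (p - 2) * dot x w).
Proof.
move=> p0.
have xx : 0 < 1 + dot x x by rewrite ltr_wpDr// dot_ge0.
have -> : (fun y : V => japanese y `^ p / p) = (fun y => (1 + dot y y) `^ (p / 2) / p).
  by apply/funext => y; rewrite japanese_powR.
by rewrite japanese_powR; exact: is_derive_sqr_powR.
Qed.

Let e : V := delta_mx 0 0.

Let dot_e s : dot (s *: e) (s *: e) = s ^+ 2.
Proof. by rewrite dotZl dotZr dot_delta /e !mxE /= mulr1 expr2. Qed.

Lemma powR2_shift p : 2 `^ p = 4 * 2 `^ (p - 2) :> R.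
Proof.
have := @powRD R 2 (p - 2) 2%:R; rewrite subrK pnatr_eq0 implybT => /(_ isT) ->.
by rewrite powR_mulrn// mulrC expr2; congr (_ * _); rewrite -natrM.
Qed.

Lemma enorm_powR_not_quadratic p : 2 < p -> forall k p0 p2 : R,
  (forall x, k * (enorm x `^ (p - 2) * dot x x + 2 * (enorm x `^ p / p)) =
    p0 + p2 * dot x x) -> k = 0.
Proof.
move=> hp k p0 p2 h; have pn : p != 0 by rewrite gt_eqF//; lra.
have ee s : 0 <= s -> enorm (s *: e) = s.
  by move=> s0; rewrite /enorm dot_e sqrtr_sqr ger0_norm.
(* Three points with |x| = 0, 1, 2. The combination with weights 3, -4, 1 kills p0 + p2 |x|^2 and
   leaves a multiple of k (1 + 2 / p) (2^(p-2) - 1). *)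
have h0 := h (0 *: e); have h1 := h (1 *: e); have h2 := h (2 *: e).
rewrite !dot_e !ee// in h0 h1 h2.
rewrite !powR0// ?subr_eq0 ?(gt_eqF hp)// in h0; rewrite !powR1 in h1.
pose tau : R := 2 `^ (p - 2).
have t2 : 2 `^ p = 4 * tau by exact: powR2_shift.
rewrite t2 -/tau in h2.
have tn : tau != 1.
  rewrite powR_eq1 subr_eq0 (gt_eqF hp) orbF negb_or -leNgt ler0n andbT.
  by rewrite gt_eqF// ltr1n.
have : k * (1 + 2 / p) * (tau - 1) = 0.
  have e1 : k * (1 + 2 / p) * (tau - 1) * 4 =
    k * (tau * 2 ^+ 2 + 2 * (4 * tau / p)) - 4 * (k * (1 * 1 ^+ 2 + 2 * (1 / p)))
     + 3 * (k * (0 * 0 ^+ 2 + 2 * (0 / p))) by rewrite expr0n/=; field.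
  have : k * (1 + 2 / p) * (tau - 1) * 4 = 0 by rewrite e1 h0 h1 h2; ring.
  by move/eqP; rewrite mulf_eq0 pnatr_eq0 orbF => /eqP.
move/eqP; rewrite !mulf_eq0 subr_eq0 (negbTE tn) orbF => /orP[/eqP //|].
have : 0 < 2 / p by rewrite divr_gt0//; lra.
by move=> q /eqP; lra.
Qed.

Lemma japanese_powR_not_quadratic p : 1 < p < 2 -> forall k p0 p2 : R,
  (forall x, k * (japanese x `^ (p - 2) * dot x x + 2 * (japanese x `^ p / p)) =
    p0 + p2 * dot x x) -> k = 0.
Proof.
move=> /andP[p1 hp] k p0 p2 h; have pn : p != 0 by rewrite gt_eqF//; lra.
pose x s := Num.sqrt (s ^+ 2 - 1) *: e.
have xx s : 1 <= s -> dot (x s) (x s) = s ^+ 2 - 1.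
  by move=> s1; rewrite dot_e sqr_sqrtr// subr_ge0 expr_ge1//; lra.
have jx s : 1 <= s -> japanese (x s) = s.
  move=> s1; rewrite /japanese enorm_sqr xx// addrC subrK sqrtr_sqr ger0_norm//; lra.
(* Points with <x> = 1, 2, 4, that is |x|^2 = 0, 3, 15; the weights 4, -5, 1 kill p0 + p2 |x|^2. Of
   the factors that remain besides k, tau - 1 is nonzero as p < 2 and the other is positive because
   4 tau = 2^p >= 2. *)
have h0 := h (x 1); have h1 := h (x 2); have h2 := h (x 4).
rewrite !xx ?jx ?ler1n// in h0 h1 h2; rewrite !powR1 in h0.
pose tau : R := 2 `^ (p - 2).
have t2 : 2 `^ p = 4 * tau by exact: powR2_shift.
have f4 r : 4 `^ r = (2 `^ r) * (2 `^ r) :> R.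
  by rewrite -powRM//; congr (_ `^ _); rewrite -natrM.
rewrite !f4 !t2 -/tau in h2; rewrite t2 -/tau in h1.
have t4 : 2 <= 4 * tau by rewrite -t2; apply: le1r_powR; lra.
have tn : tau != 1.
  rewrite powR_eq1 subr_eq0 (lt_eqF hp) orbF negb_or -leNgt ler0n andbT.
  by rewrite gt_eqF// ltr1n.
have q : 0 < 2 / p by rewrite divr_gt0//; lra.
have : k * ((tau - 1) * (15 * tau + 4 * (2 / p) * (4 * tau - 1))) = 0.
  have -> : k * ((tau - 1) * (15 * tau + 4 * (2 / p) * (4 * tau - 1))) =
    k * (tau * tau * (4 ^+ 2 - 1) + 2 * (4 * tau * (4 * tau) / p)) -
    5 * (k * (tau * (2 ^+ 2 - 1) + 2 * (4 * tau / p))) +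
    4 * (k * (1 * (1 ^+ 2 - 1) + 2 * (1 / p))) by field.
  by rewrite h0 h1 h2; ring.
move/eqP; rewrite !mulf_eq0 subr_eq0 (negbTE tn) /= => /orP[/eqP //|/eqP].
have : 0 <= 2 / p * (4 * tau - 1) by rewrite mulr_ge0//; lra.
rewrite -mulrA; lra.
Qed.

Lemma enorm_powR_not_harmonic p x : 2 < p -> x != 0 ->
  enorm (2 *: x) `^ (p - 2) != enorm x `^ (p - 2).
Proof.
move=> hp x0; have e0 := enorm_gt0 x0.
apply: powR_neq => //.
- by rewrite enormZ mulr_gt0// normr_gt0.
- by rewrite subr_eq0 gt_eqF.
- by rewrite enormZ ger0_norm// gt_eqF//; lra.
Qed.

Lemma japanese_powR_not_harmonic p x : p < 2 -> x != 0 ->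
  japanese (2 *: x) `^ (p - 2) != japanese x `^ (p - 2).
Proof.
move=> hp x0; have j0 := japanese_gt0 x.
apply: powR_neq => //; first exact: japanese_gt0.
- by rewrite subr_eq0 lt_eqF.
- apply/eqP => h; have := japanese_sqr (2 *: x); rewrite h japanese_sqr dotZl dotZr.
  have : 0 < dot x x.
    by rewrite lt_neqAle dot_ge0 andbT eq_sym; apply: contra x0 => /eqP /dot_eq0 ->.
  by lra.
Qed.

Lemma continuous_enorm_force p i : 2 < p ->
  continuous (fun x : V => enorm x `^ (p - 2) * x ord0 i).
Proof.
move=> hp x; have FF : Filter (nbhs x) := nbhs_filter x.
have [x0|x0] := eqVneq x 0; last first.
  rewrite /continuous_at; apply: cvgM; last exact: coord_cvg.
  apply: (@cvg_comp _ _ _ (@enorm R 3) (fun t => t `^ (p - 2)) _ (nbhs (enorm x))).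
    exact: continuous_enorm.
  by apply: cvg_powR; exact: enorm_gt0.
rewrite /continuous_at x0 mxE mulr0 -x0.
apply/cvgrPdist_lt => d d0; near=> y.
have y1 : enorm y < 1.
  near: y; have := @continuous_enorm x => /cvgrPdist_lt /(_ 1 ltr01).
  apply: filterS => y; rewrite x0 enorm0 sub0r normrN.
  by apply: le_lt_trans; exact: ler_norm.
have yd : `|y ord0 i| < d.
  near: y; have := coord_cvg (x := x) (i := i) => /cvgrPdist_lt /(_ d d0).
  by apply: filterS => y; rewrite x0 mxE sub0r normrN.
rewrite sub0r normrN normrM; apply: le_lt_trans yd.
rewrite ler_piMl// ger0_norm ?powR_ge0//.
have q0 : 0 <= p - 2 by rewrite subr_ge0 ltW.
have := ge0_ler_powR q0 (x := enorm y) (y := 1); rewrite powR1; apply.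
- by rewrite nnegrE enorm_ge0.
- by rewrite nnegrE.
- exact: ltW.
Unshelve. all: by end_near. Qed.

Lemma continuous_japanese_force p i :
  continuous (fun x : V => japanese x `^ (p - 2) * x ord0 i).
Proof.
move=> x; have FF : Filter (nbhs x) := nbhs_filter x.
rewrite /continuous_at; apply: cvgM; last exact: coord_cvg.
apply: (@cvg_comp _ _ _ (@japanese R 3) (fun t => t `^ (p - 2)) _ (nbhs (japanese x))).
  exact: continuous_japanese.
by apply: cvg_powR; exact: japanese_gt0.
Qed.

End potentials.

(** * Gaussians are entropy-invariant solutions *)

Section exponential_decay.
Context {R : realType}.
Local Notation V := 'rV[R]_3.

(** The n-th power of y / n <= exp(y / n). *)
Lemma exprn_expRN_bound (y : R) (n : nat) : 0 <= y ->
  y ^+ n * expR (- y) <= n%:R ^+ n.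
Proof.
move=> y0; case: n => [|n].
  by rewrite !expr0 mul1r -expR0 ler_expR oppr_le0.
have n0 : 0 < n.+1%:R :> R by [].
have h : y / n.+1%:R <= expR (y / n.+1%:R).
  by apply: le_trans (expR_ge1Dx _); rewrite lerDr.
have h2 : (y / n.+1%:R) ^+ n.+1 <= expR y.
  have -> : expR y = expR (y / n.+1%:R) ^+ n.+1.
    by rewrite -expRM_natl mulrC divfK// gt_eqF.
  by rewrite lerXn2r ?nnegrE ?divr_ge0 ?expR_ge0.
rewrite expRN ler_pdivrMr ?expR_gt0// -ler_pdivrMl ?exprn_gt0//.
by rewrite -exprVn -exprMn mulrC.
Qed.

Lemma affine_expRN_bound (k : nat) (beta a : R) : 0 < beta -> 0 <= a ->
  exists2 C, 0 <= C & forall y, 0 <= y -> (1 + a * y) ^+ k * expR (- beta * y) <= C.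
Proof.
move=> b0 a0; pose c := a / beta + 1.
have c0 : 0 < c by rewrite ltr_wpDl// divr_ge0// ltW.
exists (c ^+ k * (expR 1 * k%:R ^+ k)).
  by rewrite mulr_ge0 ?exprn_ge0 ?(ltW c0)// mulr_ge0 ?expR_ge0 ?exprn_ge0.
move=> y y0; pose w := 1 + beta * y.
have w0 : 0 <= w by rewrite /w addr_ge0// mulr_ge0// ltW.
have h1 : 1 + a * y <= c * w.
  rewrite /c /w mulrDl mul1r mulrDr mulr1 mulrA divfK ?gt_eqF//.
  have : 0 <= a / beta by rewrite divr_ge0// ltW.
  have : 0 <= beta * y by rewrite mulr_ge0// ltW.
  lra.
have h2 : (1 + a * y) ^+ k <= c ^+ k * w ^+ k.
  rewrite -exprMn lerXn2r// ?nnegrE ?mulr_ge0 ?(ltW c0)//.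
  by rewrite addr_ge0// mulr_ge0.
apply: le_trans (ler_wpM2r (expR_ge0 _) h2) _; rewrite -mulrA.
rewrite ler_wpM2l ?exprn_ge0 ?(ltW c0)//.
have -> : expR (- beta * y) = expR 1 * expR (- w).
  by rewrite -expRD /w; congr expR; ring.
rewrite mulrCA ler_wpM2l ?expR_ge0//.
exact: exprn_expRN_bound.
Qed.

Lemma japanese_le_sqr (v : V) k : japanese v ^+ k <= (1 + dot v v) ^+ k.
Proof.
rewrite -japanese_sqr -exprM mul2n -addnn exprD ler_peMl ?exprn_ege1 ?japanese_ge1//.
by rewrite exprn_ge0// ltW// japanese_gt0.
Qed.

Lemma young_dot (al : R) (u v : V) : 0 < al ->
  dot u v <= al / 4 * dot v v + dot u u / al.
Proof.
move=> a0; have := dot_ge0 ((al / 2) *: v - u).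
rewrite !(dotBl, dotBr, dotZl, dotZr) [dot v u]dotC => h.
have -> : al / 4 * dot v v + dot u u / al =
  dot u v + al^-1 * (al / 2 * (al / 2 * dot v v) - al / 2 * dot u v -
    (al / 2 * dot u v - dot u u)) by field; rewrite gt_eqF.
by rewrite lerDl; apply: mulr_ge0; [rewrite invr_ge0 ltW|lra].
Qed.

End exponential_decay.

Section gaussian.
Context {R : realType}.
Local Notation V := 'rV[R]_3.
Context (k al : R) (u : V) (al0 : 0 < al) (k0 : 0 < k).

Definition gaussian (v : V) : R := k * expR (dot u v + - al / 2 * dot v v).

Lemma gaussian_gt0 v : 0 < gaussian v.
Proof. by rewrite mulr_gt0// expR_gt0. Qed.

Lemma gaussian_decay (n : nat) : exists2 C, 0 <= C &
  forall v, japanese v ^+ n * gaussian v <= C.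
Proof.
have [C C0 hC] := @affine_expRN_bound R n (al / 4) 1 (divr_gt0 al0 (ltr0n _ 4)) ler01.
pose K := k * expR (dot u u / al).
have K0 : 0 <= K by rewrite mulr_ge0 ?expR_ge0// ltW.
exists (K * C) => [|v]; first exact: mulr_ge0.
have g : gaussian v <= K * expR (- (al / 4) * dot v v).
  rewrite /gaussian /K -(mulrA k) ler_pM2l// -expRD ler_expR.
  have := young_dot u v al0; lra.
apply: (@le_trans _ _ ((1 + dot v v) ^+ n * (K * expR (- (al / 4) * dot v v)))).
  apply: ler_pM => //; first by rewrite exprn_ge0// ltW// japanese_gt0.
    by rewrite ltW// gaussian_gt0.
  exact: japanese_le_sqr.
rewrite mulrCA ler_wpM2l//; have := hC (dot v v) (dot_ge0 v).
by rewrite mul1r.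
Qed.

Lemma quadratic_gaussian_decay (P : V -> R) (c : R) :
  (forall v, `|P v| <= c * japanese v ^+ 2) ->
  rapidly_decreasing (fun v => P v * gaussian v).
Proof.
move=> hP n; have [C C0 hC] := gaussian_decay (n + 2).
exists (c * C) => v; have g0 := gaussian_gt0 v.
have c0 : 0 <= c.
  have := le_trans (normr_ge0 _) (hP 0).
  by rewrite pmulr_lge0// exprn_gt0// japanese_gt0.
rewrite normrM (gtr0_norm g0).
apply: (@le_trans _ _ (japanese v ^+ n * (c * japanese v ^+ 2 * gaussian v))).
  rewrite ler_wpM2l ?exprn_ge0 ?(ltW (japanese_gt0 _))// ler_wpM2r ?(ltW g0)//.
have -> : japanese v ^+ n * (c * japanese v ^+ 2 * gaussian v) =
  c * (japanese v ^+ (n + 2) * gaussian v) by rewrite exprD; ring.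
by rewrite ler_wpM2l.
Qed.

Lemma is_derive_gaussian v w : is_derive v w gaussian ((dot u w - al * dot v w) * gaussian v).
Proof.
have d1 := is_derive_add (is_derive_dotl u v w)
  (is_derive_mulcl (- al / 2) (is_derive_dot_sqr v w)).
have d2 := @is_derive_outer _ _ expR (fun v => dot u v + - al / 2 * dot v v) v w _ _
  (is_derive_expR _) d1.
by apply: (is_derive_eq (is_derive_mulcl k d2)); rewrite /gaussian; field.
Qed.

Definition gaussian_partial (i : 'I_3) (v : V) : R :=
  (u ord0 i - al * v ord0 i) * gaussian v.

Lemma partial_gaussian i : partial i gaussian = gaussian_partial i.
Proof.
apply/funext => v; rewrite /partial (@derive_val _ _ _ _ _ _ _ (is_derive_gaussian v _)).
by rewrite !dot_delta.
Qed.

Lemma is_derive_coord i v w : is_derive v w (fun v : V => v ord0 i) (w ord0 i).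
Proof.
rewrite -(dot_delta w i) dotC (_ : (fun v : V => _) = (fun v => dot (delta_mx 0 i) v)).
  exact: is_derive_dotl.
by apply/funext => x; rewrite dotC dot_delta.
Qed.

Definition gaussian_partial2 (i j : 'I_3) (v : V) : R :=
  ((u ord0 i - al * v ord0 i) * (u ord0 j - al * v ord0 j) - al * (i == j)%:R) * gaussian v.

Lemma is_derive_gaussian_partial i j v :
  is_derive v (delta_mx 0 j) (gaussian_partial i) (gaussian_partial2 i j v).
Proof.
have d1 := is_derive_sub (is_derive_cst (u ord0 i) v (delta_mx 0 j))
  (is_derive_mulcl al (is_derive_coord i v (delta_mx 0 j))).
have d2 := is_derive_gaussian v (delta_mx 0 j).
apply: (is_derive_eq (is_deriveM d1 d2)).
rewrite -![_ *: _]/(_ * _) !dot_delta !mxE eqxx /= /gaussian_partial2 /cst; ring.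
Qed.

Lemma partial_gaussian_partial i j :
  partial j (gaussian_partial i) = gaussian_partial2 i j.
Proof.
by apply/funext => v; exact: (@derive_val _ _ _ _ _ _ _ (is_derive_gaussian_partial i j v)).
Qed.

Lemma continuous_gaussian : continuous gaussian.
Proof.
move=> v; have FF : Filter (nbhs v) := nbhs_filter v.
rewrite /continuous_at /gaussian; apply: cvgM; first exact: cvg_cst.
apply: (@cvg_comp _ _ _ (fun v => dot u v + - al / 2 * dot v v) expR _
  (nbhs (dot u v + - al / 2 * dot v v))); last exact: continuous_expR.
apply: cvgD; first exact: (cvg_dot (cvg_cst u) cvg_id).
by apply: cvgM; [exact: cvg_cst|exact: (cvg_dot cvg_id cvg_id)].
Qed.

Lemma continuous_gaussian_partial2 i j : continuous (gaussian_partial2 i j).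
Proof.
move=> v; have FF : Filter (nbhs v) := nbhs_filter v.
rewrite /continuous_at /gaussian_partial2; apply: cvgM; last exact: continuous_gaussian.
have l m : (fun v : V => u ord0 m - al * v ord0 m) @ v --> u ord0 m - al * v ord0 m.
  by apply: cvgB; [exact: cvg_cst|apply: cvgM; [exact: cvg_cst|exact: coord_cvg]].
by apply: cvgB; [apply: cvgM; exact: l|exact: cvg_cst].
Qed.

Lemma C2_gaussian : C2_rapidly_decreasing gaussian.
Proof.
have cb i (v : V) : `|u ord0 i - al * v ord0 i| <= (enorm u + al) * japanese v.
  have j1 := japanese_ge1 v; have h1 := coord_le_enorm u i; have h2 := coord_le_enorm v i.
  have h3 := enorm_le_japanese v; have u0 := enorm_ge0 u.
  apply: le_trans (ler_normB _ _) _; rewrite normrM (gtr0_norm al0).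
  rewrite mulrDl; apply: lerD.
    by apply: le_trans h1 _; rewrite ler_peMr.
  by rewrite ler_pM2l// (le_trans h2).
split.
- by move=> i v; apply: ex_derive; exact: is_derive_gaussian.
- move=> i j v; rewrite partial_gaussian; apply: ex_derive.
  exact: is_derive_gaussian_partial.
- move=> i j; rewrite partial_gaussian partial_gaussian_partial.
  exact: continuous_gaussian_partial2.
- rewrite (_ : gaussian = (fun v => 1 * gaussian v)); last first.
    by apply/funext => v; rewrite mul1r.
  apply: (@quadratic_gaussian_decay (fun _ => 1) 1) => v.
  by rewrite normr1 mul1r exprn_ege1// japanese_ge1.
- move=> i; rewrite partial_gaussian.
  apply: (@quadratic_gaussian_decay (fun v => u ord0 i - al * v ord0 i) (enorm u + al)) => v.
  apply: le_trans (cb i v) _; rewrite ler_wpM2l ?addr_ge0 ?enorm_ge0 ?(ltW al0)//.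
  by rewrite expr2 ler_peMr ?japanese_ge1// ltW// japanese_gt0.
- move=> i j; rewrite partial_gaussian.
  rewrite partial_gaussian_partial.
  apply: (@quadratic_gaussian_decay (fun v => (u ord0 i - al * v ord0 i) *
    (u ord0 j - al * v ord0 j) - al * (i == j)%:R) ((enorm u + al) ^+ 2 + al)) => v.
  apply: le_trans (ler_normB _ _) _; rewrite [leRHS]mulrDl; apply: lerD.
    by rewrite normrM -exprMn expr2 ler_pM.
  rewrite normrM (gtr0_norm al0) ler_pM2l//.
  apply: (@le_trans _ _ 1); last by rewrite exprn_ege1// japanese_ge1.
  by case: (i == j); rewrite ?normr1 ?normr0.
Qed.

Lemma gaussian_log : slowly_growing_log gaussian.
Proof.
exists (`|ln k| + enorm u + al), 2%N => v.
rewrite /gaussian lnM ?posrE ?expR_gt0// expRK.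
have j1 := japanese_ge1 v; have j2 := japanese_sqr v; have d0 := dot_ge0 v.
have h1 := cauchy_schwarz u v; have h3 := enorm_le_japanese v; have u0 := enorm_ge0 u.
have J1 : 1 <= japanese v ^+ 2 by rewrite exprn_ege1.
have J2 : japanese v <= japanese v ^+ 2 by rewrite expr2 ler_peMr// ltW// japanese_gt0.
apply: le_trans (ler_normD _ _) _; rewrite -addrA mulrDl; apply: lerD.
  by rewrite ler_peMr.
apply: le_trans (ler_normD _ _) _; rewrite mulrDl; apply: lerD.
  apply: le_trans h1 _; rewrite ler_wpM2l//; exact: le_trans J2.
have -> : - al / 2 * dot v v = - (al / 2 * dot v v) by ring.
rewrite normrN normrM (ger0_norm d0) ger0_norm ?divr_ge0 ?(ltW al0)//.
rewrite j2 -mulrA ler_pM2l//; lra.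
Qed.

End gaussian.

Section adjoint.
Context {R : realType}.
Local Notation V := 'rV[R]_3.

Lemma dot_mx (x y : V) : dot x y = (x *m y^T) ord0 ord0.
Proof. by rewrite mxE; apply: eq_bigr => i _; rewrite mxE. Qed.

Lemma dot_mulmxl (x y : V) (B : 'M[R]_3) : dot (x *m B) y = dot x (y *m B^T).
Proof. by rewrite !dot_mx trmx_mul trmxK mulmxA. Qed.

Lemma dot_skew (x : V) (A : 'M[R]_3) : A^T = - A -> dot (x *m A^T) x = 0.
Proof.
move=> AT; have := dot_mulmxl x x A^T.
rewrite trmxK -[A in RHS]opprK -AT mulmxN dotNr dotC => h; lra.
Qed.

Lemma mulmx_coord (x : V) (B : 'M[R]_3) l : (x *m B^T) ord0 l = dot x (row l B).
Proof. by rewrite mxE; apply: eq_bigr => i _; rewrite !mxE. Qed.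

Lemma measurable_mulmx (B : 'M[R]_3) : measurable_fun setT (fun x : V => x *m B^T).
Proof.
apply: measurable_fun_rV => l.
rewrite (_ : _ \o _ = (fun x : V => dot x (row l B))); last first.
  by apply/funext => x; rewrite /= /rV_coord mulmx_coord.
by apply: measurable_dot; [exact: measurable_id|exact: measurable_cst].
Qed.

Lemma time_within_proper (t : R) : 0 <= t ->
  ProperFilter (within [set h : R | 0 <= t + h] (0 : R)^').
Proof.
move=> t0; apply: Build_ProperFilter_ex => P.
rewrite /within /= => hP.
have n : \forall h \near (0 : R)^'+, 0 <= t + h -> P h.
  move: hP; rewrite /dnbhs /at_right !near_withinE; apply: filterS => h hh h0.
  by apply: hh; rewrite gt_eqF.
have [h hh] : exists h : R, 0 < h /\ (0 <= t + h -> P h).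
  apply: (@filter_ex _ (0 : R)^'+); near=> h; split.
    by near: h; exact: nbhs_right_gt.
  by near: h.
exists h; apply: hh.2; have := hh.1; lra.
Unshelve. all: by end_near. Qed.

Lemma time_quotient_cst (f : R -> R) (t c : R) : 0 <= t ->
  (forall s, 0 <= s -> f s = c) -> time_quotient f t --> (0 : R).
Proof.
move=> t0 fc; rewrite /time_quotient.
have PF := time_within_proper t0.
apply: cvg_near_cst; rewrite near_withinE; apply: nearW => h /= th.
by rewrite !fc// subrr mulr0.
Qed.

Lemma time_derivative_cst (f : R -> R) (t c : R) : 0 <= t ->
  (forall s, 0 <= s -> f s = c) -> time_derivative f t = 0.
Proof.
move=> t0 fc; have PF := time_within_proper t0.
by apply: cvg_lim => //; exact: time_quotient_cst fc.
Qed.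

Lemma continuous_phase_stationary (g : R -> V -> V -> R) (H : V -> V -> R) :
  (forall t x v, 0 <= t -> g t x v = H x v) ->
  (forall z : R * V * V, H p.1.2 p.2 @[p --> z] --> H z.1.2 z.2) ->
  continuous_phase g.
Proof.
move=> gH cH; apply/subspace_continuousP => z /= z0.
rewrite /from_subspace gH//.
have h : H p.1.2 p.2 @[p --> within [set z : R * V * V | 0 <= z.1.1] (nbhs z)] -->
    H z.1.2 z.2 by apply: cvg_within_filter; exact: cH.
apply: cvg_trans h; apply: near_eq_cvg; rewrite near_withinE.
by apply: nearW => p p0; rewrite gH.
Qed.

Lemma measurable_energy_density (Phi : V -> R) (m al : R) (A : 'M[R]_3) :
  measurable_fun setT Phi -> measurable_fun setT
  (fun z : V * V => (Phi z.1 + enorm z.2 ^+ 2 + 1) *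
    (m * expR (- al * (Phi z.1 + enorm z.2 ^+ 2 / 2) + dot (z.1 *m A^T) z.2))).
Proof.
move=> mP; have mPhi : measurable_fun setT (fun z : V * V => Phi z.1).
  exact: (measurableT_comp mP measurable_fst).
have me : measurable_fun setT (fun z : V * V => enorm z.2 ^+ 2).
  by apply: measurable_funX; exact: (measurable_enorm_comp measurable_snd).
apply: measurable_funM.
  apply: measurable_funD; last exact: measurable_cst.
  exact: measurable_funD.
apply: measurable_funM; first exact: measurable_cst.
apply: (measurableT_comp (@measurable_expR R)).
apply: measurable_funD; last first.
  apply: measurable_dot; last exact: measurable_snd.
  exact: (measurableT_comp (measurable_mulmx A) measurable_fst).
apply: measurable_funM; first exact: measurable_cst.
apply: measurable_funD; first exact: mPhi.
by apply: measurable_funM; [exact: me|exact: measurable_cst].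
Qed.

End adjoint.

Section converse.
Context {R : realType}.
Local Notation V := 'rV[R]_3.
Implicit Types (x y v w : V) (s t : R).
Context (gamma : R) (b : R -> R).
Context (Phi vp : V -> R).
Context (Phi_derive : forall x w, is_derive x w Phi (vp x * dot x w)).
Context (force_continuous : forall i, continuous (fun x : V => vp x * x ord0 i)).
Context (Phi_ge0 : forall x, 0 <= Phi x).
Context (K : R) (K_gt0 : 0 < K) (Phi_growth : forall x, japanese x <= K * (1 + Phi x)).
Context (m al : R) (A : 'M[R]_3) (m0 : 0 < m) (al0 : 0 < al) (AT : A^T = - A).
(** The left side is what [young_dot] produces from the rotation term. Half of alpha Phi absorbs it,
    and the other half is kept for integrability in x. *)
Context (K2 : R) (rotation_bound : forall x,
  dot (x *m A^T) (x *m A^T) / al <= al / 2 * Phi x + K2).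

Let S x : V := x *m A^T.

Let G x v : R := m * expR (- al * (Phi x + enorm v ^+ 2 / 2) + dot (S x) v).

Let G_gt0 x v : 0 < G x v.
Proof. by rewrite mulr_gt0// expR_gt0. Qed.

Let GE x v : G x v = gaussian (m * expR (- al * Phi x)) al (S x) v.
Proof.
rewrite /G /gaussian -mulrA -expRD; congr (_ * expR _).
by rewrite enorm_sqr; field.
Qed.

Let continuous_Phi : continuous Phi.
Proof.
apply: C1_continuous_fun; apply: (@C1_intro _ _ (fun i x => vp x * x ord0 i)) => //.
by move=> i x; apply: (is_derive_eq (Phi_derive x _)); rewrite dot_delta.
Qed.

Let is_derive_Gx x v w : is_derive x w (fun y => G y v)
  ((- al * (vp x * dot x w) + dot (S w) v) * G x v).
Proof.
have d1 : is_derive x w (fun y => dot (S y) v) (dot (S w) v).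
  have -> : (fun y => dot (S y) v) = (fun y => dot (v *m A) y).
    by apply/funext => y; rewrite /S dot_mulmxl trmxK dotC.
  by rewrite /S dot_mulmxl trmxK dotC; exact: is_derive_dotl.
have d2 := is_derive_add (is_derive_mulcl (- al) (is_derive_add (Phi_derive x w)
   (is_derive_cst (enorm v ^+ 2 / 2) x w))) d1.
have d3 := @is_derive_outer _ _ expR
  (fun y => - al * (Phi y + cst (enorm v ^+ 2 / 2) y) + dot (S y) v) x w _ _
  (is_derive_expR _) d2.
by apply: (is_derive_eq (is_derive_mulcl m d3)); rewrite /G /cst; ring.
Qed.

Let cvg_S (T : Type) (F : set_system T) (FF : Filter F) (f : T -> V) x i :
  f @ F --> x -> S (f p) ord0 i @[p --> F] --> S x ord0 i.
Proof.
move=> hf; rewrite /S mulmx_coord (_ : (fun p => _) = (fun p : T => dot (f p) (row i A))).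
  exact: (cvg_dot_filter hf (cvg_cst _)).
by apply/funext => p; rewrite mulmx_coord.
Qed.

Let cvg_dotS (T : Type) (F : set_system T) (FF : Filter F) (f g : T -> V) x v :
  f @ F --> x -> g @ F --> v -> dot (S (f p)) (g p) @[p --> F] --> dot (S x) v.
Proof.
move=> hf hg.
have ci i : (fun p => g p ord0 i) @ F --> v ord0 i.
  apply: (@cvg_comp _ _ _ g (fun y : V => y ord0 i) _ (nbhs v)) => //.
  exact: coord_cvg.
rewrite dot3 (_ : (fun p => _) = (fun p : T => S (f p) ord0 0 * g p ord0 0 +
  S (f p) ord0 1 * g p ord0 1 + S (f p) ord0 2%:R * g p ord0 2%:R)); last first.
  by apply/funext => p; rewrite dot3.
by apply: cvgD; [apply: cvgD|]; apply: cvgM; (exact: cvg_S || exact: ci).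
Qed.

Let cvg_G (T : Type) (F : set_system T) (FF : Filter F) (f g : T -> V) x v :
  f @ F --> x -> g @ F --> v -> G (f p) (g p) @[p --> F] --> G x v.
Proof.
move=> hf hg; rewrite /G; apply: cvgM; first exact: cvg_cst.
apply: (@cvg_comp _ _ _ (fun p => - al * (Phi (f p) + enorm (g p) ^+ 2 / 2) +
  dot (S (f p)) (g p)) expR _ (nbhs (- al * (Phi x + enorm v ^+ 2 / 2) + dot (S x) v)));
  last exact: continuous_expR.
apply: cvgD; last exact: cvg_dotS.
apply: cvgM; first exact: cvg_cst.
apply: cvgD.
  by apply: (@cvg_comp _ _ _ f Phi _ (nbhs x)) => //; exact: continuous_Phi.
apply: cvgM; last exact: cvg_cst.
rewrite enorm_sqr (_ : (fun p => _) = (fun p : T => dot (g p) (g p))).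
  exact: cvg_dot_filter.
by apply/funext => p; rewrite enorm_sqr.
Qed.

Let Gx i x v : R := (- al * (vp x * x ord0 i) + dot (S (delta_mx 0 i)) v) * G x v.

Let Gv i x v : R := (S x ord0 i - al * v ord0 i) * G x v.

Let partial_Gx i x v : partial i (fun y => G y v) x = Gx i x v.
Proof.
rewrite /partial (@derive_val _ _ _ _ _ _ _ (is_derive_Gx x v _)) dot_delta.
by [].
Qed.

Let partial_Gv i x v : partial i (G x) v = Gv i x v.
Proof.
have -> : G x = gaussian (m * expR (- al * Phi x)) al (S x).
  by apply/funext => w; exact: GE.
by rewrite partial_gaussian /gaussian_partial /Gv GE.
Qed.

Let cvg_Gx (T : Type) (F : set_system T) (FF : Filter F) (f g : T -> V) i x v :
  f @ F --> x -> g @ F --> v -> Gx i (f p) (g p) @[p --> F] --> Gx i x v.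
Proof.
move=> hf hg; rewrite /Gx; apply: cvgM; last exact: cvg_G.
apply: cvgD; last exact: (cvg_dot_filter (cvg_cst _) hg).
apply: cvgM; first exact: cvg_cst.
by apply: (@cvg_comp _ _ _ f (fun x => vp x * x ord0 i) _ (nbhs x)) => //;
  exact: force_continuous.
Qed.

Let cvg_Gv (T : Type) (F : set_system T) (FF : Filter F) (f g : T -> V) i x v :
  f @ F --> x -> g @ F --> v -> Gv i (f p) (g p) @[p --> F] --> Gv i x v.
Proof.
move=> hf hg; rewrite /Gv; apply: cvgM; last exact: cvg_G.
apply: cvgB; first exact: cvg_S.
apply: cvgM; first exact: cvg_cst.
by apply: (@cvg_comp _ _ _ g (fun y : V => y ord0 i) _ (nbhs v)) => //; exact: coord_cvg.
Qed.

Let C1_Gx v : C1 (fun y => G y v).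
Proof.
apply: (@C1_intro _ _ (fun i x => Gx i x v)).
  by move=> i x; apply: (is_derive_eq (is_derive_Gx x v _)); rewrite dot_delta.
move=> i x; have FF : Filter (nbhs x) := nbhs_filter x.
exact: (cvg_Gx _ cvg_id (cvg_cst v)).
Qed.

Context (M : R -> V -> V -> R) (ME : forall t x v, 0 <= t -> M t x v = G x v).

Let C1_M : C1_phase M.
Proof.
have fstx (z : R * V * V) : p.1.2 @[p --> z] --> z.1.2.
  by apply: (@cvg_comp _ _ _ fst snd _ (nbhs z.1)); [exact: cvg_fst|exact: cvg_snd].
have sndv (z : R * V * V) : p.2 @[p --> z] --> z.2 by exact: cvg_snd.
split.
- move=> t x v t0; split.
    by apply/cvg_ex; exists 0; apply: (time_quotient_cst t0) => s s0; exact: ME.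
  move=> i; split.
    rewrite (_ : (fun y => M t y v) = (fun y => G y v)).
      by apply: ex_derive; exact: is_derive_Gx.
    by apply/funext => y; exact: ME.
  rewrite (_ : M t x = gaussian (m * expR (- al * Phi x)) al (S x)).
    by apply: ex_derive; exact: is_derive_gaussian.
  by apply/funext => w; rewrite ME// GE.
- apply: (continuous_phase_stationary ME) => z.
  exact: (cvg_G _ (fstx z) (sndv z)).
- apply: (@continuous_phase_stationary _ _ (fun _ _ => 0)).
    by move=> t x v t0; apply: (time_derivative_cst t0) => s s0; exact: ME.
  by move=> z; exact: cvg_cst.
- move=> i; apply: (@continuous_phase_stationary _ _ (Gx i)).
    move=> t x v t0; rewrite (_ : (fun y => M t y v) = (fun y => G y v)) ?partial_Gx//.
    by apply/funext => y; exact: ME.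
  by move=> z; apply: cvg_Gx; [exact: fstx|exact: sndv].
- move=> i; apply: (@continuous_phase_stationary _ _ (Gv i)).
    move=> t x v t0; rewrite (_ : M t x = G x) ?partial_Gv//.
    by apply/funext => w; exact: ME.
  by move=> z; apply: cvg_Gv; [exact: fstx|exact: sndv].
Qed.

Let energy_bound : exists2 C, 0 <= C & forall x v,
  (Phi x + enorm v ^+ 2 + 1) * G x v <= C * japanese x ^- 6 * japanese v ^- 6.
Proof.
(* Seven powers of 1 + Phi: one from the energy, six to bound <x>^6 through [Phi_growth]. Four
   powers of 1 + |v|^2: one from the energy, three for <v>^6. *)
have [Ca Ca0 ha] := @affine_expRN_bound R 7 (al / 2) 1 (divr_gt0 al0 (ltr0n _ 2)) ler01.
have [Cb Cb0 hb] := @affine_expRN_bound R 4 (al / 4) 1 (divr_gt0 al0 (ltr0n _ 4)) ler01.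
pose C := m * expR K2 * K ^+ 6 * Ca * Cb.
have C0 : 0 <= C by rewrite !mulr_ge0 ?exprn_ge0 ?expR_ge0// ltW.
exists C => // x v.
have jx := japanese_gt0 x; have jv := japanese_gt0 v.
have F0 := Phi_ge0 x; have d0 := dot_ge0 v.
have g : G x v <= m * expR K2 * expR (- (al / 2) * Phi x) * expR (- (al / 4) * dot v v).
  rewrite /G -(mulrA m) -(mulrA m) ler_pM2l// -!expRD ler_expR enorm_sqr.
  have h1 := young_dot (S x) v al0; have h2 := rotation_bound x.
  rewrite -/(S x) in h2; lra.
have h1 : (1 + Phi x) * japanese x ^+ 6 * expR (- (al / 2) * Phi x) <= K ^+ 6 * Ca.
  have h := ha (Phi x) F0; rewrite mul1r in h.
  apply: (@le_trans _ _ (K ^+ 6 * ((1 + Phi x) ^+ 7 * expR (- (al / 2) * Phi x)))); last first.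
    by rewrite ler_wpM2l// exprn_ge0// ltW.
  have -> : K ^+ 6 * ((1 + Phi x) ^+ 7 * expR (- (al / 2) * Phi x)) =
      (1 + Phi x) * (K * (1 + Phi x)) ^+ 6 * expR (- (al / 2) * Phi x).
    by rewrite (exprMn _ K (1 + Phi x)); ring.
  rewrite ler_wpM2r ?expR_ge0// ler_wpM2l ?addr_ge0//.
  rewrite lerXn2r ?nnegrE//; first exact: ltW.
  by rewrite mulr_ge0 ?addr_ge0// ltW.
have h2 : (1 + dot v v) * japanese v ^+ 6 * expR (- (al / 4) * dot v v) <= Cb.
  have h := hb (dot v v) d0; rewrite mul1r in h.
  apply: le_trans h; rewrite ler_wpM2r ?expR_ge0//.
  by rewrite (exprM _ 2 3) japanese_sqr -exprS.
have hE : Phi x + enorm v ^+ 2 + 1 <= (1 + Phi x) * (1 + dot v v).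
  rewrite enorm_sqr; have : 0 <= Phi x * dot v v by rewrite mulr_ge0.
  lra.
rewrite ler_pdivlMr ?exprn_gt0// ler_pdivlMr ?exprn_gt0//.
apply: (@le_trans _ _ ((1 + Phi x) * (1 + dot v v) *
   (m * expR K2 * expR (- (al / 2) * Phi x) * expR (- (al / 4) * dot v v)) *
   japanese v ^+ 6 * japanese x ^+ 6)).
  rewrite ler_wpM2r ?exprn_ge0 ?(ltW jx)// ler_wpM2r ?exprn_ge0 ?(ltW jv)//.
  apply: ler_pM => //; last by rewrite ltW// G_gt0.
  by rewrite !addr_ge0// sqr_ge0.
have -> : (1 + Phi x) * (1 + dot v v) *
   (m * expR K2 * expR (- (al / 2) * Phi x) * expR (- (al / 4) * dot v v)) *
   japanese v ^+ 6 * japanese x ^+ 6 = (m * expR K2) *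
   (((1 + Phi x) * japanese x ^+ 6 * expR (- (al / 2) * Phi x)) *
    ((1 + dot v v) * japanese v ^+ 6 * expR (- (al / 4) * dot v v))) by ring.
have -> : C = (m * expR K2) * ((K ^+ 6 * Ca) * Cb) by rewrite /C; ring.
rewrite ler_wpM2l ?mulr_ge0 ?expR_ge0 ?(ltW m0)//.
have p0 : 0 <= (1 + Phi x) * japanese x ^+ 6 * expR (- (al / 2) * Phi x).
  by rewrite mulr_ge0 ?expR_ge0// mulr_ge0 ?exprn_ge0 ?addr_ge0 ?(ltW jx).
have q0 : 0 <= (1 + dot v v) * japanese v ^+ 6 * expR (- (al / 4) * dot v v).
  by rewrite mulr_ge0 ?expR_ge0// mulr_ge0 ?exprn_ge0 ?addr_ge0 ?(ltW jv).
exact: ler_pM.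
Qed.

Let measurable_energy : measurable_fun setT
  (fun z : V * V => (Phi z.1 + enorm z.2 ^+ 2 + 1) * G z.1 z.2).
Proof. exact: (measurable_energy_density _ _ _ (continuous_measurable_rV continuous_Phi)). Qed.

Let energy : (\int[lebesgue3 \x lebesgue3]_z
  ((Phi z.1 + enorm z.2 ^+ 2 + 1) * G z.1 z.2)%:E < +oo)%E.
Proof.
have [C C0 hC] := energy_bound.
have j0 (v : V) : 0 <= japanese v ^- 6 by rewrite invr_ge0 exprn_ge0// sqrtr_ge0.
have mj := @measurable_japaneseV R 3 6.
have [J J0 Je] := ge0_integral_fin j0 integral_japanese_lty.
have F0 (z : V * V) : 0 <= (Phi z.1 + enorm z.2 ^+ 2 + 1) * G z.1 z.2.
  by rewrite mulr_ge0 ?addr_ge0 ?sqr_ge0// ltW// G_gt0.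
have CJ0 : 0 <= C * J by exact: mulr_ge0.
apply: (@le_lt_trans _ _ (\int[lebesgue3]_x (C * J * japanese (x : V) ^- 6)%:E)%E).
  apply: (@integral_product_le _ _ _ _ R lebesgue3 lebesgue3
    (fun z => (Phi z.1 + enorm z.2 ^+ 2 + 1) * G z.1 z.2)
    (fun x => C * J * japanese x ^- 6)).
  - exact: measurable_energy.
  - exact: F0.
  - by apply: measurable_funM; [exact: measurable_cst|exact: mj].
  - by move=> x; exact: mulr_ge0.
  - move=> x /=; have Cx0 : 0 <= C * japanese x ^- 6 by exact: mulr_ge0.
    apply: (@le_trans _ _ (\int[lebesgue3]_v (C * japanese x ^- 6 * japanese (v : V) ^- 6)%:E)%E).
      apply: ge0_le_integral.
      + exact: measurableT.
      + by move=> v _; rewrite lee_fin; exact: (F0 (x, v)).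
      + apply/measurable_EFinP.
        exact: (measurableT_comp measurable_energy (measurable_pair1 x)).
      + apply/measurable_EFinP.
        by apply: measurable_funM; [exact: measurable_cst|exact: mj].
      + by move=> v _; rewrite lee_fin; exact: hC.
    rewrite (ge0_integralZl_real _ mj j0 Cx0) Je -EFinM lee_fin.
    by rewrite mulrAC.
rewrite (ge0_integralZl_real _ mj j0 CJ0) lte_mul_pinfty ?lee_fin//.
exact: integral_japanese_lty.
Qed.

(** At fixed x, log G is a combination of the collision invariants 1, v and |v|^2. *)
Let collision_zero x v w (s : V) : S2 s ->
  G x (post_star v w s) * G x (post v w s) = G x w * G x v.
Proof.
move=> s1.
have E (a c : V) : G x a * G x c = m * m * expR (- al * 2 * Phi x +
    - al / 2 * (dot a a + dot c c) + dot (S x) (a + c)).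
  rewrite /G mulrACA -expRD; congr (_ * expR _).
  by rewrite !enorm_sqr dotDr; field.
have e1 : dot (post_star v w s) (post_star v w s) + dot (post v w s) (post v w s) =
    dot w w + dot v v.
  have ss := S2_dot s1; have ee := enorm_sqr (v - w).
  rewrite /post_star /post; set r := enorm (v - w) in ee *.
  rewrite !(dotDl, dotDr, dotNl, dotNr, dotBl, dotBr, dotZl, dotZr) ss.
  rewrite !(dotBl, dotBr) [dot w v]dotC in ee.
  rewrite [dot w v]dotC [dot s v]dotC [dot s w]dotC.
  apply/eqP; rewrite -subr_eq0; apply/eqP.
  transitivity ((r ^+ 2 - (dot v v - dot v w - (dot v w - dot w w))) / 2); first by field.
  by rewrite ee subrr mul0r.
have e2 : post_star v w s + post v w s = w + v.
  by rewrite /post_star /post; apply/rowP => i; rewrite !mxE; field.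
by rewrite (E (post_star v w s) (post v w s)) (E w v) e1 e2.
Qed.

Lemma gaussian_entropy_invariant : entropy_invariant gamma b Phi M.
Proof.
have MG t x : 0 <= t -> M t x = G x by move=> t0; apply/funext => v; exact: ME.
split.
- by move=> t x v t0; rewrite ME.
- split; first exact: C1_M.
  move=> t x t0; have -> : M t x = gaussian (m * expR (- al * Phi x)) al (S x).
    by apply/funext => v; rewrite ME// GE.
  have k0 : 0 < m * expR (- al * Phi x) by rewrite mulr_gt0// expR_gt0.
  by split; [exact: C2_gaussian|exact: gaussian_log].
- move=> t t0; apply: le_lt_trans energy.
  rewrite (_ : (fun z : V * V => _) =
    (fun z : V * V => ((Phi z.1 + enorm z.2 ^+ 2 + 1) * G z.1 z.2)%:E))//.
  by apply/funext => z; rewrite ME.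
- move=> t x v t0; have H s : 0 <= s -> M s x v = G x v by exact: ME.
  rewrite (time_derivative_cst t0 H).
  rewrite (_ : (fun y => M t y v) = (fun y => G y v)); last first.
    by apply/funext => y; exact: ME.
  have h := C1_is_derive x v (C1_Gx v).
  rewrite -(@derive_val _ _ _ _ _ _ _ h) (@derive_val _ _ _ _ _ _ _ (is_derive_Gx x v v)).
  rewrite (gradient_Phi Phi_derive) dotZl (MG t x t0).
  have -> : dot x (gradient (G x) v) = (dot x (S x) - al * dot x v) * G x v.
    have gE i : gradient (G x) v ord0 i = Gv i x v by rewrite mxE partial_Gv.
    by rewrite !dot3 !gE /Gv; ring.
  (* Skewness annihilates S x . x and S v . v; the two terms in vp(x) x.v cancel each other. *)
  rewrite [dot x (S x)]dotC /S !(dot_skew _ AT); ring.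
- move=> t x v t0; rewrite (MG t x t0).
  have Z n z : (setT `*` @S2 R) z ->
      collision_integrand gamma (truncate b n) (G x) (G x) v z = 0.
    by move=> [_ s1]; rewrite /collision_integrand collision_zero// subrr mulr0.
  have mS : measurable (setT `*` S2 : set (V * V)).
    by apply: measurableX => //; exact: measurable_unit_sphere.
  split.
    move=> n; apply: (eq_integrable mS (cst 0%E)).
      by move=> z /set_mem zS; rewrite /= Z.
    exact: integrable0.
  rewrite (_ : (fun n => _) = (fun _ : nat => 0%E)); first exact: cvg_cst.
  apply/funext => n; apply: integral0_eq => z zS.
  by rewrite Z.
Qed.

End converse.

(** * Finite energy excludes rotation *)

Section infinite_energy.
Context {R : realType}.
Local Notation V := 'rV[R]_3.
Local Notation leb := (@lebesgue_measure R).
Implicit Types (x y v : V).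

(* Completing the square in v: the weight at x is the Gaussian centered at
   S x / al, with mass proportional to exp(|S x|^2 / (2 al) - al Phi x). *)
Lemma energy_infinite (Phi : V -> R) (m al : R) (A : 'M[R]_3) (B : set V) :
  measurable_fun setT Phi -> (forall x, 0 <= Phi x) -> 0 < m -> 0 < al ->
  measurable B -> lebesgue3 B = +oo%E ->
  (forall x, B x -> al * Phi x <= dot (x *m A^T) (x *m A^T) / (2 * al)) ->
  (\int[lebesgue3 \x lebesgue3]_z ((Phi z.1 + enorm z.2 ^+ 2 + 1) *
    (m * expR (- al * (Phi z.1 + enorm z.2 ^+ 2 / 2) + dot (z.1 *m A^T) z.2)))%:E)%E = +oo%E.
Proof.
move=> mPhi Phi0 m0 al0 mB Boo hB.
pose S x : V := x *m A^T.
pose f (z : V * V) : R := (Phi z.1 + enorm z.2 ^+ 2 + 1) *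
    (m * expR (- al * (Phi z.1 + enorm z.2 ^+ 2 / 2) + dot (z.1 *m A^T) z.2)).
have mf : measurable_fun setT f by exact: measurable_energy_density.
have f0 z : 0 <= f z.
  by rewrite /f mulr_ge0 ?addr_ge0 ?sqr_ge0// mulr_ge0 ?expR_ge0// ltW.
pose U (x v : V) : V := v + al^-1 *: S x.
have mU : measurable_fun setT (fun y : V * V => U y.1 y.2).
  apply: measurable_rVD; first exact: measurable_snd.
  apply: measurable_rVZ; first exact: measurable_cst.
  exact: (measurableT_comp (measurable_mulmx A) measurable_fst).
have pT : preserving (lebesgue3 \x lebesgue3)%E (skew id U).
  apply: preserving_skew; [by split|exact: mU|].
  by move=> x; exact: preserving_lebesgue3D.
(* After centring, the exponent is |S x|^2 / (2 al) - al Phi x - al |v|^2 / 2. It is at least - al /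
   2 for x in [B] and |v| <= 1, so the integrand is bounded below by [c] on a set of infinite
   measure. *)
pose c : R := m * expR (- (al / 2)).
have c0 : 0 < c by rewrite mulr_gt0// expR_gt0.
have mU1 : measurable (@unit_ball R) by exact: measurable_ball.
have mD : measurable (B `*` @unit_ball R) by exact: measurableX.
have mf' : measurable_fun setT (EFin \o f) by apply/measurable_EFinP.
have f0' (z : V * V) : (0 <= (EFin \o f) z)%E by rewrite lee_fin.
have e := ge0_integral_preserving pT mf' f0'.
apply/eqP; rewrite eq_le leey /= -[leRHS]e {e}.
apply: (@le_trans _ _ (\int[lebesgue3 \x lebesgue3]_(z in B `*` @unit_ball R) (cst c%:E) z)%E).
  have -> : (\int[lebesgue3 \x lebesgue3]_(z in B `*` @unit_ball R) (cst c%:E) z =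
      c%:E * (lebesgue3 \x lebesgue3) (B `*` @unit_ball R))%E by exact: integral_cst.
  have -> : ((lebesgue3 \x lebesgue3) (B `*` @unit_ball R) =
      lebesgue3 B * lebesgue3 (@unit_ball R))%E by exact: product_measure1E.
  by rewrite Boo gt0_mulye ?lebesgue3_unit_ball_gt0// gt0_muley ?lte_fin.
have mfT : measurable_fun setT ((EFin \o f) \o skew id U).
  exact: (measurableT_comp mf' pT.1).
apply: (@le_trans _ _ (\int[lebesgue3 \x lebesgue3]_(z in B `*` @unit_ball R)
    (EFin \o f) (skew id U z))%E); last first.
  apply: ge0_subset_integral => //.
apply: ge0_le_integral => //.
- by move=> z _; rewrite lee_fin ltW.
- by apply: measurable_funTS.
move=> [x v] [/= Bx v1]; rewrite lee_fin /f /c /=.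
have h := hB x Bx; rewrite -/(S x) in h.
have v2 : dot v v <= 1 by rewrite -enorm_sqr expr_le1// enorm_ge0.
have E : - al * (Phi x + enorm (U x v) ^+ 2 / 2) + dot (S x) (U x v) =
    - (al * Phi x) + dot (S x) (S x) / (2 * al) - al / 2 * dot v v.
  rewrite enorm_sqr /U !(dotDl, dotDr, dotZl, dotZr) [dot v (S x)]dotC.
  by field; rewrite gt_eqF.
rewrite E; apply: (@le_trans _ _ (1 * (m * expR (- (al / 2))))); first by rewrite mul1r.
apply: ler_pM => //; first by rewrite ltW.
  by rewrite -[leLHS]add0r lerD2r addr_ge0 ?sqr_ge0.
rewrite ler_pM2l// ler_expR.
have : al / 2 * dot v v <= al / 2 * 1 by rewrite ler_pM2l// divr_gt0.
lra.
Qed.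

Lemma powR_eventually_ge (e K : R) : 0 < e -> 0 <= K ->
  exists2 T, 1 <= T & forall y : R, T <= y -> K <= y `^ e.
Proof.
move=> e0 K0; exists (K `^ e^-1 + 1); first by rewrite lerDr powR_ge0.
move=> y Ty; have -> : K = (K `^ e^-1) `^ e.
  by rewrite -powRrM mulVf ?gt_eqF// powRr1.
have h : K `^ e^-1 <= y by apply: le_trans Ty; rewrite lerDl.
by rewrite ge0_ler_powR ?nnegrE ?powR_ge0 ?(ltW e0)// (le_trans _ h)// powR_ge0.
Qed.

Lemma powR_split (q r y : R) : 0 < y -> y `^ q = y `^ r * y `^ (q - r).
Proof.
move=> y0; rewrite -powRD; last by rewrite (gt_eqF y0) implybT.
by rewrite addrCA subrr addr0.
Qed.

(** The factors of a half-infinite square tube along axis [j]: its volume is infinite although two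
    coordinates stay bounded. *)
Definition tube (j : 'I_3) (T : R) (i : 'I_3) : set (measurableTypeR R) :=
  if i == j then [set` (`[T, +oo[ : interval R)] else [set` (`[-1, 1] : interval R)].

Lemma lebesgue3_tube j T : lebesgue3 [set x : V | [/\ tube j T 0 (x ord0 0),
  tube j T 1 (x ord0 1) & tube j T 2%:R (x ord0 2%:R)]] = +oo%E.
Proof.
have mt i : measurable (tube j T i).
  by rewrite /tube; case: ifP => _; exact: measurable_itv.
have l i : leb (tube j T i) = if i == j then +oo%E else 2%:E.
  rewrite /tube; case: ifP => _; rewrite lebesgue_measure_itv/= ?ltry//.
  by rewrite lte_fin ifT; [rewrite -EFinB; congr _%:E; lra|lra].
rewrite (lebesgue3_box (mt 0) (mt 1) (mt 2%:R)) !l.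
by have [->|->|->] := I3P j => /=; rewrite ?(gt0_mulye, gt0_muley) ?lte_fin ?ltry ?lt0y.
Qed.

Lemma measurable_tube j T : measurable [set x : V | [/\ tube j T 0 (x ord0 0),
  tube j T 1 (x ord0 1) & tube j T 2%:R (x ord0 2%:R)]].
Proof.
have mt i : measurable (tube j T i).
  by rewrite /tube; case: ifP => _; exact: measurable_itv.
rewrite (_ : mkset _ = (rV_coord 0 @^-1` tube j T 0) `&` (rV_coord 1 @^-1` tube j T 1)
    `&` (rV_coord 2%:R @^-1` tube j T 2%:R)).
  by do 2 (try apply: measurableI); apply: measurable_preimT => //;
    exact: measurable_rV_coord.
by apply/seteqP; split => [x []//|x [[]//]].
Qed.

(** A nonzero entry A_lj makes the l-th coordinate of S x grow linearly along axis [j], so |S x|^2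
    outgrows <x>^p with p < 2 on a far enough tube; the energy would then be infinite. *)
Lemma japanese_powR_rotation_free (p m al : R) (A : 'M[R]_3) : 1 < p < 2 ->
  0 < m -> 0 < al ->
  (\int[lebesgue3 \x lebesgue3]_z ((japanese (z.1 : V) `^ p / p + enorm (z.2 : V) ^+ 2 + 1) *
    (m * expR (- al * (japanese z.1 `^ p / p + enorm z.2 ^+ 2 / 2) +
       dot (z.1 *m A^T) z.2)))%:E < +oo)%E -> A = 0.
Proof.
move=> /andP[p1 p2] m0 al0; have p0 : 0 < p by apply: lt_trans p1.
move=> fin; apply/eqP/negP => /negP A0.
have [l [j a0]] : exists l j, A l j != 0.
  apply/not_existsP => h; move/eqP: A0; apply; apply/matrixP => l j; rewrite mxE.
  by apply/eqP/negP => /negP lj; apply: (h l); exists j.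
pose a := `|A l j|; have a1 : 0 < a by rewrite normr_gt0.
(* [c] covers the contribution of the two bounded coordinates and the loss 2 a in replacing x_j by y
   = x_j + 2, which dominates <x>. Thus a y <= |(S x)_l| + c, and the tube starts where 2 c <= a
   y. *)
pose c := `|A l 0| + `|A l 1| + `|A l 2%:R| + 2 * a.
have c0 : 0 <= c by rewrite !addr_ge0// mulr_ge0// ltW.
have p2' : 0 < 2 - p by lra.
(* The threshold for y^(2-p) at which (a y / 2)^2 / (2 al) reaches al y^p. *)
have K0 : 0 <= 8 * al ^+ 2 / a ^+ 2 by apply: divr_ge0; rewrite ?sqr_ge0// mulr_ge0 ?sqr_ge0.
have [T T1 hT] := powR_eventually_ge p2' K0.
pose T' := T + 2 * c / a.
have T'T : T <= T' by rewrite lerDl divr_ge0 ?(ltW a1)// mulr_ge0.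
have T'c : 2 * c / a <= T' by rewrite lerDr (le_trans _ T1).
pose B := [set x : V | [/\ tube j T' 0 (x ord0 0), tube j T' 1 (x ord0 1) &
  tube j T' 2%:R (x ord0 2%:R)]].
suff hB x : B x -> al * (japanese x `^ p / p) <= dot (x *m A^T) (x *m A^T) / (2 * al).
  have mP : measurable_fun setT (fun x : V => japanese x `^ p / p).
    apply: measurable_funM; last exact: measurable_cst.
    by apply: (measurableT_comp (measurable_powR _)); exact: measurable_japanese.
  have P0 (x : V) : 0 <= japanese x `^ p / p by rewrite divr_ge0 ?powR_ge0// ltW.
  have E := energy_infinite mP P0 m0 al0 (measurable_tube j T') (lebesgue3_tube j T') hB.
  by move: fin; rewrite E ltxx.
move=> [x0 x1 x2].
have xt i : tube j T' i (x ord0 i).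
  by have [->|->|->] := I3P i.
have xj : T' <= x ord0 j by have := xt j; rewrite /tube eqxx /= in_itv/= andbT.
have xi i : i != j -> `|x ord0 i| <= 1.
  by move=> ij; have := xt i; rewrite /tube (negbTE ij) /= in_itv/= -ler_norml.
pose y := x ord0 j + 2.
have xj1 : 1 <= x ord0 j by apply: le_trans xj; exact: le_trans T'T.
have y0 : 0 < y by rewrite /y; lra.
have Ty : T <= y by rewrite /y; lra.
have yc : 2 * c <= a * y.
  by rewrite [a * y]mulrC -ler_pdivrMr//; apply: le_trans T'c _; rewrite /y; lra.
have jap : japanese x <= y.
  rewrite -ler_sqr ?nnegrE ?(ltW y0) ?(ltW (japanese_gt0 _))// japanese_sqr.
  have : dot x x <= x ord0 j ^+ 2 + 2.
    have sq i : i != j -> x ord0 i * x ord0 i <= 1.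
      by move=> /xi; rewrite -expr2 -real_normK ?num_real// => h; rewrite expr_le1.
    rewrite dot3 expr2.
    have [jE|jE|jE] := I3P j; rewrite jE.
    - by have := sq 1; have := sq 2%:R; rewrite jE => /(_ isT) ? /(_ isT) ?; lra.
    - by have := sq 0; have := sq 2%:R; rewrite jE => /(_ isT) ? /(_ isT) ?; lra.
    - by have := sq 0; have := sq 1; rewrite jE => /(_ isT) ? /(_ isT) ?; lra.
  by rewrite /y; nra.
have Sl : a * y / 2 <= `|dot x (row l A)|.
  have : a * x ord0 j <= `|dot x (row l A)| + (c - 2 * a).
    have t3 (q r s : R) : `|q| <= `|q + r + s| + `|r| + `|s|.
      have e : q = (q + r + s) - r - s by ring.
      rewrite {1}e; apply: le_trans (ler_normB _ _) _; rewrite lerD2r.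
      exact: ler_normB.
    have A0' i : 0 <= `|A l i| by [].
    have ab i : i != j -> `|x ord0 i * A l i| <= `|A l i|.
      by move=> /xi h; rewrite normrM ler_piMl.
    have aj : a * x ord0 j = `|x ord0 j * A l j|.
      by rewrite normrM mulrC ger0_norm//; lra.
    rewrite aj /c dot3 !mxE.
    have := A0' 0; have := A0' 1; have := A0' 2%:R; rewrite /a.
    set X0 := x ord0 0 * A l 0; set X1 := x ord0 1 * A l 1.
    set X2 := x ord0 2%:R * A l 2%:R.
    have [jE|jE|jE] := I3P j.
    - have := ab 1; have := ab 2%:R; rewrite jE => /(_ isT) ? /(_ isT) ? ? ? ?.
      by have := t3 X0 X1 X2; lra.
    - have := ab 0; have := ab 2%:R; rewrite jE => /(_ isT) ? /(_ isT) ? ? ? ?.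
      have := t3 X1 X0 X2; rewrite [X1 + X0]addrC; lra.
    - have := ab 0; have := ab 1; rewrite jE => /(_ isT) ? /(_ isT) ? ? ? ?.
      have := t3 X2 X0 X1; rewrite (_ : X2 + X0 + X1 = X0 + X1 + X2); [lra|ring].
  rewrite /y; have := yc; rewrite /y; lra.
have SS : (a * y / 2) ^+ 2 <= dot (x *m A^T) (x *m A^T).
  rewrite -enorm_sqr lerXn2r ?nnegrE ?enorm_ge0//.
    by rewrite divr_ge0// mulr_ge0// ltW.
  apply: le_trans Sl _; rewrite -mulmx_coord; exact: coord_le_enorm.
have P : japanese x `^ p / p <= y `^ p.
  rewrite ler_pdivrMr//; apply: (@le_trans _ _ (y `^ p)).
    by rewrite ge0_ler_powR ?nnegrE ?(ltW y0) ?(ltW p0)// ltW// japanese_gt0.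
  by rewrite ler_peMr ?powR_ge0// ltW.
have Y : 8 * al ^+ 2 * y `^ p <= a ^+ 2 * y ^+ 2.
  have -> : y ^+ 2 = y `^ p * y `^ (2 - p).
    by rewrite -powR_mulrn ?(ltW y0)// (powR_split 2%:R p y0).
  rewrite [leRHS]mulrCA [leLHS]mulrC ler_wpM2l ?powR_ge0//.
  by rewrite [leRHS]mulrC -ler_pdivrMr ?exprn_gt0// hT.
rewrite ler_pdivlMr ?mulr_gt0//.
apply: le_trans SS; rewrite (_ : (a * y / 2) ^+ 2 = a ^+ 2 * y ^+ 2 / 4); last by field.
have : al ^+ 2 * (japanese x `^ p / p) <= al ^+ 2 * y `^ p by rewrite ler_wpM2l ?sqr_ge0.
nra.
Qed.

End infinite_energy.

(** * Growth of the potential |x|^p / p *)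

Section growth.
Context {R : realType}.
Local Notation V := 'rV[R]_3.

Lemma dot_mulmx_le (A : 'M[R]_3) : exists2 N, 0 <= N &
  forall x : V, dot (x *m A^T) (x *m A^T) <= N * dot x x.
Proof.
(* The squared Frobenius norm of [A], by Cauchy-Schwarz on each row. *)
exists (\sum_l dot (row l A) (row l A)); first by apply: sumr_ge0 => l _; exact: dot_ge0.
move=> x; rewrite mulr_suml; apply: ler_sum => l _.
rewrite mulmx_coord -expr2 -real_normK ?num_real// -!enorm_sqr mulrC -exprMn.
by rewrite lerXn2r ?nnegrE ?mulr_ge0 ?enorm_ge0// cauchy_schwarz.
Qed.

Lemma rotation_le_enorm_powR (p al : R) (A : 'M[R]_3) : 2 < p -> 0 < al ->
  exists K, forall x : V,
    dot (x *m A^T) (x *m A^T) / al <= al / 2 * (enorm x `^ p / p) + K.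
Proof.
move=> p2 al0; have p0 : 0 < p by lra.
have [N N0 hN] := dot_mulmx_le A.
have q0 : 0 < p - 2 by lra.
(* Once |x|^(p-2) exceeds this value, N |x|^2 / al <= al |x|^p / (2 p). Inside the corresponding
   ball the constant N T^2 / al takes over. *)
have K0 : 0 <= 2 * N * p / al ^+ 2.
  by apply: divr_ge0; rewrite ?sqr_ge0// !mulr_ge0// ltW.
have [T T1 hT] := powR_eventually_ge q0 K0.
exists (N * T ^+ 2 / al) => x.
apply: (@le_trans _ _ (N * enorm x ^+ 2 / al)).
  by rewrite enorm_sqr ler_wpM2r// invr_ge0 ltW.
have e0 := enorm_ge0 x; have F0 : 0 <= al / 2 * (enorm x `^ p / p).
  by rewrite !mulr_ge0 ?invr_ge0 ?powR_ge0// ltW.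
have [xT|/ltW Tx] := lerP (enorm x) T.
  rewrite -[leLHS]add0r lerD// ler_wpM2r ?invr_ge0 ?(ltW al0)// ler_wpM2l//.
  by rewrite lerXn2r ?nnegrE// (le_trans ler01).
have x0 : 0 < enorm x by apply: lt_le_trans Tx; apply: lt_le_trans T1.
rewrite -[leLHS]addr0 lerD//; last first.
  by apply: divr_ge0; [rewrite mulr_ge0 ?sqr_ge0|exact: ltW].
have -> : enorm x `^ p = enorm x ^+ 2 * enorm x `^ (p - 2).
  by rewrite -powR_mulrn// (powR_split p 2%:R x0).
have h := hT _ Tx.
have -> : al / 2 * (enorm x ^+ 2 * enorm x `^ (p - 2) / p) =
  (al / (2 * p) * enorm x ^+ 2) * enorm x `^ (p - 2) by field; rewrite gt_eqF.
apply: (@le_trans _ _ ((al / (2 * p) * enorm x ^+ 2) * (2 * N * p / al ^+ 2))).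
  rewrite le_eqVlt; apply/orP; left; apply/eqP; field.
  by rewrite !gt_eqF.
by rewrite ler_wpM2l// mulr_ge0 ?sqr_ge0// divr_ge0 ?mulr_ge0// ltW.
Qed.

Lemma japanese_le_enorm_powR (p : R) (x : V) : 1 <= p ->
  japanese x <= (2 + p) * (1 + enorm x `^ p / p).
Proof.
move=> p1; have p0 : 0 < p by lra.
have e0 := enorm_ge0 x; have P0 : 0 <= enorm x `^ p / p by rewrite divr_ge0 ?powR_ge0// ltW.
apply: (@le_trans _ _ (1 + enorm x)).
  rewrite -ler_sqr ?nnegrE ?(ltW (japanese_gt0 _)) ?addr_ge0// japanese_sqr -enorm_sqr.
  nra.
have -> : (2 + p) * (1 + enorm x `^ p / p) =
  2 + p + 2 * (enorm x `^ p / p) + enorm x `^ p by field; rewrite gt_eqF.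
have [x1|/ltW x1] := lerP (enorm x) 1.
  have := powR_ge0 (enorm x) p; lra.
have : enorm x <= enorm x `^ p by rewrite -[leLHS]powRr1// ler_powR.
lra.
Qed.

End growth.

(** * The two equivalences *)

Theorem theorem1p7 (R : realType) (gamma : R) (b : R -> R)
    (gamma_itv : -3 < gamma <= 1) (b_kernel : angular_kernel b) :
  (forall p : R, 2 < p ->
    forall M : R -> 'rV[R]_3 -> 'rV[R]_3 -> R,
    let Phi := fun x : 'rV[R]_3 => enorm x `^ p / p in
    entropy_invariant gamma b Phi M <->
    exists (m alpha : R) (A : 'M[R]_3), [/\ 0 < m, 0 < alpha, A^T = - A &
      forall (t : R) (x v : 'rV[R]_3), 0 <= t ->
        M t x v = m * expR (- alpha * (Phi x + enorm v ^+ 2 / 2)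
                            + dot (x *m A^T) v)])
  /\
  (forall p : R, 1 < p < 2 ->
    forall M : R -> 'rV[R]_3 -> 'rV[R]_3 -> R,
    let Phi := fun x : 'rV[R]_3 => japanese x `^ p / p in
    entropy_invariant gamma b Phi M <->
    exists m alpha : R, [/\ 0 < m, 0 < alpha &
      forall (t : R) (x v : 'rV[R]_3), 0 <= t ->
        M t x v = m * expR (- alpha * (Phi x + enorm v ^+ 2 / 2))]).

Proof.
split => [p p2 M Phi|p /andP[p1 p2] M Phi].
  have p0 : 0 < p by lra.
  have dPhi x w : is_derive x w Phi (enorm x `^ (p - 2) * dot x w).
    exact: is_derive_enorm_powR.
  split=> [|[m [al [A [m0 al0 AT ME]]]]].
    apply: (@entropy_invariant_form R gamma gamma_itv b b_kernel Phi _ dPhi).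
    - by move=> x; rewrite /Phi enormN.
    - by move=> x; rewrite enormN.
    - exact: enorm_powR_not_quadratic.
    - by move=> x; exact: enorm_powR_not_harmonic.
  have [K2 hK2] := rotation_le_enorm_powR A p2 al0.
  apply: (@gaussian_entropy_invariant R gamma b Phi _ dPhi _ _ (2 + p) _ _ m al A m0 al0 AT K2 hK2 M ME).
  - by move=> i; exact: continuous_enorm_force.
  - by move=> x; rewrite divr_ge0 ?powR_ge0// ltW.
  - by rewrite addr_gt0.
  - by move=> x; apply: japanese_le_enorm_powR; lra.
have p0 : 0 < p by lra.
have dPhi x w : is_derive x w Phi (japanese x `^ (p - 2) * dot x w).
  by apply: is_derive_japanese_powR; rewrite gt_eqF.
split=> [MS|[m [al [m0 al0 ME]]]].
  have [m [al [A [m0 al0 AT ME]]]] : exists (m alpha : R) (A : 'M[R]_3),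
      [/\ 0 < m, 0 < alpha, A^T = - A & forall t x v, 0 <= t ->
       M t x v = m * expR (- alpha * (Phi x + enorm v ^+ 2 / 2) + dot (x *m A^T) v)].
    apply: (@entropy_invariant_form R gamma gamma_itv b b_kernel Phi _ dPhi _ _ _ _ M MS).
    - by move=> x; rewrite /Phi japaneseN.
    - by move=> x; rewrite japaneseN.
    - by apply: japanese_powR_not_quadratic; rewrite p1.
    - by move=> x; exact: japanese_powR_not_harmonic.
  have p12 : 1 < p < 2 by rewrite p1.
  have A0 : A = 0.
    apply: (japanese_powR_rotation_free p12 m0 al0).
    (* The form is stationary, so the energy at time 0 already excludes rotation. *)
    have := ei_energy MS (lexx 0).
    rewrite (_ : (fun z : 'rV[R]_3 * 'rV[R]_3 => _) = (fun z : 'rV[R]_3 * 'rV[R]_3 =>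
      ((japanese z.1 `^ p / p + enorm z.2 ^+ 2 + 1) *
       (m * expR (- al * (japanese z.1 `^ p / p + enorm z.2 ^+ 2 / 2) +
       dot (z.1 *m A^T) z.2)))%:E)); first by [].
    by apply/funext => z; rewrite ME.
  exists m, al; split=> // t x v t0.
  by rewrite ME// A0 trmx0 mulmx0 dot0l addr0.
have T0 : (0 : 'M[R]_3)^T = - 0 by rewrite trmx0 oppr0.
have Phi0 x : 0 <= Phi x by rewrite divr_ge0 ?powR_ge0// ltW.
(* Without rotation the rotation bound holds with constant 0; the growth constant is [p], since <x>
   <= <x>^p = p Phi. *)
apply: (@gaussian_entropy_invariant R gamma b Phi _ dPhi _ Phi0 p p0 _ m al 0 m0 al0 T0 0).
- by move=> i; exact: continuous_japanese_force.
- move=> x; apply: (@le_trans _ _ (japanese x `^ p)).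
    rewrite -[leLHS]powRr1 ?(ltW (japanese_gt0 _))// ler_powR ?japanese_ge1//.
    exact: ltW.
  rewrite mulrDr mulr1 /Phi [p * (_ / p)]mulrC divfK ?gt_eqF// lerDr.
  exact: ltW.
- move=> x; rewrite trmx0 mulmx0 dot0l mul0r addr0.
  by rewrite mulr_ge0 ?Phi0// divr_ge0// ltW.
- by move=> t x v t0; rewrite ME// trmx0 mulmx0 dot0l addr0.
Qed.
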